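(* Let $P(z)=\sum_{j\ge 1}p_jz^j$ be the probability generating function of a natural-number-valued random variable (so $p_j\ge 0$, $\sum_j p_j=1$, $p_0=0$) with $0<p_1<1$, and let $E=P'(1)$. Let $\Phi$, $\kappa_n$, $\Pi$, $p$, $K$ and $\theta_m^{\ast n}$ be the objects associated with $P$ as defined in the context. Assume that (i) $P$ is entire; (ii) the integral $p(x)=\frac{1}{2\pi}\int_{-\infty}^{+\infty}\Pi(\mathbf{i}y)e^{\mathbf{i}yx}\,dy$ exists in the strong sense, meaning that $\Pi(\mathbf{i}y)\to 0$ as $y\to\pm\infty$; (iii) $\frac{\ln p_1}{\ln E}<-1$. Put $\alpha=-1-\log_E p_1$ and $\beta=-\log_E p_1>0$. Then for all $x>0$ $$p(x)=x^{\alpha}V_1(x)+x^{\alpha+\beta}V_2(x)+x^{\alpha+2\beta}V_3(x)+\dots=\sum_{n=1}^{+\infty}x^{-1-n\log_E p_1}\,V_n(x),$$ where, for every $n\ge 1$, $V_n$ is the multiplicatively periodic function with period $E$ (that is, $V_n(x/E)=V_n(x)$) given by $$V_n(x)=K_n\!\left(\frac{-\ln x}{\ln E}\right),\qquad K_n(z)=\kappa_n\sum_{m=-\infty}^{+\infty}\frac{\theta_m^{\ast n}\,e^{2\pi\mathbf{i}mz}}{\Gamma\!\left(-\frac{2\pi\mathbf{i}m+n\ln p_1}{\ln E}\right)}.$$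
   Context: Let $\mathbf{i}$ denote the imaginary unit and $\Gamma$ Euler's Gamma function. The Galton–Watson process is $X_0=1$, $X_{t+1}=\sum_{j=1}^{X_t}\xi_{j,t}$, $t\in\{0,1,2,\dots\}$, where the $\xi_{j,t}$ are independent, identically distributed, natural-number-valued random variables with probability generating function $P(z)=\mathbb{E}z^{\xi}=p_1z+p_2z^2+p_3z^3+\dots$, where $p_0=0$ and $0<p_1<1$. When $P$ is entire, $E=P'(1)=\sum_j jp_j$ is finite, and $E>1$. The function $\Phi(z)=\lim_{t\to\infty}p_1^{-t}\,\underbrace{P\circ\dots\circ P}_{t}(z)$ is analytic at least for $|z|<1$ and satisfies $\Phi(P(z))=p_1\Phi(z)$, $\Phi(0)=0$, $\Phi'(0)=1$. It has an inverse $\Phi^{-1}(z)=\kappa_1z+\kappa_2z^2+\kappa_3z^3+\dots$, analytic in some neighborhood of $z=0$; this defines the coefficients $\kappa_n$ (in particular $\kappa_1=1$). The function $\Pi(z)=\lim_{t\to+\infty}\underbrace{P\circ\dots\circ P}_{t}\left(1-\frac{z}{E^t}\right)$ is entire and satisfies $P(\Pi(z))=\Pi(Ez)$, $\Pi(0)=1$, $\Pi'(0)=-1$. The function $p(x)$ is the density of the martingale limit $W=\lim_{t\to+\infty}E^{-t}X_t$, and is computed by $p(x)=\frac{1}{2\pi}\int_{-\infty}^{+\infty}\Pi(\mathbf{i}y)e^{\mathbf{i}yx}\,dy$. The Karlin–McGregor function is the $1$-periodic function $K(z)=\Phi(\Pi(E^z))\,p_1^{-z}$, defined for real $z$ and analytic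 in a strip around $\mathbb{R}$. For $n\ge 1$, $\theta_m^{\ast n}$ ($m\in\mathbb{Z}$) denote the Fourier coefficients of the $1$-periodic function $K^n$: $K(z)^n=\sum_{m=-\infty}^{+\infty}\theta_m^{\ast n}e^{2\pi\mathbf{i}mz}$. *)

(* Defs.v *)
From Stdlib Require Import Reals ZArith.
From Coquelicot Require Import Coquelicot.

Open Scope R_scope.

(* Total value operators for C, in the style of [RInt]: meaningful when the
   limit, series or integral exists.  Since [C] is canonically a normed module
   over itself, integrals over R need the structure [C_R_CompleteNormedModule]. *)

Definition CLim_seq (u : nat -> C) : C :=
  @iota C_CompleteNormedModule
    (fun l => filterlim u eventually (locally (l : C))).

Definition CSeries (a : nat -> C) : C :=
  @iota C_CompleteNormedModule
    (fun l => @is_series C_AbsRing C_NormedModule a l).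

Definition ex_CSeries (a : nat -> C) : Prop :=
  @ex_series C_AbsRing C_NormedModule a.

(* Sums over all of Z, the two halves m >= 0 and m < 0 (m = -1-k, k >= 0)
   being required to converge separately. *)
Definition ZSeries (a : Z -> C) : C :=
  (CSeries (fun k => a (Z.of_nat k)) +
   CSeries (fun k => a (- Z.of_nat (S k))%Z))%C.

Definition ex_ZSeries (a : Z -> C) : Prop :=
  ex_CSeries (fun k => a (Z.of_nat k)) /\
  ex_CSeries (fun k => a (- Z.of_nat (S k))%Z).

Definition CRInt (f : R -> C) (a b : R) : C :=
  @RInt C_R_CompleteNormedModule f a b.

Definition CRInt_gen (f : R -> C) (Fa Fb : (R -> Prop) -> Prop) : C :=
  @RInt_gen C_R_CompleteNormedModule f Fa Fb.

Definition ex_CRInt_gen (f : R -> C) (Fa Fb : (R -> Prop) -> Prop) : Prop :=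
  @ex_RInt_gen C_R_CompleteNormedModule f Fa Fb.

Definition Cexp (z : C) : C :=
  (exp (Re z) * cos (Im z), exp (Re z) * sin (Im z)).

(* Euler's integral with t^(s-1) = exp ((s-1) ln t): this is Gamma on the half
   plane Re s > 0.  It is only used there: the arguments occurring in [KG] have
   real part - n ln p_1 / ln E > 0. *)
Definition CGamma (s : C) : C :=
  CRInt_gen (fun t => (Cexp ((s - 1) * RtoC (ln t)) * RtoC (exp (- t)))%C)
    (at_right 0) (Rbar_locally p_infty).

(* [p j] stands for P(xi = j), where xi is the offspring variable. *)

Definition is_pgf_coeffs (p : nat -> R) : Prop :=
  (forall j, 0 <= p j) /\ is_series p 1 /\ p 0%nat = 0.

Definition pgf (p : nat -> R) (z : C) : C :=
  CSeries (fun j => (RtoC (p j) * z ^ j)%C).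

Definition mean (p : nat -> R) : R := Derive (PSeries p) 1.

Definition log_mean (p : nat -> R) (x : R) : R := ln x / ln (mean p).

Definition pgf_iter (p : nat -> R) (t : nat) (z : C) : C :=
  Nat.iter t (pgf p) z.

Definition Phi (p : nat -> R) (z : C) : C :=
  CLim_seq (fun t => (pgf_iter p t z / RtoC (p 1%nat) ^ t)%C).

(* [kappa] is the sequence of Taylor coefficients at 0 of the local inverse of
   Phi.  It is determined by this property: the power series vanishes at 0, and
   Phi is injective near 0 because Phi'(0) = 1. *)
Definition is_Phi_inv_coeffs (p : nat -> R) (kappa : nat -> C) : Prop :=
  kappa 0%nat = RtoC 0 /\
  exists r : R, 0 < r /\
    forall z : C, Cmod z < r ->
      exists w : C,
        @is_pseries C_AbsRing C_NormedModule kappa z w /\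
        Cmod w < 1 /\ Phi p w = z.

Definition Pi (p : nat -> R) (z : C) : C :=
  CLim_seq (fun t => pgf_iter p t (1 - z / RtoC (mean p) ^ t)%C).

Definition density_integrand (p : nat -> R) (x y : R) : C :=
  (Pi p (Ci * RtoC y) * Cexp (Ci * RtoC y * RtoC x))%C.

Definition density (p : nat -> R) (x : R) : C :=
  (/ RtoC (2 * PI) *
   CRInt_gen (density_integrand p x)
     (Rbar_locally m_infty) (Rbar_locally p_infty))%C.

Definition KarlinMcGregor (p : nat -> R) (z : R) : C :=
  (Phi p (Pi p (RtoC (Rpower (mean p) z))) *
   RtoC (Rpower (p 1%nat) (- z)))%C.

(* m-th Fourier coefficient of the n-th power of the 1-periodic [KarlinMcGregor p]. *)
Definition theta (p : nat -> R) (n : nat) (m : Z) : C :=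
  CRInt (fun z => (KarlinMcGregor p z ^ n * Cexp (- (RtoC (2 * PI * IZR m * z) * Ci)))%C)
    0 1.

Definition KG_term (p : nat -> R) (n : nat) (z : R) (m : Z) : C :=
  (theta p n m * Cexp (RtoC (2 * PI * IZR m * z) * Ci) /
   CGamma (- ((RtoC (2 * PI * IZR m) * Ci + RtoC (INR n * ln (p 1%nat)))
              / RtoC (ln (mean p)))))%C.

Definition KG (p : nat -> R) (kappa : nat -> C) (n : nat) (z : R) : C :=
  (kappa n * ZSeries (KG_term p n z))%C.

Definition V (p : nat -> R) (kappa : nat -> C) (n : nat) (x : R) : C :=
  KG p kappa n (- ln x / ln (mean p)).

Definition alpha (p : nat -> R) : R := -1 - log_mean p (p 1%nat).

Definition beta (p : nat -> R) : R := - log_mean p (p 1%nat).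

(* Main.v *)
Require Import Defs.
From Stdlib Require Import Reals ZArith Lra Lia.
From Coquelicot Require Import Coquelicot.
Open Scope R_scope.

(* Write [E] for the mean and [beta = - log_E p_1 > 1]. The functional equation and the
   hypothesis on the imaginary axis force [Pi z = O(|z|^(-beta))] in the closed right half
   plane, so the line of the inversion integral can be moved to [Re z = c] with [c] large.
   There [Pi] is small and [Pi = sum_n kappa_n Phi(Pi)^n]. By definition of [K],
   [Phi (Pi z) = z^(-beta) K (log_E z)]; the same decay extends to a sector slightly wider than
   the half plane, so [K] is bounded in a strip wider than [|Im| <= PI / (2 ln E)] and its
   Fourier series converges geometrically on the image of the line. Everything can then be
   integrated term by term, each term being Hankel's integral
   [int e^(xz) z^(-s) dz = 2 PI i x^(s-1) / Gamma s]. The latter is obtained by inserting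
   [Gamma s z^(-s) = int_0^oo t^(s-1) e^(-zt) dt] and using Abel summation in [Im z], which turns
   the inner integral into a Poisson kernel. *)

Notation is_Cseries := (@is_series C_AbsRing C_NormedModule).
Notation ccontinuous f x := (@continuous R_UniformSpace C_R_NormedModule f x).
Notation is_CRInt := (@is_RInt C_R_NormedModule).

Definition Clim (u : nat -> C) (l : C) : Prop :=
  forall eps : R, 0 < eps ->
    exists N : nat, forall n : nat, (N <= n)%nat -> Cmod (u n - l) < eps.

Lemma Cmod_minus_sym (a b : C) : Cmod (a - b) = Cmod (b - a).
Proof.
  replace (a - b)%C with (- (b - a))%C by ring. apply Cmod_opp.
Qed.

Lemma Cmod_minus_triangle (a b c : C) : Cmod (a - c) <= Cmod (a - b) + Cmod (b - c).
Proof.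
  replace (a - c)%C with ((a - b) + (b - c))%C by ring. apply Cmod_triangle.
Qed.

Lemma Cmod_minus_le (a b : C) : Cmod (a - b) <= Cmod a + Cmod b.
Proof.
  unfold Cminus. rewrite <- (Cmod_opp b). apply Cmod_triangle.
Qed.

Lemma Cmod_triangle_inv (a b : C) : Cmod a - Cmod b <= Cmod (a - b).
Proof.
  assert (H := Cmod_triangle (a - b) b).
  replace (a - b + b)%C with a in H by ring. lra.
Qed.

Lemma Cmod_small_eq (a b : C) : (forall eps, 0 < eps -> Cmod (a - b) <= eps) -> a = b.
Proof.
  intros H.
  assert (H0 : Cmod (a - b) = 0).
  { destruct (Rle_lt_or_eq_dec _ _ (Cmod_ge_0 (a - b))) as [h|h]; auto.
    specialize (H (Cmod (a - b) / 2)). lra. }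
  apply Cmod_eq_0 in H0.
  replace a with ((a - b) + b)%C by ring. rewrite H0. ring.
Qed.

Lemma Cminus_diag_0 (a : C) : Cmod (a - a) = 0.
Proof. replace (a - a)%C with (RtoC 0) by ring. apply Cmod_0. Qed.

Lemma Cmod_RtoC_nonneg (x : R) : 0 <= x -> Cmod (RtoC x) = x.
Proof. intros H. rewrite Cmod_R. apply Rabs_pos_eq, H. Qed.

Lemma snd_le_Cmod (z : C) : Rabs (snd z) <= Cmod z.
Proof.
  eapply Rle_trans; [|apply Rmax_Cmod]. apply Rmax_r.
Qed.

Lemma Cmod_Ci : Cmod Ci = 1.
Proof.
  unfold Cmod, Ci; simpl. replace (0 * (0 * 1) + 1 * (1 * 1)) with 1 by ring. apply sqrt_1.
Qed.

Lemma Cmod_le_parts (z : C) : Cmod z <= Rabs (fst z) + Rabs (snd z).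
Proof.
  destruct z as [a b]; simpl.
  replace (a, b) with (RtoC a + Ci * RtoC b)%C.
  - eapply Rle_trans; [apply Cmod_triangle|].
    rewrite Cmod_mult, !Cmod_R, Cmod_Ci. lra.
  - unfold Ci, RtoC, Cmult, Cplus; simpl. f_equal; ring.
Qed.

Lemma Clim_filterlim (u : nat -> C) (l : C) :
  Clim u l -> filterlim u eventually (@locally C_UniformSpace l).
Proof.
  intros H.
  apply (proj2 (@filterlim_locally_ball_norm C_AbsRing nat C_NormedModule _ (@filter_filter _ _ eventually_filter) u l)).
  intros eps. destruct (H eps (cond_pos eps)) as [N HN].
  exists N. intros n Hn. apply (HN n Hn).
Qed.

Lemma filterlim_Clim (u : nat -> C) (l : C) :
  filterlim u eventually (@locally C_UniformSpace l) -> Clim u l.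
Proof.
  intros H eps Heps.
  assert (H' := proj1 (@filterlim_locally_ball_norm C_AbsRing nat C_NormedModule _ (@filter_filter _ _ eventually_filter) u l) H).
  destruct (H' (mkposreal eps Heps)) as [N HN].
  exists N. intros n Hn. apply (HN n Hn).
Qed.

Lemma CLim_seq_unique (u : nat -> C) (l : C) : Clim u l -> CLim_seq u = l.
Proof.
  intros H. unfold CLim_seq.
  apply (@iota_filterlim_locally C_AbsRing C_CompleteNormedModule nat eventually
           (Proper_StrongProper _ eventually_filter)).
  now apply Clim_filterlim.
Qed.

Lemma CSeries_unique (a : nat -> C) (l : C) : is_Cseries a l -> CSeries a = l.
Proof.
  intros H. unfold CSeries, is_series in *.
  apply (@iota_filterlim_locally C_AbsRing C_CompleteNormedModule nat eventually
           (Proper_StrongProper _ eventually_filter) (sum_n a) l H).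
Qed.

Lemma Clim_ext (u v : nat -> C) (l : C) : (forall n, u n = v n) -> Clim u l -> Clim v l.
Proof.
  intros Huv H eps He. destruct (H eps He) as [N HN]. exists N. intros n Hn.
  rewrite <- Huv. auto.
Qed.

Lemma Clim_const (l : C) : Clim (fun _ => l) l.
Proof. intros eps He. exists O. intros n _. rewrite Cminus_diag_0. exact He. Qed.

Lemma Clim_plus (u v : nat -> C) (a b : C) :
  Clim u a -> Clim v b -> Clim (fun n => u n + v n)%C (a + b)%C.
Proof.
  intros Hu Hv eps He.
  destruct (Hu (eps / 2)) as [N1 H1]; [lra|]. destruct (Hv (eps / 2)) as [N2 H2]; [lra|].
  exists (max N1 N2). intros n Hn.
  replace (u n + v n - (a + b))%C with ((u n - a) + (v n - b))%C by ring.
  eapply Rle_lt_trans; [apply Cmod_triangle|].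
  specialize (H1 n ltac:(lia)). specialize (H2 n ltac:(lia)). lra.
Qed.

Lemma Clim_scal (c : C) (u : nat -> C) (a : C) :
  Clim u a -> Clim (fun n => c * u n)%C (c * a)%C.
Proof.
  intros Hu eps He.
  assert (Hc := Cmod_ge_0 c).
  destruct (Hu (eps / (Cmod c + 1))) as [N HN]. { apply Rdiv_lt_0_compat; lra. }
  exists N. intros n Hn.
  replace (c * u n - c * a)%C with (c * (u n - a))%C by ring.
  rewrite Cmod_mult. specialize (HN n Hn).
  apply Rle_lt_trans with (Cmod c * (eps / (Cmod c + 1))).
  - apply Rmult_le_compat_l; lra.
  - replace (Cmod c * (eps / (Cmod c + 1))) with (eps * (Cmod c / (Cmod c + 1))) by (field; lra).
    assert (Cmod c / (Cmod c + 1) < 1). { apply Rlt_div_l; lra. }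
    nra.
Qed.

Lemma Clim_shift (u : nat -> C) (l : C) : Clim u l -> Clim (fun n => u (S n)) l.
Proof.
  intros H eps He. destruct (H eps He) as [N HN]. exists N. intros n Hn. apply HN. lia.
Qed.

Lemma Clim_unshift (u : nat -> C) (l : C) : Clim (fun n => u (S n)) l -> Clim u l.
Proof.
  intros H eps He. destruct (H eps He) as [N HN]. exists (S N). intros [|n] Hn; [lia|].
  apply HN. lia.
Qed.

Lemma Clim_le (u : nat -> C) (l : C) (M : R) :
  Clim u l -> (exists N, forall n, (N <= n)%nat -> Cmod (u n) <= M) -> Cmod l <= M.
Proof.
  intros H [N HN]. apply le_epsilon. intros eps He.
  destruct (H eps He) as [N' HN'].
  specialize (HN (max N N') ltac:(lia)). specialize (HN' (max N N') ltac:(lia)).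
  assert (T := Cmod_triangle_inv l (u (max N N'))).
  rewrite Cmod_minus_sym in HN'. lra.
Qed.

Lemma Clim_minus_le (u : nat -> C) (l c : C) (M : R) :
  Clim u l -> (exists N, forall n, (N <= n)%nat -> Cmod (u n - c) <= M) -> Cmod (l - c) <= M.
Proof.
  intros H HN. apply (Clim_le (fun n => u n - c)%C); auto.
  apply (Clim_plus u (fun _ => (- c)%C) l (- c)%C H), Clim_const.
Qed.

Lemma ex_Cseries_le (a : nat -> C) (b : nat -> R) :
  (forall n, Cmod (a n) <= b n) -> ex_series b -> exists l, is_Cseries a l.
Proof.
  intros H Hb.
  destruct (@ex_series_le C_AbsRing C_CompleteNormedModule a b H Hb) as [l Hl].
  exists l. exact Hl.
Qed.

Lemma Cmod_sum_n_le (a : nat -> C) (b : nat -> R) (n : nat) :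
  (forall k, (k <= n)%nat -> Cmod (a k) <= b k) -> Cmod (@sum_n C_AbelianMonoid a n) <= sum_n b n.
Proof.
  induction n as [|n IH]; intros H.
  - rewrite !sum_O. apply H. lia.
  - rewrite !sum_Sn. eapply Rle_trans; [apply Cmod_triangle|].
    apply Rplus_le_compat; [apply IH; intros; apply H; lia | apply H; lia].
Qed.

Lemma is_series_Clim (a : nat -> C) (l : C) : is_Cseries a l <-> Clim (@sum_n C_AbelianMonoid a) l.
Proof.
  split; intros H; [apply filterlim_Clim | apply Clim_filterlim]; exact H.
Qed.

Lemma sum_n_le_series (b : nat -> R) (m : R) (n : nat) :
  (forall k, 0 <= b k) -> is_series b m -> sum_n b n <= m.
Proof.
  intros Hb Hm.
  apply is_lim_seq_incr_compare.
  - exact Hm.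
  - intros k. rewrite sum_Sn. unfold plus; simpl. specialize (Hb (S k)). lra.
Qed.

Lemma Cmod_series_le (a : nat -> C) (b : nat -> R) (l : C) (m : R) :
  (forall n, Cmod (a n) <= b n) -> is_Cseries a l -> is_series b m -> Cmod l <= m.
Proof.
  intros H Ha Hb. apply is_series_Clim in Ha.
  apply (Clim_le _ _ _ Ha). exists O. intros n _.
  eapply Rle_trans; [apply (Cmod_sum_n_le a b n); auto|].
  apply sum_n_le_series; auto. intros k. eapply Rle_trans; [apply Cmod_ge_0|apply H].
Qed.

Lemma is_Cseries_unique (a : nat -> C) (l l' : C) : is_Cseries a l -> is_Cseries a l' -> l = l'.
Proof. intros H H'. rewrite <- (CSeries_unique a l H). now apply CSeries_unique. Qed.

Lemma is_Cseries_scal (c : C) (a : nat -> C) (l : C) :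
  is_Cseries a l -> is_Cseries (fun n => c * a n)%C (c * l)%C.
Proof. intros H. exact (@is_series_scal C_AbsRing C_NormedModule c a l H). Qed.

Lemma is_Cseries_minus (a b : nat -> C) (l m : C) :
  is_Cseries a l -> is_Cseries b m -> is_Cseries (fun n => a n - b n)%C (l - m)%C.
Proof. intros H H'. exact (@is_series_minus C_AbsRing C_NormedModule a b l m H H'). Qed.

Lemma is_Cseries_ext (a b : nat -> C) (l : C) :
  (forall n, a n = b n) -> is_Cseries a l -> is_Cseries b l.
Proof. intros H H'. exact (@is_series_ext C_AbsRing C_NormedModule a b l H H'). Qed.

Lemma is_Cseries_decr (a : nat -> C) (l : C) :
  a O = 0 -> is_Cseries a l -> is_Cseries (fun n => a (S n)) l.
Proof.
  intros H0 H. apply (@is_series_incr_1 C_AbsRing C_NormedModule a l).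
  change (is_Cseries a (l + a O)%C).
  replace (l + a O)%C with l; [exact H|]. rewrite H0. ring.
Qed.

Lemma ex_series_geom_scal (M q : R) : 0 <= q < 1 -> ex_series (fun n => M * q ^ n).
Proof.
  intros Hq. apply (ex_series_scal_l (V := R_NormedModule) M (fun n => q ^ n)).
  apply ex_series_geom. rewrite Rabs_pos_eq; lra.
Qed.

Lemma Cauchy_geom_Clim (u : nat -> C) (M q : R) :
  0 <= q < 1 -> (forall n, Cmod (u (S n) - u n) <= M * q ^ n) ->
  exists l, Clim u l /\ forall n, Cmod (l - u n) <= M * q ^ n / (1 - q).
Proof.
  intros Hq H.
  destruct (ex_Cseries_le (fun n => u (S n) - u n)%C _ H (ex_series_geom_scal M q Hq)) as [s Hs].
  apply is_series_Clim in Hs.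
  assert (Hsum : forall n, @sum_n C_AbelianMonoid (fun n => u (S n) - u n)%C n = (u (S n) - u O)%C).
  { intros n. induction n as [|n IH].
    - now rewrite sum_O.
    - rewrite sum_Sn, IH.
      change ((u (S n) - u O) + (u (S (S n)) - u (S n)) = u (S (S n)) - u O)%C. ring. }
  assert (Hl : Clim u (u O + s)%C).
  { apply Clim_unshift.
    apply (Clim_ext (fun n => u O + @sum_n C_AbelianMonoid (fun n => u (S n) - u n)%C n)%C).
    - intros n. rewrite Hsum. ring.
    - apply Clim_plus; [apply Clim_const|exact Hs]. }
  exists (u O + s)%C. split; [exact Hl|].
  intros n.
  assert (Hd : forall k, Cmod (u (n + k)%nat - u n) <= M * q ^ n * (1 - q ^ k) / (1 - q)).
  { intros k. induction k as [|k IH].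
    - rewrite Nat.add_0_r, Cminus_diag_0. simpl. right. field. lra.
    - eapply Rle_trans; [apply (Cmod_minus_triangle _ (u (n + k)%nat))|].
      replace (n + S k)%nat with (S (n + k)) by lia.
      specialize (H (n + k)%nat). rewrite pow_add in H. simpl.
      apply Rle_trans with (M * (q ^ n * q ^ k) + M * q ^ n * (1 - q ^ k) / (1 - q)); [lra|].
      right. field. lra. }
  assert (HM : 0 <= M). { specialize (H O). simpl in H. assert (X := Cmod_ge_0 (u 1%nat - u O)). lra. }
  apply (Clim_minus_le u); [exact Hl|]. exists n. intros m Hm.
  replace m with (n + (m - n))%nat by lia.
  eapply Rle_trans; [apply Hd|].
  apply Rmult_le_compat_r; [left; apply Rinv_0_lt_compat; lra|].
  assert (0 <= q ^ n) by (apply pow_le; lra).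
  assert (0 <= q ^ (m - n)) by (apply pow_le; lra).
  assert (0 <= M * q ^ n) by (apply Rmult_le_pos; lra). nra.
Qed.

Lemma Cexp_add (a b : C) : Cexp (a + b) = (Cexp a * Cexp b)%C.
Proof.
  destruct a as [a1 a2], b as [b1 b2]. unfold Cexp, Cplus, Cmult, Re, Im; simpl.
  rewrite exp_plus, cos_plus, sin_plus. f_equal; ring.
Qed.

Lemma Cexp_0 : Cexp 0 = 1%C.
Proof. unfold Cexp, Re, Im, RtoC; simpl. rewrite exp_0, cos_0, sin_0. f_equal; ring. Qed.

Lemma Cmod_Cexp (a : C) : Cmod (Cexp a) = exp (Re a).
Proof.
  unfold Cmod, Cexp; simpl.
  replace (_ + _) with (Rsqr (exp (Re a)) * (Rsqr (sin (Im a)) + Rsqr (cos (Im a)))) by (unfold Rsqr; ring).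
  rewrite sin2_cos2, Rmult_1_r. apply sqrt_Rsqr. left; apply exp_pos.
Qed.

Lemma Cexp_neq_0 (a : C) : Cexp a <> 0%C.
Proof.
  intros H. assert (H' := Cmod_Cexp a). rewrite H, Cmod_0 in H'. assert (X := exp_pos (Re a)). lra.
Qed.

Lemma Cexp_opp (a : C) : Cexp (- a) = (/ Cexp a)%C.
Proof.
  assert (H : (Cexp a * Cexp (- a))%C = 1%C).
  { rewrite <- Cexp_add. replace (a + - a)%C with (RtoC 0) by ring. apply Cexp_0. }
  assert (Ha := Cexp_neq_0 a).
  replace (Cexp (- a)) with (/ Cexp a * (Cexp a * Cexp (- a)))%C by (field; exact Ha).
  rewrite H. ring.
Qed.

Lemma Cexp_RtoC (x : R) : Cexp (RtoC x) = RtoC (exp x).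
Proof. unfold Cexp, Re, Im, RtoC; simpl. rewrite cos_0, sin_0. f_equal; ring. Qed.

Lemma Cexp_nat (n : nat) (a : C) : Cexp (RtoC (INR n) * a) = (Cexp a ^ n)%C.
Proof.
  induction n as [|n IH].
  - simpl (INR 0). replace (0 * a)%C with (RtoC 0) by ring. rewrite Cexp_0. reflexivity.
  - rewrite S_INR, RtoC_plus.
    replace ((INR n + 1) * a)%C with (a + INR n * a)%C by ring.
    rewrite Cexp_add, IH. reflexivity.
Qed.

Lemma Cexp_2PI (k : Z) : Cexp (RtoC (2 * PI * IZR k) * Ci) = 1%C.
Proof.
  assert (Hn : forall n : nat, Cexp (RtoC (2 * PI * INR n) * Ci) = 1%C).
  { intros n. replace (RtoC (2 * PI * INR n) * Ci)%C with (RtoC (INR n) * (RtoC (2 * PI) * Ci))%C.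
    2:{ rewrite (Rmult_comm (2 * PI)), (RtoC_mult (INR n)). ring. }
    rewrite Cexp_nat.
    replace (Cexp (RtoC (2 * PI) * Ci)) with (RtoC 1).
    - apply Cpow_1_l.
    - unfold Cexp, Re, Im, RtoC, Ci, Cmult; simpl.
      rewrite !Rmult_0_l, Rmult_0_r, Rmult_1_r, Rminus_0_r, Rplus_0_r, exp_0, cos_2PI, sin_2PI.
      f_equal; ring. }
  destruct (Z_le_gt_dec 0 k) as [Hk|Hk].
  - rewrite <- (Z2Nat.id k Hk), <- INR_IZR_INZ. apply Hn.
  - replace (RtoC (2 * PI * IZR k) * Ci)%C with (- (RtoC (2 * PI * INR (Z.to_nat (- k))) * Ci))%C.
    + rewrite Cexp_opp, Hn. field.
    + rewrite INR_IZR_INZ, Z2Nat.id, opp_IZR by lia.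
      replace (2 * PI * - IZR k) with (- (2 * PI * IZR k)) by ring. rewrite RtoC_opp. ring.
Qed.

(* Stands in for [f] being entire with derivative [f']. *)
Definition C11 (f f' : C -> C) : Prop :=
  forall r : R, exists M : R, 0 <= M /\
    (forall z, Cmod z <= r -> Cmod (f' z) <= M) /\
    (forall z h, Cmod z <= r -> Cmod h <= r ->
       Cmod (f (z + h)%C - f z - f' z * h) <= M * Cmod h ^ 2).

Lemma C11_lip (f f' : C -> C) : C11 f f' ->
  forall r, exists L, 0 <= L /\
    forall z w, Cmod z <= r -> Cmod w <= r -> Cmod (f z - f w) <= L * Cmod (z - w).
Proof.
  intros H r. destruct (H (2 * r)) as [M [HM [H1 H2]]].
  exists (M + M * (2 * Rabs r)). split.
  { assert (X := Rabs_pos r). nra. }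
  intros z w Hz Hw.
  assert (Hr : 0 <= r) by (assert (X := Cmod_ge_0 z); lra).
  rewrite Rabs_pos_eq by lra.
  assert (Hd : Cmod (z - w) <= 2 * r) by (assert (X := Cmod_minus_le z w); lra).
  specialize (H1 w ltac:(lra)). specialize (H2 w (z - w)%C ltac:(lra) Hd).
  replace (w + (z - w))%C with z in H2 by ring.
  replace (f z - f w)%C with ((f z - f w - f' w * (z - w)) + f' w * (z - w))%C by ring.
  eapply Rle_trans; [apply Cmod_triangle|]. rewrite Cmod_mult.
  assert (X := Cmod_ge_0 (z - w)).
  assert (Cmod (f' w) * Cmod (z - w) <= M * Cmod (z - w)) by (apply Rmult_le_compat_r; lra).
  assert (M * Cmod (z - w) ^ 2 <= M * (2 * r) * Cmod (z - w)).
  { simpl. rewrite Rmult_1_r, Rmult_assoc. apply Rmult_le_compat_l; [lra|].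
    apply Rmult_le_compat_r; lra. }
  lra.
Qed.

Lemma lip_bounded (f : C -> C) (r L : R) : 0 <= L ->
  (forall z w, Cmod z <= r -> Cmod w <= r -> Cmod (f z - f w) <= L * Cmod (z - w)) ->
  exists B, 0 <= B /\ forall z, Cmod z <= r -> Cmod (f z) <= B.
Proof.
  intros HL H. exists (Cmod (f 0%C) + L * Rabs r). split.
  { assert (X := Rabs_pos r). assert (Y := Cmod_ge_0 (f 0%C)). nra. }
  intros z Hz. assert (Hr : 0 <= r) by (assert (X := Cmod_ge_0 z); lra).
  specialize (H z 0%C Hz ltac:(rewrite Cmod_0; lra)).
  replace (z - 0)%C with z in H by ring.
  assert (T := Cmod_triangle_inv (f z) (f 0%C)). rewrite Rabs_pos_eq by lra.
  assert (L * Cmod z <= L * r) by (apply Rmult_le_compat_l; lra). lra.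
Qed.

Lemma C11_bounded (f f' : C -> C) : C11 f f' ->
  forall r, exists B, 0 <= B /\ forall z, Cmod z <= r -> Cmod (f z) <= B.
Proof.
  intros H r. destruct (C11_lip f f' H r) as [L [HL H1]]. now apply (lip_bounded f r L).
Qed.

Lemma C11_deriv_lip (f f' : C -> C) : C11 f f' ->
  forall r, exists L, 0 <= L /\
    forall z w, Cmod z <= r -> Cmod w <= r -> Cmod (f' z - f' w) <= L * Cmod (z - w).
Proof.
  intros H r. destruct (H (2 * r)) as [M [HM [H1 H2]]].
  exists (2 * M). split; [lra|]. intros z w Hz Hw.
  assert (Hr : 0 <= r) by (assert (X := Cmod_ge_0 z); lra).
  assert (Hd : Cmod (z - w) <= 2 * r) by (assert (X := Cmod_minus_le z w); lra).
  assert (A := H2 w (z - w)%C ltac:(lra) Hd).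
  assert (B := H2 z (w - z)%C ltac:(lra) ltac:(rewrite Cmod_minus_sym; lra)).
  replace (w + (z - w))%C with z in A by ring.
  replace (z + (w - z))%C with w in B by ring.
  rewrite (Cmod_minus_sym w z) in B.
  assert (T := Cmod_triangle (f z - f w - f' w * (z - w)) (f w - f z - f' z * (w - z))).
  replace (f z - f w - f' w * (z - w) + (f w - f z - f' z * (w - z)))%C
    with ((f' z - f' w) * (z - w))%C in T by ring.
  rewrite Cmod_mult in T.
  destruct (Rle_lt_or_eq_dec _ _ (Cmod_ge_0 (z - w))) as [h|h].
  - apply (Rmult_le_reg_r (Cmod (z - w))); [exact h|]. simpl in *. lra.
  - symmetry in h. rewrite h. apply Cmod_eq_0 in h.
    replace z with w. { rewrite Cminus_diag_0; lra. }
    replace z with ((z - w) + w)%C by ring. rewrite h; ring.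
Qed.

Lemma C11_const (c : C) : C11 (fun _ => c) (fun _ => 0%C).
Proof.
  intros r. exists 0. split; [lra|]. split.
  - intros. rewrite Cmod_0. lra.
  - intros. replace (c - c - 0 * h)%C with (RtoC 0) by ring. rewrite Cmod_0. lra.
Qed.

Lemma C11_id : C11 (fun z => z) (fun _ => 1%C).
Proof.
  intros r. exists 1. split; [lra|]. split.
  - intros. rewrite Cmod_1. lra.
  - intros. replace (z + h - z - 1 * h)%C with (RtoC 0) by ring. rewrite Cmod_0.
    assert (0 <= Cmod h ^ 2) by (apply pow_le, Cmod_ge_0). lra.
Qed.

Lemma C11_ext (f g f' g' : C -> C) :
  (forall z, f z = g z) -> (forall z, f' z = g' z) -> C11 f f' -> C11 g g'.
Proof.
  intros Hf Hf' H r. destruct (H r) as [M [HM [H1 H2]]]. exists M. split; [exact HM|]. split.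
  - intros z Hz. rewrite <- Hf'. auto.
  - intros z h Hz Hh. rewrite <- !Hf, <- Hf'. auto.
Qed.

Lemma C11_plus (f f' g g' : C -> C) : C11 f f' -> C11 g g' ->
  C11 (fun z => f z + g z)%C (fun z => f' z + g' z)%C.
Proof.
  intros Hf Hg r. destruct (Hf r) as [M [HM [H1 H2]]]. destruct (Hg r) as [N [HN [G1 G2]]].
  exists (M + N). split; [lra|]. split.
  - intros z Hz. eapply Rle_trans; [apply Cmod_triangle|].
    specialize (H1 z Hz). specialize (G1 z Hz). lra.
  - intros z h Hz Hh. specialize (H2 z h Hz Hh). specialize (G2 z h Hz Hh).
    replace (f (z + h)%C + g (z + h)%C - (f z + g z) - (f' z + g' z) * h)%C
      with ((f (z + h)%C - f z - f' z * h) + (g (z + h)%C - g z - g' z * h))%C by ring.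
    eapply Rle_trans; [apply Cmod_triangle|]. lra.
Qed.

Lemma C11_comp (f f' g g' : C -> C) : C11 f f' -> C11 g g' ->
  C11 (fun z => f (g z)) (fun z => f' (g z) * g' z)%C.
Proof.
  intros Hf Hg r.
  destruct (C11_bounded g g' Hg (2 * r)) as [B [HB Bg]].
  destruct (C11_lip g g' Hg (2 * r)) as [L [HL Lg]].
  destruct (Hf (2 * B)) as [M [HM [H1 H2]]]. destruct (Hg r) as [N [HN [G1 G2]]].
  exists (M * N + M * L ^ 2). split.
  { assert (0 <= L ^ 2) by (apply pow_le; lra). nra. }
  split.
  - intros z Hz. rewrite Cmod_mult.
    assert (0 <= r) by (assert (X := Cmod_ge_0 z); lra).
    apply Rle_trans with (M * N).
    + apply Rmult_le_compat; try apply Cmod_ge_0; [apply H1 | apply G1; lra].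
      specialize (Bg z ltac:(lra)). lra.
    + assert (0 <= L ^ 2) by (apply pow_le; lra). nra.
  - intros z h Hz Hh.
    assert (0 <= r) by (assert (X := Cmod_ge_0 z); lra).
    assert (Hzh : Cmod (z + h) <= 2 * r) by (assert (X := Cmod_triangle z h); lra).
    assert (A := Lg (z + h)%C z Hzh ltac:(lra)).
    replace (z + h - z)%C with h in A by ring.
    assert (B1 := Bg z ltac:(lra)). assert (B2 := Bg (z + h)%C Hzh).
    assert (Bk : Cmod (g (z + h)%C - g z) <= 2 * B).
    { assert (X := Cmod_minus_le (g (z + h)%C) (g z)). lra. }
    specialize (H1 (g z) ltac:(lra)).
    specialize (H2 (g z) (g (z + h)%C - g z)%C ltac:(lra) Bk).
    specialize (G2 z h Hz Hh).
    replace (g z + (g (z + h)%C - g z))%C with (g (z + h)%C) in H2 by ring.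
    replace (f (g (z + h)%C) - f (g z) - f' (g z) * g' z * h)%C
      with ((f (g (z + h)%C) - f (g z) - f' (g z) * (g (z + h)%C - g z)) +
            f' (g z) * (g (z + h)%C - g z - g' z * h))%C by ring.
    eapply Rle_trans; [apply Cmod_triangle|]. rewrite Cmod_mult.
    assert (M * Cmod (g (z + h)%C - g z) ^ 2 <= M * (L ^ 2 * Cmod h ^ 2)).
    { apply Rmult_le_compat_l; [lra|]. rewrite <- Rpow_mult_distr.
      apply pow_incr. split; [apply Cmod_ge_0|exact A]. }
    assert (Cmod (f' (g z)) * Cmod (g (z + h)%C - g z - g' z * h) <= M * (N * Cmod h ^ 2)).
    { apply Rmult_le_compat; auto; apply Cmod_ge_0. }
    lra.
Qed.

Lemma C11_scal (c : C) (f f' : C -> C) : C11 f f' -> C11 (fun z => c * f z)%C (fun z => c * f' z)%C.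
Proof.
  intros Hf r. destruct (Hf r) as [M [HM [H1 H2]]].
  exists (Cmod c * M). assert (Hc := Cmod_ge_0 c). split; [nra|]. split.
  - intros z Hz. rewrite Cmod_mult. apply Rmult_le_compat_l; auto.
  - intros z h Hz Hh.
    replace (c * f (z + h)%C - c * f z - c * f' z * h)%C with (c * (f (z + h)%C - f z - f' z * h))%C by ring.
    rewrite Cmod_mult, Rmult_assoc. apply Rmult_le_compat_l; auto.
Qed.

Lemma C11_sqr : C11 (fun z => z * z)%C (fun z => 2 * z)%C.
Proof.
  intros r. exists (1 + 2 * Rabs r). assert (X := Rabs_pos r). split; [lra|]. split.
  - intros z Hz. rewrite Cmod_mult, Cmod_RtoC_nonneg by lra.
    assert (r <= Rabs r) by apply Rle_abs. lra.
  - intros z h Hz Hh. replace ((z + h) * (z + h) - z * z - 2 * z * h)%C with (h * h)%C by ring.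
    rewrite Cmod_mult. replace (Cmod h * Cmod h) with (Cmod h ^ 2) by ring.
    assert (0 <= Cmod h ^ 2) by (apply pow_le, Cmod_ge_0). nra.
Qed.

(* Polarization reduces products to squares. *)
Lemma C11_mult (f f' g g' : C -> C) : C11 f f' -> C11 g g' ->
  C11 (fun z => f z * g z)%C (fun z => f' z * g z + f z * g' z)%C.
Proof.
  intros Hf Hg.
  assert (Hm := C11_plus _ _ _ _ Hf (C11_scal (- (1))%C _ _ Hg)).
  assert (Hp := C11_plus _ _ _ _ Hf Hg).
  assert (Sp := C11_comp _ _ _ _ C11_sqr Hp). assert (Sm := C11_comp _ _ _ _ C11_sqr Hm).
  assert (H := C11_scal (/ 4)%C _ _ (C11_plus _ _ _ _ Sp (C11_scal (- (1))%C _ _ Sm))).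
  eapply C11_ext; [| |exact H]; intros z; simpl.
  - field.
  - field.
Qed.

Lemma abs_sin_le (x : R) : Rabs (sin x) <= Rabs x.
Proof.
  destruct (MVT_gen sin 0 x cos) as [c [_ Hc]].
  - intros y _. apply is_derive_sin.
  - intros y _. apply continuity_sin.
  - rewrite sin_0, !Rminus_0_r in Hc. rewrite Hc, Rabs_mult.
    assert (Rabs (cos c) <= 1) by (apply Rabs_le, COS_bound).
    assert (X := Rabs_pos x). nra.
Qed.

Lemma one_minus_cos (x : R) : 1 - cos x = 2 * Rsqr (sin (x / 2)).
Proof.
  replace x with (2 * (x / 2)) at 1 by field. rewrite cos_2a_sin. unfold Rsqr. ring.
Qed.

Lemma one_minus_cos_le (x : R) : 0 <= 1 - cos x <= x ^ 2 / 2.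
Proof.
  rewrite one_minus_cos. assert (X := Rle_0_sqr (sin (x / 2))). split; [lra|].
  assert (Rsqr (sin (x / 2)) <= Rsqr (x / 2)) by apply Rsqr_le_abs_1, abs_sin_le.
  unfold Rsqr in *. lra.
Qed.

Lemma one_minus_cos_le_abs (x : R) : 1 - cos x <= Rabs x.
Proof.
  rewrite one_minus_cos.
  assert (A := abs_sin_le (x / 2)).
  assert (B : Rabs (sin (x / 2)) <= 1) by (apply Rabs_le, SIN_bound).
  rewrite Rsqr_abs. unfold Rsqr.
  replace (Rabs (x / 2)) with (Rabs x / 2) in A.
  2:{ unfold Rdiv. rewrite Rabs_mult, (Rabs_pos_eq (/ 2)); lra. }
  assert (X := Rabs_pos (sin (x / 2))). nra.
Qed.

Lemma abs_sin_minus_id (x : R) : Rabs (sin x - x) <= x ^ 2.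
Proof.
  destruct (MVT_gen sin 0 x cos) as [c [Hc1 Hc]].
  - intros y _. apply is_derive_sin.
  - intros y _. apply continuity_sin.
  - rewrite sin_0, !Rminus_0_r in Hc. rewrite Hc.
    replace (cos c * x - x) with (- ((1 - cos c) * x)) by ring.
    rewrite Rabs_Ropp, Rabs_mult.
    assert (A := one_minus_cos_le_abs c). assert (B := one_minus_cos_le c).
    rewrite (Rabs_pos_eq (1 - cos c)) by lra.
    assert (Rabs c <= Rabs x).
    { unfold Rmin, Rmax in Hc1. destruct (Rle_dec 0 x).
      - rewrite !Rabs_pos_eq; lra.
      - rewrite !Rabs_left1; lra. }
    replace (x ^ 2) with (Rabs x * Rabs x).
    2:{ rewrite <- Rabs_mult, Rabs_pos_eq; nra. }
    apply Rmult_le_compat_r; [apply Rabs_pos|lra].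
Qed.

Lemma exp_le_mono (x y : R) : x <= y -> exp x <= exp y.
Proof. intros [H|H]; [left; now apply exp_increasing|right; now rewrite H]. Qed.

Lemma exp_ge_1_plus (x : R) : 1 + x <= exp x.
Proof. apply exp_ineq1_le. Qed.

Lemma exp_minus_1_bounds (x : R) : x <= exp x - 1 <= x * exp x.
Proof.
  assert (A := exp_ge_1_plus x). assert (B := exp_ge_1_plus (- x)).
  assert (Hp := exp_pos x).
  assert (E : exp x * exp (- x) = 1).
  { rewrite <- exp_plus, Rplus_opp_r. apply exp_0. }
  split; [lra|]. nra.
Qed.

Lemma abs_exp_minus_1 (x : R) : Rabs (exp x - 1) <= Rabs x * exp (Rabs x).
Proof.
  assert (A := exp_minus_1_bounds x). assert (Hp := exp_pos x).
  destruct (Rle_dec 0 x) as [h|h].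
  - rewrite (Rabs_pos_eq x), Rabs_pos_eq by lra. lra.
  - rewrite (Rabs_left1 x) by lra. assert (B := exp_ge_1_plus (- x)).
    assert (exp x <= 1) by (rewrite <- exp_0; left; apply exp_increasing; lra).
    rewrite Rabs_left1 by lra. nra.
Qed.

Lemma abs_exp_remainder (x : R) : Rabs (exp x - 1 - x) <= x ^ 2 * exp (Rabs x).
Proof.
  assert (A := exp_minus_1_bounds x).
  rewrite Rabs_pos_eq by lra.
  apply Rle_trans with (x * (exp x - 1)); [lra|].
  eapply Rle_trans; [apply Rle_abs|]. rewrite Rabs_mult.
  replace (x ^ 2) with (Rabs x * Rabs x).
  2:{ rewrite <- Rabs_mult, Rabs_pos_eq; nra. }
  rewrite Rmult_assoc. apply Rmult_le_compat_l; [apply Rabs_pos|apply abs_exp_minus_1].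
Qed.

Lemma Cexp_remainder (h : C) : Cmod (Cexp h - 1 - h) <= 5 * exp (Cmod h) * Cmod h ^ 2.
Proof.
  assert (Ha := re_le_Cmod h). assert (Hb := snd_le_Cmod h). unfold Re in Ha.
  eapply Rle_trans; [apply Cmod_le_parts|].
  destruct h as [a b]. cbn -[Cmod pow Rabs] in *.
  set (m := Cmod (a, b)) in *.
  assert (Hm : 0 <= m) by apply Cmod_ge_0.
  assert (Ea : exp a <= exp m).
  { apply exp_le_mono. eapply Rle_trans; [apply Rle_abs|exact Ha]. }
  assert (Ea' : exp (Rabs a) <= exp m) by (apply exp_le_mono; exact Ha).
  assert (E1 : 1 <= exp m) by (assert (X := exp_ge_1_plus m); lra).
  assert (Pa := exp_pos a).
  assert (A2 : a ^ 2 <= m ^ 2) by (rewrite <- (pow2_abs a); apply pow_incr; split; [apply Rabs_pos|auto]).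
  assert (B2 : b ^ 2 <= m ^ 2) by (rewrite <- (pow2_abs b); apply pow_incr; split; [apply Rabs_pos|auto]).
  assert (Z : 0 <= a ^ 2) by nra. assert (Zb : 0 <= b ^ 2) by nra.
  set (E := exp m) in *.
  assert (T1 : Rabs (exp a * cos b + - (1) + - a) <= 2 * (E * m ^ 2)).
  { replace (exp a * cos b + - (1) + - a) with ((exp a - 1 - a) - exp a * (1 - cos b)) by ring.
    unfold Rminus at 1. eapply Rle_trans; [apply Rabs_triang|]. rewrite Rabs_Ropp, Rabs_mult.
    rewrite (Rabs_pos_eq (exp a)) by lra.
    assert (C1 := one_minus_cos_le b). rewrite (Rabs_pos_eq (1 - cos b)) by lra.
    assert (R1 := abs_exp_remainder a).
    assert (a ^ 2 * exp (Rabs a) <= m ^ 2 * E).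
    { apply Rmult_le_compat; auto. left; apply exp_pos. }
    assert (exp a * (1 - cos b) <= E * m ^ 2).
    { apply Rmult_le_compat; lra. }
    lra. }
  assert (T2 : Rabs (exp a * sin b + - 0 + - b) <= 2 * (E * m ^ 2)).
  { replace (exp a * sin b + - 0 + - b) with (exp a * (sin b - b) + (exp a - 1) * b) by ring.
    eapply Rle_trans; [apply Rabs_triang|]. rewrite !Rabs_mult.
    rewrite (Rabs_pos_eq (exp a)) by lra.
    assert (S1 := abs_sin_minus_id b). assert (R1 := abs_exp_minus_1 a).
    assert (exp a * Rabs (sin b - b) <= E * m ^ 2).
    { apply Rmult_le_compat; try lra. apply Rabs_pos. }
    assert (Rabs (exp a - 1) * Rabs b <= (m * E) * m).
    { apply Rmult_le_compat; try apply Rabs_pos; auto.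
      eapply Rle_trans; [exact R1|]. apply Rmult_le_compat; auto; [apply Rabs_pos|left; apply exp_pos]. }
    nra. }
  assert (0 <= E * m ^ 2) by nra.
  lra.
Qed.

Lemma C11_Cexp : C11 Cexp Cexp.
Proof.
  intros r. exists (exp r + exp r * (5 * exp r)).
  assert (Hp := exp_pos r). split; [nra|]. split.
  - intros z Hz. rewrite Cmod_Cexp.
    assert (exp (Re z) <= exp r).
    { apply exp_le_mono. assert (X := re_le_Cmod z). assert (Y := Rle_abs (Re z)). lra. }
    nra.
  - intros z h Hz Hh. rewrite Cexp_add.
    replace (Cexp z * Cexp h - Cexp z - Cexp z * h)%C with (Cexp z * (Cexp h - 1 - h))%C by ring.
    rewrite Cmod_mult, Cmod_Cexp.
    assert (exp (Re z) <= exp r).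
    { apply exp_le_mono. assert (X := re_le_Cmod z). assert (Y := Rle_abs (Re z)). lra. }
    assert (exp (Cmod h) <= exp r) by (apply exp_le_mono; lra).
    assert (X := Cexp_remainder h).
    assert (Y : 0 <= Cmod h ^ 2) by (apply pow_le, Cmod_ge_0).
    apply Rle_trans with (exp r * (5 * exp r * Cmod h ^ 2)).
    + apply Rmult_le_compat; auto; [left; apply exp_pos|apply Cmod_ge_0|].
      eapply Rle_trans; [exact X|]. apply Rmult_le_compat_r; lra.
    + nra.
Qed.

(** * The functions [Phi] and [Pi] *)

Definition entire_coeffs (a : nat -> R) : Prop :=
  (forall j, 0 <= a j) /\ forall r, 0 <= r -> ex_series (fun j => a j * r ^ j).

Lemma INR_le_pow2 (n : nat) : INR n <= 2 ^ n.
Proof.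
  induction n as [|n IH]; [simpl; lra|]. rewrite S_INR. simpl.
  assert (1 <= 2 ^ n) by (apply pow_R1_Rle; lra). lra.
Qed.

Lemma ex_series_le_nonneg (a b : nat -> R) :
  (forall n, 0 <= a n <= b n) -> ex_series b -> ex_series a.
Proof.
  intros H. apply (@ex_series_le R_AbsRing R_CompleteNormedModule a b).
  intros n. change (Rabs (a n) <= b n). rewrite Rabs_pos_eq; apply H.
Qed.

Lemma entire_coeffs_derive (a : nat -> R) : entire_coeffs a -> entire_coeffs (PS_derive a).
Proof.
  intros [Ha H]. unfold PS_derive. split.
  - intros j. apply Rmult_le_pos; [apply pos_INR|apply Ha].
  - intros r Hr.
    apply (ex_series_le_nonneg _ (fun j => a (S j) * (2 * (r + 1)) ^ S j)).
    + intros j.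
      assert (0 <= r ^ j) by (apply pow_le; lra).
      split.
      * apply Rmult_le_pos; auto. apply Rmult_le_pos; [apply pos_INR|apply Ha].
      * rewrite (Rmult_comm (INR _)), Rmult_assoc. apply Rmult_le_compat_l; [apply Ha|].
        rewrite Rpow_mult_distr. apply Rmult_le_compat; [apply pos_INR|auto|apply INR_le_pow2|].
        apply Rle_trans with ((r + 1) ^ j); [apply pow_incr; lra|].
        simpl. assert (0 <= (r + 1) ^ j) by (apply pow_le; lra). nra.
    + apply (ex_series_incr_1 (fun j => a j * (2 * (r + 1)) ^ j)). apply H. lra.
Qed.

Lemma Cmod_pgf_term (a : nat -> R) (z : C) (j : nat) : (forall j, 0 <= a j) ->
  Cmod (RtoC (a j) * z ^ j) = a j * Cmod z ^ j.
Proof. intros H. now rewrite Cmod_mult, Cmod_pow, Cmod_RtoC_nonneg. Qed.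

Lemma pgf_is_series (a : nat -> R) (z : C) : entire_coeffs a ->
  is_Cseries (fun j => RtoC (a j) * z ^ j)%C (pgf a z).
Proof.
  intros [Ha H].
  destruct (ex_Cseries_le (fun j => RtoC (a j) * z ^ j)%C (fun j => a j * Cmod z ^ j)) as [l Hl].
  - intros j. rewrite Cmod_pgf_term; [lra|exact Ha].
  - apply H, Cmod_ge_0.
  - unfold pgf. now rewrite (CSeries_unique _ l Hl).
Qed.

Lemma PSeries_is_series (a : nat -> R) (x : R) : entire_coeffs a -> 0 <= x ->
  is_series (fun j => a j * x ^ j) (PSeries a x).
Proof. intros [Ha H] Hx. apply Series_correct, H, Hx. Qed.

Lemma sum_n_RtoC (a : nat -> R) (n : nat) :
  @sum_n C_AbelianMonoid (fun j => RtoC (a j)) n = RtoC (sum_n a n).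
Proof.
  induction n as [|n IH].
  - now rewrite !sum_O.
  - rewrite !sum_Sn, IH. symmetry. apply RtoC_plus.
Qed.

Lemma is_Cseries_RtoC (a : nat -> R) (l : R) : is_series a l -> is_Cseries (fun j => RtoC (a j)) (RtoC l).
Proof.
  intros H. apply is_series_Clim. intros eps He.
  assert (H' : is_lim_seq (sum_n a) l) by exact H.
  apply is_lim_seq_spec in H'. destruct (H' (mkposreal eps He)) as [N HN]. exists N. intros n Hn.
  rewrite sum_n_RtoC, <- RtoC_minus, Cmod_R. apply (HN n Hn).
Qed.

Lemma pgf_RtoC (a : nat -> R) (x : R) : entire_coeffs a -> 0 <= x -> pgf a (RtoC x) = RtoC (PSeries a x).
Proof.
  intros H Hx. refine (is_Cseries_unique _ _ _ (pgf_is_series a x H) _).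
  apply (is_Cseries_ext (fun j => RtoC (a j * x ^ j))).
  - intros n. now rewrite RtoC_mult, RtoC_pow.
  - apply is_Cseries_RtoC, PSeries_is_series; auto.
Qed.

Lemma pgf_derive_is_series (a : nat -> R) (z : C) : entire_coeffs a ->
  is_Cseries (fun j => RtoC (a j) * (RtoC (INR j) * z ^ pred j))%C (pgf (PS_derive a) z).
Proof.
  intros H.
  apply (@is_series_decr_1 C_AbsRing C_NormedModule).
  change (is_Cseries (fun k => RtoC (a (S k)) * (RtoC (INR (S k)) * z ^ k))%C
            (pgf (PS_derive a) z + - (RtoC (a O) * (RtoC (INR 0) * z ^ 0)))%C).
  replace (pgf (PS_derive a) z + - (RtoC (a O) * (RtoC (INR 0) * z ^ 0)))%C
    with (pgf (PS_derive a) z) by (simpl; ring).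
  apply (is_Cseries_ext (fun k => RtoC (PS_derive a k) * z ^ k)%C).
  - intros n. unfold PS_derive. rewrite RtoC_mult. ring.
  - apply pgf_is_series, entire_coeffs_derive, H.
Qed.

Lemma Cpow_taylor (r : R) (z h : C) (j : nat) : Cmod z <= r -> Cmod h <= r ->
  Cmod ((z + h) ^ j - z ^ j - RtoC (INR j) * z ^ pred j * h)
    <= INR j ^ 2 * (2 * r + 1) ^ j * Cmod h ^ 2.
Proof.
  intros Hz Hh.
  assert (Hr : 0 <= r) by (assert (X := Cmod_ge_0 z); lra).
  set (rho := 2 * r + 1). assert (Hrho : 1 <= rho) by (unfold rho; lra).
  assert (H2 : 0 <= Cmod h ^ 2) by (apply pow_le, Cmod_ge_0).
  induction j as [|j IH].
  - simpl INR. replace ((z + h) ^ 0 - z ^ 0 - 0 * z ^ pred 0 * h)%C with (RtoC 0) by (simpl; ring). rewrite Cmod_0. simpl. lra.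
  - replace ((z + h) ^ S j - z ^ S j - RtoC (INR (S j)) * z ^ pred (S j) * h)%C
      with ((z + h) * ((z + h) ^ j - z ^ j - RtoC (INR j) * z ^ pred j * h)
            + RtoC (INR j) * z ^ pred j * (h * h))%C.
    2:{ rewrite S_INR, RtoC_plus. destruct j as [|j]; [simpl; ring|]. simpl pred.
        rewrite !Cpow_S. ring. }
    eapply Rle_trans; [apply Cmod_triangle|].
    rewrite !Cmod_mult, Cmod_pow, Cmod_RtoC_nonneg by apply pos_INR.
    assert (Hzh : Cmod (z + h) <= rho) by (assert (X := Cmod_triangle z h); unfold rho; lra).
    assert (P1 : 1 <= rho ^ j) by (apply pow_R1_Rle; lra).
    assert (P2 : Cmod z ^ pred j <= rho ^ j).
    { apply Rle_trans with (rho ^ pred j).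
      - apply pow_incr. split; [apply Cmod_ge_0|unfold rho; lra].
      - apply Rle_pow; [lra|lia]. }
    assert (N0 := pos_INR j).
    assert (T1 : Cmod (z + h) * Cmod ((z + h) ^ j - z ^ j - RtoC (INR j) * z ^ pred j * h)
                 <= rho * (INR j ^ 2 * rho ^ j * Cmod h ^ 2)).
    { apply Rmult_le_compat; auto; apply Cmod_ge_0. }
    assert (T2 : INR j * Cmod z ^ pred j * (Cmod h * Cmod h) <= INR j * rho ^ j * Cmod h ^ 2).
    { replace (Cmod h * Cmod h) with (Cmod h ^ 2) by ring.
      apply Rmult_le_compat_r; auto. apply Rmult_le_compat_l; auto. }
    eapply Rle_trans; [apply Rplus_le_compat; [exact T1|exact T2]|].
    rewrite S_INR. simpl (rho ^ S j).
    replace (rho * (INR j ^ 2 * rho ^ j * Cmod h ^ 2) + INR j * rho ^ j * Cmod h ^ 2)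
      with ((rho * INR j ^ 2 + INR j * 1) * (rho ^ j * Cmod h ^ 2)) by ring.
    replace ((INR j + 1) ^ 2 * (rho * rho ^ j) * Cmod h ^ 2)
      with ((rho * (INR j + 1) ^ 2) * (rho ^ j * Cmod h ^ 2)) by ring.
    apply Rmult_le_compat_r; [nra|]. nra.
Qed.

Lemma C11_pgf (a : nat -> R) : entire_coeffs a -> C11 (pgf a) (pgf (PS_derive a)).
Proof.
  intros H r.
  assert (Hd := entire_coeffs_derive a H).
  destruct (Rle_dec 0 r) as [Hr|Hr].
  2:{ exists 0. split; [lra|]. split; intros z; assert (X := Cmod_ge_0 z); intros; lra. }
  set (rho := 2 * r + 1).
  assert (Hs : ex_series (fun j => a j * (4 * rho) ^ j)) by (apply H; unfold rho; lra).
  destruct Hs as [S HS].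
  destruct (proj2 Hd r Hr) as [D HD].
  assert (PS : 0 <= S).
  { eapply Rle_trans; [|eapply (sum_n_le_series _ _ 0%nat _ HS)].
    - rewrite sum_O. simpl. assert (X := proj1 H O). lra.
    Unshelve. intros k. apply Rmult_le_pos; [apply H|]. apply pow_le. unfold rho; lra. }
  assert (PD : 0 <= D).
  { eapply Rle_trans; [|eapply (sum_n_le_series _ _ 0%nat _ HD)].
    - rewrite sum_O. simpl. assert (X := proj1 Hd O). lra.
    Unshelve. intros k. apply Rmult_le_pos; [apply Hd|]. apply pow_le. lra. }
  exists (D + S). split; [lra|]. split.
  - intros z Hz. apply Rle_trans with D; [|lra].
    refine (Cmod_series_le _ _ _ _ _ (pgf_is_series _ z Hd) HD).
    intros n. rewrite Cmod_pgf_term by apply Hd. apply Rmult_le_compat_l; [apply Hd|].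
    apply pow_incr. split; [apply Cmod_ge_0|exact Hz].
  - intros z h Hz Hh.
    assert (H2 : 0 <= Cmod h ^ 2) by (apply pow_le, Cmod_ge_0).
    apply Rle_trans with (Cmod h ^ 2 * S); [|nra].
    assert (Hser := is_Cseries_minus _ _ _ _
       (is_Cseries_minus _ _ _ _ (pgf_is_series a (z + h) H) (pgf_is_series a z H))
       (is_Cseries_scal h _ _ (pgf_derive_is_series a z H))).
    replace (pgf (PS_derive a) z * h)%C with (h * pgf (PS_derive a) z)%C by ring.
    refine (Cmod_series_le _ _ _ _ _ Hser (is_series_scal_l (V := R_NormedModule) (Cmod h ^ 2) _ _ HS)).
    intros n. simpl.
    replace (RtoC (a n) * (z + h) ^ n - RtoC (a n) * z ^ n - h * (RtoC (a n) * (RtoC (INR n) * z ^ pred n)))%C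
      with (RtoC (a n) * ((z + h) ^ n - z ^ n - RtoC (INR n) * z ^ pred n * h))%C by ring.
    rewrite Cmod_mult, Cmod_RtoC_nonneg by apply H.
    change (a n * Cmod ((z + h) ^ n - z ^ n - RtoC (INR n) * z ^ pred n * h)
            <= Cmod h ^ 2 * (a n * (4 * rho) ^ n)).
    rewrite <- Rmult_assoc, (Rmult_comm (Cmod h ^ 2)), Rmult_assoc.
    apply Rmult_le_compat_l; [apply H|].
    eapply Rle_trans; [apply (Cpow_taylor r); auto|]. fold rho.
    rewrite Rmult_comm. apply Rmult_le_compat_l; auto.
    rewrite Rpow_mult_distr.
    apply Rmult_le_compat_r; [apply pow_le; unfold rho; lra|].
    replace 4 with (2 * 2) by ring. rewrite Rpow_mult_distr.
    assert (X := INR_le_pow2 n). assert (Y := pos_INR n). nra.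
Qed.

Lemma C11_iter (f f' : C -> C) (n : nat) : C11 f f' -> exists g', C11 (fun z => Nat.iter n f z) g'.
Proof.
  intros H. induction n as [|n [g' IH]].
  - exists (fun _ => 1%C). exact C11_id.
  - eexists. exact (C11_comp _ _ _ _ H IH).
Qed.

Definition entire_offspring (p : nat -> R) : Prop :=
  is_pgf_coeffs p /\ 0 < p 1%nat < 1 /\ CV_radius p = p_infty.

Lemma entire_offspring_coeffs (p : nat -> R) : entire_offspring p -> entire_coeffs p.
Proof.
  intros [[Hp _] [_ Hcv]]. split; [exact Hp|].
  intros r Hr.
  assert (H := CV_disk_inside p r ltac:(rewrite Hcv; exact I)).
  revert H. apply ex_series_ext. intros n.
  apply Rabs_pos_eq, Rmult_le_pos; [apply Hp|now apply pow_le].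
Qed.

Lemma pgf_1 (p : nat -> R) : entire_offspring p -> pgf p 1 = 1%C.
Proof.
  intros H. assert (He := entire_offspring_coeffs p H).
  refine (is_Cseries_unique _ _ _ (pgf_is_series p 1 He) _).
  apply (is_Cseries_ext (fun j => RtoC (p j))).
  - intros n. rewrite Cpow_1_l. ring.
  - apply is_Cseries_RtoC, H.
Qed.

Lemma is_series_0 : is_series (fun _ : nat => 0) 0.
Proof.
  assert (E : is_lim_seq (sum_n (fun _ : nat => 0)) 0).
  { apply is_lim_seq_ext with (fun _ => 0); [|apply is_lim_seq_const].
    intros n. rewrite sum_n_const. ring. }
  exact E.
Qed.

Lemma is_Cseries_tail2 (a : nat -> C) (l : C) : a O = 0%C -> is_Cseries a l ->
  is_Cseries (fun k => a (S (S k))) (l - a 1%nat)%C.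
Proof.
  intros H0 H. apply is_Cseries_decr in H; [|exact H0].
  apply (@is_series_incr_1 C_AbsRing C_NormedModule (fun k => a (S k))).
  change (is_Cseries (fun k => a (S k)) (l - a 1%nat + a 1%nat)%C).
  replace (l - a 1%nat + a 1%nat)%C with l by ring. exact H.
Qed.

Lemma is_series_tail2 (a : nat -> R) (l : R) : a O = 0 -> is_series a l ->
  is_series (fun k => a (S (S k))) (l - a 1%nat).
Proof.
  intros H0 H.
  apply (@is_series_incr_1 R_AbsRing R_NormedModule (fun k => a (S k))).
  apply (@is_series_incr_1 R_AbsRing R_NormedModule a).
  change (is_series a (l - a 1%nat + a 1%nat + a O)).
  rewrite H0. replace (l - a 1%nat + a 1%nat + 0) with l by ring. exact H.
Qed.

Lemma pgf_minus_linear (p : nat -> R) (z : C) : entire_offspring p -> Cmod z <= 1 ->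
  Cmod (pgf p z - RtoC (p 1%nat) * z) <= (1 - p 1%nat) * Cmod z ^ 2.
Proof.
  intros H Hz. assert (He := entire_offspring_coeffs p H).
  destruct H as [[Hp [Hs H0]] [H1 Hcv]].
  assert (A := is_Cseries_tail2 (fun j => RtoC (p j) * z ^ j)%C _ ltac:(simpl; rewrite H0; ring) (pgf_is_series p z He)).
  simpl in A. rewrite Cmult_1_r in A.
  assert (B := is_series_tail2 _ _ H0 Hs).
  apply (is_series_scal_l (V := R_NormedModule) (Cmod z ^ 2)) in B.
  rewrite Rmult_comm.
  refine (Cmod_series_le _ _ _ _ _ A B).
  intros n. change (scal (Cmod z ^ 2) (p (S (S n)))) with (Cmod z ^ 2 * p (S (S n))).
  rewrite !Cmod_mult, Cmod_pow, Cmod_RtoC_nonneg by apply Hp.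
  assert (X := Cmod_ge_0 z). assert (Y : 0 <= Cmod z ^ n <= 1).
  { split; [now apply pow_le|]. rewrite <- (pow1 n). apply pow_incr; lra. }
  assert (Z := Hp (S (S n))).
  rewrite Rmult_comm. apply Rmult_le_compat_r; [exact Z|].
  replace (Cmod z ^ 2) with (Cmod z * (Cmod z * 1)) by ring.
  apply Rmult_le_compat_l; auto. apply Rmult_le_compat_l; auto. lra.
Qed.

Lemma pgf_unit_disc (p : nat -> R) (z : C) : entire_offspring p -> Cmod z <= 1 ->
  Cmod (pgf p z) <= Cmod z * (p 1%nat + (1 - p 1%nat) * Cmod z).
Proof.
  intros H Hz. assert (X := pgf_minus_linear p z H Hz).
  assert (T := Cmod_triangle_inv (pgf p z) (RtoC (p 1%nat) * z)).
  rewrite Cmod_mult, Cmod_RtoC_nonneg in T by (destruct H as [_ [H1 _]]; lra).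
  simpl in X. lra.
Qed.

Lemma pgf_unit_disc_le (p : nat -> R) (z : C) : entire_offspring p -> Cmod z <= 1 ->
  Cmod (pgf p z) <= Cmod z.
Proof.
  intros H Hz. eapply Rle_trans; [now apply pgf_unit_disc|].
  assert (X := Cmod_ge_0 z). destruct H as [_ [H1 _]].
  assert (0 <= (1 - p 1%nat) * (Cmod z * (1 - Cmod z))) by (apply Rmult_le_pos; nra). nra.
Qed.

Lemma pgf_iter_S (p : nat -> R) (t : nat) (z : C) : pgf_iter p (S t) z = pgf p (pgf_iter p t z).
Proof. reflexivity. Qed.

Lemma pgf_iter_comm (p : nat -> R) (t : nat) (z : C) : pgf_iter p (S t) z = pgf_iter p t (pgf p z).
Proof. induction t as [|t IH]; [reflexivity|]. rewrite pgf_iter_S, IH. reflexivity. Qed.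

Lemma pgf_iter_unit_disc (p : nat -> R) (t : nat) (z : C) : entire_offspring p -> Cmod z <= 1 ->
  Cmod (pgf_iter p t z) <= Cmod z.
Proof.
  intros H Hz. induction t as [|t IH]; [apply Rle_refl|].
  rewrite pgf_iter_S. eapply Rle_trans; [apply pgf_unit_disc_le; [exact H|lra]|exact IH].
Qed.

Lemma pgf_iter_geometric (p : nat -> R) (rho : R) (t : nat) (z : C) :
  entire_offspring p -> rho < 1 -> Cmod z <= rho ->
  Cmod (pgf_iter p t z) <= (p 1%nat + (1 - p 1%nat) * rho) ^ t * rho.
Proof.
  intros H Hr Hz. assert (H1 : 0 < p 1%nat < 1) by apply H.
  assert (H0 := Cmod_ge_0 z).
  set (lam := p 1%nat + (1 - p 1%nat) * rho).
  assert (Hl : 0 < lam < 1) by (unfold lam; nra).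
  induction t as [|t IH]; [simpl; lra|].
  rewrite pgf_iter_S. set (w := pgf_iter p t z) in *.
  assert (Hw0 := Cmod_ge_0 w).
  assert (Q : 0 < lam ^ t <= 1).
  { split; [now apply pow_lt|]. rewrite <- (pow1 t). apply pow_incr; lra. }
  assert (Hw : Cmod w <= rho) by nra.
  eapply Rle_trans; [apply pgf_unit_disc; [exact H|lra]|].
  simpl. assert (p 1%nat + (1 - p 1%nat) * Cmod w <= lam) by (unfold lam; nra).
  apply Rle_trans with (Cmod w * lam); [apply Rmult_le_compat_l; lra|]. nra.
Qed.

Lemma pgf_iter_rate (p : nat -> R) (rho : R) : entire_offspring p -> rho < 1 ->
  exists A, 1 <= A /\ forall t z, Cmod z <= rho ->
    Cmod (pgf_iter p t z) <= A * p 1%nat ^ t * Cmod z.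
Proof.
  intros H Hr. assert (H1 : 0 < p 1%nat < 1) by apply H.
  destruct (Rlt_dec rho 0) as [Hn|Hn].
  { exists 1. split; [lra|]. intros t z Hz. assert (X := Cmod_ge_0 z). lra. }
  set (lam := p 1%nat + (1 - p 1%nat) * rho).
  assert (Hl : 0 < lam < 1) by (unfold lam; nra).
  set (K := (1 - p 1%nat) / p 1%nat).
  assert (HK : 0 < K) by (apply Rdiv_lt_0_compat; lra).
  assert (HKl : 0 < K / (1 - lam)) by (apply Rdiv_lt_0_compat; lra).
  exists (exp (K / (1 - lam))). split.
  { assert (X := exp_ge_1_plus (K / (1 - lam))). lra. }
  intros t z Hz.
  assert (M : Cmod (pgf_iter p t z) <= exp (K * (1 - lam ^ t) / (1 - lam)) * p 1%nat ^ t * Cmod z).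
  { induction t as [|t IH].
    - simpl. unfold Rdiv. rewrite Rminus_diag, Rmult_0_r, Rmult_0_l, exp_0. lra.
    - rewrite pgf_iter_S. assert (G := pgf_iter_geometric p rho t z H Hr Hz). fold lam in G.
      set (w := pgf_iter p t z) in *. assert (Hw := Cmod_ge_0 w).
      assert (Q : 0 < lam ^ t <= 1).
      { split; [now apply pow_lt|]. rewrite <- (pow1 t). apply pow_incr; lra. }
      assert (Hw1 : Cmod w <= lam ^ t) by nra.
      eapply Rle_trans; [apply pgf_unit_disc; [exact H|lra]|].
      replace (p 1%nat + (1 - p 1%nat) * Cmod w) with (p 1%nat * (1 + K * Cmod w))
        by (unfold K; field; lra).
      replace (exp (K * (1 - lam ^ S t) / (1 - lam)))
        with (exp (K * (1 - lam ^ t) / (1 - lam)) * exp (K * lam ^ t)).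
      2:{ rewrite <- exp_plus. f_equal. simpl. field. lra. }
      assert (E : 1 + K * Cmod w <= exp (K * lam ^ t)).
      { eapply Rle_trans; [|apply exp_ge_1_plus]. nra. }
      simpl.
      replace (exp (K * (1 - lam ^ t) / (1 - lam)) * exp (K * lam ^ t) * (p 1%nat * p 1%nat ^ t) * Cmod z)
        with ((exp (K * (1 - lam ^ t) / (1 - lam)) * p 1%nat ^ t * Cmod z) * (p 1%nat * exp (K * lam ^ t))) by ring.
      apply Rmult_le_compat; auto.
      + apply Rmult_le_pos; [lra|]. nra.
      + apply Rmult_le_compat_l; lra. }
  eapply Rle_trans; [exact M|].
  apply Rmult_le_compat_r; [apply Cmod_ge_0|]. apply Rmult_le_compat_r; [apply pow_le; lra|].
  apply exp_le_mono. unfold Rdiv. apply Rmult_le_compat_r; [left; apply Rinv_0_lt_compat; lra|].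
  assert (0 < lam ^ t) by now apply pow_lt. nra.
Qed.

Definition Phi_iter (p : nat -> R) (t : nat) (z : C) : C :=
  (pgf_iter p t z / RtoC (p 1%nat) ^ t)%C.

Lemma Cmod_div_pow (x : R) (t : nat) (z : C) : 0 < x -> Cmod (z / RtoC x ^ t) = Cmod z / x ^ t.
Proof.
  intros Hx. rewrite Cmod_div.
  - now rewrite Cmod_pow, Cmod_RtoC_nonneg by lra.
  - apply Cpow_nz. intros E. injection E. lra.
Qed.

Lemma RtoC_neq_0 (x : R) : x <> 0 -> RtoC x <> 0%C.
Proof. intros H E. injection E. exact H. Qed.

Lemma Phi_limit (p : nat -> R) (rho : R) : entire_offspring p -> rho < 1 ->
  exists B, 0 <= B /\ forall z, Cmod z <= rho ->
    Clim (fun t => Phi_iter p t z) (Phi p z) /\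
    forall t, Cmod (Phi p z - Phi_iter p t z) <= B * p 1%nat ^ t.
Proof.
  intros H Hr. assert (H1 : 0 < p 1%nat < 1) by apply H.
  destruct (Rlt_dec rho 0) as [Hn|Hn].
  { exists 1. split; [lra|]. intros z Hz. assert (X := Cmod_ge_0 z). lra. }
  destruct (pgf_iter_rate p rho H Hr) as [A [HA HR]].
  set (K := (1 - p 1%nat) * A ^ 2 / p 1%nat).
  assert (HK : 0 <= K).
  { unfold K. apply Rmult_le_pos; [|left; apply Rinv_0_lt_compat; lra]. nra. }
  exists (K / (1 - p 1%nat)). split.
  { apply Rmult_le_pos; [lra|left; apply Rinv_0_lt_compat; lra]. }
  intros z Hz.
  destruct (Cauchy_geom_Clim (fun t => Phi_iter p t z) K (p 1%nat) ltac:(lra)) as [l [Hl1 Hl2]].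
  - intros t. unfold Phi_iter. rewrite pgf_iter_S. specialize (HR t z Hz).
    set (w := pgf_iter p t z) in *.
    assert (N1 := RtoC_neq_0 (p 1%nat) ltac:(lra)).
    assert (N2 := Cpow_nz _ t N1).
    replace (pgf p w / RtoC (p 1%nat) ^ S t - w / RtoC (p 1%nat) ^ t)%C
      with ((pgf p w - RtoC (p 1%nat) * w) / RtoC (p 1%nat) ^ S t)%C
      by (rewrite Cpow_S; field; auto).
    rewrite Cmod_div_pow by lra.
    assert (Q : 0 < p 1%nat ^ t <= 1).
    { split; [apply pow_lt; lra|]. rewrite <- (pow1 t). apply pow_incr; lra. }
    assert (W : Cmod w <= 1).
    { unfold w. eapply Rle_trans; [apply pgf_iter_unit_disc; [exact H|lra]|lra]. }
    assert (X := pgf_minus_linear p w H W). assert (Cw := Cmod_ge_0 w).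
    assert (W2 : Cmod w <= A * p 1%nat ^ t).
    { eapply Rle_trans; [exact HR|]. rewrite <- (Rmult_1_r (A * p 1%nat ^ t)) at 2.
      apply Rmult_le_compat_l; [nra|]. assert (Y := Cmod_ge_0 z). lra. }
    assert (W3 : Cmod w ^ 2 <= (A * p 1%nat ^ t) ^ 2) by (apply pow_incr; lra).
    assert (0 < p 1%nat ^ S t) by (apply pow_lt; lra).
    apply Rmult_le_reg_r with (p 1%nat ^ S t); [auto|].
    unfold Rdiv at 1. rewrite Rmult_assoc, Rinv_l, Rmult_1_r by lra.
    eapply Rle_trans; [exact X|].
    apply Rle_trans with ((1 - p 1%nat) * (A * p 1%nat ^ t) ^ 2).
    + apply Rmult_le_compat_l; lra.
    + right. unfold K. simpl. field. lra.
  - assert (E : Phi p z = l) by (apply CLim_seq_unique, Hl1).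
    rewrite E. split; [exact Hl1|]. intros t.
    replace (K / (1 - p 1%nat) * p 1%nat ^ t) with (K * p 1%nat ^ t / (1 - p 1%nat)) by (field; lra).
    apply Hl2.
Qed.

Lemma Phi_bound (p : nat -> R) (rho : R) : entire_offspring p -> rho < 1 ->
  exists A, 1 <= A /\ forall z, Cmod z <= rho -> Cmod (Phi p z) <= A * Cmod z.
Proof.
  intros H Hr. assert (H1 : 0 < p 1%nat < 1) by apply H.
  destruct (pgf_iter_rate p rho H Hr) as [A [HA HR]].
  destruct (Phi_limit p rho H Hr) as [B [HB HL]].
  exists A. split; [exact HA|]. intros z Hz.
  apply (Clim_le _ _ _ (proj1 (HL z Hz))). exists O. intros t _. unfold Phi_iter.
  rewrite Cmod_div_pow by lra. assert (0 < p 1%nat ^ t) by (apply pow_lt; lra).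
  apply Rle_div_l; [lra|]. specialize (HR t z Hz). lra.
Qed.

Lemma Phi_pgf (p : nat -> R) (z : C) : entire_offspring p -> Cmod z < 1 ->
  Phi p (pgf p z) = (RtoC (p 1%nat) * Phi p z)%C.
Proof.
  intros H Hz. assert (H1 : 0 < p 1%nat < 1) by apply H.
  destruct (Phi_limit p (Cmod z) H Hz) as [B [HB HL]].
  apply CLim_seq_unique.
  apply (Clim_ext (fun t => RtoC (p 1%nat) * Phi_iter p (S t) z)%C).
  - intros t. unfold Phi_iter. rewrite pgf_iter_comm.
    assert (N1 := RtoC_neq_0 (p 1%nat) ltac:(lra)).
    assert (N2 := Cpow_nz _ t N1). rewrite Cpow_S. field. auto.
  - apply Clim_scal. apply Clim_shift with (u := fun t => Phi_iter p t z).
    apply HL. lra.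
Qed.

Lemma pgf_almost_linear_near_0 (p : nat -> R) : entire_offspring p ->
  exists D, 0 <= D /\ forall u v r, Cmod u <= r -> Cmod v <= r -> r <= 1 ->
    p 1%nat * Cmod (u - v) * (1 - D * r) <= Cmod (pgf p u - pgf p v).
Proof.
  intros H. assert (H1 : 0 < p 1%nat < 1) by apply H.
  assert (HC := C11_pgf p (entire_offspring_coeffs p H)).
  destruct (HC 2) as [M [HM [HM1 HM2]]].
  destruct (C11_deriv_lip _ _ HC 1) as [L [HL HL1]].
  assert (D0 : pgf (PS_derive p) 0%C = RtoC (p 1%nat)).
  { refine (is_Cseries_unique _ _ _ (pgf_is_series _ 0 (entire_coeffs_derive _ (entire_offspring_coeffs p H))) _).
    apply (is_Cseries_ext (fun j => RtoC (match j with O => p 1%nat | _ => 0 end))).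
    - intros [|n]; unfold PS_derive; simpl; [|ring]. rewrite Rmult_1_l. ring.
    - apply is_Cseries_RtoC.
      apply (@is_series_decr_1 R_AbsRing R_NormedModule).
      change (is_series (fun _ : nat => 0) (p 1%nat + - p 1%nat)). rewrite Rplus_opp_r.
      apply is_series_0. }
  exists ((L + 2 * M) / p 1%nat). split.
  { apply Rmult_le_pos; [lra|left; apply Rinv_0_lt_compat; lra]. }
  intros u v r Hu Hv Hr.
  assert (R0 : 0 <= r) by (assert (X := Cmod_ge_0 u); lra).
  assert (Huv : Cmod (u - v) <= 2 * r) by (assert (X := Cmod_minus_le u v); lra).
  assert (A := HM2 v (u - v)%C ltac:(lra) ltac:(lra)).
  replace (v + (u - v))%C with u in A by ring.
  assert (B := HL1 v 0%C ltac:(lra) ltac:(rewrite Cmod_0; lra)).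
  replace (v - 0)%C with v in B by ring. rewrite D0 in B.
  assert (T := Cmod_triangle_inv (RtoC (p 1%nat) * (u - v)) (pgf p u - pgf p v)).
  rewrite Cmod_mult, Cmod_RtoC_nonneg in T by lra.
  replace (RtoC (p 1%nat) * (u - v) - (pgf p u - pgf p v))%C
    with (- ((pgf p u - pgf p v - pgf (PS_derive p) v * (u - v))
             + (pgf (PS_derive p) v - RtoC (p 1%nat)) * (u - v)))%C in T by ring.
  rewrite Cmod_opp in T.
  assert (T2 := Cmod_triangle (pgf p u - pgf p v - pgf (PS_derive p) v * (u - v))
             ((pgf (PS_derive p) v - RtoC (p 1%nat)) * (u - v))).
  rewrite Cmod_mult in T2.
  assert (X := Cmod_ge_0 (u - v)).
  assert (Y1 : M * Cmod (u - v) ^ 2 <= 2 * M * r * Cmod (u - v)).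
  { simpl. rewrite Rmult_1_r. replace (2 * M * r * Cmod (u - v)) with (M * (2 * r * Cmod (u - v))) by ring.
    apply Rmult_le_compat_l; [lra|]. apply Rmult_le_compat_r; lra. }
  assert (Y2 : Cmod (pgf (PS_derive p) v - RtoC (p 1%nat)) * Cmod (u - v) <= L * r * Cmod (u - v)).
  { apply Rmult_le_compat_r; auto. eapply Rle_trans; [exact B|]. apply Rmult_le_compat_l; lra. }
  replace (p 1%nat * Cmod (u - v) * (1 - (L + 2 * M) / p 1%nat * r))
    with (p 1%nat * Cmod (u - v) - (2 * M * r * Cmod (u - v) + L * r * Cmod (u - v))) by (field; lra).
  lra.
Qed.

Lemma Phi_inj_near_0 (p : nat -> R) : entire_offspring p ->
  exists r, 0 < r < 1 /\ forall u v, Cmod u <= r -> Cmod v <= r -> Phi p u = Phi p v -> u = v.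
Proof.
  intros H. assert (H1 : 0 < p 1%nat < 1) by apply H.
  destruct (pgf_iter_rate p (1 / 2) H ltac:(lra)) as [A [HA HR]].
  destruct (Phi_limit p (1 / 2) H ltac:(lra)) as [B [HB HL]].
  destruct (pgf_almost_linear_near_0 p H) as [D [HD HP]].
  set (K := D * A + A + 1).
  assert (HK : 1 <= K) by (unfold K; nra).
  set (r := (1 - p 1%nat) / (2 * K)).
  assert (Hr : 0 < r) by (apply Rdiv_lt_0_compat; lra).
  assert (HrK : r * K = (1 - p 1%nat) / 2) by (unfold r; field; lra).
  assert (Hr2 : r <= 1 / 2) by nra.
  exists r. split; [lra|]. intros u v Hu Hv HE.
  assert (Main : forall t, Cmod (u - v) * (1 - (D * A * r) * (1 - p 1%nat ^ t) / (1 - p 1%nat))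
                  <= Cmod (Phi_iter p t u - Phi_iter p t v)).
  { induction t as [|t IH].
    - unfold Phi_iter. simpl. right.
      replace (u / 1 - v / 1)%C with (u - v)%C by field. field. lra.
    - assert (Q : 0 < p 1%nat ^ t <= 1).
      { split; [apply pow_lt; lra|]. rewrite <- (pow1 t). apply pow_incr; lra. }
      assert (Iu := HR t u ltac:(lra)). assert (Iv := HR t v ltac:(lra)).
      set (a := pgf_iter p t u) in *. set (b := pgf_iter p t v) in *.
      assert (Ar : A * r <= 1) by (unfold K in HrK; nra).
      assert (Ba : Cmod a <= A * p 1%nat ^ t * r).
      { eapply Rle_trans; [exact Iu|]. apply Rmult_le_compat_l; nra. }
      assert (Bb : Cmod b <= A * p 1%nat ^ t * r).
      { eapply Rle_trans; [exact Iv|]. apply Rmult_le_compat_l; nra. }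
      assert (S1 := HP a b (A * p 1%nat ^ t * r) Ba Bb ltac:(nra)).
      unfold Phi_iter in *. rewrite !pgf_iter_S. fold a b. fold a b in IH.
      replace (pgf p a / RtoC (p 1%nat) ^ S t - pgf p b / RtoC (p 1%nat) ^ S t)%C
        with ((pgf p a - pgf p b) / RtoC (p 1%nat) ^ S t)%C by (unfold Cdiv; ring).
      replace (a / RtoC (p 1%nat) ^ t - b / RtoC (p 1%nat) ^ t)%C
        with ((a - b) / RtoC (p 1%nat) ^ t)%C in IH by (unfold Cdiv; ring).
      rewrite Cmod_div_pow in * by lra.
      set (d := Cmod (a - b) / p 1%nat ^ t) in *.
      assert (Hd : 0 <= d).
      { unfold d. apply Rmult_le_pos; [apply Cmod_ge_0|left; apply Rinv_0_lt_compat; lra]. }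
      apply Rle_trans with (d * (1 - D * (A * p 1%nat ^ t * r))).
      2:{ apply (Rle_div_r (d * (1 - D * (A * p 1%nat ^ t * r))) _ (p 1%nat ^ S t)); [apply pow_lt; lra|]. simpl.
          replace (d * (1 - D * (A * p 1%nat ^ t * r)) * (p 1%nat * p 1%nat ^ t))
            with (p 1%nat * Cmod (a - b) * (1 - D * (A * p 1%nat ^ t * r))) by (unfold d; field; lra).
          exact S1. }
      set (G := D * A * r) in *.
      assert (HG : 0 <= G <= (1 - p 1%nat) / 2).
      { unfold G. split; [apply Rmult_le_pos; [nra|lra]|]. unfold K in HrK. nra. }
      set (q := p 1%nat ^ t) in *.
      replace (1 - D * (A * q * r)) with (1 - G * q) by (unfold G; ring).
      set (s := G * (1 - q) / (1 - p 1%nat)).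
      fold s in IH.
      assert (Hs : 0 <= s).
      { unfold s. apply Rmult_le_pos; [nra|left; apply Rinv_0_lt_compat; lra]. }
      replace (G * (1 - p 1%nat ^ S t) / (1 - p 1%nat)) with (s + G * q).
      2:{ unfold s, q. simpl. field. lra. }
      assert (E0 := Cmod_ge_0 (u - v)). set (e := Cmod (u - v)) in *.
      assert (0 <= 1 - G * q) by nra.
      apply Rle_trans with (e * (1 - s) * (1 - G * q)).
      + rewrite Rmult_assoc. apply Rmult_le_compat_l; [exact E0|].
        assert (0 <= s * (G * q)) by (apply Rmult_le_pos; [lra|apply Rmult_le_pos; lra]).
        replace ((1 - s) * (1 - G * q)) with (1 - (s + G * q) + s * (G * q)) by ring. lra.
      + apply Rmult_le_compat_r; auto. }
  assert (Half : forall t, Cmod (u - v) / 2 <= Cmod (Phi_iter p t u - Phi_iter p t v)).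
  { intros t. eapply Rle_trans; [|apply Main].
    unfold Rdiv at 1. apply Rmult_le_compat_l; [apply Cmod_ge_0|].
    assert (Q : 0 < p 1%nat ^ t <= 1).
    { split; [apply pow_lt; lra|]. rewrite <- (pow1 t). apply pow_incr; lra. }
    assert (HG : 0 <= D * A * r <= (1 - p 1%nat) / 2).
    { split; [apply Rmult_le_pos; [nra|lra]|]. unfold K in HrK. nra. }
    assert (D * A * r * (1 - p 1%nat ^ t) / (1 - p 1%nat) <= / 2).
    { apply Rle_div_l; [lra|]. nra. }
    lra. }
  apply Cmod_small_eq. intros eps He.
  destruct (HL u ltac:(lra)) as [Lu _]. destruct (HL v ltac:(lra)) as [Lv _].
  rewrite HE in Lu.
  destruct (Lu (eps / 4)) as [N1 HN1]; [lra|]. destruct (Lv (eps / 4)) as [N2 HN2]; [lra|].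
  specialize (HN1 (max N1 N2) ltac:(lia)). specialize (HN2 (max N1 N2) ltac:(lia)).
  specialize (Half (max N1 N2)).
  assert (T := Cmod_minus_triangle (Phi_iter p (max N1 N2) u) (Phi p v) (Phi_iter p (max N1 N2) v)).
  rewrite (Cmod_minus_sym (Phi p v)) in T. lra.
Qed.

Lemma mean_PSeries (p : nat -> R) : entire_offspring p -> mean p = PSeries (PS_derive p) 1.
Proof.
  intros H. unfold mean. apply Derive_PSeries.
  destruct H as [_ [_ Hcv]]. rewrite Hcv. exact I.
Qed.

Lemma pgf_derive_1 (p : nat -> R) : entire_offspring p -> pgf (PS_derive p) 1 = RtoC (mean p).
Proof.
  intros H. rewrite (mean_PSeries p H).
  apply pgf_RtoC; [apply entire_coeffs_derive, entire_offspring_coeffs, H|lra].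
Qed.

Lemma mean_gt_1 (p : nat -> R) : entire_offspring p -> 1 < mean p.
Proof.
  intros H. rewrite (mean_PSeries p H).
  assert (He := entire_coeffs_derive p (entire_offspring_coeffs p H)).
  assert (Hs := PSeries_is_series (PS_derive p) 1 He ltac:(lra)).
  destruct H as [[Hp [Hs1 H0]] [H1 _]].
  assert (B := is_series_tail2 _ _ H0 Hs1).
  assert (B2 : is_series (fun k => p (S k)) 1).
  { apply (@is_series_incr_1 R_AbsRing R_NormedModule p).
    change (is_series p (1 + p O)). rewrite H0, Rplus_0_r. exact Hs1. }
  assert (D := is_series_minus _ _ _ _ Hs B2).
  assert (D' : is_series (fun k => p (S (S k)) * INR (S k)) (PSeries (PS_derive p) 1 - 1)).
  { apply (@is_series_incr_1 R_AbsRing R_NormedModule (fun k => p (S k) * INR k)).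
    change (is_series (fun k => p (S k) * INR k) (PSeries (PS_derive p) 1 - 1 + p 1%nat * INR 0)).
    simpl INR. rewrite Rmult_0_r, Rplus_0_r.
    revert D. apply is_series_ext. intros n.
    change (PS_derive p n * 1 ^ n - p (S n) = p (S n) * INR n).
    unfold PS_derive. rewrite pow1, S_INR. ring. }
  assert (L : 1 - p 1%nat <= PSeries (PS_derive p) 1 - 1).
  { rewrite <- (is_series_unique _ _ B), <- (is_series_unique _ _ D').
    apply Series_le; [|eexists; exact D'].
    intros n. split; [apply Hp|]. rewrite <- (Rmult_1_r (p (S (S n)))) at 1.
    apply Rmult_le_compat_l; [apply Hp|]. rewrite S_INR. assert (X := pos_INR n). lra. }
  lra.
Qed.

(* [Q = 1 - P (1 - .)] moves the repelling fixed point of the generating function to 0. *)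
Definition conj_iter (p : nat -> R) (t : nat) (w : C) : C := (1 - pgf_iter p t (1 - w))%C.

Lemma conj_iter_S (p : nat -> R) (t : nat) (w : C) :
  conj_iter p (S t) w = conj_iter p 1 (conj_iter p t w).
Proof.
  unfold conj_iter. rewrite pgf_iter_S. simpl.
  now replace (1 - (1 - pgf_iter p t (1 - w)))%C with (pgf_iter p t (1 - w)) by ring.
Qed.

Lemma conj_iter_comm (p : nat -> R) (t : nat) (w : C) :
  conj_iter p (S t) w = conj_iter p t (conj_iter p 1 w).
Proof.
  unfold conj_iter. rewrite pgf_iter_comm. simpl.
  now replace (1 - (1 - pgf p (1 - w)))%C with (pgf p (1 - w)) by ring.
Qed.

Lemma conj_iter_0 (p : nat -> R) (t : nat) : entire_offspring p -> conj_iter p t 0 = 0%C.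
Proof.
  intros H. induction t as [|t IH].
  - unfold conj_iter. simpl. ring.
  - rewrite conj_iter_S, IH. unfold conj_iter. simpl.
    replace (1 - 0)%C with (RtoC 1) by ring. rewrite (pgf_1 p H). ring.
Qed.

Lemma conj_almost_linear (p : nat -> R) : entire_offspring p ->
  exists K, 0 <= K /\
    (forall u v r, Cmod u <= r -> Cmod v <= r -> r <= 1 ->
       Cmod (conj_iter p 1 u - conj_iter p 1 v) <= mean p * Cmod (u - v) * (1 + K * r)) /\
    (forall u, Cmod u <= 1 -> Cmod (conj_iter p 1 u - RtoC (mean p) * u) <= K * Cmod u ^ 2).
Proof.
  intros H. assert (HE := mean_gt_1 p H).
  assert (HC := C11_pgf p (entire_offspring_coeffs p H)).
  destruct (HC 2) as [M [HM [HM1 HM2]]].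
  destruct (C11_deriv_lip _ _ HC 2) as [L [HL HL1]].
  assert (D1 := pgf_derive_1 p H).
  exists (L + 2 * M). split; [lra|]. split.
  - intros u v r Hu Hv Hr.
    assert (R0 : 0 <= r) by (assert (X := Cmod_ge_0 u); lra).
    assert (Huv : Cmod (u - v) <= 2 * r) by (assert (X := Cmod_minus_le u v); lra).
    assert (B1 : Cmod (1 - v) <= 2) by (assert (X := Cmod_minus_le 1 v); rewrite Cmod_1 in X; lra).
    assert (A := HM2 (1 - v)%C (v - u)%C B1 ltac:(rewrite Cmod_minus_sym; lra)).
    replace (1 - v + (v - u))%C with (1 - u)%C in A by ring.
    rewrite (Cmod_minus_sym v u) in A.
    assert (B := HL1 (1 - v)%C 1%C B1 ltac:(rewrite Cmod_1; lra)). rewrite D1 in B.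
    replace (1 - v - 1)%C with (- v)%C in B by ring. rewrite Cmod_opp in B.
    unfold conj_iter. simpl.
    replace (1 - pgf p (1 - u) - (1 - pgf p (1 - v)))%C
      with (- ((pgf p (1 - u) - pgf p (1 - v) - pgf (PS_derive p) (1 - v) * (v - u))
               + (pgf (PS_derive p) (1 - v) - RtoC (mean p)) * (v - u)) + RtoC (mean p) * (u - v))%C by ring.
    eapply Rle_trans; [apply Cmod_triangle|]. rewrite Cmod_opp.
    assert (T2 := Cmod_triangle (pgf p (1 - u) - pgf p (1 - v) - pgf (PS_derive p) (1 - v) * (v - u))
             ((pgf (PS_derive p) (1 - v) - RtoC (mean p)) * (v - u))).
    rewrite Cmod_mult, (Cmod_minus_sym v u) in T2.
    rewrite (Cmod_mult (RtoC (mean p))), Cmod_RtoC_nonneg by lra.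
    assert (X := Cmod_ge_0 (u - v)).
    assert (Y1 : M * Cmod (u - v) ^ 2 <= 2 * M * r * Cmod (u - v)).
    { simpl. rewrite Rmult_1_r. replace (2 * M * r * Cmod (u - v)) with (M * (2 * r * Cmod (u - v))) by ring.
      apply Rmult_le_compat_l; [lra|]. apply Rmult_le_compat_r; lra. }
    assert (Y2 : Cmod (pgf (PS_derive p) (1 - v) - RtoC (mean p)) * Cmod (u - v) <= L * r * Cmod (u - v)).
    { apply Rmult_le_compat_r; auto. eapply Rle_trans; [exact B|]. apply Rmult_le_compat_l; lra. }
    assert (Y3 : (L + 2 * M) * r * Cmod (u - v) <= mean p * ((L + 2 * M) * r * Cmod (u - v))).
    { assert (0 <= (L + 2 * M) * r * Cmod (u - v)) by (apply Rmult_le_pos; [apply Rmult_le_pos|]; lra). nra. }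
    lra.
  - intros u Hu.
    assert (A := HM2 1%C (- u)%C ltac:(rewrite Cmod_1; lra) ltac:(rewrite Cmod_opp; lra)).
    rewrite D1, (pgf_1 p H), Cmod_opp in A.
    replace (1 + - u)%C with (1 - u)%C in A by ring.
    unfold conj_iter. simpl.
    replace (1 - pgf p (1 - u) - RtoC (mean p) * u)%C
      with (- (pgf p (1 - u) - 1 - RtoC (mean p) * - u))%C by ring.
    rewrite Cmod_opp. assert (0 <= Cmod u ^ 2) by (apply pow_le, Cmod_ge_0). simpl in *. nra.
Qed.

(* The factors [1 + K' E^(k-t)], k < t, multiply up to at most [exp (K' / (E - 1)) <= 2]. *)
Lemma conj_iter_lip (p : nat -> R) : entire_offspring p ->
  exists K rho, 0 <= K /\ 0 < rho /\ rho * K <= mean p /\ rho <= 1 /\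
    (forall u, Cmod u <= 1 -> Cmod (conj_iter p 1 u - RtoC (mean p) * u) <= K * Cmod u ^ 2) /\
    forall t u v, Cmod u <= rho / mean p ^ t -> Cmod v <= rho / mean p ^ t ->
      Cmod (conj_iter p t u - conj_iter p t v) <= 2 * mean p ^ t * Cmod (u - v).
Proof.
  intros H. assert (HE := mean_gt_1 p H). set (E := mean p) in *.
  destruct (conj_almost_linear p H) as [K [HK [HL HQ]]]. fold E in HL, HQ.
  set (rho := (E - 1) / (4 * (K + E))).
  assert (Hrho : 0 < rho) by (apply Rdiv_lt_0_compat; lra).
  assert (Er : rho * (4 * (K + E)) = E - 1) by (unfold rho; field; lra).
  assert (H2r : 2 * rho <= 1) by nra.
  exists K, rho. split; [exact HK|]. split; [exact Hrho|].
  split; [nra|]. split; [lra|]. split; [exact HQ|].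
  intros t.
  assert (Ht : 0 < E ^ t) by (apply pow_lt; lra).
  set (K' := 2 * K * rho / (E - 1)).
  assert (HK' : 0 <= K' <= 1 / 2).
  { unfold K'. split.
    - apply Rmult_le_pos; [nra|left; apply Rinv_0_lt_compat; lra].
    - apply Rle_div_l; nra. }
  assert (He2 : exp K' <= 2).
  { assert (X := exp_ge_1_plus (- K')). assert (Y := exp_pos K').
    assert (Z : exp K' * exp (- K') = 1) by (rewrite <- exp_plus, Rplus_opp_r; apply exp_0). nra. }
  assert (Hmono : forall k, (k <= t)%nat -> 0 < E ^ k / E ^ t <= 1).
  { intros k Hk. assert (0 < E ^ k) by (apply pow_lt; lra). split; [apply Rdiv_lt_0_compat; lra|].
    apply Rle_div_l; [lra|]. rewrite Rmult_1_l. apply Rle_pow; [lra|exact Hk]. }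
  assert (Hexp : forall k, (k <= t)%nat -> exp (K' * (E ^ k / E ^ t)) <= 2).
  { intros k Hk. eapply Rle_trans; [|exact He2]. apply exp_le_mono. assert (X := Hmono k Hk). nra. }
  assert (Step : forall k x d, (S k <= t)%nat -> 0 <= d -> d <= E ^ k * x * exp (K' * (E ^ k / E ^ t)) ->
    E * d * (1 + K * (2 * rho * (E ^ k / E ^ t))) <= E ^ S k * x * exp (K' * (E ^ S k / E ^ t))).
  { intros k x d Hk Hd0 Hd.
    replace (exp (K' * (E ^ S k / E ^ t))) with (exp (K' * (E ^ k / E ^ t)) * exp (K * (2 * rho * (E ^ k / E ^ t)))).
    2:{ rewrite <- exp_plus. f_equal. unfold K'. simpl. field. lra. }
    assert (X := exp_ge_1_plus (K * (2 * rho * (E ^ k / E ^ t)))).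
    assert (Y := Hmono k ltac:(lia)).
    assert (0 <= K * (2 * rho * (E ^ k / E ^ t))).
    { apply Rmult_le_pos; [lra|]. apply Rmult_le_pos; lra. }
    simpl.
    replace (E * E ^ k * x * (exp (K' * (E ^ k / E ^ t)) * exp (K * (2 * rho * (E ^ k / E ^ t)))))
      with (E * (E ^ k * x * exp (K' * (E ^ k / E ^ t))) * exp (K * (2 * rho * (E ^ k / E ^ t)))) by ring.
    apply Rmult_le_compat; try lra.
    - apply Rmult_le_pos; lra.
    - apply Rmult_le_compat_l; lra. }
  assert (Grow : forall k w, (k <= t)%nat -> Cmod w <= rho / E ^ t ->
            Cmod (conj_iter p k w) <= E ^ k * Cmod w * exp (K' * (E ^ k / E ^ t))).
  { intros k w Hk Hw. induction k as [|k IH].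
    - unfold conj_iter. simpl. replace (1 - (1 - w))%C with w by ring.
      assert (X := exp_ge_1_plus (K' * (1 / E ^ t))). assert (Y := Cmod_ge_0 w).
      assert (Z := Hmono O Hk). simpl in Z. assert (0 <= K' * (1 / E ^ t)) by (apply Rmult_le_pos; lra). nra.
    - specialize (IH ltac:(lia)). rewrite conj_iter_S.
      assert (B : Cmod (conj_iter p k w) <= 2 * rho * (E ^ k / E ^ t)).
      { eapply Rle_trans; [exact IH|]. assert (X := Hexp k ltac:(lia)).
        assert (0 < E ^ k) by (apply pow_lt; lra).
        replace (2 * rho * (E ^ k / E ^ t)) with (E ^ k * (rho / E ^ t) * 2) by (field; lra).
        apply Rmult_le_compat; auto; [|left; apply exp_pos|apply Rmult_le_compat_l; lra].
        apply Rmult_le_pos; [lra|apply Cmod_ge_0]. }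
      assert (Y := Hmono k ltac:(lia)).
      assert (A := HL (conj_iter p k w) 0%C (2 * rho * (E ^ k / E ^ t)) B
                     ltac:(rewrite Cmod_0; nra) ltac:(nra)).
      rewrite (conj_iter_0 p 1 H) in A.
      replace (conj_iter p 1 (conj_iter p k w) - 0)%C with (conj_iter p 1 (conj_iter p k w)) in A by ring.
      replace (conj_iter p k w - 0)%C with (conj_iter p k w) in A by ring.
      eapply Rle_trans; [exact A|]. apply Step; auto. apply Cmod_ge_0. }
  assert (Lip : forall k u v, (k <= t)%nat -> Cmod u <= rho / E ^ t -> Cmod v <= rho / E ^ t ->
            Cmod (conj_iter p k u - conj_iter p k v) <= E ^ k * Cmod (u - v) * exp (K' * (E ^ k / E ^ t))).
  { intros k u v Hk Hu Hv. induction k as [|k IH].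
    - unfold conj_iter. simpl. replace (1 - (1 - u) - (1 - (1 - v)))%C with (u - v)%C by ring.
      assert (X := exp_ge_1_plus (K' * (1 / E ^ t))). assert (Y := Cmod_ge_0 (u - v)).
      assert (Z := Hmono O Hk). simpl in Z. assert (0 <= K' * (1 / E ^ t)) by (apply Rmult_le_pos; lra). nra.
    - specialize (IH ltac:(lia)). rewrite !(conj_iter_S p k).
      assert (B : forall w, Cmod w <= rho / E ^ t -> Cmod (conj_iter p k w) <= 2 * rho * (E ^ k / E ^ t)).
      { intros w Hw. eapply Rle_trans; [apply Grow; [lia|exact Hw]|]. assert (X := Hexp k ltac:(lia)).
        assert (0 < E ^ k) by (apply pow_lt; lra).
        replace (2 * rho * (E ^ k / E ^ t)) with (E ^ k * (rho / E ^ t) * 2) by (field; lra).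
        apply Rmult_le_compat; auto; [|left; apply exp_pos|apply Rmult_le_compat_l; lra].
        apply Rmult_le_pos; [lra|apply Cmod_ge_0]. }
      assert (Y := Hmono k ltac:(lia)).
      eapply Rle_trans; [apply (HL _ _ (2 * rho * (E ^ k / E ^ t)) (B u Hu) (B v Hv)); nra|].
      apply Step; auto. apply Cmod_ge_0. }
  intros u v Hu Hv. eapply Rle_trans; [apply (Lip t u v); auto|].
  assert (X := Hexp t ltac:(lia)). assert (Y := Cmod_ge_0 (u - v)).
  rewrite (Rmult_assoc 2), (Rmult_comm 2). apply Rmult_le_compat_l; auto. nra.
Qed.

Definition Pi_iter (p : nat -> R) (t : nat) (z : C) : C := pgf_iter p t (1 - z / RtoC (mean p) ^ t)%C.

Lemma Pi_iter_conj (p : nat -> R) (t : nat) (z : C) :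
  Pi_iter p t z = (1 - conj_iter p t (z / RtoC (mean p) ^ t))%C.
Proof. unfold Pi_iter, conj_iter. ring. Qed.

Lemma Pi_iter_S (p : nat -> R) (t : nat) (z : C) : entire_offspring p ->
  Pi_iter p (S t) (RtoC (mean p) * z) = pgf p (Pi_iter p t z).
Proof.
  intros H. unfold Pi_iter. rewrite pgf_iter_S. f_equal. f_equal.
  assert (N1 := RtoC_neq_0 (mean p) ltac:(assert (X := mean_gt_1 p H); lra)).
  assert (N2 := Cpow_nz _ t N1). rewrite Cpow_S. field. auto.
Qed.

Lemma Pi_local (p : nat -> R) : entire_offspring p ->
  exists r c, 0 < r /\ 0 <= c /\
    (forall z t, Cmod z <= r -> Cmod (Pi p z - Pi_iter p t z) <= c * Cmod z ^ 2 * (/ mean p) ^ t) /\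
    (forall z w, Cmod z <= r -> Cmod w <= r -> Cmod (Pi p z - Pi p w) <= 2 * Cmod (z - w)) /\
    (forall z, Cmod z <= r -> Clim (fun t => Pi_iter p t z) (Pi p z)).
Proof.
  intros H. assert (HE := mean_gt_1 p H).
  destruct (conj_iter_lip p H) as [K [rho [HK [Hrho [HrK [Hr1 [HQ HL]]]]]]].
  set (E := mean p) in *.
  assert (Hinv : 0 < / E < 1).
  { split; [apply Rinv_0_lt_compat; lra|]. rewrite <- Rinv_1. apply Rinv_lt_contravar; lra. }
  assert (Conv : forall z, Cmod z <= rho / 2 -> exists l, Clim (fun t => Pi_iter p t z) l /\
            forall t, Cmod (l - Pi_iter p t z) <= 2 * K * Cmod z ^ 2 * (/ E) ^ t / (1 - / E)).
  { intros z Hz. apply Cauchy_geom_Clim; [lra|]. intros t.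
    rewrite !Pi_iter_conj, conj_iter_comm. fold E.
    assert (Z0 := Cmod_ge_0 z).
    assert (N1 := RtoC_neq_0 E ltac:(lra)). assert (N2 := Cpow_nz _ t N1).
    assert (Et : 1 <= E ^ t) by (apply pow_R1_Rle; lra).
    set (w := (z / RtoC E ^ S t)%C).
    assert (Hw : Cmod w = Cmod z / E ^ S t) by (unfold w; apply Cmod_div_pow; lra).
    replace (z / RtoC E ^ t)%C with (RtoC E * w)%C by (unfold w; rewrite Cpow_S; field; auto).
    assert (HEw : E * Cmod w = Cmod z / E ^ t) by (rewrite Hw; simpl; field; lra).
    assert (HEwr : E * Cmod w <= rho / 2 / E ^ t).
    { rewrite HEw. apply Rmult_le_compat_r; [left; apply Rinv_0_lt_compat|]; lra. }
    assert (Hsm : rho / 2 / E ^ t <= rho / 2).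
    { apply Rle_div_l; [lra|]. nra. }
    assert (W0 := Cmod_ge_0 w).
    assert (Hw1 : Cmod w <= 1) by nra.
    specialize (HQ w Hw1).
    assert (KE : K * Cmod w ^ 2 <= E * Cmod w).
    { simpl. rewrite Rmult_1_r, <- Rmult_assoc. apply Rmult_le_compat_r; [lra|].
      apply Rle_trans with (K * rho); [|lra]. apply Rmult_le_compat_l; nra. }
    assert (Hmw : Cmod (RtoC E * w) = E * Cmod w) by (rewrite Cmod_mult, Cmod_RtoC_nonneg; lra).
    assert (B2 : Cmod (RtoC E * w) <= rho / E ^ t).
    { rewrite Hmw. eapply Rle_trans; [exact HEwr|].
      apply Rmult_le_compat_r; [left; apply Rinv_0_lt_compat|]; lra. }
    assert (B1 : Cmod (conj_iter p 1 w) <= rho / E ^ t).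
    { replace (conj_iter p 1 w) with ((conj_iter p 1 w - RtoC E * w) + RtoC E * w)%C by ring.
      eapply Rle_trans; [apply Cmod_triangle|]. rewrite Hmw.
      replace (rho / E ^ t) with (rho / 2 / E ^ t + rho / 2 / E ^ t) by (field; lra). lra. }
    replace (1 - conj_iter p t (conj_iter p 1 w) - (1 - conj_iter p t (RtoC E * w)))%C
      with (- (conj_iter p t (conj_iter p 1 w) - conj_iter p t (RtoC E * w)))%C by ring.
    rewrite Cmod_opp. eapply Rle_trans; [apply (HL t _ _ B1 B2)|].
    apply Rle_trans with (2 * E ^ t * (K * Cmod w ^ 2)).
    { apply Rmult_le_compat_l; [nra|exact HQ]. }
    rewrite Hw. simpl. rewrite pow_inv.
    replace (2 * E ^ t * (K * (Cmod z / (E * E ^ t) * (Cmod z / (E * E ^ t) * 1))))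
      with (2 * K * (Cmod z * (Cmod z * 1)) * / E ^ t * (/ E * / E)) by (field; lra).
    assert (0 < / E ^ t) by (apply Rinv_0_lt_compat; lra).
    assert (0 <= 2 * K * (Cmod z * (Cmod z * 1)) * / E ^ t).
    { apply Rmult_le_pos; [nra|lra]. }
    rewrite <- (Rmult_1_r (2 * K * (Cmod z * (Cmod z * 1)) * / E ^ t)) at 2.
    apply Rmult_le_compat_l; [auto|nra]. }
  assert (Conv' : forall z, Cmod z <= rho / 2 -> Clim (fun t => Pi_iter p t z) (Pi p z) /\
            forall t, Cmod (Pi p z - Pi_iter p t z) <= 2 * K * Cmod z ^ 2 * (/ E) ^ t / (1 - / E)).
  { intros z Hz. destruct (Conv z Hz) as [l [L1 L2]].
    replace (Pi p z) with l; [auto|]. symmetry. apply CLim_seq_unique. exact L1. }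
  exists (rho / 2), (2 * K / (1 - / E)).
  split; [lra|]. split; [apply Rmult_le_pos; [lra|left; apply Rinv_0_lt_compat; lra]|].
  split; [|split].
  - intros z t Hz. replace (2 * K / (1 - / E) * Cmod z ^ 2 * (/ E) ^ t)
      with (2 * K * Cmod z ^ 2 * (/ E) ^ t / (1 - / E)) by (field; lra).
    now apply Conv'.
  - intros z w Hz Hw.
    assert (L := Clim_plus _ _ _ _ (proj1 (Conv' z Hz)) (Clim_scal (- (1))%C _ _ (proj1 (Conv' w Hw)))).
    replace (Pi p z - Pi p w)%C with (Pi p z + - (1) * Pi p w)%C by ring.
    apply (Clim_le _ _ _ L). exists O. intros t _. rewrite !Pi_iter_conj. fold E.
    assert (N1 := RtoC_neq_0 E ltac:(lra)). assert (N2 := Cpow_nz _ t N1).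
    assert (Et : 1 <= E ^ t) by (apply pow_R1_Rle; lra).
    assert (Small : forall x, Cmod x <= rho / 2 -> Cmod (x / RtoC E ^ t) <= rho / E ^ t).
    { intros x Hx. rewrite Cmod_div_pow by lra.
      apply Rmult_le_compat_r; [left; apply Rinv_0_lt_compat|]; lra. }
    replace (1 - conj_iter p t (z / RtoC E ^ t) + - (1) * (1 - conj_iter p t (w / RtoC E ^ t)))%C
      with (- (conj_iter p t (z / RtoC E ^ t) - conj_iter p t (w / RtoC E ^ t)))%C by ring.
    rewrite Cmod_opp. eapply Rle_trans; [apply HL; auto|].
    replace (z / RtoC E ^ t - w / RtoC E ^ t)%C with ((z - w) / RtoC E ^ t)%C by (unfold Cdiv; ring).
    rewrite Cmod_div_pow by lra. right. field. lra.
  - intros z Hz. now apply Conv'.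
Qed.

Definition Pi_regular (p : nat -> R) (r : R) : Prop :=
  (forall eps, 0 < eps -> exists T, forall t z, (T <= t)%nat -> Cmod z <= r ->
     Cmod (Pi p z - Pi_iter p t z) <= eps) /\
  (exists L, 0 <= L /\ forall z w, Cmod z <= r -> Cmod w <= r -> Cmod (Pi p z - Pi p w) <= L * Cmod (z - w)).

Lemma pow_small (q eps : R) : 0 <= q < 1 -> 0 < eps ->
  exists N, forall n, (N <= n)%nat -> q ^ n <= eps.
Proof.
  intros Hq He. destruct (pow_lt_1_zero q ltac:(rewrite Rabs_pos_eq; lra) eps He) as [N HN].
  exists N. intros n Hn. specialize (HN n ltac:(lia)). assert (X := Rle_abs (q ^ n)). lra.
Qed.

Lemma Pi_regular_step (p : nat -> R) (r : R) : entire_offspring p ->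
  Pi_regular p r -> Pi_regular p (mean p * r) /\
    forall z, Cmod z <= r -> Pi p (RtoC (mean p) * z) = pgf p (Pi p z).
Proof.
  intros H [HU [L [HL HLip]]]. assert (HE := mean_gt_1 p H). set (E := mean p) in *.
  assert (HC := C11_pgf p (entire_offspring_coeffs p H)).
  destruct (lip_bounded (Pi p) r L HL HLip) as [B [HB HBb]].
  destruct (C11_lip _ _ HC (B + 1)) as [L2 [HL2 HLip2]].
  assert (Unif : forall eps, 0 < eps -> exists T, forall t z, (T <= t)%nat -> Cmod z <= r ->
     Cmod (pgf p (Pi p z) - Pi_iter p (S t) (RtoC E * z)) <= eps).
  { intros eps He.
    destruct (HU (Rmin 1 (eps / (L2 + 1)))) as [T HT].
    { apply Rmin_pos; [lra|apply Rdiv_lt_0_compat; lra]. }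
    exists T. intros t z Ht Hz. specialize (HT t z Ht Hz). specialize (HBb z Hz).
    replace (Pi_iter p (S t) (RtoC E * z)) with (pgf p (Pi_iter p t z))
      by (symmetry; exact (Pi_iter_S p t z H)).
    assert (M1 := Rmin_l 1 (eps / (L2 + 1))). assert (M2 := Rmin_r 1 (eps / (L2 + 1))).
    assert (Bt : Cmod (Pi_iter p t z) <= B + 1).
    { assert (X := Cmod_triangle_inv (Pi_iter p t z) (Pi p z)). rewrite Cmod_minus_sym in X. lra. }
    eapply Rle_trans; [apply HLip2; lra|].
    apply Rle_trans with (L2 * (eps / (L2 + 1))); [apply Rmult_le_compat_l; lra|].
    replace (L2 * (eps / (L2 + 1))) with (eps * (L2 / (L2 + 1))) by (field; lra).
    assert (L2 / (L2 + 1) <= 1) by (apply Rle_div_l; lra). nra. }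
  assert (Eqn : forall z, Cmod z <= r -> Pi p (RtoC E * z) = pgf p (Pi p z)).
  { intros z Hz. apply CLim_seq_unique. apply Clim_unshift. intros eps He.
    destruct (Unif (eps / 2)) as [T HT]; [lra|]. exists T. intros n Hn.
    specialize (HT n z Hn Hz). rewrite Cmod_minus_sym in HT.
    eapply Rle_lt_trans; [exact HT|lra]. }
  assert (Scale : forall z, Cmod z <= E * r -> exists y, z = (RtoC E * y)%C /\ Cmod y <= r).
  { intros z Hz. exists (z / RtoC E)%C.
    assert (N1 := RtoC_neq_0 E ltac:(lra)). split; [field; auto|].
    rewrite Cmod_div, Cmod_RtoC_nonneg by (auto || lra). apply Rle_div_l; lra. }
  split; [split|exact Eqn].
  - intros eps He. destruct (Unif eps He) as [T HT]. exists (S T). intros [|t] z Ht Hz; [lia|].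
    destruct (Scale z Hz) as [y [-> Hy]]. rewrite (Eqn y Hy). apply HT; [lia|exact Hy].
  - exists (L2 * L / E). split.
    { apply Rmult_le_pos; [nra|left; apply Rinv_0_lt_compat; lra]. }
    intros z w Hz Hw. destruct (Scale z Hz) as [y [-> Hy]]. destruct (Scale w Hw) as [x [-> Hx]].
    rewrite (Eqn y Hy), (Eqn x Hx).
    assert (B1 := HBb y Hy). assert (B2 := HBb x Hx).
    eapply Rle_trans; [apply HLip2; lra|].
    replace (RtoC E * y - RtoC E * x)%C with (RtoC E * (y - x))%C by ring.
    rewrite Cmod_mult, Cmod_RtoC_nonneg by lra.
    replace (L2 * L / E * (E * Cmod (y - x))) with (L2 * (L * Cmod (y - x))) by (field; lra).
    apply Rmult_le_compat_l; [lra|]. now apply HLip.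
Qed.

Lemma Pi_regular_mono (p : nat -> R) (r s : R) : s <= r -> Pi_regular p r -> Pi_regular p s.
Proof.
  intros Hs [HU [L [HL HLip]]]. split.
  - intros eps He. destruct (HU eps He) as [T HT]. exists T. intros t z Ht Hz. apply HT; [auto|lra].
  - exists L. split; [auto|]. intros z w Hz Hw. apply HLip; lra.
Qed.

Lemma pow_unbounded (q x : R) : 1 < q -> exists n, x <= q ^ n.
Proof.
  intros Hq. destruct (Pow_x_infinity q ltac:(rewrite Rabs_pos_eq; lra) x) as [N HN].
  exists N. specialize (HN N ltac:(lia)). rewrite Rabs_pos_eq in HN; [lra|apply pow_le; lra].
Qed.

Lemma Pi_regular_all (p : nat -> R) (r : R) : entire_offspring p -> Pi_regular p r.
Proof.
  intros H. assert (HE := mean_gt_1 p H).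
  destruct (Pi_local p H) as [r0 [c [Hr0 [Hc [H1 [H2 H3]]]]]].
  assert (Hinv : 0 < / mean p < 1).
  { split; [apply Rinv_0_lt_compat; lra|]. rewrite <- Rinv_1. apply Rinv_lt_contravar; lra. }
  assert (B : Pi_regular p r0).
  { split.
    - intros eps He. destruct (pow_small (/ mean p) (eps / (c * r0 ^ 2 + 1))) as [T HT]; [lra| |].
      { apply Rdiv_lt_0_compat; [lra|]. assert (0 <= c * r0 ^ 2) by (apply Rmult_le_pos; [lra|apply pow_le; lra]). lra. }
      exists T. intros t z Ht Hz. eapply Rle_trans; [apply H1, Hz|].
      specialize (HT t Ht). assert (0 <= (/ mean p) ^ t) by (apply pow_le; lra).
      assert (c * Cmod z ^ 2 <= c * r0 ^ 2).
      { apply Rmult_le_compat_l; [lra|]. apply pow_incr. split; [apply Cmod_ge_0|lra]. }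
      assert (0 <= c * Cmod z ^ 2) by (apply Rmult_le_pos; [lra|apply pow_le, Cmod_ge_0]).
      apply Rle_trans with ((c * r0 ^ 2) * (eps / (c * r0 ^ 2 + 1))).
      { apply Rmult_le_compat; lra. }
      replace (c * r0 ^ 2 * (eps / (c * r0 ^ 2 + 1))) with (eps * (c * r0 ^ 2 / (c * r0 ^ 2 + 1))) by (field; lra).
      assert (c * r0 ^ 2 / (c * r0 ^ 2 + 1) <= 1) by (apply Rle_div_l; lra). nra.
    - exists 2. split; [lra|exact H2]. }
  assert (S : forall k, Pi_regular p (mean p ^ k * r0)).
  { induction k as [|k IH]; [simpl; now rewrite Rmult_1_l|].
    simpl. rewrite Rmult_assoc. now apply Pi_regular_step. }
  destruct (pow_unbounded (mean p) (r / r0) HE) as [k Hk].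
  apply (Pi_regular_mono p (mean p ^ k * r0)); [|apply S].
  apply Rle_div_l in Hk; lra.
Qed.

Lemma Pi_mean (p : nat -> R) (z : C) : entire_offspring p -> Pi p (RtoC (mean p) * z) = pgf p (Pi p z).
Proof.
  intros H. apply (Pi_regular_step p (Cmod z) H); [now apply Pi_regular_all|lra].
Qed.

Lemma Pi_mean_pow (p : nat -> R) (k : nat) (z : C) : entire_offspring p ->
  Pi p (RtoC (mean p ^ k) * z) = pgf_iter p k (Pi p z).
Proof.
  intros H. induction k as [|k IH].
  - simpl. now rewrite Cmult_1_l.
  - rewrite pgf_iter_S, <- IH, <- Pi_mean by exact H. f_equal. simpl. rewrite RtoC_mult. ring.
Qed.

Lemma Pi_0 (p : nat -> R) : entire_offspring p -> Pi p 0 = 1%C.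
Proof.
  intros H. apply CLim_seq_unique. apply (Clim_ext (fun _ => 1%C)); [|apply Clim_const].
  intros t. replace (1 - 0 / RtoC (mean p) ^ t)%C with (1 - 0)%C by (unfold Cdiv; ring).
  assert (X := conj_iter_0 p t H). unfold conj_iter in X.
  replace (pgf_iter p t (1 - 0)) with (1 - (1 - pgf_iter p t (1 - 0)))%C by ring.
  rewrite X. ring.
Qed.

Lemma pgf_iter_dominated (p : nat -> R) (t : nat) (w : C) (s : R) : entire_offspring p ->
  Cmod w <= s -> Cmod (pgf_iter p t w) <= Cmod (pgf_iter p t (RtoC s)).
Proof.
  intros H Hw. assert (He := entire_offspring_coeffs p H).
  assert (D : exists x, 0 <= x /\ pgf_iter p t (RtoC s) = RtoC x /\ Cmod (pgf_iter p t w) <= x).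
  { induction t as [|t [x [Hx [E L]]]].
    - exists s. simpl. assert (X := Cmod_ge_0 w). repeat split; lra.
    - exists (PSeries p x). rewrite !pgf_iter_S, E, (pgf_RtoC p x He Hx).
      assert (B : Cmod (pgf p (pgf_iter p t w)) <= PSeries p x).
      { refine (Cmod_series_le _ _ _ _ _ (pgf_is_series p (pgf_iter p t w) He) (PSeries_is_series p x He Hx)).
        intros n. rewrite Cmod_pgf_term by apply He. apply Rmult_le_compat_l; [apply He|].
        apply pow_incr. split; [apply Cmod_ge_0|exact L]. }
      split; [|split; [reflexivity|exact B]].
      eapply Rle_trans; [apply Cmod_ge_0|exact B]. }
  destruct D as [x [Hx [E L]]]. rewrite E, Cmod_RtoC_nonneg; auto.
Qed.

Lemma Cmod_1_minus_le (w : C) : Cmod (1 - w) <= 1 - Re w + Cmod w ^ 2 / 2.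
Proof.
  assert (X := re_le_Cmod w). assert (Y := Rle_abs (Re w)). assert (Z := Cmod_ge_0 w).
  assert (P : 0 <= 1 - Re w + Cmod w ^ 2 / 2) by nra.
  rewrite <- (Rabs_pos_eq (Cmod (1 - w))), <- (Rabs_pos_eq _ P) by apply Cmod_ge_0.
  apply Rsqr_le_abs_0. unfold Rsqr.
  assert (S1 : forall u : C, Cmod u * Cmod u = fst u ^ 2 + snd u ^ 2).
  { intros u. unfold Cmod. apply sqrt_sqrt.
    assert (A := pow2_ge_0 (fst u)). assert (B := pow2_ge_0 (snd u)). lra. }
  assert (S2 : Cmod w ^ 2 = fst w ^ 2 + snd w ^ 2) by (rewrite <- S1; ring).
  rewrite S1. destruct w as [a b]. cbn -[Cmod pow] in *. rewrite S2 in *.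
  assert (Q : 0 <= (- a + (a ^ 2 + b ^ 2) / 2) ^ 2) by apply pow2_ge_0. nra.
Qed.

Lemma Cmod_Pi_le (p : nat -> R) (z : C) (d : R) : entire_offspring p -> d <= Re z ->
  Cmod (Pi p z) <= Cmod (Pi p (RtoC d)).
Proof.
  intros H Hd. assert (HE := mean_gt_1 p H). set (E := mean p) in *.
  destruct (Pi_regular_all p (Cmod z + Rabs d + 1) H) as [HU [L [HL HLip]]].
  apply le_epsilon. intros eps He.
  set (eta := Rmin 1 (eps / (L + 2))).
  assert (Heta : 0 < eta) by (apply Rmin_pos; [lra|apply Rdiv_lt_0_compat; lra]).
  destruct (HU eta Heta) as [T HT].
  destruct (pow_unbounded E (Cmod z ^ 2 / 2 / eta) HE) as [N HN].
  set (t := max T N).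
  assert (Et : Cmod z ^ 2 / 2 <= eta * E ^ t).
  { apply Rle_div_l in HN; [|lra]. rewrite Rmult_comm in HN.
    eapply Rle_trans; [exact HN|]. apply Rmult_le_compat_l; [lra|]. apply Rle_pow; [lra|unfold t; lia]. }
  assert (Et0 : 0 < E ^ t) by (apply pow_lt; lra).
  set (dt := d - Cmod z ^ 2 / 2 / E ^ t).
  assert (Hz2 : 0 <= Cmod z ^ 2 / 2) by (assert (X := pow2_ge_0 (Cmod z)); lra).
  assert (Hdt : d - eta <= dt <= d).
  { unfold dt. split.
    - assert (Cmod z ^ 2 / 2 / E ^ t <= eta) by (apply Rle_div_l; lra). lra.
    - assert (0 <= Cmod z ^ 2 / 2 / E ^ t).
      { apply Rmult_le_pos; [lra|left; apply Rinv_0_lt_compat; lra]. } lra. }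
  assert (Dom : Cmod (Pi_iter p t z) <= Cmod (Pi_iter p t (RtoC dt))).
  { unfold Pi_iter. fold E. rewrite <- !RtoC_pow, <- !RtoC_div, <- RtoC_minus by lra.
    apply pgf_iter_dominated; [exact H|].
    eapply Rle_trans; [apply Cmod_1_minus_le|].
    assert (N1 := RtoC_neq_0 _ (Rgt_not_eq _ _ Et0)).
    rewrite Cmod_div, Cmod_RtoC_nonneg by (auto || lra).
    replace (Re (z / RtoC (E ^ t))) with (Re z / E ^ t).
    2:{ destruct z as [a b]. unfold Cdiv, Cinv, Cmult, Re, RtoC; simpl. field. lra. }
    assert (d / E ^ t <= Re z / E ^ t) by (apply Rmult_le_compat_r; [left; apply Rinv_0_lt_compat|]; lra).
    replace (dt / E ^ t) with (d / E ^ t - (Cmod z / E ^ t) ^ 2 / 2) by (unfold dt; field; lra). lra. }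
  assert (A1 := Rmin_l 1 (eps / (L + 2))). assert (A2 := Rmin_r 1 (eps / (L + 2))). fold eta in A1, A2.
  assert (Ad := Rabs_pos d). assert (Az := Cmod_ge_0 z).
  assert (Bd : Cmod (RtoC d) <= Cmod z + Rabs d + 1) by (rewrite Cmod_R; lra).
  assert (Bdt : Cmod (RtoC dt) <= Cmod z + Rabs d + 1).
  { rewrite Cmod_R. replace dt with (d + - (d - dt)) by ring.
    eapply Rle_trans; [apply Rabs_triang|]. rewrite Rabs_Ropp, (Rabs_pos_eq (d - dt)); lra. }
  assert (C1 := HT t z ltac:(unfold t; lia) ltac:(lra)).
  assert (C2 := HT t (RtoC dt) ltac:(unfold t; lia) Bdt).
  assert (C3 := HLip (RtoC dt) (RtoC d) Bdt Bd).
  rewrite <- RtoC_minus, Cmod_R in C3.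
  assert (Rabs (dt - d) <= eta) by (apply Rabs_le; lra).
  assert (L * Rabs (dt - d) <= L * eta) by (apply Rmult_le_compat_l; lra).
  assert (T1 := Cmod_triangle_inv (Pi p z) (Pi_iter p t z)).
  assert (T2 := Cmod_triangle_inv (Pi_iter p t (RtoC dt)) (Pi p (RtoC dt))). rewrite Cmod_minus_sym in T2.
  assert (T3 := Cmod_triangle_inv (Pi p (RtoC dt)) (Pi p (RtoC d))).
  assert (eta * (L + 2) <= eps) by (apply Rle_div_r in A2; lra).
  lra.
Qed.

Lemma Cmod_Pi_lt_1 (p : nat -> R) (z : C) : entire_offspring p -> 0 < Re z -> Cmod (Pi p z) < 1.
Proof.
  intros H Hz. destruct (Pi_local p H) as [r0 [c [Hr0 [Hc [H1 _]]]]].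
  set (d := Rmin (Re z) (Rmin (1 / 2) (Rmin r0 (/ (2 * (c + 1)))))).
  assert (Hd : 0 < d).
  { repeat apply Rmin_pos; try lra. apply Rinv_0_lt_compat; lra. }
  assert (D1 : d <= Re z) by apply Rmin_l.
  assert (D2 : d <= Rmin (1 / 2) (Rmin r0 (/ (2 * (c + 1))))) by apply Rmin_r.
  assert (D3 := Rmin_l (1 / 2) (Rmin r0 (/ (2 * (c + 1))))).
  assert (D4 := Rmin_r (1 / 2) (Rmin r0 (/ (2 * (c + 1))))).
  assert (D5 := Rmin_l r0 (/ (2 * (c + 1)))). assert (D6 := Rmin_r r0 (/ (2 * (c + 1)))).
  eapply Rle_lt_trans; [apply (Cmod_Pi_le p z d H D1)|].
  specialize (H1 (RtoC d) O). rewrite Cmod_RtoC_nonneg in H1 by lra. specialize (H1 ltac:(lra)).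
  unfold Pi_iter in H1. simpl in H1.
  replace (1 - RtoC d / 1)%C with (RtoC (1 - d)) in H1 by (rewrite RtoC_minus; field).
  assert (T := Cmod_triangle_inv (Pi p (RtoC d)) (RtoC (1 - d))).
  rewrite Cmod_RtoC_nonneg in T by lra.
  assert (c * d <= / 2).
  { apply Rle_trans with ((c + 1) * / (2 * (c + 1))); [apply Rmult_le_compat; lra|]. right. field. lra. }
  nra.
Qed.

Definition ccont (f : R -> C) (x : R) : Prop :=
  forall eps, 0 < eps -> exists del, 0 < del /\
    forall y, Rabs (y - x) < del -> Cmod (f y - f x) < eps.

Lemma ccont_continuous (f : R -> C) (x : R) : ccont f x -> ccontinuous f x.
Proof.
  intros H. apply filterlim_locally. intros eps.
  destruct (H eps (cond_pos eps)) as [del [Hd Hf]].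
  exists (mkposreal del Hd). intros y Hy. specialize (Hf y Hy).
  split.
  - eapply Rle_lt_trans; [apply (re_le_Cmod (f y - f x))|exact Hf].
  - eapply Rle_lt_trans; [apply (snd_le_Cmod (f y - f x))|exact Hf].
Qed.

Lemma continuous_ccont (f : R -> C) (x : R) :
  continuous (fun t => fst (f t)) x -> continuous (fun t => snd (f t)) x -> ccont f x.
Proof.
  intros H1 H2 eps He.
  assert (A := proj1 (filterlim_locally (fun t => fst (f t)) (fst (f x))) H1 (mkposreal (eps / 2) ltac:(lra))).
  assert (B := proj1 (filterlim_locally (fun t => snd (f t)) (snd (f x))) H2 (mkposreal (eps / 2) ltac:(lra))).
  destruct (filter_and _ _ A B) as [del Hd].
  exists del. split; [apply cond_pos|]. intros y Hy. destruct (Hd y Hy) as [C1 C2].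
  eapply Rle_lt_trans; [apply Cmod_le_parts|].
  assert (D1 : Rabs (fst (f y) - fst (f x)) < eps / 2) by exact C1.
  assert (D2 : Rabs (snd (f y) - snd (f x)) < eps / 2) by exact C2.
  unfold Cminus, Cplus, Copp; simpl. unfold Rminus in *. lra.
Qed.

Lemma ccont_parts (f : R -> C) (x : R) : ccont f x ->
  continuous (fun t => fst (f t)) x /\ continuous (fun t => snd (f t)) x.
Proof.
  intros H. split; apply filterlim_locally; intros eps;
    destruct (H eps (cond_pos eps)) as [del [Hd Hf]];
    exists (mkposreal del Hd); intros y Hy; specialize (Hf y Hy).
  - eapply Rle_lt_trans; [apply (re_le_Cmod (f y - f x))|exact Hf].
  - eapply Rle_lt_trans; [apply (snd_le_Cmod (f y - f x))|exact Hf].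
Qed.

Lemma ccont_ext (f g : R -> C) (x : R) : (forall y, f y = g y) -> ccont f x -> ccont g x.
Proof.
  intros E H eps He. destruct (H eps He) as [d [Hd Hf]]. exists d. split; [auto|].
  intros y Hy. rewrite <- !E. auto.
Qed.

Lemma ccont_const (c : C) (x : R) : ccont (fun _ => c) x.
Proof. intros eps He. exists 1. split; [lra|]. intros. rewrite Cminus_diag_0. auto. Qed.

Lemma ccont_RtoC (f : R -> R) (x : R) : continuous f x -> ccont (fun t => RtoC (f t)) x.
Proof. intros H. apply continuous_ccont; simpl; [exact H|apply continuous_const]. Qed.

Lemma ccont_mult (f g : R -> C) (x : R) : ccont f x -> ccont g x -> ccont (fun t => f t * g t)%C x.
Proof.
  intros Hf Hg. apply ccont_parts in Hf. apply ccont_parts in Hg.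
  destruct Hf as [F1 F2], Hg as [G1 G2].
  apply continuous_ccont; simpl.
  - apply (continuous_minus (V := R_NormedModule)); apply (continuous_mult (K := R_AbsRing)); auto.
  - apply (continuous_plus (V := R_NormedModule)); apply (continuous_mult (K := R_AbsRing)); auto.
Qed.

Lemma ccont_plus (f g : R -> C) (x : R) : ccont f x -> ccont g x -> ccont (fun t => f t + g t)%C x.
Proof.
  intros Hf Hg. apply ccont_parts in Hf. apply ccont_parts in Hg.
  destruct Hf as [F1 F2], Hg as [G1 G2].
  apply continuous_ccont; simpl; apply (continuous_plus (V := R_NormedModule)); auto.
Qed.

Lemma ccont_scal (c : C) (g : R -> C) (x : R) : ccont g x -> ccont (fun t => c * g t)%C x.
Proof. intros H. apply ccont_mult; [apply ccont_const|exact H]. Qed.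

Lemma ccont_minus (f g : R -> C) (x : R) : ccont f x -> ccont g x -> ccont (fun t => f t - g t)%C x.
Proof.
  intros Hf Hg. apply (ccont_ext (fun t => f t + (- (1)) * g t)%C).
  - intros y. ring.
  - apply ccont_plus; [exact Hf|now apply ccont_scal].
Qed.

Lemma ccont_pow (f : R -> C) (n : nat) (x : R) : ccont f x -> ccont (fun t => f t ^ n)%C x.
Proof.
  intros H. induction n as [|n IH]; [exact (ccont_const 1%C x)|].
  exact (ccont_mult _ _ _ H IH).
Qed.

Lemma ccont_lip (F : C -> C) (f : R -> C) (x : R) (L del : R) : 0 <= L -> 0 < del ->
  (forall w, Cmod (w - f x) < del -> Cmod (F w - F (f x)) <= L * Cmod (w - f x)) ->
  ccont f x -> ccont (fun t => F (f t)) x.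
Proof.
  intros HL Hdel HF Hf eps He.
  destruct (Hf (Rmin del (eps / (L + 1)))) as [d [Hd Hfd]].
  { apply Rmin_pos; [auto|apply Rdiv_lt_0_compat; lra]. }
  exists d. split; [exact Hd|]. intros y Hy. specialize (Hfd y Hy).
  assert (A := Rmin_l del (eps / (L + 1))). assert (B := Rmin_r del (eps / (L + 1))).
  eapply Rle_lt_trans; [apply HF; lra|].
  assert (Cmod (f y - f x) * (L + 1) < eps).
  { apply Rlt_div_r; lra. }
  assert (X := Cmod_ge_0 (f y - f x)). nra.
Qed.

Lemma ccont_C11 (F F' : C -> C) (f : R -> C) (x : R) : C11 F F' ->
  ccont f x -> ccont (fun t => F (f t)) x.
Proof.
  intros HF. destruct (C11_lip F F' HF (Cmod (f x) + 1)) as [L [HL HLip]].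
  apply (ccont_lip F f x L 1); [auto|lra|].
  intros w Hw. apply HLip; [|lra].
  assert (T := Cmod_triangle_inv w (f x)). lra.
Qed.

Lemma ccont_Cexp (f : R -> C) (x : R) : ccont f x -> ccont (fun t => Cexp (f t)) x.
Proof. apply (ccont_C11 Cexp Cexp), C11_Cexp. Qed.

Lemma ccont_id (x : R) : ccont (fun t => RtoC t) x.
Proof. apply (ccont_RtoC (fun t => t)), continuous_id. Qed.

Lemma ccont_line (a b : C) (x : R) : ccont (fun t => a + RtoC t * b)%C x.
Proof.
  apply ccont_plus; [apply ccont_const|]. apply ccont_mult; [apply ccont_id|apply ccont_const].
Qed.

Lemma C_R_norm (z : C) : @norm R_AbsRing C_R_NormedModule z = Cmod z.
Proof.
  unfold norm, Cmod; simpl. unfold prod_norm, norm; simpl.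
  change (sqrt (Rabs (fst z) ^ 2 + Rabs (snd z) ^ 2) = sqrt (fst z ^ 2 + snd z ^ 2)).
  now rewrite !pow2_abs.
Qed.

Lemma is_CRInt_parts (f : R -> C) (a b : R) (l : C) :
  is_CRInt f a b l <->
  is_RInt (fun t => fst (f t)) a b (fst l) /\ is_RInt (fun t => snd (f t)) a b (snd l).
Proof.
  split.
  - intros H. split.
    + exact (@is_RInt_fct_extend_fst R_NormedModule R_NormedModule f a b l H).
    + exact (@is_RInt_fct_extend_snd R_NormedModule R_NormedModule f a b l H).
  - intros [H1 H2]. destruct l as [l1 l2].
    exact (@is_RInt_fct_extend_pair R_NormedModule R_NormedModule f a b l1 l2 H1 H2).
Qed.

Lemma CRInt_unique (f : R -> C) (a b : R) (l : C) : is_CRInt f a b l -> CRInt f a b = l.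
Proof. intros H. exact (@is_RInt_unique C_R_CompleteNormedModule f a b l H). Qed.

Lemma is_CRInt_unique (f : R -> C) (a b : R) (l l' : C) : is_CRInt f a b l -> is_CRInt f a b l' -> l = l'.
Proof. intros H H'. rewrite <- (CRInt_unique _ _ _ _ H). now apply CRInt_unique. Qed.

Lemma CRInt_correct (f : R -> C) (a b : R) :
  (forall x, Rmin a b <= x <= Rmax a b -> ccont f x) -> is_CRInt f a b (CRInt f a b).
Proof.
  intros H. apply (@RInt_correct C_R_CompleteNormedModule).
  apply (@ex_RInt_continuous C_R_CompleteNormedModule).
  intros z Hz. now apply ccont_continuous, H.
Qed.

Lemma CRInt_correct_le (f : R -> C) (a b : R) : a <= b ->
  (forall x, a <= x <= b -> ccont f x) -> is_CRInt f a b (CRInt f a b).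
Proof.
  intros Hab H. apply CRInt_correct. rewrite Rmin_left, Rmax_right by lra. exact H.
Qed.

Lemma is_CRInt_scal (c : C) (f : R -> C) (a b : R) (l : C) :
  is_CRInt f a b l -> is_CRInt (fun t => c * f t)%C a b (c * l)%C.
Proof.
  intros H. apply is_CRInt_parts in H. destruct H as [H1 H2]. apply is_CRInt_parts. simpl. split.
  - apply (is_RInt_minus (V := R_NormedModule)); apply (is_RInt_scal (V := R_NormedModule)); auto.
  - apply (is_RInt_plus (V := R_NormedModule)); apply (is_RInt_scal (V := R_NormedModule)); auto.
Qed.

Lemma is_CRInt_plus (f g : R -> C) (a b : R) (l m : C) :
  is_CRInt f a b l -> is_CRInt g a b m -> is_CRInt (fun t => f t + g t)%C a b (l + m)%C.
Proof. intros H H'. exact (@is_RInt_plus C_R_NormedModule f g a b l m H H'). Qed.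

Lemma is_CRInt_minus (f g : R -> C) (a b : R) (l m : C) :
  is_CRInt f a b l -> is_CRInt g a b m -> is_CRInt (fun t => f t - g t)%C a b (l - m)%C.
Proof. intros H H'. exact (@is_RInt_minus C_R_NormedModule f g a b l m H H'). Qed.

Lemma is_CRInt_ext (f g : R -> C) (a b : R) (l : C) :
  (forall x, Rmin a b < x < Rmax a b -> f x = g x) -> is_CRInt f a b l -> is_CRInt g a b l.
Proof. apply (@is_RInt_ext C_R_NormedModule). Qed.

Lemma is_CRInt_Chasles (f : R -> C) (a b c : R) (l m : C) :
  is_CRInt f a b l -> is_CRInt f b c m -> is_CRInt f a c (l + m)%C.
Proof. intros H H'. exact (@is_RInt_Chasles C_R_NormedModule f a b c l m H H'). Qed.

Lemma is_CRInt_swap (f : R -> C) (a b : R) (l : C) : is_CRInt f b a l -> is_CRInt f a b (- l)%C.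
Proof. intros H. exact (@is_RInt_swap C_R_NormedModule f a b l H). Qed.

Lemma is_CRInt_const (c : C) (a b : R) : is_CRInt (fun _ => c) a b (RtoC (b - a) * c)%C.
Proof.
  apply is_CRInt_parts. simpl. split.
  - replace ((b - a) * fst c - 0 * snd c) with ((b - a) * fst c) by ring.
    apply (is_RInt_const (V := R_NormedModule)).
  - replace ((b - a) * snd c + 0 * fst c) with ((b - a) * snd c) by ring.
    apply (is_RInt_const (V := R_NormedModule)).
Qed.

Lemma is_CRInt_shift (f : R -> C) (v a b : R) (l : C) :
  is_CRInt f (a + v) (b + v) l -> is_CRInt (fun y => f (y + v)) a b l.
Proof.
  intros H.
  assert (H' : is_CRInt f (1 * a + v) (1 * b + v) l) by (rewrite !Rmult_1_l; exact H).
  apply (@is_RInt_comp_lin C_R_NormedModule) in H'.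
  revert H'. apply is_RInt_ext. intros x _. rewrite Rmult_1_l.
  destruct (f (x + v)) as [u w]. unfold scal; simpl. unfold prod_scal, scal; simpl.
  unfold mult; simpl. f_equal; ring.
Qed.

Lemma is_CRInt_norm_le (f : R -> C) (g : R -> R) (a b : R) (l : C) (m : R) : a <= b ->
  (forall x, a <= x <= b -> Cmod (f x) <= g x) -> is_CRInt f a b l -> is_RInt g a b m -> Cmod l <= m.
Proof.
  intros Hab H Hl Hm. rewrite <- C_R_norm.
  apply (@norm_RInt_le C_R_NormedModule f g a b l m Hab); auto.
  intros x Hx. rewrite C_R_norm. auto.
Qed.

Lemma is_CRInt_norm_le_const (f : R -> C) (a b M : R) (l : C) : a <= b ->
  (forall x, a <= x <= b -> Cmod (f x) <= M) -> is_CRInt f a b l -> Cmod l <= (b - a) * M.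
Proof.
  intros Hab H Hl. rewrite <- C_R_norm.
  apply (@norm_RInt_le_const C_R_NormedModule f a b l M Hab); auto.
  intros x Hx. rewrite C_R_norm. auto.
Qed.

Lemma is_CRInt_RtoC (f : R -> R) (a b l : R) : is_RInt f a b l -> is_CRInt (fun t => RtoC (f t)) a b (RtoC l).
Proof.
  intros H. apply is_CRInt_parts. simpl. split; [exact H|].
  assert (X := is_RInt_const (V := R_NormedModule) a b 0).
  change (scal (b - a) 0) with ((b - a) * 0) in X. rewrite Rmult_0_r in X. exact X.
Qed.

(** * Iterated integrals *)

Definition cont2 (h : R -> R -> C) : Prop :=
  forall x y eps, 0 < eps -> exists del, 0 < del /\
    forall u v, Rabs (u - x) < del -> Rabs (v - y) < del -> Cmod (h u v - h x y) < eps.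

Lemma continuity_RInt_param (h : R -> R -> R) (a b y : R) :
  (forall u v, continuity_2d_pt h u v) -> continuous (fun v => RInt (fun u => h u v) a b) y.
Proof.
  intros H.
  assert (Cu : forall v u, continuous (fun u => h u v) u).
  { intros v u. apply filterlim_locally. intros eps. destruct (H u v eps) as [d Hd].
    exists d. intros w Hw. apply Hd; [exact Hw|]. rewrite Rminus_diag, Rabs_R0. apply cond_pos. }
  assert (Ex : forall v a b, ex_RInt (fun u => h u v) a b).
  { intros v a0 b0. apply (@ex_RInt_continuous R_CompleteNormedModule). intros u _. apply Cu. }
  apply filterlim_locally. intros eps.
  assert (He' : 0 < eps / 2 / (Rabs (b - a) + 1)).
  { assert (X := cond_pos eps). assert (Y := Rabs_pos (b - a)). apply Rdiv_lt_0_compat; lra. }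
  destruct (uniform_continuity_2d_1d h (Rmin a b) (Rmax a b) y (fun x _ => H x y) (mkposreal _ He')) as [d Hd].
  exists d. intros v Hv.
  change (Rabs (RInt (fun u => h u v) a b - RInt (fun u => h u y) a b) < eps).
  rewrite <- (RInt_minus (V := R_CompleteNormedModule)) by apply Ex.
  apply Rle_lt_trans with (Rabs (b - a) * (eps / 2 / (Rabs (b - a) + 1))).
  - apply (norm_RInt_le_const_abs (V := R_NormedModule)
             (fun u => minus (h u v) (h u y)) a b _ (eps / 2 / (Rabs (b - a) + 1))).
    + intros u Hu. change (Rabs (h u v - h u y) <= eps / 2 / (Rabs (b - a) + 1)).
      left. assert (Hv' : Rabs (v - y) < d) by exact Hv. apply Rabs_def2 in Hv'.
      assert (X := cond_pos d). apply Hd; auto; try lra.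
      rewrite Rminus_diag, Rabs_R0. exact X.
    + apply (@RInt_correct R_CompleteNormedModule).
      apply (@ex_RInt_minus R_NormedModule); apply Ex.
  - assert (X := cond_pos eps). assert (Y := Rabs_pos (b - a)).
    replace (Rabs (b - a) * (eps / 2 / (Rabs (b - a) + 1)))
      with (eps / 2 * (Rabs (b - a) / (Rabs (b - a) + 1))) by (field; lra).
    assert (Rabs (b - a) / (Rabs (b - a) + 1) <= 1) by (apply Rle_div_l; lra). nra.
Qed.

Lemma continuity_2d_swap (h : R -> R -> R) :
  (forall u v, continuity_2d_pt h u v) -> forall u v, continuity_2d_pt (fun x y => h y x) u v.
Proof.
  intros H u v eps. destruct (H v u eps) as [d Hd]. exists d. intros x y Hx Hy. now apply Hd.
Qed.

(* Both sides, as functions of the outer endpoint [b], have the same derivative. *)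
Lemma Fubini_R (h : R -> R -> R) (a b c d : R) : a < b ->
  (forall u v, continuity_2d_pt h u v) ->
  RInt (fun v => RInt (fun u => h u v) a b) c d = RInt (fun u => RInt (fun v => h u v) c d) a b.
Proof.
  intros Hab H.
  assert (H' := continuity_2d_swap h H).
  assert (Cu : forall v u, continuous (fun u => h u v) u).
  { intros v u. apply filterlim_locally. intros eps. destruct (H u v eps) as [e He].
    exists e. intros w Hw. apply He; [exact Hw|]. rewrite Rminus_diag, Rabs_R0. apply cond_pos. }
  assert (ExU : forall v a b, ex_RInt (fun u => h u v) a b).
  { intros v a0 b0. apply (@ex_RInt_continuous R_CompleteNormedModule). intros u _. apply Cu. }
  assert (Cg : forall x, continuous (fun u => RInt (fun v => h u v) c d) x).
  { intros x. apply (continuity_RInt_param (fun v u => h u v)). exact H'. }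
  set (phi := fun x => RInt (fun v => RInt (fun u => h u v) a x) c d).
  set (psi := fun x => RInt (fun u => RInt (fun v => h u v) c d) a x).
  assert (DU : forall v x, is_derive (fun x => RInt (fun u => h u v) a x) x (h x v)).
  { intros v x. apply (is_derive_RInt (V := R_NormedModule) (fun u => h u v) (fun x => RInt (fun u => h u v) a x) a x).
    - exists (mkposreal 1 Rlt_0_1). intros y _. apply (@RInt_correct R_CompleteNormedModule), ExU.
    - apply Cu. }
  assert (D1 : forall x, is_derive phi x (RInt (fun v => h x v) c d)).
  { intros x. unfold phi.
    replace (RInt (fun v => h x v) c d)
      with (RInt (fun v => Derive (fun u => RInt (fun w => h w v) a u) x) c d).
    2:{ apply RInt_ext. intros v _. apply is_derive_unique, DU. }
    apply (is_derive_RInt_param (fun x v => RInt (fun u => h u v) a x)).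
    - exists (mkposreal 1 Rlt_0_1). intros y _ t _. eexists. apply DU.
    - intros t _. apply (continuity_2d_pt_ext h); [|apply H].
      intros u v. symmetry. apply is_derive_unique, DU.
    - exists (mkposreal 1 Rlt_0_1). intros y _.
      apply (@ex_RInt_continuous R_CompleteNormedModule). intros z _.
      apply (continuity_RInt_param h). exact H. }
  assert (D2 : forall x, is_derive psi x (RInt (fun v => h x v) c d)).
  { intros x. apply (is_derive_RInt (V := R_NormedModule) (fun u => RInt (fun v => h u v) c d) psi a x).
    - exists (mkposreal 1 Rlt_0_1). intros y _. apply (@RInt_correct R_CompleteNormedModule).
      apply (@ex_RInt_continuous R_CompleteNormedModule). intros z _. apply Cg.
    - apply Cg. }
  assert (E : phi a - psi a = phi b - psi b).
  { apply (eq_is_derive (V := R_NormedModule) (fun x => phi x - psi x) a b); [|exact Hab].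
    intros t _.
    assert (D := is_derive_minus phi psi t _ _ (D1 t) (D2 t)).
    replace (@zero R_NormedModule) with (minus (RInt (fun v => h t v) c d) (RInt (fun v => h t v) c d)).
    - exact D.
    - apply Rplus_opp_r. }
  assert (Z1 : psi a = 0) by (unfold psi; apply (RInt_point (V := R_CompleteNormedModule))).
  assert (Z2 : phi a = 0).
  { unfold phi. rewrite (RInt_ext _ (fun _ => 0)).
    - rewrite (RInt_const (V := R_CompleteNormedModule)). apply Rmult_0_r.
    - intros v _. apply (RInt_point (V := R_CompleteNormedModule)). }
  unfold phi, psi in *. lra.
Qed.

Lemma cont2_parts (h : R -> R -> C) : cont2 h ->
  (forall u v, continuity_2d_pt (fun x y => fst (h x y)) u v) /\
  (forall u v, continuity_2d_pt (fun x y => snd (h x y)) u v).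
Proof.
  intros H. split; intros x y eps; destruct (H x y eps (cond_pos eps)) as [d [Hd Hh]];
    exists (mkposreal d Hd); intros u v Hu Hv; specialize (Hh u v Hu Hv).
  - eapply Rle_lt_trans; [apply (re_le_Cmod (h u v - h x y))|exact Hh].
  - eapply Rle_lt_trans; [apply (snd_le_Cmod (h u v - h x y))|exact Hh].
Qed.

Lemma cont2_ccont_1 (h : R -> R -> C) (v x : R) : cont2 h -> ccont (fun u => h u v) x.
Proof.
  intros H eps He. destruct (H x v eps He) as [d [Hd Hh]]. exists d. split; [auto|].
  intros y Hy. apply Hh; [exact Hy|]. now rewrite Rminus_diag, Rabs_R0.
Qed.

Lemma cont2_ccont_2 (h : R -> R -> C) (u x : R) : cont2 h -> ccont (fun v => h u v) x.
Proof.
  intros H eps He. destruct (H u x eps He) as [d [Hd Hh]]. exists d. split; [auto|].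
  intros y Hy. apply Hh; [|exact Hy]. now rewrite Rminus_diag, Rabs_R0.
Qed.

Lemma CRInt_fst_snd (f : R -> C) (a b : R) : (forall x, ccont f x) ->
  CRInt f a b = (RInt (fun t => fst (f t)) a b, RInt (fun t => snd (f t)) a b).
Proof.
  intros H. assert (A := CRInt_correct f a b (fun x _ => H x)).
  apply is_CRInt_parts in A. destruct A as [A B].
  apply (@is_RInt_unique R_CompleteNormedModule) in A.
  apply (@is_RInt_unique R_CompleteNormedModule) in B.
  rewrite (surjective_pairing (CRInt f a b)). now rewrite <- A, <- B.
Qed.

Lemma ccont_CRInt_param (h : R -> R -> C) (a b y : R) : cont2 h ->
  ccont (fun v => CRInt (fun u => h u v) a b) y.
Proof.
  intros H. destruct (cont2_parts h H) as [H1 H2].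
  apply (ccont_ext (fun v => (RInt (fun u => fst (h u v)) a b, RInt (fun u => snd (h u v)) a b))).
  - intros v. symmetry. apply CRInt_fst_snd. intros x. now apply cont2_ccont_1.
  - apply continuous_ccont; simpl.
    + now apply (continuity_RInt_param (fun u v => fst (h u v))).
    + now apply (continuity_RInt_param (fun u v => snd (h u v))).
Qed.

Lemma cont2_swap (h : R -> R -> C) : cont2 h -> cont2 (fun x y => h y x).
Proof.
  intros H x y eps He. destruct (H y x eps He) as [d [Hd Hh]]. exists d. split; auto.
Qed.

Lemma Fubini_C (h : R -> R -> C) (a b c d : R) : a < b -> cont2 h ->
  CRInt (fun v => CRInt (fun u => h u v) a b) c d = CRInt (fun u => CRInt (fun v => h u v) c d) a b.
Proof.
  intros Hab H. destruct (cont2_parts h H) as [H1 H2].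
  rewrite (CRInt_fst_snd (fun v => CRInt (fun u => h u v) a b)) by (intros; now apply ccont_CRInt_param).
  rewrite (CRInt_fst_snd (fun u => CRInt (fun v => h u v) c d)).
  2:{ intros. apply (ccont_CRInt_param (fun v u => h u v)). now apply cont2_swap. }
  f_equal.
  - transitivity (RInt (fun v => RInt (fun u => fst (h u v)) a b) c d).
    { apply RInt_ext. intros v _. rewrite CRInt_fst_snd; [reflexivity|]. intros. now apply cont2_ccont_1. }
    rewrite (Fubini_R (fun u v => fst (h u v)) a b c d Hab H1).
    apply RInt_ext. intros u _. rewrite CRInt_fst_snd; [reflexivity|]. intros. now apply cont2_ccont_2.
  - transitivity (RInt (fun v => RInt (fun u => snd (h u v)) a b) c d).
    { apply RInt_ext. intros v _. rewrite CRInt_fst_snd; [reflexivity|]. intros. now apply cont2_ccont_1. }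
    rewrite (Fubini_R (fun u v => snd (h u v)) a b c d Hab H2).
    apply RInt_ext. intros u _. rewrite CRInt_fst_snd; [reflexivity|]. intros. now apply cont2_ccont_2.
Qed.

Lemma is_derive_of_quadratic (g : R -> R) (x l M d : R) : 0 <= M -> 0 < d ->
  (forall h, Rabs h < d -> Rabs (g (x + h) - g x - l * h) <= M * h ^ 2) -> is_derive g x l.
Proof.
  intros HM Hd H. apply is_derive_Reals. intros eps He.
  assert (Hd' : 0 < Rmin d (eps / (M + 1))).
  { apply Rmin_pos; [auto|apply Rdiv_lt_0_compat; lra]. }
  exists (mkposreal _ Hd'). intros h Hh Hlt. simpl in Hlt.
  assert (A := Rmin_l d (eps / (M + 1))). assert (B := Rmin_r d (eps / (M + 1))).
  specialize (H h ltac:(lra)).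
  replace ((g (x + h) - g x) / h - l) with ((g (x + h) - g x - l * h) / h) by (field; auto).
  unfold Rdiv. rewrite Rabs_mult, Rabs_inv.
  assert (Hp : 0 < Rabs h) by now apply Rabs_pos_lt.
  apply Rle_lt_trans with (M * Rabs h).
  - apply Rle_div_l; [exact Hp|]. rewrite Rmult_assoc.
    replace (Rabs h * Rabs h) with (h ^ 2); [exact H|].
    rewrite <- Rabs_mult, Rabs_pos_eq; nra.
  - assert (Rabs h * (M + 1) < eps) by (apply Rlt_div_r; lra). nra.
Qed.

Lemma C11_FTC (f f' : C -> C) (z b : C) (s t : R) : C11 f f' ->
  is_CRInt (fun u => f' (z + RtoC u * b) * b)%C s t (f (z + RtoC t * b)%C - f (z + RtoC s * b)%C)%C.
Proof.
  intros H.
  assert (Q : forall u, exists M, 0 <= M /\ forall h, Rabs h < 1 ->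
     Cmod (f (z + RtoC (u + h) * b)%C - f (z + RtoC u * b)%C - f' (z + RtoC u * b)%C * b * RtoC h) <= M * h ^ 2).
  { intros u. destruct (H (Cmod (z + RtoC u * b) + Cmod b)) as [M [HM [_ H2]]].
    exists (M * Cmod b ^ 2). assert (Hb := Cmod_ge_0 b).
    split; [apply Rmult_le_pos; [lra|apply pow_le; lra]|].
    intros h Hh. assert (Hz := Cmod_ge_0 (z + RtoC u * b)).
    assert (Hhb : Cmod (RtoC h * b) <= Cmod b).
    { rewrite Cmod_mult, Cmod_R. nra. }
    specialize (H2 (z + RtoC u * b)%C (RtoC h * b)%C ltac:(lra) ltac:(lra)).
    replace (z + RtoC u * b + RtoC h * b)%C with (z + RtoC (u + h) * b)%C in H2 by (rewrite RtoC_plus; ring).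
    replace (f' (z + RtoC u * b)%C * b * RtoC h)%C with (f' (z + RtoC u * b)%C * (RtoC h * b))%C by ring.
    eapply Rle_trans; [exact H2|]. rewrite Cmod_mult, Cmod_R, Rpow_mult_distr, pow2_abs. lra. }
  assert (Cd : forall u, ccont (fun u => f' (z + RtoC u * b) * b)%C u).
  { intros u. apply ccont_mult; [|apply ccont_const].
    destruct (C11_deriv_lip f f' H (Cmod (z + RtoC u * b) + 1)) as [L [HL HLip]].
    apply (ccont_lip f' (fun u => z + RtoC u * b)%C u L 1 HL ltac:(lra)).
    - intros w Hw. apply HLip; [|lra].
      assert (T := Cmod_triangle_inv w (z + RtoC u * b)). lra.
    - apply ccont_line. }
  apply is_CRInt_parts. split.
  - apply (@is_RInt_derive R_CompleteNormedModule (fun u => fst (f (z + RtoC u * b)%C))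
             (fun u => fst (f' (z + RtoC u * b)%C * b)%C)).
    + intros u _. destruct (Q u) as [M [HM HQ]].
      apply (is_derive_of_quadratic _ _ _ M 1 HM ltac:(lra)). intros h Hh.
      eapply Rle_trans; [|apply (HQ h Hh)]. eapply Rle_trans; [|apply re_le_Cmod].
      right. f_equal. unfold Re. simpl. ring.
    + intros u _. apply (ccont_parts _ u (Cd u)).
  - apply (@is_RInt_derive R_CompleteNormedModule (fun u => snd (f (z + RtoC u * b)%C))
             (fun u => snd (f' (z + RtoC u * b)%C * b)%C)).
    + intros u _. destruct (Q u) as [M [HM HQ]].
      apply (is_derive_of_quadratic _ _ _ M 1 HM ltac:(lra)). intros h Hh.
      eapply Rle_trans; [|apply (HQ h Hh)]. eapply Rle_trans; [|apply snd_le_Cmod].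
      right. f_equal. simpl. ring.
    + intros u _. apply (ccont_parts _ u (Cd u)).
Qed.

Lemma pair_horizontal (x y : R) : ((0, y) + RtoC x * 1)%C = (x, y).
Proof. unfold Cplus, Cmult, RtoC; simpl. f_equal; ring. Qed.

Lemma pair_vertical (x y : R) : (RtoC x + RtoC y * Ci)%C = (x, y).
Proof. unfold Cplus, Cmult, RtoC, Ci; simpl. f_equal; ring. Qed.

Definition rect_int (f : C -> C) (a b c d : R) : C :=
  (CRInt (fun x => f (x, c)) a b + Ci * CRInt (fun y => f (b, y)) c d
   - CRInt (fun x => f (x, d)) a b - Ci * CRInt (fun y => f (a, y)) c d)%C.

Lemma Cmod_pair_le (x y : R) : Cmod (x, y) <= Rabs x + Rabs y.
Proof. apply (Cmod_le_parts (x, y)). Qed.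

Lemma cont2_lip (F : C -> C) :
  (forall r, exists L, 0 <= L /\ forall z w, Cmod z <= r -> Cmod w <= r -> Cmod (F z - F w) <= L * Cmod (z - w)) ->
  cont2 (fun x y => F (x, y)).
Proof.
  intros H x y eps He. destruct (H (Rabs x + Rabs y + 2)) as [L [HL HLip]].
  exists (Rmin 1 (eps / (2 * (L + 1)))).
  assert (A := Rmin_l 1 (eps / (2 * (L + 1)))). assert (B := Rmin_r 1 (eps / (2 * (L + 1)))).
  split. { apply Rmin_pos; [lra|apply Rdiv_lt_0_compat; lra]. }
  intros u v Hu Hv.
  assert (D : Cmod ((u, v) - (x, y)) <= Rabs (u - x) + Rabs (v - y)).
  { eapply Rle_trans; [apply Cmod_le_parts|]. simpl. unfold Rminus. lra. }
  assert (N := Cmod_pair_le x y). assert (T := Cmod_triangle_inv (u, v) (x, y)).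
  eapply Rle_lt_trans; [apply HLip; lra|].
  apply Rle_lt_trans with ((L + 1) * (Rabs (u - x) + Rabs (v - y)) - (Rabs (u - x) + Rabs (v - y))).
  - assert (L * Cmod ((u, v) - (x, y)) <= L * (Rabs (u - x) + Rabs (v - y))) by (apply Rmult_le_compat_l; lra). lra.
  - assert (Rabs (u - x) * (2 * (L + 1)) < eps) by (apply Rlt_div_r; lra).
    assert (Rabs (v - y) * (2 * (L + 1)) < eps) by (apply Rlt_div_r; lra).
    assert (X := Rabs_pos (u - x)). assert (Y := Rabs_pos (v - y)). nra.
Qed.

Lemma rect_int_C11 (f f' : C -> C) (a b c d : R) : C11 f f' -> a < b -> rect_int f a b c d = 0%C.
Proof.
  intros H Hab.
  assert (K2 : cont2 (fun x y => f' (x, y))) by (apply cont2_lip, C11_deriv_lip with f; exact H).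
  assert (K1 : cont2 (fun x y => f (x, y))) by (apply cont2_lip, C11_lip with f'; exact H).
  assert (FH : forall y, CRInt (fun x => f' (x, y)) a b = (f (b, y) - f (a, y))%C).
  { intros y. apply CRInt_unique. rewrite <- (pair_horizontal a y), <- (pair_horizontal b y).
    generalize (C11_FTC f f' (0, y) 1 a b H). apply is_CRInt_ext. intros x _.
    rewrite pair_horizontal. ring. }
  assert (FV : forall x, (Ci * CRInt (fun y => f' (x, y)) c d)%C = (f (x, d) - f (x, c))%C).
  { intros x.
    assert (I := CRInt_correct (fun y => f' (x, y)) c d (fun y _ => cont2_ccont_2 _ x y K2)).
    apply (is_CRInt_scal Ci) in I.
    refine (is_CRInt_unique _ _ _ _ _ I _).
    rewrite <- (pair_vertical x c), <- (pair_vertical x d).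
    generalize (C11_FTC f f' (RtoC x) Ci c d H). apply is_CRInt_ext. intros y _.
    rewrite pair_vertical. ring. }
  assert (F := Fubini_C (fun x y => f' (x, y)) a b c d Hab K2).
  assert (Cx : forall y u, ccont (fun x => f (x, y)) u) by (intros; apply (cont2_ccont_1 (fun x y => f (x, y))); exact K1).
  assert (Cy : forall x u, ccont (fun y => f (x, y)) u) by (intros; apply (cont2_ccont_2 (fun x y => f (x, y))); exact K1).
  assert (L : CRInt (fun y => CRInt (fun x => f' (x, y)) a b) c d
              = (CRInt (fun y => f (b, y)) c d - CRInt (fun y => f (a, y)) c d)%C).
  { apply CRInt_unique. apply (is_CRInt_ext (fun y => f (b, y) - f (a, y))%C).
    - intros y _. symmetry. apply FH.
    - apply is_CRInt_minus; apply CRInt_correct; auto. }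
  assert (Rr : (Ci * CRInt (fun x => CRInt (fun y => f' (x, y)) c d) a b)%C
              = (CRInt (fun x => f (x, d)) a b - CRInt (fun x => f (x, c)) a b)%C).
  { assert (I : is_CRInt (fun x => CRInt (fun y => f' (x, y)) c d) a b (CRInt (fun x => CRInt (fun y => f' (x, y)) c d) a b)).
    { apply CRInt_correct. intros x _. apply (ccont_CRInt_param (fun y x => f' (x, y))).
      apply (cont2_swap (fun x y => f' (x, y))). exact K2. }
    apply (is_CRInt_scal Ci) in I.
    refine (is_CRInt_unique _ _ _ _ _ I _).
    apply (is_CRInt_ext (fun x => f (x, d) - f (x, c))%C).
    - intros x _. symmetry. apply FV.
    - apply is_CRInt_minus; apply CRInt_correct; auto. }
  rewrite <- F, L in Rr. unfold rect_int.
  replace (CRInt (fun x => f (x, c)) a b + Ci * CRInt (fun y => f (b, y)) c d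
   - CRInt (fun x => f (x, d)) a b - Ci * CRInt (fun y => f (a, y)) c d)%C
   with (Ci * (CRInt (fun y => f (b, y)) c d - CRInt (fun y => f (a, y)) c d)
         - (CRInt (fun x => f (x, d)) a b - CRInt (fun x => f (x, c)) a b))%C by ring.
  rewrite Rr. ring.
Qed.

(** * Uniform limits of entire functions *)

Definition in_box (A B U W : R) (z : C) : Prop := A < fst z < B /\ U < snd z < W.

Definition unif_entire (f : C -> C) (S : C -> Prop) : Prop :=
  forall eps, 0 < eps -> exists g g', C11 g g' /\ forall z, S z -> Cmod (f z - g z) <= eps.

Lemma unif_entire_C11 (f f' : C -> C) (S : C -> Prop) : C11 f f' -> unif_entire f S.
Proof.
  intros H eps He. exists f, f'. split; [exact H|]. intros z _. rewrite Cminus_diag_0. lra.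
Qed.

Lemma unif_entire_ext (f g : C -> C) (S : C -> Prop) : (forall z, S z -> f z = g z) ->
  unif_entire f S -> unif_entire g S.
Proof.
  intros E H eps He. destruct (H eps He) as [h [h' [Hh Ha]]]. exists h, h'. split; [exact Hh|].
  intros z Hz. rewrite <- E; auto.
Qed.

Definition bounded_set (S : C -> Prop) : Prop := exists r, forall z, S z -> Cmod z <= r.

Lemma in_box_bounded (A B U W : R) : bounded_set (in_box A B U W).
Proof.
  exists (Rabs A + Rabs B + (Rabs U + Rabs W)). intros [x y] [H1 H2]. simpl in *.
  assert (X : forall l u t, l < t < u -> Rabs t <= Rabs l + Rabs u).
  { intros l u t Ht. apply Rabs_le.
    assert (E1 := Rle_abs u). assert (E2 := Rle_abs (- l)). rewrite Rabs_Ropp in E2.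
    assert (E3 := Rabs_pos u). assert (E4 := Rabs_pos l). lra. }
  eapply Rle_trans; [apply Cmod_pair_le|]. apply Rplus_le_compat; apply X; lra.
Qed.

Lemma unif_entire_bounded (f : C -> C) (S : C -> Prop) : bounded_set S -> unif_entire f S ->
  exists B, 0 <= B /\ forall z, S z -> Cmod (f z) <= B.
Proof.
  intros [r Hr] H. destruct (H 1 ltac:(lra)) as [g [g' [Hg Ha]]].
  destruct (C11_bounded g g' Hg r) as [B [HB Hb]]. exists (B + 1). split; [lra|].
  intros z Hz. assert (T := Cmod_triangle_inv (f z) (g z)). specialize (Ha z Hz).
  specialize (Hb z (Hr z Hz)). lra.
Qed.

Lemma unif_entire_mult (f g : C -> C) (S : C -> Prop) : bounded_set S ->
  unif_entire f S -> unif_entire g S -> unif_entire (fun z => f z * g z)%C S.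
Proof.
  intros HS Hf Hg eps He.
  destruct (unif_entire_bounded f S HS Hf) as [B1 [HB1 Hb1]].
  destruct (unif_entire_bounded g S HS Hg) as [B2 [HB2 Hb2]].
  set (eta := Rmin 1 (eps / (B1 + B2 + 1))).
  assert (Heta : 0 < eta) by (apply Rmin_pos; [lra|apply Rdiv_lt_0_compat; lra]).
  assert (E1 : eta <= 1) by apply Rmin_l.
  assert (E2 : eta * (B1 + B2 + 1) <= eps) by (apply Rle_div_r; [lra|apply Rmin_r]).
  destruct (Hf eta Heta) as [u [u' [Hu Au]]]. destruct (Hg eta Heta) as [v [v' [Hv Av]]].
  eexists. eexists. split; [exact (C11_mult u u' v v' Hu Hv)|].
  intros z Hz. simpl. specialize (Au z Hz). specialize (Av z Hz).
  specialize (Hb1 z Hz). specialize (Hb2 z Hz).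
  replace (f z * g z - u z * v z)%C with ((f z - u z) * g z + u z * (g z - v z))%C by ring.
  eapply Rle_trans; [apply Cmod_triangle|]. rewrite !Cmod_mult.
  assert (U : Cmod (u z) <= B1 + 1).
  { assert (T := Cmod_triangle_inv (u z) (f z)). rewrite Cmod_minus_sym in T. lra. }
  assert (Cmod (f z - u z) * Cmod (g z) <= eta * B2) by (apply Rmult_le_compat; auto; apply Cmod_ge_0).
  assert (Cmod (u z) * Cmod (g z - v z) <= (B1 + 1) * eta) by (apply Rmult_le_compat; auto; apply Cmod_ge_0).
  lra.
Qed.

Lemma unif_entire_pow (f : C -> C) (S : C -> Prop) (n : nat) : bounded_set S ->
  unif_entire f S -> unif_entire (fun z => f z ^ n)%C S.
Proof.
  intros HS Hf. induction n as [|n IH].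
  - exact (unif_entire_C11 _ _ S (C11_const 1%C)).
  - exact (unif_entire_mult _ _ S HS Hf IH).
Qed.

Lemma unif_entire_C11_comp (F F' f : C -> C) (S : C -> Prop) : bounded_set S -> C11 F F' ->
  unif_entire f S -> unif_entire (fun z => F (f z)) S.
Proof.
  intros HS HF Hf eps He.
  destruct (unif_entire_bounded f S HS Hf) as [B [HB Hb]].
  destruct (C11_lip F F' HF (B + 1)) as [L [HL HLip]].
  set (eta := Rmin 1 (eps / (L + 1))).
  assert (Heta : 0 < eta) by (apply Rmin_pos; [lra|apply Rdiv_lt_0_compat; lra]).
  assert (E1 : eta <= 1) by apply Rmin_l.
  assert (E2 : eta * (L + 1) <= eps) by (apply Rle_div_r; [lra|apply Rmin_r]).
  destruct (Hf eta Heta) as [u [u' [Hu Au]]].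
  eexists. eexists. split; [exact (C11_comp F F' u u' HF Hu)|].
  intros z Hz. simpl. specialize (Au z Hz). specialize (Hb z Hz).
  assert (U : Cmod (u z) <= B + 1).
  { assert (T := Cmod_triangle_inv (u z) (f z)). rewrite Cmod_minus_sym in T. lra. }
  eapply Rle_trans; [apply HLip; lra|].
  assert (L * Cmod (f z - u z) <= L * eta) by (apply Rmult_le_compat_l; lra). lra.
Qed.

Lemma unif_entire_limit (f : C -> C) (S : C -> Prop) :
  (forall eps, 0 < eps -> exists g, unif_entire g S /\ forall z, S z -> Cmod (f z - g z) <= eps) ->
  unif_entire f S.
Proof.
  intros H eps He. destruct (H (eps / 2) ltac:(lra)) as [g [Hg A]].
  destruct (Hg (eps / 2) ltac:(lra)) as [h [h' [Hh B]]]. exists h, h'. split; [exact Hh|].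
  intros z Hz. assert (T := Cmod_minus_triangle (f z) (g z) (h z)).
  specialize (A z Hz). specialize (B z Hz). lra.
Qed.

Lemma unif_entire_ccont (f : C -> C) (S : C -> Prop) (gam : R -> C) (t : R) (d : R) :
  unif_entire f S -> 0 < d -> (forall w, Cmod (w - gam t) < d -> S w) -> ccont gam t ->
  ccont (fun u => f (gam u)) t.
Proof.
  intros H Hd HS Hg eps He.
  destruct (H (eps / 4) ltac:(lra)) as [g [g' [HC A]]].
  destruct (ccont_C11 g g' gam t HC Hg (eps / 4) ltac:(lra)) as [d1 [Hd1 H1]].
  destruct (Hg d Hd) as [d2 [Hd2 H2]].
  exists (Rmin d1 d2). split; [now apply Rmin_pos|].
  intros y Hy. assert (X := Rmin_l d1 d2). assert (Y := Rmin_r d1 d2).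
  specialize (H1 y ltac:(lra)). specialize (H2 y ltac:(lra)).
  assert (A1 := A _ (HS _ H2)).
  assert (A2 := A (gam t) (HS _ ltac:(rewrite Cminus_diag_0; lra))).
  assert (T1 := Cmod_minus_triangle (f (gam y)) (g (gam y)) (f (gam t))).
  assert (T2 := Cmod_minus_triangle (g (gam y)) (g (gam t)) (f (gam t))).
  rewrite (Cmod_minus_sym (g (gam t)) (f (gam t))) in T2. lra.
Qed.

Lemma in_box_open (A B U W : R) (z : C) : in_box A B U W z ->
  exists d, 0 < d /\ forall w, Cmod (w - z) < d -> in_box A B U W w.
Proof.
  destruct z as [x y]. intros [H1 H2]. simpl in *.
  set (d := Rmin (Rmin (x - A) (B - x)) (Rmin (y - U) (W - y))).
  exists d.
  assert (D1 := Rmin_l (Rmin (x - A) (B - x)) (Rmin (y - U) (W - y))).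
  assert (D2 := Rmin_r (Rmin (x - A) (B - x)) (Rmin (y - U) (W - y))).
  assert (D3 := Rmin_l (x - A) (B - x)). assert (D4 := Rmin_r (x - A) (B - x)).
  assert (D5 := Rmin_l (y - U) (W - y)). assert (D6 := Rmin_r (y - U) (W - y)).
  fold d in D1, D2.
  split. { repeat apply Rmin_pos; lra. }
  intros [u v] Hw.
  assert (E1 := re_le_Cmod ((u, v) - (x, y))). assert (E2 := snd_le_Cmod ((u, v) - (x, y))).
  unfold Re in E1. simpl in E1, E2.
  assert (F1 : Rabs (u + - x) < d) by lra. assert (F2 : Rabs (v + - y) < d) by lra.
  apply Rabs_def2 in F1. apply Rabs_def2 in F2.
  split; simpl; lra.
Qed.

Lemma ccont_pair_1 (y x : R) : ccont (fun u => (u, y)) x.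
Proof. apply continuous_ccont; simpl; [apply continuous_id|apply continuous_const]. Qed.

Lemma ccont_pair_2 (x y : R) : ccont (fun v => (x, v)) y.
Proof. apply continuous_ccont; simpl; [apply continuous_const|apply continuous_id]. Qed.

Lemma unif_entire_box_ccont (f : C -> C) (A B U W : R) (gam : R -> C) (t : R) :
  unif_entire f (in_box A B U W) -> in_box A B U W (gam t) -> ccont gam t -> ccont (fun u => f (gam u)) t.
Proof.
  intros H Hb Hg. destruct (in_box_open _ _ _ _ _ Hb) as [d [Hd HS]].
  exact (unif_entire_ccont f _ gam t d H Hd HS Hg).
Qed.

Lemma rect_int_unif_entire (f : C -> C) (A B U W a b c d : R) :
  unif_entire f (in_box A B U W) -> A < a -> a < b -> b < B -> U < c -> c <= d -> d < W ->
  rect_int f a b c d = 0%C.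
Proof.
  intros H Ha Hab Hb Hc Hcd Hd.
  assert (Box : forall x y, a <= x <= b -> c <= y <= d -> in_box A B U W (x, y)).
  { intros x y Hx Hy. split; simpl; lra. }
  assert (Kx : forall y, c <= y <= d -> is_CRInt (fun x => f (x, y)) a b (CRInt (fun x => f (x, y)) a b)).
  { intros y Hy. apply CRInt_correct_le; [lra|]. intros x Hx.
    apply (unif_entire_box_ccont f A B U W (fun u => (u, y)) x H); [auto|apply ccont_pair_1]. }
  assert (Ky : forall x, a <= x <= b -> is_CRInt (fun y => f (x, y)) c d (CRInt (fun y => f (x, y)) c d)).
  { intros x Hx. apply CRInt_correct_le; [lra|]. intros y Hy.
    apply (unif_entire_box_ccont f A B U W (fun v => (x, v)) y H); [auto|apply ccont_pair_2]. }
  apply Cmod_small_eq. intros eps He.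
  set (N := 2 * (b - a) + 2 * (d - c) + 1).
  assert (HN : 1 <= N) by (unfold N; lra).
  destruct (H (eps / N) ltac:(apply Rdiv_lt_0_compat; lra)) as [g [g' [Hg Ag]]].
  rewrite <- (rect_int_C11 g g' a b c d Hg Hab).
  assert (Gx : forall y, is_CRInt (fun x => g (x, y)) a b (CRInt (fun x => g (x, y)) a b)).
  { intros y. apply CRInt_correct. intros x _. apply (ccont_C11 g g' (fun u => (u, y)) x Hg), ccont_pair_1. }
  assert (Gy : forall x, is_CRInt (fun y => g (x, y)) c d (CRInt (fun y => g (x, y)) c d)).
  { intros x. apply CRInt_correct. intros y _. apply (ccont_C11 g g' (fun v => (x, v)) y Hg), ccont_pair_2. }
  assert (Dx : forall y, c <= y <= d ->
     Cmod (CRInt (fun x => f (x, y)) a b - CRInt (fun x => g (x, y)) a b) <= (b - a) * (eps / N)).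
  { intros y Hy.
    apply (is_CRInt_norm_le_const (fun x => f (x, y) - g (x, y))%C a b _ _ ltac:(lra)); [|now apply is_CRInt_minus; auto].
    intros x Hx. apply Ag, Box; auto. }
  assert (Dy : forall x, a <= x <= b ->
     Cmod (CRInt (fun y => f (x, y)) c d - CRInt (fun y => g (x, y)) c d) <= (d - c) * (eps / N)).
  { intros x Hx.
    apply (is_CRInt_norm_le_const (fun y => f (x, y) - g (x, y))%C c d _ _ ltac:(lra)); [|now apply is_CRInt_minus; auto].
    intros y Hy. apply Ag, Box; auto. }
  unfold rect_int.
  match goal with |- Cmod ((?X1 + Ci * ?X2 - ?X3 - Ci * ?X4) - (?Y1 + Ci * ?Y2 - ?Y3 - Ci * ?Y4)) <= _ =>
    replace ((X1 + Ci * X2 - X3 - Ci * X4) - (Y1 + Ci * Y2 - Y3 - Ci * Y4))%C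
      with ((X1 - Y1) + Ci * (X2 - Y2) + (- (X3 - Y3) + - (Ci * (X4 - Y4))))%C by ring
  end.
  eapply Rle_trans; [apply Cmod_triangle|].
  eapply Rle_trans; [apply Rplus_le_compat; apply Cmod_triangle|].
  rewrite !Cmod_opp, !Cmod_mult, Cmod_Ci, !Rmult_1_l.
  assert (Q1 := Dx c ltac:(lra)). assert (Q2 := Dx d ltac:(lra)).
  assert (Q3 := Dy a ltac:(lra)). assert (Q4 := Dy b ltac:(lra)).
  apply Rle_trans with ((N - 1) * (eps / N)).
  { unfold N at 1. lra. }
  replace eps with (N * (eps / N)) at 2 by (field; lra).
  apply Rmult_le_compat_r; [|lra]. left. apply Rdiv_lt_0_compat; lra.
Qed.

(** * Integrals over the real line *)

Definition line_int (f : R -> C) (l : C) : Prop :=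
  forall eps, 0 < eps -> exists Y, 0 <= Y /\
    forall a b, a <= - Y -> Y <= b -> Cmod (CRInt f a b - l) <= eps.

Definition integrable_dom (g : R -> R) : Prop :=
  (forall t, 0 <= g t) /\ (forall t, continuous g t) /\
  forall eps, 0 < eps -> exists Y, 0 <= Y /\
    forall a b, a <= b -> (Y <= a \/ b <= - Y) -> RInt g a b <= eps.

Lemma CRInt_Chasles (f : R -> C) (a b c : R) : (forall x, ccont f x) ->
  CRInt f a c = (CRInt f a b + CRInt f b c)%C.
Proof.
  intros H. apply CRInt_unique. apply is_CRInt_Chasles with b; apply CRInt_correct; auto.
Qed.

Lemma RInt_dom_correct (g : R -> R) (a b : R) : (forall t, continuous g t) -> is_RInt g a b (RInt g a b).
Proof.
  intros H. apply (@RInt_correct R_CompleteNormedModule).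
  apply (@ex_RInt_continuous R_CompleteNormedModule). auto.
Qed.

Lemma integrable_dom_scal (K : R) (g : R -> R) : 0 <= K -> integrable_dom g ->
  integrable_dom (fun t => K * g t).
Proof.
  intros HK [H1 [H2 H3]]. split; [|split].
  - intros t. apply Rmult_le_pos; auto.
  - intros t. apply (continuous_scal_r (V := R_NormedModule) K g). apply H2.
  - intros eps He. destruct (H3 (eps / (K + 1)) ltac:(apply Rdiv_lt_0_compat; lra)) as [Y [HY Ht]].
    exists Y. split; [exact HY|]. intros a b Hab Hc.
    assert (E : RInt (fun t => K * g t) a b = K * RInt g a b).
    { apply (@is_RInt_unique R_CompleteNormedModule). apply (is_RInt_scal (V := R_NormedModule)).
      now apply RInt_dom_correct. }
    rewrite E. specialize (Ht a b Hab Hc).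
    apply Rle_trans with (K * (eps / (K + 1))); [apply Rmult_le_compat_l; lra|].
    replace (K * (eps / (K + 1))) with (eps * (K / (K + 1))) by (field; lra).
    assert (K / (K + 1) <= 1) by (apply Rle_div_l; lra). nra.
Qed.

Lemma integrable_dom_bound (g : R -> R) : integrable_dom g ->
  exists B, 0 <= B /\ forall a b, a <= b -> RInt g a b <= B.
Proof.
  intros [H1 [H2 H3]]. destruct (H3 1 ltac:(lra)) as [Y [HY Ht]].
  assert (Pos : forall a b, a <= b -> 0 <= RInt g a b).
  { intros a b Hab. apply (RInt_ge_0 g a b Hab); [|intros; apply H1].
    eexists. now apply RInt_dom_correct. }
  assert (Ch : forall a b c, RInt g a c = RInt g a b + RInt g b c).
  { intros a b c. symmetry. apply (RInt_Chasles (V := R_CompleteNormedModule) g a b c);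
      eexists; now apply RInt_dom_correct. }
  exists (RInt g (- Y) Y + 2). split; [assert (X := Pos (- Y) Y ltac:(lra)); lra|].
  intros a b Hab.
  set (a' := Rmin a (- Y)). set (b' := Rmax b Y).
  assert (A1 : a' <= a) by apply Rmin_l. assert (A2 : a' <= - Y) by apply Rmin_r.
  assert (B1 : b <= b') by apply Rmax_l. assert (B2 : Y <= b') by apply Rmax_r.
  assert (E1 := Ch a' a b'). assert (E2 := Ch a b b').
  assert (E3 := Ch a' (- Y) b'). assert (E4 := Ch (- Y) Y b').
  assert (P1 := Pos a' a A1). assert (P2 := Pos b b' B1).
  assert (Q1 := Ht a' (- Y) A2 ltac:(right; lra)). assert (Q2 := Ht Y b' B2 ltac:(left; lra)).
  lra.
Qed.

Lemma CRInt_dom_le (f : R -> C) (g : R -> R) (a b : R) : a <= b -> (forall x, ccont f x) ->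
  (forall t, continuous g t) -> (forall t, Cmod (f t) <= g t) -> Cmod (CRInt f a b) <= RInt g a b.
Proof.
  intros Hab Hf Hg H.
  apply (is_CRInt_norm_le f g a b _ _ Hab); [auto| |].
  - apply CRInt_correct; auto.
  - now apply RInt_dom_correct.
Qed.

Lemma line_int_tail (f : R -> C) (g : R -> R) : (forall x, ccont f x) -> integrable_dom g ->
  (forall t, Cmod (f t) <= g t) ->
  forall eps, 0 < eps -> exists Y, 0 <= Y /\ forall N a b, Y <= N -> a <= - N -> N <= b ->
    Cmod (CRInt f a b - CRInt f (- N) N) <= eps.
Proof.
  intros Hf [H1 [H2 H3]] H eps He. destruct (H3 (eps / 2) ltac:(lra)) as [Y [HY Ht]].
  exists Y. split; [exact HY|]. intros N a b HN Ha Hb.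
  rewrite (CRInt_Chasles f a (- N) b Hf), (CRInt_Chasles f (- N) N b Hf).
  replace (CRInt f a (- N) + (CRInt f (- N) N + CRInt f N b) - CRInt f (- N) N)%C
    with (CRInt f a (- N) + CRInt f N b)%C by ring.
  eapply Rle_trans; [apply Cmod_triangle|].
  assert (A := CRInt_dom_le f g a (- N) Ha Hf H2 H). assert (B := CRInt_dom_le f g N b Hb Hf H2 H).
  assert (C1 := Ht a (- N) Ha ltac:(right; lra)). assert (C2 := Ht N b Hb ltac:(left; lra)). lra.
Qed.

Lemma Cauchy_Clim (u : nat -> C) :
  (forall eps, 0 < eps -> exists N, forall n m, (N <= n)%nat -> (N <= m)%nat -> Cmod (u n - u m) <= eps) ->
  exists l, Clim u l.
Proof.
  intros H.
  assert (A1 : ex_finite_lim_seq (fun n => fst (u n))).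
  { apply ex_lim_seq_cauchy_corr. intros eps. destruct (H (eps / 2)) as [N HN].
    { assert (X := cond_pos eps). lra. }
    exists N. intros n m Hn Hm. specialize (HN n m Hn Hm).
    assert (X := re_le_Cmod (u n - u m)). unfold Re in X. simpl in X.
    assert (Y := cond_pos eps). unfold Rminus. lra. }
  assert (A2 : ex_finite_lim_seq (fun n => snd (u n))).
  { apply ex_lim_seq_cauchy_corr. intros eps. destruct (H (eps / 2)) as [N HN].
    { assert (X := cond_pos eps). lra. }
    exists N. intros n m Hn Hm. specialize (HN n m Hn Hm).
    assert (X := snd_le_Cmod (u n - u m)). simpl in X.
    assert (Y := cond_pos eps). unfold Rminus. lra. }
  destruct A1 as [l1 L1], A2 as [l2 L2]. exists (l1, l2). intros eps He.
  apply is_lim_seq_spec in L1. apply is_lim_seq_spec in L2.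
  destruct (L1 (mkposreal (eps / 2) ltac:(lra))) as [N1 H1].
  destruct (L2 (mkposreal (eps / 2) ltac:(lra))) as [N2 H2].
  exists (max N1 N2). intros n Hn. specialize (H1 n ltac:(lia)). specialize (H2 n ltac:(lia)).
  simpl in H1, H2. eapply Rle_lt_trans; [apply Cmod_le_parts|]. simpl. unfold Rminus in *. lra.
Qed.

Lemma line_int_exists (f : R -> C) (g : R -> R) : (forall x, ccont f x) -> integrable_dom g ->
  (forall t, Cmod (f t) <= g t) -> exists l, line_int f l.
Proof.
  intros Hf Hg H. assert (T := line_int_tail f g Hf Hg H).
  destruct (Cauchy_Clim (fun n => CRInt f (- INR n) (INR n))) as [l Hl].
  - intros eps He. destruct (T (eps / 2) ltac:(lra)) as [Y [HY HT]].
    destruct (INR_unbounded Y) as [N HN]. exists N. intros n m Hn Hm.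
    apply le_INR in Hn. apply le_INR in Hm.
    assert (A := HT (INR N) (- INR n) (INR n) ltac:(lra) ltac:(lra) ltac:(lra)).
    assert (B := HT (INR N) (- INR m) (INR m) ltac:(lra) ltac:(lra) ltac:(lra)).
    rewrite Cmod_minus_sym in B.
    assert (X := Cmod_minus_triangle (CRInt f (- INR n) (INR n)) (CRInt f (- INR N) (INR N)) (CRInt f (- INR m) (INR m))).
    lra.
  - exists l. intros eps He. destruct (T (eps / 2) ltac:(lra)) as [Y [HY HT]].
    destruct (Hl (eps / 2) ltac:(lra)) as [N1 H1].
    destruct (INR_unbounded Y) as [N2 HN]. set (N := max N1 N2).
    assert (HN2 : INR N2 <= INR N) by (apply le_INR; unfold N; lia).
    specialize (H1 N ltac:(unfold N; lia)).
    exists (INR N). split; [apply pos_INR|]. intros a b Ha Hb.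
    assert (A := HT (INR N) a b ltac:(lra) ltac:(lra) ltac:(lra)).
    assert (X := Cmod_minus_triangle (CRInt f a b) (CRInt f (- INR N) (INR N)) l). lra.
Qed.

Lemma line_int_le (f : R -> C) (l c : C) (M : R) : line_int f l ->
  (exists Y, forall N, Y <= N -> Cmod (CRInt f (- N) N - c) <= M) -> Cmod (l - c) <= M.
Proof.
  intros H [Y HY]. apply le_epsilon. intros eps He.
  destruct (H eps He) as [Y' [HY' Ht]].
  assert (M1 := Rmax_l Y Y'). assert (M2 := Rmax_r Y Y').
  specialize (HY (Rmax Y Y') M1). specialize (Ht (- Rmax Y Y') (Rmax Y Y') ltac:(lra) M2).
  rewrite Cmod_minus_sym in Ht.
  assert (T := Cmod_minus_triangle l (CRInt f (- Rmax Y Y') (Rmax Y Y')) c). lra.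
Qed.

Lemma line_int_ext (f g : R -> C) (l : C) : (forall t, f t = g t) -> line_int f l -> line_int g l.
Proof.
  intros E H eps He. destruct (H eps He) as [Y [HY Ht]]. exists Y. split; [auto|].
  intros a b Ha Hb. replace (CRInt g a b) with (CRInt f a b); [auto|].
  apply (@RInt_ext C_R_CompleteNormedModule). intros x _. apply E.
Qed.

Lemma line_int_plus (f g : R -> C) (l m : C) : (forall x, ccont f x) -> (forall x, ccont g x) ->
  line_int f l -> line_int g m -> line_int (fun t => f t + g t)%C (l + m)%C.
Proof.
  intros Cf Cg Hf Hg eps He.
  destruct (Hf (eps / 2) ltac:(lra)) as [Y1 [P1 H1]]. destruct (Hg (eps / 2) ltac:(lra)) as [Y2 [P2 H2]].
  assert (M1 := Rmax_l Y1 Y2). assert (M2 := Rmax_r Y1 Y2).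
  exists (Rmax Y1 Y2). split; [lra|]. intros a b Ha Hb.
  specialize (H1 a b ltac:(lra) ltac:(lra)). specialize (H2 a b ltac:(lra) ltac:(lra)).
  rewrite (CRInt_unique (fun t => f t + g t)%C a b (CRInt f a b + CRInt g a b)%C)
    by (apply is_CRInt_plus; apply CRInt_correct; auto).
  replace (CRInt f a b + CRInt g a b - (l + m))%C with ((CRInt f a b - l) + (CRInt g a b - m))%C by ring.
  eapply Rle_trans; [apply Cmod_triangle|]. lra.
Qed.

Lemma line_int_scal (c : C) (f : R -> C) (l : C) : (forall x, ccont f x) ->
  line_int f l -> line_int (fun t => c * f t)%C (c * l)%C.
Proof.
  intros Cf Hf eps He. assert (Hc := Cmod_ge_0 c).
  destruct (Hf (eps / (Cmod c + 1)) ltac:(apply Rdiv_lt_0_compat; lra)) as [Y [P H]].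
  exists Y. split; [exact P|]. intros a b Ha Hb. specialize (H a b Ha Hb).
  rewrite (CRInt_unique (fun t => c * f t)%C a b (c * CRInt f a b)%C)
    by (apply is_CRInt_scal; apply CRInt_correct; auto).
  replace (c * CRInt f a b - c * l)%C with (c * (CRInt f a b - l))%C by ring. rewrite Cmod_mult.
  apply Rle_trans with (Cmod c * (eps / (Cmod c + 1))); [apply Rmult_le_compat_l; lra|].
  replace (Cmod c * (eps / (Cmod c + 1))) with (eps * (Cmod c / (Cmod c + 1))) by (field; lra).
  assert (Cmod c / (Cmod c + 1) <= 1) by (apply Rle_div_l; lra). nra.
Qed.

Lemma line_int_bound (g : R -> R) : integrable_dom g -> exists B, 0 <= B /\
  forall K f l, 0 <= K -> (forall x, ccont f x) -> (forall t, Cmod (f t) <= K * g t) ->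
    line_int f l -> Cmod l <= K * B.
Proof.
  intros Hg. destruct (integrable_dom_bound g Hg) as [B [HB Hb]]. exists B. split; [exact HB|].
  intros K f l HK Cf H Hl. destruct Hg as [H1 [H2 H3]].
  replace l with (l - 0)%C by ring. apply (line_int_le f l 0 (K * B) Hl).
  exists 0. intros N HN. replace (CRInt f (- N) N - 0)%C with (CRInt f (- N) N) by ring.
  apply Rle_trans with (K * RInt g (- N) N); [|apply Rmult_le_compat_l; auto; apply Hb; lra].
  apply (is_CRInt_norm_le f (fun t => K * g t) (- N) N _ _ ltac:(lra)); [auto| |].
  - apply CRInt_correct; auto.
  - apply (is_RInt_scal (V := R_NormedModule)). now apply RInt_dom_correct.
Qed.

Lemma sum_n_C_Sn (F : nat -> C) (n : nat) :
  @sum_n C_AbelianMonoid F (S n) = (@sum_n C_AbelianMonoid F n + F (S n))%C.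
Proof. exact (sum_Sn F n). Qed.

Lemma sum_n_C_O (F : nat -> C) : @sum_n C_AbelianMonoid F O = F O.
Proof. exact (sum_O F). Qed.

Lemma line_int_sum (f : nat -> R -> C) (l : nat -> C) (n : nat) :
  (forall k x, ccont (f k) x) -> (forall k, line_int (f k) (l k)) ->
  (forall x, ccont (fun t => @sum_n C_AbelianMonoid (fun k => f k t) n) x) /\
  line_int (fun t => @sum_n C_AbelianMonoid (fun k => f k t) n) (@sum_n C_AbelianMonoid l n).
Proof.
  intros Cf Hf. induction n as [|n [IH1 IH2]].
  - split.
    + intros x. apply (ccont_ext (f O)); [|apply Cf]. intros y. symmetry. apply sum_n_C_O.
    + rewrite sum_n_C_O. apply (line_int_ext (f O)); [|apply Hf]. intros y. symmetry.
      exact (sum_n_C_O (fun k => f k y)).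
  - split.
    + intros x. apply (ccont_ext (fun t => @sum_n C_AbelianMonoid (fun k => f k t) n + f (S n) t)%C).
      * intros y. symmetry. exact (sum_n_C_Sn (fun k => f k y) n).
      * apply ccont_plus; auto.
    + rewrite sum_n_C_Sn.
      apply (line_int_ext (fun t => @sum_n C_AbelianMonoid (fun k => f k t) n + f (S n) t)%C).
      * intros y. symmetry. exact (sum_n_C_Sn (fun k => f k y) n).
      * apply line_int_plus; auto.
Qed.

Lemma is_series_remainder (a : nat -> R) (A : R) : (forall k, 0 <= a k) -> is_series a A ->
  forall eps, 0 < eps -> exists N, forall n, (N <= n)%nat -> 0 <= A - sum_n a n <= eps.
Proof.
  intros Ha HA eps He. assert (L : is_lim_seq (sum_n a) A) by exact HA.
  apply is_lim_seq_spec in L. destruct (L (mkposreal eps He)) as [N HN].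
  exists N. intros n Hn. specialize (HN n Hn). simpl in HN. apply Rabs_def2 in HN.
  assert (X := sum_n_le_series a A n Ha HA). lra.
Qed.

Lemma Cmod_series_remainder (f : nat -> C) (a : nat -> R) (s : C) (A : R) (n : nat) :
  (forall k, Cmod (f k) <= a k) -> is_Cseries f s -> is_series a A ->
  Cmod (s - @sum_n C_AbelianMonoid f n) <= A - sum_n a n.
Proof.
  intros H Hs HA.
  assert (Hf : is_Cseries (fun k => f (S n + k)%nat) (s - @sum_n C_AbelianMonoid f n)%C).
  { apply (@is_series_incr_n C_AbsRing C_NormedModule f (S n)); [lia|]. simpl pred.
    change (is_Cseries f (s - @sum_n C_AbelianMonoid f n + @sum_n C_AbelianMonoid f n)%C).
    replace (s - @sum_n C_AbelianMonoid f n + @sum_n C_AbelianMonoid f n)%C with s by ring. exact Hs. }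
  assert (Ha : is_series (fun k => a (S n + k)%nat) (A - sum_n a n)).
  { apply (@is_series_incr_n R_AbsRing R_NormedModule a (S n)); [lia|]. simpl pred.
    change (is_series a (A - sum_n a n + sum_n a n)).
    replace (A - sum_n a n + sum_n a n) with A by ring. exact HA. }
  refine (Cmod_series_le _ _ _ _ _ Hf Ha). intros k. apply H.
Qed.

Lemma sum_n_Rscal (c : R) (a : nat -> R) (n : nat) : sum_n (fun k => c * a k) n = c * sum_n a n.
Proof.
  induction n as [|n IH]; [now rewrite !sum_O|].
  rewrite !sum_Sn, IH. unfold plus; simpl. ring.
Qed.

Lemma line_int_series (g : R -> R) (f : nat -> R -> C) (F : R -> C) (a : nat -> R) (l : nat -> C) (I : C) :
  integrable_dom g -> (forall k x, ccont (f k) x) -> (forall x, ccont F x) ->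
  (forall k t, Cmod (f k t) <= a k * g t) -> (forall k, 0 <= a k) -> ex_series a ->
  (forall t, is_Cseries (fun k => f k t) (F t)) -> (forall k, line_int (f k) (l k)) ->
  line_int F I -> is_Cseries l I.
Proof.
  intros Hg Cf CF Hb Ha [A HA] Hs Hl HI.
  destruct (line_int_bound g Hg) as [B [HB HBnd]].
  apply is_series_Clim. intros eps He.
  destruct (is_series_remainder a A Ha HA (eps / (2 * (B + 1))) ltac:(apply Rdiv_lt_0_compat; lra)) as [N HN].
  exists N. intros n Hn. specialize (HN n Hn).
  destruct (line_int_sum f l n Cf Hl) as [S1 S2].
  assert (D : line_int (fun t => @sum_n C_AbelianMonoid (fun k => f k t) n + (- (1)) * F t)%C
                       (@sum_n C_AbelianMonoid l n + (- (1)) * I)%C).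
  { apply line_int_plus; auto; [intros; now apply ccont_scal|now apply line_int_scal]. }
  replace (@sum_n C_AbelianMonoid l n - I)%C with (@sum_n C_AbelianMonoid l n + (- (1)) * I)%C by ring.
  apply Rle_lt_trans with (eps / (2 * (B + 1)) * B).
  - apply (HBnd (eps / (2 * (B + 1))) _ _ ltac:(left; apply Rdiv_lt_0_compat; lra)) with (3 := D).
    + intros x. apply ccont_plus; auto. now apply ccont_scal.
    + intros t. destruct Hg as [G1 _].
      replace (@sum_n C_AbelianMonoid (fun k => f k t) n + - (1) * F t)%C
        with (- (F t - @sum_n C_AbelianMonoid (fun k => f k t) n))%C by ring.
      rewrite Cmod_opp.
      eapply Rle_trans.
      * apply (Cmod_series_remainder (fun k => f k t) (fun k => g t * a k) (F t) (g t * A) n).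
        -- intros k. rewrite Rmult_comm. apply Hb.
        -- apply Hs.
        -- apply (is_series_scal_l (V := R_NormedModule) (g t)). exact HA.
      * rewrite (sum_n_Rscal (g t) a n).
        change (g t * A - g t * sum_n a n <= eps / (2 * (B + 1)) * g t).
        rewrite <- Rmult_minus_distr_l, Rmult_comm. apply Rmult_le_compat_r; [apply G1|lra].
  - replace (eps / (2 * (B + 1)) * B) with (eps / 2 * (B / (B + 1))) by (field; lra).
    assert (B / (B + 1) <= 1) by (apply Rle_div_l; lra). nra.
Qed.

Lemma line_int_RInt_gen (f : R -> C) (l : C) : (forall x, ccont f x) -> line_int f l ->
  @is_RInt_gen C_R_NormedModule f (Rbar_locally m_infty) (Rbar_locally p_infty) l.
Proof.
  intros Cf H. intros P [eps HP].
  destruct (H (eps / 2)) as [Y [HY Ht]]. { assert (X := cond_pos eps). lra. }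
  apply (Filter_prod _ _ _ (fun a => a < - Y) (fun b => Y < b)).
  - now exists (- Y).
  - now exists Y.
  - intros a b Ha Hb. exists (CRInt f a b). split; [apply CRInt_correct; auto|].
    apply HP. specialize (Ht a b ltac:(lra) ltac:(lra)). assert (X := cond_pos eps).
    split.
    + eapply Rle_lt_trans; [apply (re_le_Cmod (CRInt f a b - l))|]. lra.
    + eapply Rle_lt_trans; [apply (snd_le_Cmod (CRInt f a b - l))|]. lra.
Qed.

Lemma CRInt_gen_line_int (f : R -> C) (l : C) : (forall x, ccont f x) -> line_int f l ->
  CRInt_gen f (Rbar_locally m_infty) (Rbar_locally p_infty) = l.
Proof.
  intros Cf H. apply (@is_RInt_gen_unique C_R_CompleteNormedModule _ _
    (Proper_StrongProper _ (Rbar_locally_filter m_infty))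
    (Proper_StrongProper _ (Rbar_locally_filter p_infty))).
  now apply line_int_RInt_gen.
Qed.

(** * The weight [(1 + t^2)^(-b/2)] *)

Definition pow_weight (b t : R) : R := Rpower (1 + t ^ 2) (- b / 2).

Lemma pow_weight_pos (b t : R) : 0 < pow_weight b t.
Proof. apply exp_pos. Qed.

Lemma Rpower_continuous (b x : R) : 0 < x -> continuous (fun t => Rpower t b) x.
Proof.
  intros Hx. apply (ex_derive_continuous (fun t => Rpower t b)). eexists.
  apply is_derive_Reals. now apply derivable_pt_lim_power.
Qed.

Lemma pow_weight_continuous (b t : R) : continuous (pow_weight b) t.
Proof.
  unfold pow_weight. apply (continuous_comp (fun t => 1 + t ^ 2) (fun x => Rpower x (- b / 2))).
  - apply (ex_derive_continuous (fun t => 1 + t ^ 2)). auto_derive. auto.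
  - apply Rpower_continuous. assert (X := pow2_ge_0 t). lra.
Qed.

Lemma pow_weight_le (b t : R) : 0 <= b -> 0 < t -> pow_weight b t <= Rpower t (- b).
Proof.
  intros Hb Ht. unfold pow_weight.
  replace (Rpower t (- b)) with (Rpower (t ^ 2) (- b / 2)).
  2:{ rewrite <- (Rpower_pow 2 t Ht), Rpower_mult. f_equal. simpl. field. }
  unfold Rpower. apply exp_le_mono.
  assert (ln (t ^ 2) <= ln (1 + t ^ 2)). { left. apply ln_increasing; nra. }
  nra.
Qed.

Lemma RInt_Rpower (b x y : R) : 1 < b -> 0 < x <= y ->
  is_RInt (fun t => Rpower t (- b)) x y ((Rpower x (1 - b) - Rpower y (1 - b)) / (b - 1)).
Proof.
  intros Hb Hxy.
  replace ((Rpower x (1 - b) - Rpower y (1 - b)) / (b - 1))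
    with (minus (/ (1 - b) * Rpower y (1 - b)) (/ (1 - b) * Rpower x (1 - b))).
  2:{ unfold minus, plus, opp; simpl. field. lra. }
  apply (is_RInt_derive (V := R_CompleteNormedModule) (fun t => / (1 - b) * Rpower t (1 - b))).
  - intros t Ht. rewrite Rmin_left in Ht by lra.
    replace (Rpower t (- b)) with (/ (1 - b) * ((1 - b) * Rpower t (1 - b - 1))).
    + apply is_derive_scal. apply is_derive_Reals. apply derivable_pt_lim_power. lra.
    + replace (1 - b - 1) with (- b) by ring. field. lra.
  - intros t Ht. rewrite Rmin_left in Ht by lra. apply Rpower_continuous. lra.
Qed.

Lemma Rpower_neg_small (b eps : R) : 0 < b -> 0 < eps -> exists Y, 1 <= Y /\
  forall x, Y <= x -> Rpower x (- b) <= eps.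
Proof.
  intros Hb He. exists (Rmax 1 (Rpower eps (- / b))).
  split; [apply Rmax_l|]. intros x Hx.
  assert (X1 := Rmax_l 1 (Rpower eps (- / b))). assert (X2 := Rmax_r 1 (Rpower eps (- / b))).
  replace eps with (Rpower (Rpower eps (- / b)) (- b)) at 1.
  2:{ rewrite Rpower_mult. replace (- / b * - b) with 1 by (field; lra). now apply Rpower_1. }
  rewrite (Rpower_Ropp x b), (Rpower_Ropp (Rpower eps (- / b)) b). apply Rinv_le_contravar; [apply exp_pos|].
  apply Rle_Rpower_l; [lra|]. split; [apply exp_pos|lra].
Qed.

Lemma pow_weight_integrable (b : R) : 1 < b -> integrable_dom (pow_weight b).
Proof.
  intros Hb. split; [intros; left; apply pow_weight_pos|]. split; [apply pow_weight_continuous|].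
  intros eps He.
  destruct (Rpower_neg_small (b - 1) (eps * (b - 1)) ltac:(lra) ltac:(nra)) as [Y [HY Hs]].
  assert (Right : forall x y, Y <= x -> x <= y -> RInt (pow_weight b) x y <= eps).
  { intros x y Hx Hxy.
    apply Rle_trans with ((Rpower x (1 - b) - Rpower y (1 - b)) / (b - 1)).
    - rewrite <- (is_RInt_unique _ _ _ _ (RInt_Rpower b x y Hb ltac:(lra))).
      apply RInt_le; [exact Hxy| | |].
      + eexists. apply RInt_dom_correct, pow_weight_continuous.
      + eexists. apply RInt_Rpower; lra.
      + intros t Ht. apply pow_weight_le; lra.
    - apply Rle_div_l; [lra|]. specialize (Hs x Hx). replace (- (b - 1)) with (1 - b) in Hs by ring.
      assert (0 < Rpower y (1 - b)) by apply exp_pos. lra. }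
  exists Y. split; [lra|]. intros x y Hxy [Hx|Hy]; [now apply Right|].
  replace (RInt (pow_weight b) x y) with (RInt (pow_weight b) (- y) (- x)); [apply Right; lra|].
  symmetry. apply (@is_RInt_unique R_CompleteNormedModule).
  assert (I := RInt_dom_correct (pow_weight b) (- x) (- y) (pow_weight_continuous b)).
  apply (is_RInt_comp_opp (V := R_NormedModule)) in I.
  apply (is_RInt_opp (V := R_NormedModule)) in I.
  replace (RInt (pow_weight b) (- y) (- x)) with (opp (RInt (pow_weight b) (- x) (- y))).
  - revert I. apply is_RInt_ext. intros t _. rewrite opp_opp. unfold pow_weight. f_equal. f_equal. ring.
  - apply (opp_RInt_swap (V := R_CompleteNormedModule)). eexists. apply RInt_dom_correct, pow_weight_continuous.
Qed.

Lemma exp_ge_sqr (u : R) : 0 <= u -> (1 + u / 2) ^ 2 <= exp u.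
Proof.
  intros Hu. replace (exp u) with (exp (u / 2) ^ 2).
  - apply pow_incr. assert (X := exp_ge_1_plus (u / 2)). lra.
  - simpl. rewrite Rmult_1_r, <- exp_plus. f_equal. field.
Qed.

(* Dominates Euler's integrand in the variable [u = ln t]. *)
Lemma exp_exp_bound (sigma k u : R) : 1 < sigma -> 0 < k ->
  exp (sigma * u - k * exp u) <= 4 * exp ((sigma + 1) ^ 2 / k) * pow_weight 2 u.
Proof.
  intros Hs Hk.
  assert (P : 0 < (sigma + 1) ^ 2 / k) by (apply Rdiv_lt_0_compat; nra).
  assert (A : sigma * u - k * exp u <= (sigma + 1) ^ 2 / k + - Rabs u).
  { destruct (Rle_dec 0 u) as [Hu|Hu].
    - rewrite Rabs_pos_eq by lra. assert (E := exp_ge_sqr u Hu).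
      assert (k * (1 + u / 2) ^ 2 <= k * exp u) by (apply Rmult_le_compat_l; lra).
      assert (Q : (sigma + 1) * u - k * (u ^ 2 / 4) <= (sigma + 1) ^ 2 / k).
      { apply Rle_div_r; [lra|].
        assert (0 <= (sigma + 1 - k * u / 2) ^ 2) by apply pow2_ge_0. nra. }
      nra.
    - rewrite Rabs_left1 by lra. assert (X := exp_pos u). nra. }
  eapply Rle_trans; [apply exp_le_mono, A|]. rewrite exp_plus.
  assert (W : exp (- Rabs u) <= 4 * pow_weight 2 u).
  { unfold pow_weight. replace (- (2) / 2) with (- (1)) by field.
    rewrite Rpower_Ropp, Rpower_1 by (assert (X := pow2_ge_0 u); lra).
    assert (E := exp_ge_sqr (Rabs u) (Rabs_pos u)). assert (X := pow2_ge_0 u).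
    rewrite exp_Ropp.
    replace (4 * / (1 + u ^ 2)) with (/ ((1 + u ^ 2) / 4)) by (field; lra).
    apply Rinv_le_contravar; [lra|].
    rewrite <- (pow2_abs u). assert (Y := Rabs_pos u). nra. }
  assert (X := exp_pos ((sigma + 1) ^ 2 / k)). nra.
Qed.

Definition euler_fun (s w : C) : C := (Cexp (s * w) * Cexp (- Cexp w))%C.

Lemma C11_linear (s : C) : C11 (fun w => s * w)%C (fun _ => s * 1)%C.
Proof. apply C11_scal, C11_id. Qed.

Lemma C11_euler_fun (s : C) : exists g', C11 (euler_fun s) g'.
Proof.
  assert (A := C11_comp _ _ _ _ C11_Cexp (C11_linear s)).
  assert (B := C11_comp _ _ _ _ C11_Cexp (C11_scal (- (1))%C _ _ C11_Cexp)).
  eexists. eapply C11_ext; [| |exact (C11_mult _ _ _ _ A B)].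
  - intros z. unfold euler_fun. f_equal. f_equal. ring.
  - intros z. reflexivity.
Qed.

Lemma Cmod_euler_fun (s : C) (u v : R) :
  Cmod (euler_fun s (u, v)) = exp (Re s * u - cos v * exp u) * exp (- Im s * v).
Proof.
  unfold euler_fun. rewrite Cmod_mult, !Cmod_Cexp, <- !exp_plus. f_equal.
  destruct s as [a b]. unfold Re, Im; simpl. ring.
Qed.

Lemma exp_le_abs (a b m : R) : Rabs b <= m -> exp (a * b) <= exp (Rabs a * m).
Proof.
  intros H. apply exp_le_mono. eapply Rle_trans; [apply Rle_abs|]. rewrite Rabs_mult.
  apply Rmult_le_compat_l; [apply Rabs_pos|exact H].
Qed.

Lemma euler_fun_bound (s : C) (phi : R) : 1 < Re s -> Rabs phi < PI / 2 ->
  exists K, 0 <= K /\ forall u v, Rabs v <= Rabs phi -> Cmod (euler_fun s (u, v)) <= K * pow_weight 2 u.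
Proof.
  intros Hs Hphi. assert (Hk : 0 < cos phi) by (apply Rabs_def2 in Hphi; apply cos_gt_0; lra).
  exists (4 * exp ((Re s + 1) ^ 2 / cos phi) * exp (Rabs (- Im s) * Rabs phi)).
  assert (P1 := exp_pos ((Re s + 1) ^ 2 / cos phi)). assert (P2 := exp_pos (Rabs (- Im s) * Rabs phi)).
  split; [nra|]. intros u v Hv. rewrite Cmod_euler_fun.
  assert (Hc : cos phi <= cos v).
  { assert (E : forall t, cos t = cos (Rabs t)).
    { intros t. unfold Rabs. destruct (Rcase_abs t); [now rewrite cos_neg|reflexivity]. }
    rewrite (E phi), (E v). assert (X := Rabs_pos v). assert (Y := PI_RGT_0).
    apply cos_decr_1; lra. }
  assert (A : exp (Re s * u - cos v * exp u) <= 4 * exp ((Re s + 1) ^ 2 / cos phi) * pow_weight 2 u).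
  { eapply Rle_trans; [|apply (exp_exp_bound (Re s) (cos phi) u Hs Hk)].
    apply exp_le_mono. assert (X := exp_pos u). nra. }
  assert (B := exp_le_abs (- Im s) v (Rabs phi) Hv).
  assert (W := pow_weight_pos 2 u).
  replace (4 * exp ((Re s + 1) ^ 2 / cos phi) * exp (Rabs (- Im s) * Rabs phi) * pow_weight 2 u)
    with (4 * exp ((Re s + 1) ^ 2 / cos phi) * pow_weight 2 u * exp (Rabs (- Im s) * Rabs phi)) by ring.
  apply Rmult_le_compat; auto; left; apply exp_pos.
Qed.

Lemma ccont_euler_fun (s : C) (gam : R -> C) (t : R) : ccont gam t -> ccont (fun u => euler_fun s (gam u)) t.
Proof. destruct (C11_euler_fun s) as [g' Hg]. apply (ccont_C11 _ _ _ _ Hg). Qed.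

Lemma pow_weight_2_small (eps : R) : 0 < eps -> exists Y, 1 <= Y /\ forall x, Y <= Rabs x -> pow_weight 2 x <= eps.
Proof.
  intros He. destruct (Rpower_neg_small 2 eps ltac:(lra) He) as [Y [HY H]].
  exists Y. split; [exact HY|]. intros x Hx.
  eapply Rle_trans; [|apply (H _ Hx)].
  replace (pow_weight 2 x) with (pow_weight 2 (Rabs x)).
  - apply pow_weight_le; lra.
  - unfold pow_weight. now rewrite pow2_abs.
Qed.

Lemma euler_line_shift (s : C) (phi : R) (l : C) : 1 < Re s -> Rabs phi < PI / 2 ->
  line_int (fun t => euler_fun s (t, 0)) l -> line_int (fun t => euler_fun s (t, phi)) l.
Proof.
  intros Hs Hphi Hl eps He.
  destruct (euler_fun_bound s phi Hs Hphi) as [K [HK Hb]].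
  destruct (C11_euler_fun s) as [g' Hg].
  assert (Pphi := Rabs_pos phi).
  destruct (pow_weight_2_small (eps / 4 / (K * Rabs phi + 1))) as [Y1 [HY1 HW]].
  { apply Rdiv_lt_0_compat; nra. }
  destruct (Hl (eps / 4) ltac:(lra)) as [Y2 [HY2 HL]].
  assert (M1 := Rmax_l Y1 Y2). assert (M2 := Rmax_r Y1 Y2).
  exists (Rmax Y1 Y2). split; [lra|]. intros a b Ha Hb'.
  specialize (HL a b ltac:(lra) ltac:(lra)).
  assert (R0 := rect_int_C11 _ _ a b 0 phi Hg ltac:(lra)). unfold rect_int in R0.
  assert (Side : forall u, Y1 <= Rabs u -> Cmod (CRInt (fun y => euler_fun s (u, y)) 0 phi) <= eps / 4).
  { intros u Hu. specialize (HW u Hu).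
    assert (Bd : forall v, Rabs v <= Rabs phi -> Cmod (euler_fun s (u, v)) <= K * (eps / 4 / (K * Rabs phi + 1))).
    { intros v Hv. eapply Rle_trans; [apply Hb, Hv|]. apply Rmult_le_compat_l; lra. }
    assert (Cor : forall p q, is_CRInt (fun y => euler_fun s (u, y)) p q (CRInt (fun y => euler_fun s (u, y)) p q)).
    { intros p q. apply CRInt_correct. intros v _. apply (ccont_euler_fun s (fun v => (u, v))), ccont_pair_2. }
    assert (Fin : Rabs phi * (K * (eps / 4 / (K * Rabs phi + 1))) <= eps / 4).
    { replace (Rabs phi * (K * (eps / 4 / (K * Rabs phi + 1))))
        with (eps / 4 * (K * Rabs phi / (K * Rabs phi + 1))) by (field; nra).
      assert (K * Rabs phi / (K * Rabs phi + 1) <= 1) by (apply Rle_div_l; nra). nra. }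
    destruct (Rle_dec 0 phi) as [Hp|Hp].
    - rewrite (Rabs_pos_eq phi) in * by lra. eapply Rle_trans; [|exact Fin].
      rewrite <- (Rminus_0_r phi) at 2.
      apply (is_CRInt_norm_le_const (fun y => euler_fun s (u, y)) 0 phi _ _ Hp); [|apply Cor].
      intros v Hv. apply Bd. rewrite Rabs_pos_eq; lra.
    - rewrite (Rabs_left1 phi) in * by lra. eapply Rle_trans; [|exact Fin].
      replace (- phi) with (0 - phi) at 1 by ring.
      rewrite <- Cmod_opp.
      apply (is_CRInt_norm_le_const (fun y => euler_fun s (u, y)) phi 0 _ _ ltac:(lra)).
      + intros v Hv. apply Bd. rewrite Rabs_left1; lra.
      + apply is_CRInt_swap, Cor. }
  assert (S1 := Side a ltac:(rewrite Rabs_left1; lra)). assert (S2 := Side b ltac:(rewrite Rabs_pos_eq; lra)).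
  set (I0 := CRInt (fun x => euler_fun s (x, 0)) a b) in *.
  set (I1 := CRInt (fun x => euler_fun s (x, phi)) a b) in *.
  set (Sb := CRInt (fun y => euler_fun s (b, y)) 0 phi) in *.
  set (Sa := CRInt (fun y => euler_fun s (a, y)) 0 phi) in *.
  replace (I1 - l)%C with ((I0 - l) + Ci * Sb + - (Ci * Sa) - (I0 + Ci * Sb - I1 - Ci * Sa))%C by ring.
  rewrite R0. replace (I0 - l + Ci * Sb + - (Ci * Sa) - 0)%C with (I0 - l + Ci * Sb + - (Ci * Sa))%C by ring.
  eapply Rle_trans; [apply Cmod_triangle|]. rewrite Cmod_opp.
  assert (T := Cmod_triangle (I0 - l) (Ci * Sb)).
  rewrite !Cmod_mult, Cmod_Ci in *. lra.
Qed.

Lemma line_int_translate (f : R -> C) (v : R) (l : C) : (forall x, ccont f x) ->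
  line_int f l -> line_int (fun t => f (t + v)) l.
Proof.
  intros Cf H eps He. destruct (H eps He) as [Y [HY Ht]]. exists (Y + Rabs v).
  assert (X := Rabs_pos v). split; [lra|]. intros a b Ha Hb.
  assert (A := Rle_abs v). assert (B := Rle_abs (- v)). rewrite Rabs_Ropp in B.
  rewrite (CRInt_unique _ a b (CRInt f (a + v) (b + v))).
  - apply Ht; lra.
  - apply is_CRInt_shift. apply CRInt_correct; auto.
Qed.

Lemma continuous_exp_at (x : R) : continuous exp x.
Proof. apply (ex_derive_continuous exp). auto_derive. auto. Qed.

Lemma continuous_ln_at (x : R) : 0 < x -> continuous ln x.
Proof. intros H. apply (ex_derive_continuous ln). auto_derive. auto. Qed.

Lemma line_int_euler_exists (s : C) : 1 < Re s -> exists l, line_int (fun t => euler_fun s (t, 0)) l.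
Proof.
  intros Hs. destruct (euler_fun_bound s 0 Hs) as [K [HK Hb]].
  { rewrite Rabs_R0. assert (X := PI_RGT_0). lra. }
  apply (line_int_exists _ (fun t => K * pow_weight 2 t)).
  - intros x. apply (ccont_euler_fun s (fun t => (t, 0))), ccont_pair_1.
  - apply integrable_dom_scal; [exact HK|]. apply pow_weight_integrable. lra.
  - intros t. apply Hb. lra.
Qed.

(* Substitution [t = exp u] in Euler's integral. *)
Lemma CGamma_line_int (s : C) : 1 < Re s -> line_int (fun t => euler_fun s (t, 0)) (CGamma s).
Proof.
  intros Hs. destruct (line_int_euler_exists s Hs) as [l Hl].
  replace (CGamma s) with l; [exact Hl|]. symmetry.
  unfold CGamma, CRInt_gen.
  refine (@is_RInt_gen_unique C_R_CompleteNormedModule _ _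
           (Proper_StrongProper _ (at_right_proper_filter 0)) (Proper_StrongProper _ (Rbar_locally_filter p_infty)) _ l _).
  set (F := fun t => (Cexp ((s - 1) * RtoC (ln t)) * RtoC (exp (- t)))%C).
  assert (CF : forall t, 0 < t -> ccont F t).
  { intros t Ht. apply ccont_mult.
    - apply ccont_Cexp, ccont_scal, ccont_RtoC. now apply continuous_ln_at.
    - apply ccont_RtoC. apply (ex_derive_continuous (fun t => exp (- t))). auto_derive. auto. }
  assert (Sub : forall a b, 0 < a -> 0 < b -> is_CRInt F a b (CRInt (fun t => euler_fun s (t, 0)) (ln a) (ln b))).
  { intros a b Ha Hb.
    assert (I : is_CRInt F a b (CRInt F a b)).
    { apply CRInt_correct. intros x Hx. apply CF. unfold Rmin in Hx. destruct (Rle_dec a b); lra. }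
    replace (CRInt (fun t => euler_fun s (t, 0)) (ln a) (ln b)) with (CRInt F a b); [exact I|].
    symmetry. apply CRInt_unique.
    assert (S := @is_RInt_comp C_R_CompleteNormedModule F exp exp (ln a) (ln b)).
    rewrite !exp_ln in S by auto.
    assert (S' : is_CRInt (fun y => @scal R_AbsRing C_R_NormedModule (exp y) (F (exp y))) (ln a) (ln b) (CRInt F a b)).
    { apply S.
      - intros x _. apply ccont_continuous, CF, exp_pos.
      - intros x _. split; [|apply continuous_exp_at].
        apply is_derive_exp. }
    revert S'. apply is_CRInt_ext. intros x _. unfold F, euler_fun. rewrite ln_exp.
    transitivity (RtoC (exp x) * (Cexp ((s - 1) * RtoC x) * RtoC (exp (- exp x))))%C.
    { destruct (Cexp ((s - 1) * RtoC x) * RtoC (exp (- exp x)))%C as [u w].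
      unfold scal; simpl. unfold prod_scal, scal; simpl. unfold mult; simpl.
      unfold Cmult, RtoC; simpl. f_equal; ring. }
    change (x, 0) with (RtoC x). rewrite (Cexp_RtoC x), <- RtoC_opp, Cexp_RtoC, Cmult_assoc.
    f_equal. rewrite <- Cexp_RtoC, <- Cexp_add. f_equal. ring. }
  intros P [eps HP].
  destruct (Hl (eps / 2)) as [Y [HY Ht]]. { assert (X := cond_pos eps). lra. }
  apply (Filter_prod _ _ _ (fun a => 0 < a /\ ln a <= - Y) (fun b => 0 < b /\ Y <= ln b)).
  - exists (mkposreal _ (exp_pos (- Y))). intros a Ha H0. split; [exact H0|].
    rewrite <- (ln_exp (- Y)). left. apply ln_increasing; [exact H0|].
    assert (Ha' : Rabs (a - 0) < exp (- Y)) by exact Ha. rewrite Rminus_0_r in Ha'.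
    apply Rabs_def2 in Ha'. lra.
  - exists (exp Y). intros b Hb. assert (X := exp_pos Y). split; [lra|].
    rewrite <- (ln_exp Y) at 1. left. apply ln_increasing; auto.
  - intros a b [Ha1 Ha2] [Hb1 Hb2]. eexists. split; [apply Sub; auto|].
    apply HP. specialize (Ht (ln a) (ln b) Ha2 Hb2). assert (X := cond_pos eps).
    split.
    + eapply Rle_lt_trans; [apply (re_le_Cmod (CRInt (fun t => euler_fun s (t, 0)) (ln a) (ln b) - l))|]. lra.
    + eapply Rle_lt_trans; [apply (snd_le_Cmod (CRInt (fun t => euler_fun s (t, 0)) (ln a) (ln b) - l))|]. lra.
Qed.

(** * The complex logarithm on the right half plane *)

Definition clog (z : C) : C := (ln (fst z ^ 2 + snd z ^ 2) / 2, atan (snd z / fst z)).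

Lemma Cexp_clog (z : C) : 0 < fst z -> Cexp (clog z) = z.
Proof.
  intros Hx. destruct z as [x y]. simpl in Hx. unfold clog, Cexp, Re, Im. cbn -[pow].
  assert (P : 0 < x ^ 2 + y ^ 2) by (assert (X := pow2_ge_0 y); nra).
  assert (E : exp (ln (x ^ 2 + y ^ 2) / 2) = x * sqrt (1 + (y / x) ^ 2)).
  { rewrite <- (sqrt_pow2 (exp (ln (x ^ 2 + y ^ 2) / 2))) by (left; apply exp_pos).
    replace (exp (ln (x ^ 2 + y ^ 2) / 2) ^ 2) with (x ^ 2 + y ^ 2).
    - rewrite <- (sqrt_pow2 x) at 2 by lra. rewrite <- sqrt_mult_alt by apply pow2_ge_0.
      f_equal. field. lra.
    - replace (exp (ln (x ^ 2 + y ^ 2) / 2) ^ 2)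
        with (exp (ln (x ^ 2 + y ^ 2) / 2) * exp (ln (x ^ 2 + y ^ 2) / 2)) by ring.
      rewrite <- exp_plus.
      replace (ln (x ^ 2 + y ^ 2) / 2 + ln (x ^ 2 + y ^ 2) / 2) with (ln (x ^ 2 + y ^ 2)) by field.
      symmetry. now apply exp_ln. }
  assert (S : 0 < sqrt (1 + (y / x) ^ 2)).
  { apply sqrt_lt_R0. assert (X := pow2_ge_0 (y / x)). lra. }
  rewrite E, cos_atan, sin_atan.
  replace (Rsqr (y / x)) with ((y / x) ^ 2) by (unfold Rsqr; ring).
  f_equal; field; repeat split; lra.
Qed.

Lemma snd_clog_bound (z : C) : Rabs (snd (clog z)) < PI / 2.
Proof. unfold clog; simpl. assert (X := atan_bound (snd z / fst z)). apply Rabs_def1; lra. Qed.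

Lemma ccont_clog_line (c : R) (y : R) : 0 < c -> ccont (fun y => clog (c, y)) y.
Proof.
  intros Hc. unfold clog. cbn [fst snd]. apply continuous_ccont; cbn [fst snd].
  - apply (ex_derive_continuous (fun t => ln (c ^ 2 + t ^ 2) / 2)). auto_derive.
    assert (X := pow2_ge_0 y). nra.
  - apply (continuous_comp (fun t => t / c) atan).
    + apply (ex_derive_continuous (fun t => t / c)). auto_derive. lra.
    + apply continuity_pt_filterlim. apply derivable_continuous_pt, derivable_pt_atan.
Qed.

(** * Inversion of the Laplace transform of a power *)

Definition laplace_fun (s : C) (z : C) (t : R) : C :=
  (Cexp (s * RtoC t) * Cexp (- (z * RtoC (exp t))))%C.

Lemma ccont_laplace_fun (s z : C) (t : R) : ccont (laplace_fun s z) t.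
Proof.
  apply ccont_mult; apply ccont_Cexp.
  - apply ccont_scal, ccont_id.
  - apply (ccont_ext (fun t => (- z) * RtoC (exp t))%C); [intros; ring|].
    apply ccont_scal, ccont_RtoC, continuous_exp_at.
Qed.

Lemma Cmod_laplace_fun (s z : C) (t : R) : Cmod (laplace_fun s z t) = exp (Re s * t - Re z * exp t).
Proof.
  unfold laplace_fun. rewrite Cmod_mult, !Cmod_Cexp, <- exp_plus. f_equal.
  destruct s as [a b], z as [x y]. unfold Re; simpl. ring.
Qed.

Lemma laplace_line_int (s z : C) : 1 < Re s -> 0 < fst z ->
  line_int (laplace_fun s z) (Cexp (- (s * clog z)) * CGamma s)%C.
Proof.
  intros Hs Hz.
  assert (H := euler_line_shift s (snd (clog z)) _ Hs (snd_clog_bound z) (CGamma_line_int s Hs)).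
  assert (Cc : forall x, ccont (fun t => euler_fun s (t, snd (clog z))) x).
  { intros x. apply (ccont_euler_fun s (fun t => (t, snd (clog z)))), ccont_pair_1. }
  apply (line_int_translate _ (fst (clog z)) _ Cc) in H.
  apply (line_int_scal (Cexp (- (s * clog z)))) in H.
  2:{ intros x. apply (ccont_euler_fun s (fun t => (t + fst (clog z), snd (clog z)))).
      apply continuous_ccont; simpl; [|apply continuous_const].
      apply (ex_derive_continuous (fun t => t + ln (fst z * (fst z * 1) + snd z * (snd z * 1)) / 2)). auto_derive. auto. }
  revert H. apply line_int_ext. intros t.
  replace (t + fst (clog z), snd (clog z)) with (RtoC t + clog z)%C.
  2:{ unfold RtoC, Cplus. destruct (clog z) as [u v]; simpl. f_equal; ring. }
  unfold euler_fun, laplace_fun. rewrite Cmult_assoc, <- Cexp_add, Cexp_add with (a := RtoC t).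
  rewrite Cexp_clog, Cexp_RtoC by exact Hz. f_equal; f_equal; ring.
Qed.

Lemma cont2_fst (f : R -> C) : (forall x, ccont f x) -> cont2 (fun x _ => f x).
Proof.
  intros H x y eps He. destruct (H x eps He) as [d [Hd Hf]]. exists d. split; [auto|]. intros u v Hu _. auto.
Qed.

Lemma cont2_snd (f : R -> C) : (forall x, ccont f x) -> cont2 (fun _ y => f y).
Proof.
  intros H x y eps He. destruct (H y eps He) as [d [Hd Hf]]. exists d. split; [auto|]. intros u v _ Hv. auto.
Qed.

Lemma cont2_mult (f g : R -> R -> C) : cont2 f -> cont2 g -> cont2 (fun x y => f x y * g x y)%C.
Proof.
  intros Hf Hg x y eps He.
  assert (A := Cmod_ge_0 (f x y)). assert (B := Cmod_ge_0 (g x y)).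
  set (eta := Rmin 1 (eps / (Cmod (f x y) + Cmod (g x y) + 2))).
  assert (Heta : 0 < eta) by (apply Rmin_pos; [lra|apply Rdiv_lt_0_compat; lra]).
  assert (E1 : eta <= 1) by apply Rmin_l.
  assert (E2 : eta * (Cmod (f x y) + Cmod (g x y) + 2) <= eps) by (apply Rle_div_r; [lra|apply Rmin_r]).
  destruct (Hf x y eta Heta) as [d1 [Hd1 H1]]. destruct (Hg x y eta Heta) as [d2 [Hd2 H2]].
  assert (M1 := Rmin_l d1 d2). assert (M2 := Rmin_r d1 d2).
  exists (Rmin d1 d2). split; [now apply Rmin_pos|]. intros u v Hu Hv.
  specialize (H1 u v ltac:(lra) ltac:(lra)). specialize (H2 u v ltac:(lra) ltac:(lra)).
  replace (f u v * g u v - f x y * g x y)%C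
    with ((f u v - f x y) * (g u v - g x y) + (f u v - f x y) * g x y + f x y * (g u v - g x y))%C by ring.
  eapply Rle_lt_trans; [apply Cmod_triangle|].
  eapply Rle_lt_trans; [apply Rplus_le_compat_r, Cmod_triangle|]. rewrite !Cmod_mult.
  assert (P1 := Cmod_ge_0 (f u v - f x y)). assert (P2 := Cmod_ge_0 (g u v - g x y)). nra.
Qed.

Lemma cont2_C11 (F F' : C -> C) (h : R -> R -> C) : C11 F F' -> cont2 h -> cont2 (fun x y => F (h x y)).
Proof.
  intros HF Hh x y eps He. destruct (C11_lip F F' HF (Cmod (h x y) + 1)) as [L [HL HLip]].
  destruct (Hh x y (Rmin 1 (eps / (L + 1)))) as [d [Hd H]].
  { apply Rmin_pos; [lra|apply Rdiv_lt_0_compat; lra]. }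
  assert (A := Rmin_l 1 (eps / (L + 1))). assert (B := Rmin_r 1 (eps / (L + 1))).
  exists d. split; [exact Hd|]. intros u v Hu Hv. specialize (H u v Hu Hv).
  assert (T := Cmod_triangle_inv (h u v) (h x y)).
  eapply Rle_lt_trans; [apply HLip; lra|].
  assert (Cmod (h u v - h x y) * (L + 1) < eps) by (apply Rlt_div_r; lra).
  assert (X := Cmod_ge_0 (h u v - h x y)). nra.
Qed.

Definition poisson (eps u : R) : R := 2 * eps / (eps ^ 2 + u ^ 2).

Definition abel (eps y : R) : R := exp (- (eps * Rabs y)).

Lemma abel_continuous (eps y : R) : continuous (abel eps) y.
Proof.
  apply (continuous_comp (fun y => - (eps * Rabs y)) exp); [|apply continuous_exp_at].
  apply (continuous_opp (V := R_NormedModule)), (continuous_scal_r (V := R_NormedModule) eps Rabs).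
  apply continuous_Rabs.
Qed.

Lemma abel_kernel (eps u Y : R) : 0 < eps -> 0 <= Y ->
  Cmod (CRInt (fun y => RtoC (abel eps y) * Cexp (Ci * RtoC y * RtoC u))%C (- Y) Y - RtoC (poisson eps u))
    <= 2 * exp (- (eps * Y)) / eps.
Proof.
  intros He HY. set (b := (- eps, u) : C). set (b' := (eps, u) : C).
  assert (Nb : forall e : R, e <> 0 -> (e, u) <> RtoC 0) by (intros e Hne E; injection E; auto).
  assert (Hb : b <> 0%C) by (apply Nb; lra). assert (Hb' : b' <> 0%C) by (apply Nb; lra).
  assert (R1 : is_CRInt (fun y => RtoC (abel eps y) * Cexp (Ci * RtoC y * RtoC u))%C 0 Y
                 (/ b * (Cexp (RtoC Y * b) - 1))%C).
  { assert (F := is_CRInt_scal (/ b) _ _ _ _ (C11_FTC Cexp Cexp 0 b 0 Y C11_Cexp)).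
    replace (Cexp (0 + RtoC Y * b) - Cexp (0 + RtoC 0 * b))%C with (Cexp (RtoC Y * b) - 1)%C in F.
    2:{ rewrite !Cplus_0_l, Cmult_0_l, Cexp_0. reflexivity. }
    revert F. apply is_CRInt_ext. intros y Hy. rewrite Rmin_left, Rmax_right in Hy by lra.
    transitivity (Cexp (0 + RtoC y * b)); [field; exact Hb|].
    unfold abel. rewrite Rabs_pos_eq by lra. rewrite <- Cexp_RtoC, <- Cexp_add. f_equal.
    unfold b, RtoC, Ci, Cmult, Cplus; simpl. f_equal; ring. }
  assert (R2 : is_CRInt (fun y => RtoC (abel eps y) * Cexp (Ci * RtoC y * RtoC u))%C (- Y) 0
                 (/ b' * (1 - Cexp (RtoC (- Y) * b')))%C).
  { assert (F := is_CRInt_scal (/ b') _ _ _ _ (C11_FTC Cexp Cexp 0 b' (- Y) 0 C11_Cexp)).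
    replace (Cexp (0 + RtoC 0 * b') - Cexp (0 + RtoC (- Y) * b'))%C with (1 - Cexp (RtoC (- Y) * b'))%C in F.
    2:{ rewrite !Cplus_0_l, Cmult_0_l, Cexp_0. reflexivity. }
    revert F. apply is_CRInt_ext. intros y Hy. rewrite Rmin_left, Rmax_right in Hy by lra.
    transitivity (Cexp (0 + RtoC y * b')); [field; exact Hb'|].
    unfold abel. rewrite Rabs_left1 by lra. rewrite <- Cexp_RtoC, <- Cexp_add. f_equal.
    unfold b', RtoC, Ci, Cmult, Cplus; simpl. f_equal; ring. }
  rewrite (CRInt_unique _ _ _ _ (is_CRInt_Chasles _ _ _ _ _ _ R2 R1)).
  assert (PE : (/ b' - / b)%C = RtoC (poisson eps u)).
  { assert (X := pow2_ge_0 u). unfold poisson, b, b', Cminus, Cinv, Cplus, Copp, RtoC; simpl. f_equal; field; nra. }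
  rewrite <- PE.
  replace (/ b' * (1 - Cexp (RtoC (- Y) * b')) + / b * (Cexp (RtoC Y * b) - 1) - (/ b' - / b))%C
    with (/ b * Cexp (RtoC Y * b) - / b' * Cexp (RtoC (- Y) * b'))%C by ring.
  eapply Rle_trans; [apply Cmod_minus_le|]. rewrite !Cmod_mult, !Cmod_Cexp, !Cmod_inv by auto.
  replace (Re (RtoC Y * b)) with (- (eps * Y)) by (unfold b, Re, RtoC; simpl; ring).
  replace (Re (RtoC (- Y) * b')) with (- (eps * Y)) by (unfold b', Re, RtoC; simpl; ring).
  assert (B1 : eps <= Cmod b).
  { assert (X := re_le_Cmod b). unfold b, Re in X. cbn [fst] in X. rewrite Rabs_Ropp, Rabs_pos_eq in X; [exact X|lra]. }
  assert (B2 : eps <= Cmod b').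
  { assert (X := re_le_Cmod b'). unfold b', Re in X. cbn [fst] in X. rewrite Rabs_pos_eq in X; [exact X|lra]. }
  assert (I1 : / Cmod b <= / eps) by (apply Rinv_le_contravar; lra).
  assert (I2 : / Cmod b' <= / eps) by (apply Rinv_le_contravar; lra).
  assert (X := exp_pos (- (eps * Y))). unfold Rdiv. nra.
Qed.

Lemma poisson_pos (eps u : R) : 0 < eps -> 0 < poisson eps u.
Proof. intros H. apply Rdiv_lt_0_compat; [lra|]. assert (X := pow2_ge_0 u). nra. Qed.

Lemma poisson_kernel_primitive (eps x a b : R) : 0 < eps ->
  is_RInt (fun t => exp t * poisson eps (x - exp t)) a b
    (2 * atan ((exp b - x) / eps) - 2 * atan ((exp a - x) / eps)).
Proof.
  intros He.
  apply (is_RInt_derive (V := R_CompleteNormedModule) (fun t => 2 * atan ((exp t - x) / eps))).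
  - intros t _. unfold poisson. auto_derive; [auto|].
    assert (X := pow2_ge_0 (x - exp t)). assert (Y := pow2_ge_0 ((exp t - x) / eps)).
    replace ((x - exp t) ^ 2) with (((exp t - x) / eps) ^ 2 * eps ^ 2) by (field; lra).
    unfold Rsqr. field. nra.
  - intros t _. unfold poisson. apply (ex_derive_continuous (fun t => exp t * (2 * eps / (eps ^ 2 + (x - exp t) ^ 2)))).
    auto_derive. assert (X := pow2_ge_0 (x - exp t)). simpl in X. nra.
Qed.

Lemma atan_large (v : R) : 0 < v -> PI / 2 - / v <= atan v < PI / 2.
Proof.
  intros Hv. split; [|apply atan_bound].
  assert (E := atan_inv v Hv).
  destruct (MVT_gen atan 0 (/ v) (fun t => / (1 + t ^ 2))) as [c [_ Hc]].
  - intros y _. apply is_derive_Reals, derivable_pt_lim_atan.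
  - intros y _. apply derivable_continuous_pt, derivable_pt_atan.
  - rewrite atan_0, !Rminus_0_r in Hc.
    assert (P : 0 < / v) by now apply Rinv_0_lt_compat.
    assert (/ (1 + c ^ 2) <= 1).
    { rewrite <- Rinv_1. apply Rinv_le_contravar; [lra|]. assert (X := pow2_ge_0 c). lra. }
    nra.
Qed.

Lemma Rmult_div_small (K eta : R) : 0 <= K -> 0 < eta -> K * (eta / (K + 1)) <= eta.
Proof.
  intros HK He. replace (K * (eta / (K + 1))) with (eta * (K / (K + 1))) by (field; lra).
  assert (K / (K + 1) <= 1) by (apply Rle_div_l; lra). nra.
Qed.

Lemma poisson_kernel_mass (eps x a b : R) : 0 < eps -> 0 < x -> exp a <= x / 2 -> x + 1 <= exp b ->
  Rabs (2 * atan ((exp b - x) / eps) - 2 * atan ((exp a - x) / eps) - 2 * PI) <= 2 * eps + 4 * eps / x.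
Proof.
  intros He Hx Ha Hb.
  assert (B := atan_large ((exp b - x) / eps) ltac:(apply Rdiv_lt_0_compat; lra)).
  assert (A := atan_large ((x - exp a) / eps) ltac:(apply Rdiv_lt_0_compat; lra)).
  replace ((exp a - x) / eps) with (- ((x - exp a) / eps)) by (field; lra).
  rewrite atan_opp.
  assert (B1 : / ((exp b - x) / eps) <= eps).
  { replace (/ ((exp b - x) / eps)) with (eps / (exp b - x)) by (field; lra).
    apply Rle_div_l; [lra|]. nra. }
  assert (A1 : / ((x - exp a) / eps) <= 2 * eps / x).
  { replace (/ ((x - exp a) / eps)) with (eps / (x - exp a)) by (field; lra).
    apply Rle_div_l; [lra|]. replace (2 * eps / x * (x - exp a)) with (2 * eps * ((x - exp a) / x)) by (field; lra).
    assert (Hr : 1 / 2 <= (x - exp a) / x) by (apply (proj1 (Rle_div_r _ _ _ Hx)); lra).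
    revert Hr. generalize ((x - exp a) / x). intros r Hr. nra. }
  replace (4 * eps / x) with (2 * (2 * eps / x)) by (field; lra).
  apply Rabs_le. lra.
Qed.

(* The kernels [exp t * poisson eps (x - exp t)] concentrate at [t = ln x], with total mass [2 PI]. *)
Lemma poisson_approx_identity (q : R -> C) (x Bq : R) : 0 < x -> (forall t, ccont q t) ->
  (forall t, Cmod (q t) <= Bq) ->
  forall eta, 0 < eta -> exists eps0 A0, 0 < eps0 /\ 0 <= A0 /\
    forall eps a b, 0 < eps -> eps <= eps0 -> a <= - A0 -> A0 <= b ->
      Cmod (CRInt (fun t => RtoC (exp t * poisson eps (x - exp t)) * q t)%C a b
            - RtoC (2 * PI) * q (ln x)) <= eta.
Proof.
  intros Hx Cq HB eta Heta. assert (PP := PI_RGT_0).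
  assert (HBq : 0 <= Bq) by (eapply Rle_trans; [apply Cmod_ge_0|apply (HB 0)]).
  destruct (Cq (ln x) (eta / (4 * PI)) ltac:(apply Rdiv_lt_0_compat; lra)) as [del' [Hdel' Hq']].
  set (del := del' / 2). set (t0 := ln x).
  assert (Hdel : 0 < del) by (unfold del; lra).
  assert (Hq : forall t, t0 - del <= t <= t0 + del -> Cmod (q t - q t0) <= eta / (4 * PI)).
  { intros t Ht. left. apply Hq'. fold t0. apply Rabs_def1; unfold del in Ht; lra. }
  assert (Ex : exp t0 = x) by (apply exp_ln, Hx).
  set (d1 := x - exp (t0 - del)). set (d2 := exp (t0 + del) - x).
  assert (Hd1 : 0 < d1) by (unfold d1; rewrite <- Ex at 1; apply Rlt_0_minus, exp_increasing; lra).
  assert (Hd2 : 0 < d2) by (unfold d2; rewrite <- Ex; apply Rlt_0_minus, exp_increasing; lra).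
  set (N := (Bq + 1) * (4 / d1 + 4 / d2 + 2 + 4 / x)).
  assert (P1 : 0 < 4 / d1) by (apply Rdiv_lt_0_compat; lra).
  assert (P2 : 0 < 4 / d2) by (apply Rdiv_lt_0_compat; lra).
  assert (P3 : 0 < 4 / x) by (apply Rdiv_lt_0_compat; lra).
  assert (HN : 0 < N) by (unfold N; nra).
  set (A0 := Rabs (ln (x / 2)) + Rabs (ln (x + 1)) + Rabs t0 + del).
  exists (eta / 2 / N), A0.
  split; [apply Rdiv_lt_0_compat; lra|].
  assert (Q1 := Rabs_pos (ln (x / 2))). assert (Q2 := Rabs_pos (ln (x + 1))). assert (Q3 := Rabs_pos t0).
  split; [unfold A0; lra|].
  intros eps a b He Hee Ha Hb.
  assert (U1 := Rle_abs (ln (x + 1))). assert (U2 := Rle_abs (- ln (x / 2))). rewrite Rabs_Ropp in U2.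
  assert (U3 := Rle_abs t0). assert (U4 := Rle_abs (- t0)). rewrite Rabs_Ropp in U4.
  unfold A0 in Ha, Hb.
  assert (Ha1 : exp a <= x / 2) by (rewrite <- (exp_ln (x / 2)) by lra; apply exp_le_mono; lra).
  assert (Hb1 : x + 1 <= exp b) by (rewrite <- (exp_ln (x + 1)) by lra; apply exp_le_mono; lra).
  set (k := fun t => exp t * poisson eps (x - exp t)).
  set (P := fun t => 2 * atan ((exp t - x) / eps)).
  assert (Kk : forall u v, is_RInt k u v (P v - P u)) by (intros; apply poisson_kernel_primitive, He).
  assert (kpos : forall t, 0 <= k t).
  { intros t. apply Rmult_le_pos; [left; apply exp_pos|left; apply poisson_pos, He]. }
  assert (Ck : forall t, continuous k t).
  { intros t. unfold k, poisson. apply (ex_derive_continuous (fun t => exp t * (2 * eps / (eps ^ 2 + (x - exp t) ^ 2)))).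
    auto_derive. assert (X := pow2_ge_0 (x - exp t)). simpl in X. nra. }
  set (D := fun t => (RtoC (k t) * (q t - q t0))%C).
  assert (CD : forall t, ccont D t).
  { intros t. apply ccont_mult; [apply ccont_RtoC, Ck|]. apply ccont_minus; [apply Cq|apply ccont_const]. }
  assert (ID : forall u v, is_CRInt D u v (CRInt D u v)) by (intros; apply CRInt_correct; auto).
  assert (Split : CRInt (fun t => RtoC (k t) * q t)%C a b = (CRInt D a b + RtoC (P b - P a) * q t0)%C).
  { apply CRInt_unique. apply (is_CRInt_ext (fun t => D t + q t0 * RtoC (k t))%C).
    - intros t _. unfold D. ring.
    - apply is_CRInt_plus; [apply ID|]. rewrite Cmult_comm. apply is_CRInt_scal, is_CRInt_RtoC, Kk. }
  change (Cmod (CRInt (fun t => RtoC (k t) * q t)%C a b - RtoC (2 * PI) * q t0) <= eta).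
  rewrite Split.
  replace (CRInt D a b + RtoC (P b - P a) * q t0 - RtoC (2 * PI) * q t0)%C
    with (CRInt D a b + RtoC (P b - P a - 2 * PI) * q t0)%C by (rewrite (RtoC_minus _ (2 * PI)); ring).
  rewrite (CRInt_Chasles D a (t0 - del) b CD), (CRInt_Chasles D (t0 - del) (t0 + del) b CD).
  assert (Out : forall u v, u <= v -> Cmod (CRInt D u v) <= 2 * Bq * (P v - P u)).
  { intros u v Huv.
    apply (is_CRInt_norm_le D (fun t => 2 * Bq * k t) u v _ _ Huv); [|apply ID|].
    - intros t _. unfold D. rewrite Cmod_mult, Cmod_RtoC_nonneg by auto. rewrite Rmult_comm.
      apply Rmult_le_compat_r; auto.
      eapply Rle_trans; [apply Cmod_minus_le|]. assert (X := HB t). assert (Y := HB t0). lra.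
    - apply (is_RInt_scal (V := R_NormedModule)). apply Kk. }
  assert (Inn : Cmod (CRInt D (t0 - del) (t0 + del)) <= eta / (4 * PI) * (P (t0 + del) - P (t0 - del))).
  { apply (is_CRInt_norm_le D (fun t => eta / (4 * PI) * k t) (t0 - del) (t0 + del) _ _ ltac:(lra)); [|apply ID|].
    - intros t Ht. unfold D. rewrite Cmod_mult, Cmod_RtoC_nonneg by auto. rewrite Rmult_comm.
      apply Rmult_le_compat_r; auto.
    - apply (is_RInt_scal (V := R_NormedModule)). apply Kk. }
  assert (O1 := Out a (t0 - del) ltac:(lra)). assert (O2 := Out (t0 + del) b ltac:(lra)).
  assert (Pb : forall t, - PI <= P t <= PI).
  { intros t. unfold P. assert (X := atan_bound ((exp t - x) / eps)). lra. }
  assert (L1 : P (t0 - del) <= - PI + 2 * eps / d1).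
  { unfold P. replace ((exp (t0 - del) - x) / eps) with (- (d1 / eps)) by (unfold d1; field; lra).
    rewrite atan_opp. assert (X := atan_large (d1 / eps) ltac:(apply Rdiv_lt_0_compat; lra)).
    replace (2 * eps / d1) with (2 * / (d1 / eps)) by (field; lra). lra. }
  assert (L2 : PI - 2 * eps / d2 <= P (t0 + del)).
  { unfold P. fold d2. assert (X := atan_large (d2 / eps) ltac:(apply Rdiv_lt_0_compat; lra)).
    replace (2 * eps / d2) with (2 * / (d2 / eps)) by (field; lra). lra. }
  assert (M := poisson_kernel_mass eps x a b He Hx Ha1 Hb1). fold (P b) (P a) in M.
  assert (Pa := Pb a). assert (Pbb := Pb b). assert (Pl := Pb (t0 - del)). assert (Pr := Pb (t0 + del)).
  assert (I2 : eta / (4 * PI) * (P (t0 + del) - P (t0 - del)) <= eta / 2).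
  { apply Rle_trans with (eta / (4 * PI) * (2 * PI)).
    - apply Rmult_le_compat_l; [left; apply Rdiv_lt_0_compat|]; lra.
    - right. field. lra. }
  assert (HBt := HB t0).
  eapply Rle_trans; [apply Cmod_triangle|].
  assert (T1 := Cmod_triangle (CRInt D a (t0 - del)) (CRInt D (t0 - del) (t0 + del) + CRInt D (t0 + del) b)).
  assert (T2 := Cmod_triangle (CRInt D (t0 - del) (t0 + del)) (CRInt D (t0 + del) b)).
  rewrite Cmod_mult, Cmod_R.
  assert (F1 : 2 * Bq * (P (t0 - del) - P a) <= (Bq + 1) * (4 / d1) * eps).
  { apply Rle_trans with (2 * Bq * (2 * eps / d1)); [apply Rmult_le_compat_l; lra|].
    replace (2 * Bq * (2 * eps / d1)) with (Bq * (4 / d1) * eps) by (field; lra).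
    apply Rmult_le_compat_r; [lra|]. apply Rmult_le_compat_r; lra. }
  assert (F2 : 2 * Bq * (P b - P (t0 + del)) <= (Bq + 1) * (4 / d2) * eps).
  { apply Rle_trans with (2 * Bq * (2 * eps / d2)); [apply Rmult_le_compat_l; lra|].
    replace (2 * Bq * (2 * eps / d2)) with (Bq * (4 / d2) * eps) by (field; lra).
    apply Rmult_le_compat_r; [lra|]. apply Rmult_le_compat_r; lra. }
  assert (F3 : Rabs (P b - P a - 2 * PI) * Cmod (q t0) <= (Bq + 1) * (2 + 4 / x) * eps).
  { apply Rle_trans with ((2 * eps + 4 * eps / x) * (Bq + 1)).
    - apply Rmult_le_compat; try lra; [apply Rabs_pos|apply Cmod_ge_0].
    - right. field. lra. }
  assert (F4 : N * eps <= eta / 2).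
  { rewrite Rmult_comm. apply Rle_div_r in Hee; lra. }
  unfold N in F4. lra.
Qed.

Lemma line_int_tail_uniform (g : R -> R) : integrable_dom g -> forall eps, 0 < eps ->
  exists Y, 0 <= Y /\ forall f l, (forall x, ccont f x) -> (forall t, Cmod (f t) <= g t) -> line_int f l ->
    forall N, Y <= N -> Cmod (CRInt f (- N) N - l) <= eps.
Proof.
  intros [G1 [G2 G3]] eps He. destruct (G3 (eps / 2) ltac:(lra)) as [Y [HY Ht]].
  exists Y. split; [exact HY|]. intros f l Cf H Hl N HN.
  rewrite Cmod_minus_sym. apply (line_int_le f l _ eps Hl). exists N. intros M HM.
  rewrite (CRInt_Chasles f (- M) (- N) M Cf), (CRInt_Chasles f (- N) N M Cf).
  replace (CRInt f (- M) (- N) + (CRInt f (- N) N + CRInt f N M) - CRInt f (- N) N)%C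
    with (CRInt f (- M) (- N) + CRInt f N M)%C by ring.
  eapply Rle_trans; [apply Cmod_triangle|].
  assert (A := CRInt_dom_le f g (- M) (- N) ltac:(lra) Cf G2 H).
  assert (B := CRInt_dom_le f g N M HM Cf G2 H).
  assert (C1 := Ht (- M) (- N) ltac:(lra) ltac:(right; lra)). assert (C2 := Ht N M HM ltac:(left; lra)). lra.
Qed.

Definition bromwich (s : C) (x c y : R) : C :=
  (Cexp (- (s * clog (c, y))) * Cexp ((c, y) * RtoC x))%C.

Lemma ccont_bromwich (s : C) (x c y : R) : 0 < c -> ccont (bromwich s x c) y.
Proof.
  intros Hc. apply ccont_mult; apply ccont_Cexp.
  - apply (ccont_ext (fun y => (- s) * clog (c, y))%C); [intros; ring|].
    apply ccont_scal, ccont_clog_line, Hc.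
  - apply ccont_mult; [apply ccont_pair_2|apply ccont_const].
Qed.

Lemma Cmod_Cexp_clog_le (s : C) (c y : R) : 0 <= Re s -> 1 <= c ->
  Cmod (Cexp (- (s * clog (c, y)))) <= exp (Rabs (Im s) * (PI / 2)) * pow_weight (Re s) y.
Proof.
  intros Hs Hc. rewrite Cmod_Cexp. unfold pow_weight, Rpower. rewrite <- exp_plus. apply exp_le_mono.
  assert (B := snd_clog_bound (c, y)).
  assert (E : Re (- (s * clog (c, y))) = Im s * snd (clog (c, y)) - Re s * fst (clog (c, y))).
  { destruct s as [a b]. destruct (clog (c, y)). unfold Re, Im; simpl. ring. }
  rewrite E.
  assert (X : Im s * snd (clog (c, y)) <= Rabs (Im s) * (PI / 2)).
  { eapply Rle_trans; [apply Rle_abs|]. rewrite Rabs_mult. apply Rmult_le_compat_l; [apply Rabs_pos|lra]. }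
  assert (L : ln (1 + y ^ 2) <= 2 * fst (clog (c, y))).
  { unfold clog. cbn [fst snd]. replace (2 * (ln (c ^ 2 + y ^ 2) / 2)) with (ln (c ^ 2 + y ^ 2)) by field.
    assert (Y := pow2_ge_0 y). destruct (Req_dec c 1) as [->|Hn]; [right; f_equal; ring|].
    left. apply ln_increasing; nra. }
  nra.
Qed.

Lemma Cmod_bromwich_le (s : C) (x c y : R) : 0 <= Re s -> 1 <= c ->
  Cmod (bromwich s x c y) <= exp (Rabs (Im s) * (PI / 2)) * exp (c * x) * pow_weight (Re s) y.
Proof.
  intros Hs Hc. unfold bromwich. rewrite Cmod_mult. assert (A := Cmod_Cexp_clog_le s c y Hs Hc).
  assert (E : Cmod (Cexp ((c, y) * RtoC x)) = exp (c * x)).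
  { rewrite Cmod_Cexp. f_equal. unfold Re, RtoC; simpl. ring. }
  rewrite E. assert (X := exp_pos (c * x)).
  replace (exp (Rabs (Im s) * (PI / 2)) * exp (c * x) * pow_weight (Re s) y)
    with (exp (Rabs (Im s) * (PI / 2)) * pow_weight (Re s) y * exp (c * x)) by ring.
  apply Rmult_le_compat_r; lra.
Qed.

Lemma abel_le_1 (eps y : R) : 0 <= eps -> 0 < abel eps y <= 1.
Proof.
  intros He. split; [apply exp_pos|]. rewrite <- exp_0. apply exp_le_mono.
  assert (X := Rabs_pos y). nra.
Qed.

Lemma one_minus_abel_le (eps y g : R) : 0 < eps -> 0 < g <= 1 ->
  1 - abel eps y <= Rpower eps g * Rpower (1 + y ^ 2) (g / 2).
Proof.
  intros He Hg. set (u := eps * sqrt (1 + y ^ 2)).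
  assert (Y := pow2_ge_0 y).
  assert (S : Rabs y <= sqrt (1 + y ^ 2)).
  { rewrite <- (sqrt_pow2 (Rabs y)) by apply Rabs_pos. apply sqrt_le_1_alt. rewrite pow2_abs. lra. }
  assert (S0 : 0 < sqrt (1 + y ^ 2)) by (apply sqrt_lt_R0; lra).
  assert (U : 0 < u) by (unfold u; nra).
  replace (Rpower eps g * Rpower (1 + y ^ 2) (g / 2)) with (Rpower u g).
  2:{ unfold u. rewrite <- Rpower_mult_distr by lra. f_equal.
      rewrite <- (Rpower_sqrt (1 + y ^ 2)) by lra. rewrite Rpower_mult. f_equal. field. }
  assert (B := abel_le_1 eps y ltac:(lra)).
  assert (E : 1 - abel eps y <= u).
  { unfold abel. assert (X := exp_ge_1_plus (- (eps * Rabs y))). unfold u.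
    assert (eps * Rabs y <= eps * sqrt (1 + y ^ 2)) by (apply Rmult_le_compat_l; lra). lra. }
  destruct (Rle_dec 1 u) as [H1|H1].
  - assert (1 <= Rpower u g).
    { unfold Rpower. rewrite <- exp_0. apply exp_le_mono.
      assert (0 <= ln u) by (rewrite <- ln_1; apply ln_le; lra). nra. }
    lra.
  - assert (u <= Rpower u g).
    { rewrite <- (Rpower_1 u U) at 1. unfold Rpower. apply exp_le_mono.
      assert (ln u <= 0) by (rewrite <- ln_1; apply ln_le; lra). nra. }
    lra.
Qed.

Lemma Rpower_small (g eta : R) : 0 < g -> 0 < eta -> exists e0, 0 < e0 /\ forall e, 0 < e <= e0 -> Rpower e g <= eta.
Proof.
  intros Hg He. exists (Rpower eta (/ g)). split; [apply exp_pos|]. intros e Hee.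
  apply Rle_trans with (Rpower (Rpower eta (/ g)) g).
  - apply Rle_Rpower_l; lra.
  - rewrite Rpower_mult, Rinv_l, Rpower_1; lra.
Qed.

Lemma abel_summation (f : R -> C) (K sigma : R) : 1 < sigma -> 0 <= K -> (forall x, ccont f x) ->
  (forall y, Cmod (f y) <= K * pow_weight sigma y) ->
  forall eta, 0 < eta -> exists e0, 0 < e0 /\ forall e Y, 0 < e <= e0 -> 0 <= Y ->
    Cmod (CRInt f (- Y) Y - CRInt (fun y => RtoC (abel e y) * f y)%C (- Y) Y) <= eta.
Proof.
  intros Hs HK Cf Hf eta Heta.
  set (g := Rmin 1 ((sigma - 1) / 2)).
  assert (Hg : 0 < g) by (apply Rmin_pos; lra).
  assert (Hg1 : g <= 1) by apply Rmin_l. assert (Hg2 : g <= (sigma - 1) / 2) by apply Rmin_r.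
  destruct (integrable_dom_bound _ (pow_weight_integrable (sigma - g) ltac:(lra))) as [B [HB Hb]].
  destruct (Rpower_small g (eta / (K * B + 1)) Hg) as [e0 [He0 Hsmall]].
  { apply Rdiv_lt_0_compat; nra. }
  exists e0. split; [exact He0|]. intros e Y He HY.
  assert (I1 : is_CRInt f (- Y) Y (CRInt f (- Y) Y)) by (apply CRInt_correct; auto).
  assert (Ca : forall x, ccont (fun y => RtoC (abel e y) * f y)%C x).
  { intros x. apply ccont_mult; [apply ccont_RtoC, abel_continuous|apply Cf]. }
  assert (I2 := CRInt_correct _ (- Y) Y (fun x _ => Ca x)).
  apply Rle_trans with (Rpower e g * K * RInt (pow_weight (sigma - g)) (- Y) Y).
  - apply (is_CRInt_norm_le _ (fun y => Rpower e g * K * pow_weight (sigma - g) y) (- Y) Y _ _ ltac:(lra))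
      with (2 := is_CRInt_minus _ _ _ _ _ _ I1 I2).
    + intros y _. replace (f y - RtoC (abel e y) * f y)%C with (RtoC (1 - abel e y) * f y)%C
        by (rewrite RtoC_minus; ring).
      assert (A := abel_le_1 e y ltac:(lra)).
      rewrite Cmod_mult, Cmod_RtoC_nonneg by lra.
      apply Rle_trans with (Rpower e g * Rpower (1 + y ^ 2) (g / 2) * (K * pow_weight sigma y)).
      * apply Rmult_le_compat; [lra|apply Cmod_ge_0| |apply Hf]. apply one_minus_abel_le; lra.
      * right. unfold pow_weight. replace (- (sigma - g) / 2) with (g / 2 + - sigma / 2) by field.
        rewrite (Rpower_plus (g / 2)). ring.
    + apply (is_RInt_scal (V := R_NormedModule)). apply RInt_dom_correct, pow_weight_continuous.
  - specialize (Hsmall e He). specialize (Hb (- Y) Y ltac:(lra)).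
    assert (P : 0 < Rpower e g) by apply exp_pos.
    apply Rle_trans with (Rpower e g * (K * B)).
    + rewrite Rmult_assoc. apply Rmult_le_compat_l; [lra|]. apply Rmult_le_compat_l; lra.
    + rewrite Rmult_comm. eapply Rle_trans; [|apply (Rmult_div_small (K * B) eta); nra].
      apply Rmult_le_compat_l; nra.
Qed.

(* [exp t] times this is the [Cexp (s t) exp (c (x - exp t))] left after Fubini. *)
Definition gamma_profile (s : C) (x c t : R) : C :=
  (Cexp ((s - 1) * RtoC t) * Cexp (RtoC (c * (x - exp t))))%C.

Lemma ccont_gamma_profile (s : C) (x c t : R) : ccont (gamma_profile s x c) t.
Proof.
  apply ccont_mult; apply ccont_Cexp; [apply ccont_scal, ccont_id|].
  apply ccont_RtoC. apply (ex_derive_continuous (fun t => c * (x - exp t))). auto_derive. auto.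
Qed.

Lemma Cmod_gamma_profile (s : C) (x c t : R) :
  Cmod (gamma_profile s x c t) = exp ((Re s - 1) * t - c * exp t) * exp (c * x).
Proof.
  unfold gamma_profile. rewrite Cmod_mult, !Cmod_Cexp, <- !exp_plus. f_equal.
  destruct s as [a b]. unfold Re, RtoC; simpl. ring.
Qed.

Lemma pow_weight_le_1 (b t : R) : 0 <= b -> pow_weight b t <= 1.
Proof.
  intros Hb. unfold pow_weight, Rpower.
  apply Rle_trans with (exp 0); [apply exp_le_mono|rewrite exp_0; lra].
  assert (X := pow2_ge_0 t).
  assert (L : 0 <= ln (1 + t ^ 2)) by (rewrite <- ln_1; apply ln_le; lra).
  assert (Y : 0 <= b * ln (1 + t ^ 2)) by (apply Rmult_le_pos; lra). lra.
Qed.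

Lemma gamma_profile_bounded (s : C) (x c : R) : 1 < Re s -> 0 < c ->
  exists B, forall t, Cmod (gamma_profile s x c t) <= B.
Proof.
  intros Hs Hc. exists ((1 + 4 * exp ((Re s + 1) ^ 2 / c)) * exp (c * x)). intros t.
  rewrite Cmod_gamma_profile. apply Rmult_le_compat_r; [left; apply exp_pos|].
  assert (P := exp_pos ((Re s + 1) ^ 2 / c)).
  destruct (Rle_dec 0 t) as [Ht|Ht].
  - assert (A := exp_exp_bound (Re s) c t Hs Hc). assert (W := pow_weight_le_1 2 t ltac:(lra)).
    assert (E : exp ((Re s - 1) * t - c * exp t) <= exp (Re s * t - c * exp t)) by (apply exp_le_mono; lra). nra.
  - assert (E : exp ((Re s - 1) * t - c * exp t) <= exp 0).
    { apply exp_le_mono. assert (X := exp_pos t). nra. }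
    rewrite exp_0 in E. lra.
Qed.

Lemma gamma_fubini (s : C) (x c : R) : 1 < Re s -> 0 < c -> exists K3, 0 <= K3 /\
  forall eps Y eta, 0 < eps -> 0 < Y -> 0 < eta -> exists A0, forall A, A0 <= A ->
    Cmod (CGamma s * CRInt (fun y => RtoC (abel eps y) * bromwich s x c y)%C (- Y) Y
          - CRInt (fun t => RtoC (exp t * poisson eps (x - exp t)) * gamma_profile s x c t)%C (- A) A)
      <= eta + 2 * exp (- (eps * Y)) / eps * K3.
Proof.
  intros Hs Hc.
  set (Kl := 4 * exp ((Re s + 1) ^ 2 / c)).
  assert (HKl : 0 < Kl) by (unfold Kl; assert (X := exp_pos ((Re s + 1) ^ 2 / c)); lra).
  assert (Hdom : integrable_dom (fun t => Kl * pow_weight 2 t)).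
  { apply integrable_dom_scal; [lra|]. apply pow_weight_integrable. lra. }
  destruct (integrable_dom_bound _ Hdom) as [B [HB Hb]].
  assert (Ex := exp_pos (c * x)).
  exists (exp (c * x) * B). split; [nra|].
  intros eps Y eta He HY Heta.
  destruct (line_int_tail_uniform _ Hdom (eta / (2 * Y * exp (c * x) + 1))) as [A1 [HA1 Htail]].
  { apply Rdiv_lt_0_compat; nra. }
  exists (A1 + 1). intros A HA.
  set (h := fun t y => (RtoC (abel eps y) * Cexp ((c, y) * RtoC x) * laplace_fun s (c, y) t)%C).
  assert (Ch : cont2 h).
  { unfold h. apply cont2_mult.
    - apply (cont2_snd (fun y => RtoC (abel eps y) * Cexp ((c, y) * RtoC x))%C). intros y.
      apply ccont_mult; [apply ccont_RtoC, abel_continuous|].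
      apply ccont_Cexp, ccont_mult; [apply ccont_pair_2|apply ccont_const].
    - unfold laplace_fun. apply cont2_mult.
      + apply (cont2_fst (fun t => Cexp (s * RtoC t))). intros t. apply ccont_Cexp, ccont_scal, ccont_id.
      + apply (cont2_C11 Cexp Cexp _ C11_Cexp).
        assert (Q : cont2 (fun t y => (- (1)) * ((c, y) * RtoC (exp t)))%C).
        { apply cont2_mult; [apply (cont2_fst (fun _ => (- (1))%C)); intros; apply ccont_const|].
          apply cont2_mult.
          - apply (cont2_snd (fun y => (c, y))). intros; apply ccont_pair_2.
          - apply (cont2_fst (fun t => RtoC (exp t))). intros; apply ccont_RtoC, continuous_exp_at. }
        intros t y e Hee. destruct (Q t y e Hee) as [d [Hd HQ]]. exists d. split; [exact Hd|].
        intros u v Hu Hv. specialize (HQ u v Hu Hv).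
        replace (- ((c, v) * RtoC (exp u)) - - ((c, y) * RtoC (exp t)))%C
          with (- (1) * ((c, v) * RtoC (exp u)) - - (1) * ((c, y) * RtoC (exp t)))%C by ring. exact HQ. }
  assert (F := Fubini_C h (- A) A (- Y) Y ltac:(lra) Ch).
  set (X1 := CRInt (fun v => CRInt (fun u => h u v) (- A) A) (- Y) Y) in *.
  set (X2 := CRInt (fun u => CRInt (fun v => h u v) (- Y) Y) (- A) A) in *.
  set (brom := fun y => (RtoC (abel eps y) * bromwich s x c y)%C).
  set (prof := fun t => (RtoC (exp t * poisson eps (x - exp t)) * gamma_profile s x c t)%C).
  change (Cmod (CGamma s * CRInt brom (- Y) Y - CRInt prof (- A) A)
            <= eta + 2 * exp (- (eps * Y)) / eps * (exp (c * x) * B)).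
  assert (Cbrom : forall y, ccont brom y).
  { intros y. apply ccont_mult; [apply ccont_RtoC, abel_continuous|now apply ccont_bromwich]. }
  assert (Cprof : forall t, ccont prof t).
  { intros t. apply ccont_mult; [|apply ccont_gamma_profile]. apply ccont_RtoC. unfold poisson.
    apply (ex_derive_continuous (fun t => exp t * (2 * eps / (eps ^ 2 + (x - exp t) ^ 2)))).
    auto_derive. assert (X := pow2_ge_0 (x - exp t)). simpl in X. nra. }
  assert (Cl : forall y t, ccont (laplace_fun s (c, y)) t) by (intros; apply ccont_laplace_fun).
  assert (E1 : Cmod (CGamma s * CRInt brom (- Y) Y - X1) <= eta).
  { assert (I1 : is_CRInt (fun y => CGamma s * brom y)%C (- Y) Y (CGamma s * CRInt brom (- Y) Y)%C).
    { apply is_CRInt_scal, CRInt_correct; auto. }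
    assert (I2 : is_CRInt (fun v => CRInt (fun u => h u v) (- A) A) (- Y) Y X1).
    { apply CRInt_correct. intros y _. now apply (ccont_CRInt_param h). }
    assert (Z := is_CRInt_minus _ _ _ _ _ _ I1 I2).
    eapply Rle_trans.
    - apply (is_CRInt_norm_le_const _ (- Y) Y (exp (c * x) * (eta / (2 * Y * exp (c * x) + 1))) _ ltac:(lra)) with (2 := Z).
      intros y _. unfold brom, bromwich.
      rewrite (CRInt_unique (fun u => h u y) (- A) A
                (RtoC (abel eps y) * Cexp ((c, y) * RtoC x) * CRInt (laplace_fun s (c, y)) (- A) A)%C).
      2:{ apply is_CRInt_scal, CRInt_correct; auto. }
      replace (CGamma s * (RtoC (abel eps y) * (Cexp (- (s * clog (c, y))) * Cexp ((c, y) * RtoC x)))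
               - RtoC (abel eps y) * Cexp ((c, y) * RtoC x) * CRInt (laplace_fun s (c, y)) (- A) A)%C
        with (RtoC (abel eps y) * Cexp ((c, y) * RtoC x) *
              - (CRInt (laplace_fun s (c, y)) (- A) A - Cexp (- (s * clog (c, y))) * CGamma s))%C by ring.
      rewrite !Cmod_mult, Cmod_opp. assert (Ab := abel_le_1 eps y ltac:(lra)).
      rewrite Cmod_RtoC_nonneg by lra.
      assert (E2 : Cmod (Cexp ((c, y) * RtoC x)) = exp (c * x)).
      { rewrite Cmod_Cexp. f_equal. unfold Re, RtoC; simpl. ring. }
      rewrite E2. apply Rmult_le_compat; [nra|apply Cmod_ge_0|nra|].
      apply (Htail (laplace_fun s (c, y)) _ (Cl y)); [|apply (laplace_line_int s (c, y) Hs Hc)|lra].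
      intros t. rewrite Cmod_laplace_fun. apply (exp_exp_bound (Re s) c t Hs Hc).
    - replace ((Y - - Y) * (exp (c * x) * (eta / (2 * Y * exp (c * x) + 1))))
        with (2 * Y * exp (c * x) * (eta / (2 * Y * exp (c * x) + 1))) by ring.
      apply Rmult_div_small; nra. }
  assert (E2 : Cmod (X2 - CRInt prof (- A) A) <= 2 * exp (- (eps * Y)) / eps * (exp (c * x) * B)).
  { assert (I2 : is_CRInt (fun u => CRInt (fun v => h u v) (- Y) Y) (- A) A X2).
    { apply CRInt_correct. intros t _. apply (ccont_CRInt_param (fun v u => h u v)). now apply cont2_swap. }
    assert (I1 : is_CRInt prof (- A) A (CRInt prof (- A) A)) by (apply CRInt_correct; auto).
    assert (Z := is_CRInt_minus _ _ _ _ _ _ I2 I1).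
    set (w := 2 * exp (- (eps * Y)) / eps).
    assert (Hw : 0 <= w).
    { unfold w. left. apply Rdiv_lt_0_compat; [|lra]. assert (X := exp_pos (- (eps * Y))). lra. }
    apply Rle_trans with (w * exp (c * x) * RInt (fun t => Kl * pow_weight 2 t) (- A) A).
    - apply (is_CRInt_norm_le _ (fun t => w * exp (c * x) * (Kl * pow_weight 2 t)) (- A) A _ _ ltac:(lra)) with (2 := Z).
      + intros t _.
        assert (Ci1 : forall y, ccont (fun y => RtoC (abel eps y) * Cexp (Ci * RtoC y * RtoC (x - exp t)))%C y).
        { intros y. apply ccont_mult; [apply ccont_RtoC, abel_continuous|].
          apply ccont_Cexp, ccont_mult; [apply ccont_scal, ccont_id|apply ccont_const]. }
        rewrite (CRInt_unique (fun v => h t v) (- Y) Y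
                  (RtoC (exp t) * gamma_profile s x c t *
                   CRInt (fun y => RtoC (abel eps y) * Cexp (Ci * RtoC y * RtoC (x - exp t)))%C (- Y) Y)%C).
        2:{ apply (is_CRInt_ext (fun y => RtoC (exp t) * gamma_profile s x c t *
                     (RtoC (abel eps y) * Cexp (Ci * RtoC y * RtoC (x - exp t))))%C).
            - intros y _. unfold h, gamma_profile, laplace_fun.
              assert (E : (RtoC (exp t) * (Cexp ((s - 1) * RtoC t) * Cexp (RtoC (c * (x - exp t)))) *
                             Cexp (Ci * RtoC y * RtoC (x - exp t)))%C
                          = (Cexp ((c, y) * RtoC x) * (Cexp (s * RtoC t) * Cexp (- ((c, y) * RtoC (exp t)))))%C).
              { rewrite <- (Cexp_RtoC t) at 1. rewrite <- !Cexp_add. f_equal. destruct s as [sa sb].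
                unfold RtoC, Ci, Cmult, Cplus, Copp, Cminus; simpl. f_equal; ring. }
              replace (RtoC (abel eps y) * Cexp ((c, y) * RtoC x) *
                       (Cexp (s * RtoC t) * Cexp (- ((c, y) * RtoC (exp t)))))%C
                with (RtoC (abel eps y) * (Cexp ((c, y) * RtoC x) * (Cexp (s * RtoC t) * Cexp (- ((c, y) * RtoC (exp t))))))%C by ring.
              rewrite <- E. ring.
            - apply is_CRInt_scal, CRInt_correct; auto. }
        unfold prof. rewrite RtoC_mult.
        replace (RtoC (exp t) * gamma_profile s x c t *
                  CRInt (fun y => RtoC (abel eps y) * Cexp (Ci * RtoC y * RtoC (x - exp t)))%C (- Y) Y -
                 RtoC (exp t) * RtoC (poisson eps (x - exp t)) * gamma_profile s x c t)%C
          with (RtoC (exp t) * gamma_profile s x c t *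
                (CRInt (fun y => RtoC (abel eps y) * Cexp (Ci * RtoC y * RtoC (x - exp t)))%C (- Y) Y -
                 RtoC (poisson eps (x - exp t))))%C by ring.
        rewrite !Cmod_mult, Cmod_gamma_profile, Cmod_RtoC_nonneg by (left; apply exp_pos).
        assert (K1 := abel_kernel eps (x - exp t) Y He ltac:(lra)). fold w in K1.
        assert (K2 : exp t * (exp ((Re s - 1) * t - c * exp t) * exp (c * x)) <= Kl * pow_weight 2 t * exp (c * x)).
        { rewrite <- Rmult_assoc, <- exp_plus. apply Rmult_le_compat_r; [lra|].
          replace (t + ((Re s - 1) * t - c * exp t)) with (Re s * t - c * exp t) by ring.
          apply (exp_exp_bound (Re s) c t Hs Hc). }
        replace (w * exp (c * x) * (Kl * pow_weight 2 t)) with (Kl * pow_weight 2 t * exp (c * x) * w) by ring.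
        apply Rmult_le_compat; auto; [|apply Cmod_ge_0].
        assert (X := exp_pos t). assert (X' := exp_pos ((Re s - 1) * t - c * exp t)).
        apply Rmult_le_pos; [lra|]. apply Rmult_le_pos; lra.
      + apply (is_RInt_scal (V := R_NormedModule)). apply RInt_dom_correct, Hdom.
    - rewrite Rmult_assoc. apply Rmult_le_compat_l; [exact Hw|]. apply Rmult_le_compat_l; [lra|]. apply Hb. lra. }
  rewrite <- F in E2.
  assert (T := Cmod_minus_triangle (CGamma s * CRInt brom (- Y) Y) X1 (CRInt prof (- A) A)).
  lra.
Qed.

Lemma gamma_inversion (s : C) (x c : R) : 1 < Re s -> 0 < x -> 1 <= c ->
  exists J, line_int (bromwich s x c) J /\
    (CGamma s * J)%C = (RtoC (2 * PI) * Cexp ((s - 1) * RtoC (ln x)))%C.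
Proof.
  intros Hs Hx Hc.
  set (K := exp (Rabs (Im s) * (PI / 2)) * exp (c * x)).
  assert (HK : 0 <= K) by (unfold K; left; apply Rmult_lt_0_compat; apply exp_pos).
  assert (Cb : forall y, ccont (bromwich s x c) y) by (intros; apply ccont_bromwich; lra).
  assert (Bb : forall y, Cmod (bromwich s x c y) <= K * pow_weight (Re s) y) by (intros; apply Cmod_bromwich_le; lra).
  destruct (line_int_exists (bromwich s x c) (fun t => K * pow_weight (Re s) t) Cb) as [J HJ]; [|exact Bb|].
  { apply integrable_dom_scal; [exact HK|]. now apply pow_weight_integrable. }
  exists J. split; [exact HJ|].
  apply Cmod_small_eq. intros eta Heta.
  set (G := Cmod (CGamma s)). assert (HG : 0 <= G) by apply Cmod_ge_0.
  destruct (gamma_profile_bounded s x c Hs ltac:(lra)) as [Bq HBq].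
  destruct (gamma_fubini s x c Hs ltac:(lra)) as [K3 [HK3 HF]].
  destruct (poisson_approx_identity (gamma_profile s x c) x Bq Hx (fun t => ccont_gamma_profile s x c t) HBq (eta / 5) ltac:(lra))
    as [e1 [A1 [He1 [HA1 HP]]]].
  destruct (abel_summation (bromwich s x c) K (Re s) Hs HK Cb Bb (eta / 5 / (G + 1))) as [e2 [He2 HA2]].
  { apply Rdiv_lt_0_compat; lra. }
  set (e := Rmin e1 e2).
  assert (He : 0 < e) by now apply Rmin_pos.
  assert (Le1 : e <= e1) by apply Rmin_l. assert (Le2 : e <= e2) by apply Rmin_r.
  destruct (HJ (eta / 5 / (G + 1)) ltac:(apply Rdiv_lt_0_compat; lra)) as [Y1 [HY1 HJ1]].
  set (v := eta / 5 * e / (2 * K3 + 1)).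
  assert (Hv : 0 < v) by (apply Rdiv_lt_0_compat; nra).
  set (Y := Rmax (Y1 + 1) (- ln v / e)).
  assert (HYa : Y1 + 1 <= Y) by apply Rmax_l. assert (HYb : - ln v / e <= Y) by apply Rmax_r.
  assert (Hexp : exp (- (e * Y)) <= v).
  { rewrite <- (exp_ln v Hv). apply exp_le_mono. apply Rle_div_l in HYb; lra. }
  assert (Hk : 2 * exp (- (e * Y)) / e * K3 <= eta / 5).
  { apply Rle_trans with (2 * v / e * K3).
    - apply Rmult_le_compat_r; [exact HK3|]. apply Rmult_le_compat_r; [left; now apply Rinv_0_lt_compat|lra].
    - unfold v. replace (2 * (eta / 5 * e / (2 * K3 + 1)) / e * K3) with (2 * K3 * (eta / 5 / (2 * K3 + 1))) by (field; lra).
      apply Rmult_div_small; lra. }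
  destruct (HF e Y (eta / 5) He ltac:(lra) ltac:(lra)) as [A2 HF2].
  set (A := Rmax A1 A2).
  assert (LA1 : A1 <= A) by apply Rmax_l. assert (LA2 : A2 <= A) by apply Rmax_r.
  specialize (HF2 A LA2). specialize (HP e (- A) A He Le1 ltac:(lra) LA1).
  specialize (HA2 e Y ltac:(lra) ltac:(lra)). specialize (HJ1 (- Y) Y ltac:(lra) ltac:(lra)).
  assert (PV : gamma_profile s x c (ln x) = Cexp ((s - 1) * RtoC (ln x))).
  { unfold gamma_profile. rewrite exp_ln by exact Hx. rewrite Rminus_diag, Rmult_0_r, Cexp_0. ring. }
  rewrite PV in HP.
  set (Ib := CRInt (bromwich s x c) (- Y) Y) in *.
  set (Ia := CRInt (fun y => RtoC (abel e y) * bromwich s x c y)%C (- Y) Y) in *.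
  set (Ip := CRInt (fun t => RtoC (exp t * poisson e (x - exp t)) * gamma_profile s x c t)%C (- A) A) in *.
  set (V := (RtoC (2 * PI) * Cexp ((s - 1) * RtoC (ln x)))%C) in *.
  replace (CGamma s * J - V)%C
    with ((CGamma s * Ia - Ip) + (Ip - V) + (CGamma s * (Ib - Ia) + CGamma s * - (Ib - J)))%C by ring.
  eapply Rle_trans; [apply Cmod_triangle|].
  assert (T1 := Cmod_triangle (CGamma s * Ia - Ip) (Ip - V)).
  assert (T2 := Cmod_triangle (CGamma s * (Ib - Ia)) (CGamma s * - (Ib - J))).
  rewrite !Cmod_mult, Cmod_opp in T2. fold G in T2.
  assert (W1 : G * Cmod (Ib - Ia) <= eta / 5).
  { eapply Rle_trans; [|apply (Rmult_div_small G (eta / 5)); lra]. apply Rmult_le_compat_l; lra. }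
  assert (W2 : G * Cmod (Ib - J) <= eta / 5).
  { eapply Rle_trans; [|apply (Rmult_div_small G (eta / 5)); lra]. apply Rmult_le_compat_l; lra. }
  lra.
Qed.

(** * Fourier series *)

Definition fourier_mode (m : Z) (u : R) : C := Cexp (RtoC (2 * PI * IZR m * u) * Ci).

Lemma fourier_mode_add (m n : Z) (u : R) :
  (fourier_mode m u * fourier_mode n u)%C = fourier_mode (m + n) u.
Proof.
  unfold fourier_mode. rewrite <- Cexp_add, plus_IZR. f_equal.
  rewrite <- Cmult_plus_distr_r, <- RtoC_plus. f_equal. f_equal. ring.
Qed.

Lemma fourier_mode_0 (u : R) : fourier_mode 0 u = 1%C.
Proof. unfold fourier_mode. rewrite Rmult_0_r, Rmult_0_l, Cmult_0_l. apply Cexp_0. Qed.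

Lemma Cmod_fourier_mode (m : Z) (u : R) : Cmod (fourier_mode m u) = 1.
Proof.
  unfold fourier_mode. rewrite Cmod_Cexp. rewrite <- exp_0. f_equal.
  unfold Re, RtoC, Ci; simpl. ring.
Qed.

Lemma fourier_mode_periodic (m : Z) (u : R) : fourier_mode m (u + 1) = fourier_mode m u.
Proof.
  unfold fourier_mode. rewrite Rmult_plus_distr_l, Rmult_1_r, RtoC_plus, Cmult_plus_distr_r, Cexp_add.
  rewrite Cexp_2PI. ring.
Qed.

Lemma ccont_fourier_mode (m : Z) (u : R) : ccont (fourier_mode m) u.
Proof.
  apply ccont_Cexp. apply ccont_mult; [|apply ccont_const]. apply ccont_RtoC.
  apply (ex_derive_continuous (fun u => 2 * PI * IZR m * u)). auto_derive. auto.
Qed.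

Lemma CRInt_ext_all (f g : R -> C) (a b : R) : (forall t, f t = g t) -> CRInt f a b = CRInt g a b.
Proof. intros E. apply (@RInt_ext C_R_CompleteNormedModule). intros x _. apply E. Qed.

Lemma CRInt_translate (f : R -> C) (v a b : R) : (forall x, ccont f x) ->
  CRInt (fun t => f (t + v)) a b = CRInt f (a + v) (b + v).
Proof. intros Cf. apply CRInt_unique, is_CRInt_shift, CRInt_correct; auto. Qed.

Lemma CRInt_period (f : R -> C) (a : R) : (forall x, ccont f x) -> (forall t, f (t + 1) = f t) ->
  CRInt f a (a + 1) = CRInt f 0 1.
Proof.
  intros Cf Hp.
  assert (E : CRInt f 1 (a + 1) = CRInt f 0 a).
  { rewrite <- (Rplus_0_l 1) at 1. rewrite <- (CRInt_translate f 1 0 a Cf).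
    apply CRInt_ext_all. exact Hp. }
  assert (A := CRInt_Chasles f 0 1 (a + 1) Cf). assert (B := CRInt_Chasles f 0 a (a + 1) Cf).
  rewrite E in A. rewrite A in B.
  replace (CRInt f a (a + 1)) with (CRInt f 0 a + CRInt f a (a + 1) - CRInt f 0 a)%C by ring.
  rewrite <- B. ring.
Qed.

Lemma CRInt_scal_eq (c : C) (f : R -> C) (a b : R) : (forall x, ccont f x) ->
  CRInt (fun t => c * f t)%C a b = (c * CRInt f a b)%C.
Proof. intros Cf. apply CRInt_unique, is_CRInt_scal, CRInt_correct; auto. Qed.

Lemma CRInt_plus_eq (f g : R -> C) (a b : R) : (forall x, ccont f x) -> (forall x, ccont g x) ->
  CRInt (fun t => f t + g t)%C a b = (CRInt f a b + CRInt g a b)%C.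
Proof. intros Cf Cg. apply CRInt_unique, is_CRInt_plus; apply CRInt_correct; auto. Qed.

Definition sqr_cos (x u : R) : R := cos (PI * (u - x)) ^ 2.

Lemma sqr_cos_modes (x u : R) :
  RtoC (sqr_cos x u) = (/ RtoC 4 * (2 + fourier_mode (-1) x * fourier_mode 1 u + fourier_mode 1 x * fourier_mode (-1) u))%C.
Proof.
  unfold fourier_mode. rewrite <- !Cexp_add.
  replace (RtoC (2 * PI * -1 * x) * Ci + RtoC (2 * PI * 1 * u) * Ci)%C with (RtoC (2 * (PI * (u - x))) * Ci)%C.
  2:{ rewrite <- Cmult_plus_distr_r, <- RtoC_plus. f_equal. f_equal. ring. }
  replace (RtoC (2 * PI * 1 * x) * Ci + RtoC (2 * PI * -1 * u) * Ci)%C with (- (RtoC (2 * (PI * (u - x))) * Ci))%C.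
  2:{ replace (- (RtoC (2 * (PI * (u - x))) * Ci))%C with (RtoC (- (2 * (PI * (u - x)))) * Ci)%C by (rewrite RtoC_opp; ring).
      rewrite <- Cmult_plus_distr_r, <- RtoC_plus. f_equal. f_equal. ring. }
  unfold sqr_cos. set (v := PI * (u - x)).
  unfold Cexp, RtoC, Ci, Re, Im, Cmult, Cplus, Copp, Cinv; simpl.
  replace (2 * v * 0 - 0 * 1) with 0 by ring. replace (2 * v * 1 + 0 * 0) with (2 * v) by ring.
  rewrite Ropp_0, exp_0, cos_neg, sin_neg, cos_2a_cos. f_equal; field.
Qed.

Lemma sqr_cos_periodic (x u : R) : sqr_cos x (u + 1) = sqr_cos x u.
Proof.
  unfold sqr_cos. replace (PI * (u + 1 - x)) with (PI * (u - x) + PI) by ring.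
  rewrite neg_cos. ring.
Qed.

Lemma sqr_cos_continuous (x u : R) : continuous (sqr_cos x) u.
Proof. apply (ex_derive_continuous (sqr_cos x)). unfold sqr_cos. auto_derive. auto. Qed.

Lemma fourier_trig_zero (D : R -> C) (x : R) : (forall u, ccont D u) ->
  (forall m, CRInt (fun u => D u * fourier_mode m u)%C 0 1 = 0%C) ->
  forall N m, CRInt (fun u => D u * RtoC (sqr_cos x u) ^ N * fourier_mode m u)%C 0 1 = 0%C.
Proof.
  intros CD H.
  assert (CN : forall N u, ccont (fun u => D u * RtoC (sqr_cos x u) ^ N)%C u).
  { intros N u. apply ccont_mult; [apply CD|]. apply (ccont_pow (fun u => RtoC (sqr_cos x u))).
    apply ccont_RtoC, sqr_cos_continuous. }
  assert (CM : forall N m u, ccont (fun u => D u * RtoC (sqr_cos x u) ^ N * fourier_mode m u)%C u).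
  { intros N m u. apply ccont_mult; [apply CN|apply ccont_fourier_mode]. }
  induction N as [|N IH]; intros m.
  - rewrite <- (H m). apply CRInt_ext_all. intros t. simpl. ring.
  - rewrite (CRInt_ext_all _ (fun u => / RtoC 4 * 2 * (D u * RtoC (sqr_cos x u) ^ N * fourier_mode m u)
       + (/ RtoC 4 * fourier_mode (-1) x * (D u * RtoC (sqr_cos x u) ^ N * fourier_mode (1 + m) u)
          + / RtoC 4 * fourier_mode 1 x * (D u * RtoC (sqr_cos x u) ^ N * fourier_mode (-1 + m) u)))%C).
    + rewrite CRInt_plus_eq, CRInt_plus_eq, !CRInt_scal_eq, !IH; intros; auto.
      * ring.
      * apply ccont_scal, CM.
      * apply ccont_scal, CM.
      * apply ccont_scal, CM.
      * apply ccont_plus; apply ccont_scal, CM.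
    + intros u. rewrite Cpow_S, sqr_cos_modes at 1. rewrite <- !fourier_mode_add. ring.
Qed.

(* Powers of [cos^2 (PI (u - x))] form a positive summability kernel made of trigonometric polynomials. *)
Lemma fourier_unique (D : R -> C) (B : R) : (forall u, ccont D u) -> (forall u, D (u + 1) = D u) ->
  (forall u, Cmod (D u) <= B) ->
  (forall m, CRInt (fun u => D u * fourier_mode m u)%C 0 1 = 0%C) ->
  forall x, D x = 0%C.
Proof.
  intros CD HP HB H x. assert (PP := PI_RGT_0).
  assert (HB0 : 0 <= B) by (eapply Rle_trans; [apply Cmod_ge_0|apply (HB 0)]).
  assert (Goal0 : forall eta, 0 < eta -> Cmod (D x) <= eta).
  { intros eta Heta.
    destruct (CD x (eta / 2) ltac:(lra)) as [d' [Hd' Hc]].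
    set (d := Rmin (d' / 2) (1 / 4)).
    assert (Hd : 0 < d) by (apply Rmin_pos; lra).
    assert (Hd1 : d <= d' / 2) by apply Rmin_l. assert (Hd2 : d <= 1 / 4) by apply Rmin_r.
    assert (Cos : forall a b, 0 <= a <= b -> b <= 1 / 2 -> cos (PI * b) <= cos (PI * a)).
    { intros a b Ha Hb. apply cos_decr_1; nra. }
    assert (C1 : 0 < cos (PI * d)) by (apply cos_gt_0; nra).
    assert (C2 : cos (PI * d) < cos (PI * (d / 2))) by (apply cos_decreasing_1; nra).
    set (tau := cos (PI * d) ^ 2). assert (Htau : 0 < tau) by (unfold tau; apply pow_lt; lra).
    set (r := cos (PI * (d / 2)) ^ 2 / tau).
    assert (Hr : 1 < r). { unfold r. apply (Rlt_div_r 1); [exact Htau|]. unfold tau. nra. }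
    assert (Sq : forall u, sqr_cos x u = cos (PI * Rabs (u - x)) ^ 2).
    { intros u. unfold sqr_cos. destruct (Rle_dec 0 (u - x)) as [h|h].
      - now rewrite Rabs_pos_eq.
      - rewrite Rabs_left1 by lra. replace (PI * - (u - x)) with (- (PI * (u - x))) by ring. now rewrite cos_neg. }
    set (k := fun u => sqr_cos x u / tau).
    assert (k0 : forall u, 0 <= k u).
    { intros u. apply Rmult_le_pos; [apply pow2_ge_0|left; now apply Rinv_0_lt_compat]. }
    assert (kout : forall u, d <= Rabs (u - x) <= 1 / 2 -> k u <= 1).
    { intros u Hu. unfold k. apply Rle_div_l; [exact Htau|]. rewrite Rmult_1_l, Sq. unfold tau.
      apply pow_incr. split; [|apply Cos; lra].
      assert (cos (PI * (1 / 2)) <= cos (PI * Rabs (u - x))) by (apply Cos; lra).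
      replace (PI * (1 / 2)) with (PI / 2) in * by field. rewrite cos_PI2 in *. lra. }
    assert (kin : forall u, Rabs (u - x) <= d / 2 -> r <= k u).
    { intros u Hu. unfold k, r. apply Rmult_le_compat_r; [left; now apply Rinv_0_lt_compat|].
      rewrite Sq. apply pow_incr. split; [lra|]. apply Cos; [|lra]. split; [apply Rabs_pos|exact Hu]. }
    assert (Ck : forall N u, continuous (fun u => k u ^ N) u).
    { intros N u. apply (ex_derive_continuous (fun u => k u ^ N)). unfold k, sqr_cos. auto_derive. auto. }
    destruct (pow_unbounded r (2 * B / (d * (eta / 2))) Hr) as [N HN].
    assert (Ik := fun a b => RInt_dom_correct (fun u => k u ^ N) a b (Ck N)).
    set (S := RInt (fun u => k u ^ N) (x - 1 / 2) (x + 1 / 2)) in *.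
    assert (HS : d * r ^ N <= S).
    { unfold S.
      assert (Ch : S = RInt (fun u => k u ^ N) (x - 1 / 2) (x - d / 2) + (RInt (fun u => k u ^ N) (x - d / 2) (x + d / 2)
                   + RInt (fun u => k u ^ N) (x + d / 2) (x + 1 / 2))).
      { unfold S. rewrite <- (RInt_Chasles (V := R_CompleteNormedModule) _ (x - 1 / 2) (x - d / 2) (x + 1 / 2)) by (eexists; apply Ik).
        rewrite <- (RInt_Chasles (V := R_CompleteNormedModule) _ (x - d / 2) (x + d / 2) (x + 1 / 2)) by (eexists; apply Ik).
        reflexivity. }
      fold S. rewrite Ch.
      assert (G : forall a b, a <= b -> 0 <= RInt (fun u => k u ^ N) a b).
      { intros a b Hab. apply RInt_ge_0; [exact Hab|eexists; apply Ik|]. intros. now apply pow_le. }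
      assert (G1 := G (x - 1 / 2) (x - d / 2) ltac:(lra)). assert (G2 := G (x + d / 2) (x + 1 / 2) ltac:(lra)).
      assert (G3 : d * r ^ N <= RInt (fun u => k u ^ N) (x - d / 2) (x + d / 2)).
      { replace (d * r ^ N) with (RInt (fun _ => r ^ N) (x - d / 2) (x + d / 2)).
        - apply RInt_le; [lra|eexists; apply (is_RInt_const (V := R_NormedModule))|eexists; apply Ik|].
          intros u Hu. apply pow_incr. split; [lra|]. apply kin. apply Rabs_le. lra.
        - rewrite (RInt_const (V := R_CompleteNormedModule)). unfold scal; simpl. unfold mult; simpl. field. }
      lra. }
    set (h := fun u => (D u * RtoC (k u) ^ N)%C).
    assert (Ckk : forall u, ccont (fun u => RtoC (k u) ^ N)%C u).
    { intros u. apply (ccont_ext (fun u => RtoC (k u ^ N))); [intros; apply RtoC_pow|]. apply ccont_RtoC, Ck. }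
    assert (Chh : forall u, ccont h u) by (intros u; apply ccont_mult; auto).
    assert (Z : CRInt h (x - 1 / 2) (x + 1 / 2) = 0%C).
    { replace (x + 1 / 2) with (x - 1 / 2 + 1) by field. rewrite (CRInt_period h (x - 1 / 2) Chh).
      - assert (F := fourier_trig_zero D x CD H N 0).
        rewrite (CRInt_ext_all h (fun u => / RtoC tau ^ N * (D u * RtoC (sqr_cos x u) ^ N * fourier_mode 0 u))%C).
        + rewrite CRInt_scal_eq, F; [ring|]. intros u.
          apply ccont_mult; [|apply ccont_fourier_mode]. apply ccont_mult; [apply CD|].
          apply (ccont_pow (fun u => RtoC (sqr_cos x u))), ccont_RtoC, sqr_cos_continuous.
        + intros u. unfold h, k. rewrite fourier_mode_0. rewrite RtoC_div by lra.
          unfold Cdiv. rewrite Cpow_mult_l, Cpow_inv; [ring|]. intros E. injection E. lra.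
      - intros u. unfold h, k. now rewrite HP, sqr_cos_periodic. }
    assert (I : is_CRInt (fun u => D x * RtoC (k u) ^ N - h u)%C (x - 1 / 2) (x + 1 / 2) (D x * RtoC S - 0)%C).
    { apply is_CRInt_minus.
      - apply is_CRInt_scal. apply (is_CRInt_ext (fun u => RtoC (k u ^ N))); [intros; apply RtoC_pow|].
        apply is_CRInt_RtoC, Ik.
      - rewrite <- Z. apply CRInt_correct; auto. }
    assert (Bd : Cmod (D x * RtoC S - 0) <= eta / 2 * S + 2 * B).
    { apply (is_CRInt_norm_le _ (fun u => eta / 2 * k u ^ N + 2 * B) (x - 1 / 2) (x + 1 / 2) _ _ ltac:(lra)) with (2 := I).
      - intros u Hu. unfold h.
        replace (D x * RtoC (k u) ^ N - D u * RtoC (k u) ^ N)%C with ((D x - D u) * RtoC (k u) ^ N)%C by ring.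
        rewrite Cmod_mult, Cmod_pow, Cmod_RtoC_nonneg by auto.
        assert (P : 0 <= k u ^ N) by now apply pow_le.
        assert (A := Cmod_minus_le (D x) (D u)). assert (A1 := HB x). assert (A2 := HB u).
        destruct (Rlt_dec (Rabs (u - x)) d) as [h1|h1].
        + assert (Cmod (D x - D u) <= eta / 2) by (rewrite Cmod_minus_sym; left; apply Hc; lra).
          assert (Cmod (D x - D u) * k u ^ N <= eta / 2 * k u ^ N) by (apply Rmult_le_compat_r; lra). lra.
        + assert (K1 : k u ^ N <= 1).
          { rewrite <- (pow1 N). apply pow_incr. split; [auto|]. apply kout. split; [lra|]. apply Rabs_le. lra. }
          assert (X := Cmod_ge_0 (D x - D u)). nra.
      - apply (is_RInt_plus (V := R_NormedModule)).
        + apply (is_RInt_scal (V := R_NormedModule)). apply Ik.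
        + assert (Q := is_RInt_const (V := R_NormedModule) (x - 1 / 2) (x + 1 / 2) (2 * B)).
          change (scal (x + 1 / 2 - (x - 1 / 2)) (2 * B)) with ((x + 1 / 2 - (x - 1 / 2)) * (2 * B)) in Q.
          replace ((x + 1 / 2 - (x - 1 / 2)) * (2 * B)) with (2 * B) in Q by field. exact Q. }
    assert (RN : 0 < r ^ N) by (apply pow_lt; lra).
    assert (SP : 0 < S) by nra.
    replace (D x * RtoC S - 0)%C with (D x * RtoC S)%C in Bd by ring.
    rewrite Cmod_mult, Cmod_RtoC_nonneg in Bd by lra.
    assert (F : 2 * B <= eta / 2 * S).
    { apply Rle_div_l in HN; [|nra]. nra. }
    apply (Rmult_le_reg_r S); [exact SP|]. lra. }
  apply Cmod_small_eq. intros eta Heta. replace (D x - 0)%C with (D x) by ring. auto.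
Qed.

Lemma is_Cseries_single (a : nat -> C) (k0 : nat) : (forall k, k <> k0 -> a k = 0%C) -> is_Cseries a (a k0).
Proof.
  intros H. apply is_series_Clim. intros eps He. exists k0. intros n Hn.
  assert (S : forall n, (@sum_n C_AbelianMonoid a n : C) = if le_dec k0 n then a k0 else RtoC 0).
  { induction n0 as [|j IH].
    - rewrite sum_n_C_O. destruct (le_dec k0 0) as [h|h].
      + now replace k0 with O by lia.
      + apply H. lia.
    - rewrite sum_n_C_Sn, IH. destruct (le_dec k0 j) as [h|h]; destruct (le_dec k0 (S j)) as [h'|h']; try lia.
      + rewrite (H (S j)) by lia. ring.
      + replace k0 with (S j) by lia. ring.
      + rewrite (H (S j)) by lia. ring. }
  rewrite S. destruct (le_dec k0 n); [|lia]. now rewrite Cminus_diag_0.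
Qed.

Lemma is_Cseries_zero (a : nat -> C) : (forall k, a k = 0%C) -> is_Cseries a (RtoC 0).
Proof. intros H. rewrite <- (H O) at 1. apply is_Cseries_single. auto. Qed.

Lemma ccont_series (f : nat -> R -> C) (F : R -> C) (a : nat -> R) (x : R) :
  (forall k t, Cmod (f k t) <= a k) -> ex_series a -> (forall k, ccont (f k) x) ->
  (forall t, is_Cseries (fun k => f k t) (F t)) -> ccont F x.
Proof.
  intros Hb [A HA] Cf HF eps He.
  assert (Ha : forall k, 0 <= a k) by (intros k; eapply Rle_trans; [apply Cmod_ge_0|apply (Hb k x)]).
  destruct (is_series_remainder a A Ha HA (eps / 4) ltac:(lra)) as [N HN].
  specialize (HN N ltac:(lia)).
  assert (CS : ccont (fun t => @sum_n C_AbelianMonoid (fun k => f k t) N) x).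
  { clear HN. induction N as [|N IH].
    - apply (ccont_ext (f O)); [|apply Cf]. intros y. symmetry. exact (sum_n_C_O (fun k => f k y)).
    - apply (ccont_ext (fun t => @sum_n C_AbelianMonoid (fun k => f k t) N + f (S N) t)%C).
      + intros y. symmetry. exact (sum_n_C_Sn (fun k => f k y) N).
      + apply ccont_plus; auto. }
  destruct (CS (eps / 4) ltac:(lra)) as [d [Hd Hc]]. exists d. split; [exact Hd|].
  intros y Hy. specialize (Hc y Hy).
  assert (R1 := Cmod_series_remainder (fun k => f k y) a (F y) A N (fun k => Hb k y) (HF y) HA).
  assert (R2 := Cmod_series_remainder (fun k => f k x) a (F x) A N (fun k => Hb k x) (HF x) HA).
  assert (T1 := Cmod_minus_triangle (F y) (@sum_n C_AbelianMonoid (fun k => f k y) N) (F x)).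
  assert (T2 := Cmod_minus_triangle (@sum_n C_AbelianMonoid (fun k => f k y) N) (@sum_n C_AbelianMonoid (fun k => f k x) N) (F x)).
  rewrite (Cmod_minus_sym (@sum_n C_AbelianMonoid (fun k => f k x) N) (F x)) in T2. lra.
Qed.

Lemma CRInt_series (f : nat -> R -> C) (F : R -> C) (a : nat -> R) (u v : R) : u <= v ->
  (forall k t, Cmod (f k t) <= a k) -> ex_series a -> (forall k x, ccont (f k) x) ->
  (forall t, is_Cseries (fun k => f k t) (F t)) ->
  is_Cseries (fun k => CRInt (f k) u v) (CRInt F u v).
Proof.
  intros Huv Hb Ea Cf HF.
  assert (CF : forall x, ccont F x) by (intros x; apply (ccont_series f F a x Hb Ea); auto).
  destruct Ea as [A HA].
  assert (Ha : forall k, 0 <= a k) by (intros k; eapply Rle_trans; [apply Cmod_ge_0|apply (Hb k u)]).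
  assert (IS : forall n, is_CRInt (fun t => @sum_n C_AbelianMonoid (fun k => f k t) n) u v
                 (@sum_n C_AbelianMonoid (fun k => CRInt (f k) u v) n)).
  { induction n as [|n IH].
    - rewrite sum_n_C_O. apply (is_CRInt_ext (f O)).
      + intros x _. symmetry. exact (sum_n_C_O (fun k => f k x)).
      + apply CRInt_correct; auto.
    - rewrite sum_n_C_Sn. apply (is_CRInt_ext (fun t => @sum_n C_AbelianMonoid (fun k => f k t) n + f (S n) t)%C).
      + intros x _. symmetry. exact (sum_n_C_Sn (fun k => f k x) n).
      + apply is_CRInt_plus; [exact IH|]. apply CRInt_correct; auto. }
  apply is_series_Clim. intros eps He.
  destruct (is_series_remainder a A Ha HA (eps / (2 * (v - u + 1))) ltac:(apply Rdiv_lt_0_compat; lra)) as [N HN].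
  exists N. intros n Hn. specialize (HN n Hn).
  assert (I := is_CRInt_minus _ _ _ _ _ _ (CRInt_correct F u v (fun x _ => CF x)) (IS n)).
  rewrite Cmod_minus_sym.
  eapply Rle_lt_trans.
  - apply (is_CRInt_norm_le_const _ u v (eps / (2 * (v - u + 1))) _ Huv) with (2 := I).
    intros t _. eapply Rle_trans; [|apply HN].
    apply (Cmod_series_remainder (fun k => f k t) a (F t) A n); auto.
  - replace ((v - u) * (eps / (2 * (v - u + 1)))) with (eps / 2 * ((v - u) / (v - u + 1))) by (field; lra).
    assert ((v - u) / (v - u + 1) <= 1) by (apply Rle_div_l; lra). nra.
Qed.

Lemma fourier_orthogonality (m : Z) : CRInt (fourier_mode m) 0 1 = if Z.eq_dec m 0 then 1%C else 0%C.
Proof.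
  destruct (Z.eq_dec m 0) as [->|Hm].
  - rewrite (CRInt_ext_all _ (fun _ => 1%C)) by apply fourier_mode_0.
    rewrite (CRInt_unique _ _ _ _ (is_CRInt_const 1 0 1)). rewrite Rminus_0_r. ring.
  - (* translating by 1/(2m) changes the sign of the integrand *)
    assert (Nz : IZR m <> 0) by now apply eq_IZR_contrapositive.
    assert (E : CRInt (fourier_mode m) 0 1 = (- CRInt (fourier_mode m) 0 1)%C).
    { rewrite <- (CRInt_period (fourier_mode m) (/ (2 * IZR m)) (ccont_fourier_mode m) (fourier_mode_periodic m)) at 1.
      rewrite <- (Rplus_0_l (/ (2 * IZR m))) at 1. rewrite (Rplus_comm _ 1).
      rewrite <- (CRInt_translate (fourier_mode m) _ 0 1 (ccont_fourier_mode m)).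
      rewrite (CRInt_ext_all _ (fun u => (- (1)) * fourier_mode m u)%C).
      - rewrite CRInt_scal_eq by apply ccont_fourier_mode. ring.
      - intros u. unfold fourier_mode.
        replace (2 * PI * IZR m * (u + / (2 * IZR m))) with (2 * PI * IZR m * u + PI) by (field; exact Nz).
        rewrite RtoC_plus, Cmult_plus_distr_r, Cexp_add.
        replace (Cexp (RtoC PI * Ci)) with (- (1))%C; [ring|].
        unfold Cexp, RtoC, Ci, Re, Im, Cmult, Copp; simpl.
        replace (PI * 0 - 0 * 1) with 0 by ring. replace (PI * 1 + 0 * 0) with PI by ring.
        rewrite exp_0, cos_PI, sin_PI. f_equal; ring. }
    set (I := CRInt (fourier_mode m) 0 1) in *.
    replace I with (/ RtoC 2 * (I + I))%C by field. rewrite E at 1. ring.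
Qed.

Lemma fourier_half_coeff (iota : nat -> Z) (c : nat -> C) (a : nat -> R) (F : R -> C) (m : Z) :
  (forall k, Cmod (c k) <= a k) -> ex_series a ->
  (forall t, is_Cseries (fun k => c k * fourier_mode (iota k) t)%C (F t)) ->
  is_Cseries (fun k => if Z.eq_dec (iota k + m) 0 then c k else RtoC 0)
    (CRInt (fun u => F u * fourier_mode m u)%C 0 1).
Proof.
  intros Hc Ea HF.
  apply (is_Cseries_ext (fun k => CRInt (fun u => c k * fourier_mode (iota k + m) u)%C 0 1)).
  - intros k. rewrite CRInt_scal_eq by apply ccont_fourier_mode. rewrite fourier_orthogonality.
    destruct (Z.eq_dec (iota k + m) 0); ring.
  - apply (CRInt_series _ _ a); [lra| |exact Ea| |].
    + intros k t. rewrite Cmod_mult, Cmod_fourier_mode, Rmult_1_r. apply Hc.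
    + intros k x. apply ccont_scal, ccont_fourier_mode.
    + intros t. apply (is_Cseries_ext (fun k => fourier_mode m t * (c k * fourier_mode (iota k) t))%C).
      * intros k. rewrite <- fourier_mode_add. ring.
      * rewrite Cmult_comm. apply is_Cseries_scal, HF.
Qed.

Lemma fourier_expansion (g : R -> C) (B : R) (th : Z -> C) (a : nat -> R) :
  (forall u, ccont g u) -> (forall u, g (u + 1) = g u) -> (forall u, Cmod (g u) <= B) ->
  (forall m, th m = CRInt (fun u => g u * fourier_mode (- m) u)%C 0 1) ->
  ex_series a -> (forall k, Cmod (th (Z.of_nat k)) <= a k) -> (forall k, Cmod (th (- Z.of_nat (S k))%Z) <= a k) ->
  forall u, exists l1 l2,
    is_Cseries (fun k => th (Z.of_nat k) * fourier_mode (Z.of_nat k) u)%C l1 /\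
    is_Cseries (fun k => th (- Z.of_nat (S k))%Z * fourier_mode (- Z.of_nat (S k)) u)%C l2 /\
    g u = (l1 + l2)%C.
Proof.
  intros Cg Pg Bg Hth Ea H1 H2.
  assert (Ex1 : forall u, exists l, is_Cseries (fun k => th (Z.of_nat k) * fourier_mode (Z.of_nat k) u)%C l).
  { intros u. apply (ex_Cseries_le _ a); [|exact Ea]. intros n.
    rewrite Cmod_mult, Cmod_fourier_mode, Rmult_1_r. apply H1. }
  assert (Ex2 : forall u, exists l, is_Cseries (fun k => th (- Z.of_nat (S k))%Z * fourier_mode (- Z.of_nat (S k)) u)%C l).
  { intros u. apply (ex_Cseries_le _ a); [|exact Ea]. intros n.
    rewrite Cmod_mult, Cmod_fourier_mode, Rmult_1_r. apply H2. }
  set (F1 := fun u => CSeries (fun k => th (Z.of_nat k) * fourier_mode (Z.of_nat k) u)%C).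
  set (F2 := fun u => CSeries (fun k => th (- Z.of_nat (S k))%Z * fourier_mode (- Z.of_nat (S k)) u)%C).
  assert (S1 : forall u, is_Cseries (fun k => th (Z.of_nat k) * fourier_mode (Z.of_nat k) u)%C (F1 u)).
  { intros u. destruct (Ex1 u) as [l Hl]. unfold F1. now rewrite (CSeries_unique _ _ Hl). }
  assert (S2 : forall u, is_Cseries (fun k => th (- Z.of_nat (S k))%Z * fourier_mode (- Z.of_nat (S k)) u)%C (F2 u)).
  { intros u. destruct (Ex2 u) as [l Hl]. unfold F2. now rewrite (CSeries_unique _ _ Hl). }
  assert (C1 : forall u, ccont F1 u).
  { intros u. apply (ccont_series (fun k t => th (Z.of_nat k) * fourier_mode (Z.of_nat k) t)%C F1 a); auto.
    - intros k t. rewrite Cmod_mult, Cmod_fourier_mode, Rmult_1_r. apply H1.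
    - intros k. apply ccont_scal, ccont_fourier_mode. }
  assert (C2 : forall u, ccont F2 u).
  { intros u. apply (ccont_series (fun k t => th (- Z.of_nat (S k))%Z * fourier_mode (- Z.of_nat (S k)) t)%C F2 a); auto.
    - intros k t. rewrite Cmod_mult, Cmod_fourier_mode, Rmult_1_r. apply H2.
    - intros k. apply ccont_scal, ccont_fourier_mode. }
  assert (P1 : forall u, F1 (u + 1) = F1 u).
  { intros u. apply (is_Cseries_unique _ _ _ (S1 (u + 1))).
    apply (is_Cseries_ext (fun k => th (Z.of_nat k) * fourier_mode (Z.of_nat k) u)%C); [|apply S1].
    intros n. now rewrite fourier_mode_periodic. }
  assert (P2 : forall u, F2 (u + 1) = F2 u).
  { intros u. apply (is_Cseries_unique _ _ _ (S2 (u + 1))).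
    apply (is_Cseries_ext (fun k => th (- Z.of_nat (S k))%Z * fourier_mode (- Z.of_nat (S k)) u)%C); [|apply S2].
    intros n. now rewrite fourier_mode_periodic. }
  destruct Ea as [A HA].
  assert (B1 : forall u, Cmod (F1 u) <= A).
  { intros u. apply (Cmod_series_le _ a _ _) with (2 := S1 u) (3 := HA).
    intros n. rewrite Cmod_mult, Cmod_fourier_mode, Rmult_1_r. apply H1. }
  assert (B2 : forall u, Cmod (F2 u) <= A).
  { intros u. apply (Cmod_series_le _ a _ _) with (2 := S2 u) (3 := HA).
    intros n. rewrite Cmod_mult, Cmod_fourier_mode, Rmult_1_r. apply H2. }
  set (D := fun u => (g u + (- (1)) * (F1 u + F2 u))%C).
  assert (CF : forall u, ccont (fun u => F1 u + F2 u)%C u) by (intros u; apply ccont_plus; auto).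
  assert (CD : forall u, ccont D u) by (intros u; apply ccont_plus; [auto|apply ccont_scal, CF]).
  assert (Zero : forall u, D u = 0%C).
  { apply (fourier_unique D (B + 2 * A) CD).
    - intros u. unfold D. now rewrite Pg, P1, P2.
    - intros u. unfold D. eapply Rle_trans; [apply Cmod_triangle|].
      rewrite Cmod_mult, Cmod_opp, Cmod_1, Rmult_1_l.
      assert (X := Cmod_triangle (F1 u) (F2 u)). assert (X1 := B1 u). assert (X2 := B2 u). assert (X3 := Bg u). lra.
    - intros m.
      assert (Q1 := fourier_half_coeff Z.of_nat (fun k => th (Z.of_nat k)) a F1 m H1 (ex_intro _ A HA) S1).
      assert (Q2 := fourier_half_coeff (fun k => - Z.of_nat (S k))%Z (fun k => th (- Z.of_nat (S k))%Z) a F2 m H2 (ex_intro _ A HA) S2).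
      assert (Cgm : forall (f : R -> C), (forall u, ccont f u) -> forall u, ccont (fun u => f u * fourier_mode m u)%C u).
      { intros f Cf u. apply ccont_mult; [apply Cf|apply ccont_fourier_mode]. }
      rewrite (CRInt_ext_all _ (fun u => g u * fourier_mode m u +
                 (- (1)) * (F1 u * fourier_mode m u + F2 u * fourier_mode m u))%C) by (intros; unfold D; ring).
      rewrite CRInt_plus_eq, CRInt_scal_eq, CRInt_plus_eq; auto.
      2:{ intros u. apply ccont_plus; apply Cgm; auto. }
      2:{ intros u. apply ccont_scal, ccont_plus; apply Cgm; auto. }
      assert (E0 : CRInt (fun u => g u * fourier_mode m u)%C 0 1 = th (- m)%Z).
      { rewrite Hth. apply CRInt_ext_all. intros t. now rewrite Z.opp_involutive. }
      rewrite E0.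
      destruct (Z_le_gt_dec m 0) as [Hm|Hm].
      + rewrite (is_Cseries_unique _ _ (th (- m)%Z) Q1), (is_Cseries_unique _ _ 0%C Q2); [ring| |].
        * apply is_Cseries_zero. intros k. destruct (Z.eq_dec (- Z.of_nat (S k) + m) 0); [lia|reflexivity].
        * assert (Sg := is_Cseries_single (fun k => if Z.eq_dec (Z.of_nat k + m) 0 then th (Z.of_nat k) else 0%C) (Z.to_nat (- m))).
          simpl in Sg. destruct (Z.eq_dec (Z.of_nat (Z.to_nat (- m)) + m) 0) as [_|h]; [|lia].
          rewrite Z2Nat.id in Sg by lia. apply Sg.
          intros k Hk. destruct (Z.eq_dec (Z.of_nat k + m) 0); [lia|reflexivity].
      + rewrite (is_Cseries_unique _ _ 0%C Q1), (is_Cseries_unique _ _ (th (- m)%Z) Q2); [ring| |].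
        * assert (Sg := is_Cseries_single (fun k => if Z.eq_dec (- Z.of_nat (S k) + m) 0 then th (- Z.of_nat (S k))%Z else 0%C) (Z.to_nat (m - 1))).
          cbv beta in Sg. destruct (Z.eq_dec (- Z.of_nat (S (Z.to_nat (m - 1))) + m) 0) as [_|h]; [|lia].
          replace (- Z.of_nat (S (Z.to_nat (m - 1))))%Z with (- m)%Z in Sg by lia. apply Sg.
          intros k Hk. destruct (Z.eq_dec (- Z.of_nat (S k) + m) 0); [lia|reflexivity].
        * apply is_Cseries_zero. intros k. destruct (Z.eq_dec (Z.of_nat k + m) 0); [lia|reflexivity]. }
  intros u. exists (F1 u), (F2 u). split; [apply S1|]. split; [apply S2|].
  replace (g u) with (D u + (F1 u + F2 u))%C by (unfold D; ring). rewrite Zero. ring.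
Qed.

Lemma C11_pgf_iter (p : nat -> R) (t : nat) : entire_offspring p -> exists g', C11 (pgf_iter p t) g'.
Proof. intros H. apply (C11_iter _ _ t (C11_pgf p (entire_offspring_coeffs p H))). Qed.

Lemma C11_Phi_iter (p : nat -> R) (t : nat) : entire_offspring p -> exists g', C11 (Phi_iter p t) g'.
Proof.
  intros H. destruct (C11_pgf_iter p t H) as [g' Hg]. eexists.
  eapply C11_ext; [| |exact (C11_scal (/ RtoC (p 1%nat) ^ t)%C _ _ Hg)].
  - intros z. unfold Phi_iter, Cdiv. ring.
  - intros z. reflexivity.
Qed.

Lemma C11_Pi_iter (p : nat -> R) (t : nat) : entire_offspring p -> exists g', C11 (Pi_iter p t) g'.
Proof.
  intros H. destruct (C11_pgf_iter p t H) as [g' Hg].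
  assert (L := C11_plus _ _ _ _ (C11_const 1%C) (C11_scal (- / RtoC (mean p) ^ t)%C _ _ C11_id)).
  eexists. eapply C11_ext; [| |exact (C11_comp _ _ _ _ Hg L)].
  - intros z. unfold Pi_iter. f_equal. unfold Cdiv. ring.
  - intros z. reflexivity.
Qed.

Lemma unif_entire_Pi (p : nat -> R) (S : C -> Prop) : entire_offspring p -> bounded_set S ->
  unif_entire (Pi p) S.
Proof.
  intros H [r Hr] eps He. destruct (Pi_regular_all p r H) as [HU _].
  destruct (HU eps He) as [T HT]. destruct (C11_Pi_iter p T H) as [g' Hg].
  exists (Pi_iter p T), g'. split; [exact Hg|]. intros z Hz. apply HT; auto.
Qed.

Lemma unif_entire_Pi_comp (p : nat -> R) (f f' : C -> C) (S : C -> Prop) : entire_offspring p ->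
  bounded_set S -> C11 f f' -> unif_entire (fun w => Pi p (f w)) S.
Proof.
  intros H [r Hr] Hf eps He. destruct (C11_bounded f f' Hf r) as [B [_ HB]].
  destruct (unif_entire_Pi p (fun z => Cmod z <= B) H (ex_intro _ B (fun z Hz => Hz)) eps He) as [g [g' [Hg Ha]]].
  exists (fun w => g (f w)). eexists. split; [exact (C11_comp _ _ _ _ Hg Hf)|].
  intros w Hw. apply Ha, HB, Hr, Hw.
Qed.

Lemma unif_entire_Phi_comp (p : nat -> R) (f : C -> C) (S : C -> Prop) (rho : R) : entire_offspring p ->
  bounded_set S -> rho < 1 -> (forall w, S w -> Cmod (f w) <= rho) -> unif_entire f S ->
  unif_entire (fun w => Phi p (f w)) S.
Proof.
  intros H HS Hrho Hf Uf. apply unif_entire_limit. intros eps He.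
  assert (H1 : 0 < p 1%nat < 1) by apply H.
  destruct (Phi_limit p rho H Hrho) as [B [HB HL]].
  destruct (pow_small (p 1%nat) (eps / (B + 1)) ltac:(lra) ltac:(apply Rdiv_lt_0_compat; lra)) as [t Ht].
  exists (fun w => Phi_iter p t (f w)). split.
  - destruct (C11_Phi_iter p t H) as [g' Hg]. exact (unif_entire_C11_comp _ _ f S HS Hg Uf).
  - intros w Hw. eapply Rle_trans; [apply (HL (f w) (Hf w Hw))|].
    apply Rle_trans with (B * (eps / (B + 1))); [|now apply Rmult_div_small].
    apply Rmult_le_compat_l; [exact HB|]. apply Ht. lia.
Qed.

(** * Decay of [Pi] in the right half plane *)

Definition vanishing_Pi (p : nat -> R) : Prop :=
  filterlim (fun y : R => Pi p (Ci * RtoC y)%C) (Rbar_locally p_infty) (locally (RtoC 0)) /\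
  filterlim (fun y : R => Pi p (Ci * RtoC y)%C) (Rbar_locally m_infty) (locally (RtoC 0)).

Lemma vanishing_Pi_half (p : nat -> R) : vanishing_Pi p ->
  exists Y, 0 < Y /\ forall y, Y <= Rabs y -> Cmod (Pi p (0, y)) <= 1 / 2.
Proof.
  intros [H1 H2].
  assert (E : forall y, (Ci * RtoC y)%C = (0, y)).
  { intros y. unfold Ci, RtoC, Cmult; simpl. f_equal; ring. }
  assert (Small : forall w : C, @ball C_UniformSpace (RtoC 0) (1 / 4) w -> Cmod w <= 1 / 2).
  { intros w [B1 B2].
    assert (D1 : Rabs (fst w - 0) < 1 / 4) by exact B1. assert (D2 : Rabs (snd w - 0) < 1 / 4) by exact B2.
    rewrite Rminus_0_r in D1, D2. eapply Rle_trans; [apply Cmod_le_parts|]. lra. }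
  assert (P4 : 0 < 1 / 4) by lra.
  destruct (H1 (fun w => @ball C_UniformSpace (RtoC 0) (1 / 4) w)) as [M1 HM1].
  { exists (mkposreal _ P4). auto. }
  destruct (H2 (fun w => @ball C_UniformSpace (RtoC 0) (1 / 4) w)) as [M2 HM2].
  { exists (mkposreal _ P4). auto. }
  assert (Q1 := Rabs_pos M1). assert (Q2 := Rabs_pos M2).
  assert (U1 := Rle_abs M1). assert (U2 := Rle_abs (- M2)). rewrite Rabs_Ropp in U2.
  exists (Rabs M1 + Rabs M2 + 1). split; [lra|]. intros y Hy. rewrite <- E. apply Small.
  destruct (Rle_dec 0 y) as [h|h].
  - rewrite (Rabs_pos_eq y) in Hy by lra. apply HM1. lra.
  - rewrite (Rabs_left1 y) in Hy by lra. apply HM2. lra.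
Qed.

Lemma Cmod_fst_snd (z : C) : Cmod z <= Rabs (Re z) + Rabs (Im z).
Proof. apply Cmod_le_parts. Qed.

(* The annulus is compact and meets the imaginary axis only where [|Pi| <= 1/2],
   so [|Pi| < 1] persists slightly to the left of that axis. *)
Lemma Pi_annulus_bound (p : nat -> R) : entire_offspring p -> vanishing_Pi p ->
  exists k rho del, 0 <= rho < 1 /\ 0 < del /\
    forall z, mean p ^ k <= Cmod z -> Cmod z <= mean p ^ (k + 3) -> - del <= Re z -> Cmod (Pi p z) <= rho.
Proof.
  intros H HV. assert (HE := mean_gt_1 p H).
  destruct (vanishing_Pi_half p HV) as [Y [HY HYb]].
  destruct (pow_unbounded (mean p) (Y + 1) HE) as [k Hk].
  destruct (Pi_regular_all p (mean p ^ (k + 3)) H) as [_ [L [HL HLip]]].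
  set (del := Rmin 1 (/ (4 * (L + 1)))).
  assert (Hdel : 0 < del) by (apply Rmin_pos; [lra|apply Rinv_0_lt_compat; lra]).
  assert (D1 : del <= 1) by apply Rmin_l. assert (D2 : del <= / (4 * (L + 1))) by apply Rmin_r.
  assert (B1 : Cmod (Pi p (RtoC del)) < 1) by (apply Cmod_Pi_lt_1; [exact H|exact Hdel]).
  exists k, (Rmax (3 / 4) (Cmod (Pi p (RtoC del)))), del.
  assert (M1 := Rmax_l (3 / 4) (Cmod (Pi p (RtoC del)))). assert (M2 := Rmax_r (3 / 4) (Cmod (Pi p (RtoC del)))).
  split; [split; [lra|apply Rmax_lub_lt; lra]|]. split; [exact Hdel|].
  intros z Hz1 Hz2 Hz3.
  destruct (Rle_dec del (Re z)) as [h|h].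
  - eapply Rle_trans; [apply (Cmod_Pi_le p z del H h)|exact M2].
  - assert (A := Cmod_fst_snd z).
    assert (Rabs (Re z) <= del) by (apply Rabs_le; lra).
    assert (Iz : Y <= Rabs (Im z)) by lra.
    assert (C0 : Cmod (0, Im z) <= mean p ^ (k + 3)).
    { eapply Rle_trans; [|exact Hz2]. eapply Rle_trans; [apply Cmod_le_parts|]. simpl.
      rewrite Rabs_R0, Rplus_0_l. apply snd_le_Cmod. }
    assert (Q := HLip z (0, Im z) Hz2 C0). assert (Q2 := HYb (Im z) Iz).
    replace (z - (0, Im z))%C with (RtoC (Re z)) in Q.
    2:{ destruct z as [a b]. unfold Cminus, Cplus, Copp, RtoC, Re, Im; simpl. f_equal; ring. }
    rewrite Cmod_R in Q.
    assert (T := Cmod_triangle_inv (Pi p z) (Pi p (0, Im z))).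
    assert (W : L * Rabs (Re z) <= 1 / 4).
    { apply Rle_trans with (L * / (4 * (L + 1))); [apply Rmult_le_compat_l; lra|].
      apply (Rle_div_l L (1 / 4) (4 * (L + 1))); lra. }
    lra.
Qed.

Lemma mean_scale (p : nat -> R) (k : nat) (x : R) : entire_offspring p -> mean p ^ k <= x ->
  exists j, mean p ^ k <= x / mean p ^ j <= mean p ^ (k + 1).
Proof.
  intros H Hx. assert (HE := mean_gt_1 p H).
  assert (Pk : forall n, 0 < mean p ^ n) by (intros; apply pow_lt; lra).
  destruct (pow_unbounded (mean p) x HE) as [N HN].
  assert (Step : forall n, x <= mean p ^ (k + n) -> exists j, mean p ^ k <= x / mean p ^ j <= mean p ^ (k + 1)).
  { induction n as [|n IH]; intros Hn.
    - exists O. simpl. rewrite Nat.add_0_r in Hn. rewrite pow_add. simpl. assert (X := Pk k).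
      rewrite Rdiv_1_r. split; [lra|]. nra.
    - destruct (Rle_dec x (mean p ^ (k + n))) as [h|h]; [now apply IH|].
      exists n. assert (X := Pk n). split.
      + apply (Rle_div_r (mean p ^ k) x (mean p ^ n) X). rewrite <- pow_add. lra.
      + apply (Rle_div_l x (mean p ^ (k + 1)) (mean p ^ n) X). rewrite <- pow_add.
        now replace (k + 1 + n)%nat with (k + S n)%nat by lia. }
  apply (Step N). eapply Rle_trans; [exact HN|]. apply Rle_pow; [lra|lia].
Qed.

Definition decay (p : nat -> R) : R := - (ln (p 1%nat) / ln (mean p)).

Lemma ln_mean_pos (p : nat -> R) : entire_offspring p -> 0 < ln (mean p).
Proof. intros H. rewrite <- ln_1. apply ln_increasing; [lra|now apply mean_gt_1]. Qed.

Lemma exp_decay (p : nat -> R) : entire_offspring p -> exp (- (decay p * ln (mean p))) = p 1%nat.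
Proof.
  intros H. assert (L := ln_mean_pos p H). unfold decay.
  replace (- (- (ln (p 1%nat) / ln (mean p)) * ln (mean p))) with (ln (p 1%nat)) by (field; lra).
  apply exp_ln, H.
Qed.

Lemma decay_pos (p : nat -> R) : entire_offspring p -> 0 < decay p.
Proof.
  intros H. assert (L := ln_mean_pos p H). assert (H1 : 0 < p 1%nat < 1) by apply H.
  unfold decay. assert (ln (p 1%nat) < 0) by (rewrite <- ln_1; apply ln_increasing; lra).
  replace (- (ln (p 1%nat) / ln (mean p))) with (- ln (p 1%nat) / ln (mean p)) by (field; lra).
  apply Rdiv_lt_0_compat; lra.
Qed.

Lemma pow_offspring_mean (p : nat -> R) (j : nat) : entire_offspring p ->
  p 1%nat ^ j = Rpower (mean p ^ j) (- decay p).
Proof.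
  intros H. assert (HE := mean_gt_1 p H). assert (H1 : 0 < p 1%nat < 1) by apply H.
  rewrite <- !Rpower_pow by lra. rewrite Rpower_mult.
  unfold Rpower at 1. rewrite <- (exp_decay p H) at 1. rewrite ln_exp.
  unfold Rpower. f_equal. ring.
Qed.

Lemma Pi_decay (p : nat -> R) : entire_offspring p -> vanishing_Pi p ->
  exists R0 K, 1 <= R0 /\ 0 <= K /\
    forall z, 0 <= Re z -> R0 <= Cmod z -> Cmod (Pi p z) <= K * Rpower (Cmod z) (- decay p).
Proof.
  intros H HV. assert (HE := mean_gt_1 p H). assert (H1 : 0 < p 1%nat < 1) by apply H.
  destruct (Pi_annulus_bound p H HV) as [k [rho [del [Hrho [Hdel HB]]]]].
  destruct (pgf_iter_rate p rho H (proj2 Hrho)) as [A [HA HR]].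
  assert (Pk : forall n, 0 < mean p ^ n) by (intros; apply pow_lt; lra).
  exists (mean p ^ k), (A * Rpower (mean p ^ (k + 1)) (decay p)).
  split; [apply pow_R1_Rle; lra|]. split; [apply Rmult_le_pos; [lra|left; apply exp_pos]|].
  intros z Hz1 Hz2. destruct (mean_scale p k (Cmod z) H Hz2) as [j Hj].
  assert (Pj := Pk j).
  set (y := (z / RtoC (mean p) ^ j)%C).
  assert (Hy : Cmod y = Cmod z / mean p ^ j) by (unfold y; apply Cmod_div_pow; lra).
  assert (N1 := RtoC_neq_0 (mean p) ltac:(lra)). assert (N2 := Cpow_nz _ j N1).
  assert (Ez : z = (RtoC (mean p ^ j) * y)%C) by (unfold y; rewrite RtoC_pow; field; exact N2).
  assert (Ry : 0 <= Re y).
  { unfold y. rewrite <- RtoC_pow. destruct z as [a b]. unfold Re in *; simpl in *.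
    replace (a * (mean p ^ j / (mean p ^ j * (mean p ^ j * 1) + 0 * (0 * 1))) - b * (- 0 / (mean p ^ j * (mean p ^ j * 1) + 0 * (0 * 1))))
      with (a * / mean p ^ j) by (field; lra).
    apply Rmult_le_pos; [lra|left; now apply Rinv_0_lt_compat]. }
  assert (By : Cmod (Pi p y) <= rho).
  { apply HB; [lra| |lra]. rewrite Hy. eapply Rle_trans; [apply Hj|]. apply Rle_pow; [lra|lia]. }
  rewrite Ez at 1. rewrite (Pi_mean_pow p j y H).
  eapply Rle_trans; [apply (HR j _ By)|].
  rewrite (pow_offspring_mean p j H).
  assert (Zp : 0 < Cmod z) by (assert (X := Pk k); lra).
  apply Rle_trans with (A * Rpower (mean p ^ j) (- decay p)).
  { rewrite <- (Rmult_1_r (A * Rpower (mean p ^ j) (- decay p))) at 2.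
    apply Rmult_le_compat_l; [|lra]. apply Rmult_le_pos; [lra|left; apply exp_pos]. }
  rewrite Rmult_assoc. apply Rmult_le_compat_l; [lra|].
  rewrite !Rpower_Ropp.
  replace (Rpower (mean p ^ (k + 1)) (decay p) * / Rpower (Cmod z) (decay p))
    with (/ (Rpower (Cmod z) (decay p) * / Rpower (mean p ^ (k + 1)) (decay p))).
  2:{ field. split; apply Rgt_not_eq, exp_pos. }
  apply Rinv_le_contravar.
  - apply Rmult_lt_0_compat; [apply exp_pos|apply Rinv_0_lt_compat, exp_pos].
  - apply (Rle_div_l (Rpower (Cmod z) (decay p)) _ (Rpower (mean p ^ (k + 1)) (decay p))); [apply exp_pos|].
    rewrite Rpower_mult_distr by (auto; apply Pk).
    apply Rle_Rpower_l; [left; now apply decay_pos|]. split; [exact Zp|].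
    destruct Hj as [_ Hj]. apply (Rle_div_l (Cmod z) (mean p ^ (k + 1)) (mean p ^ j) Pj) in Hj. lra.
Qed.

(** * The Karlin-McGregor function in a strip *)

Definition KM_complex (p : nat -> R) (w : C) : C :=
  (Phi p (Pi p (Cexp (RtoC (ln (mean p)) * w))) * Cexp (RtoC (decay p * ln (mean p)) * w))%C.

Lemma KM_complex_real (p : nat -> R) (x : R) : entire_offspring p ->
  KarlinMcGregor p x = KM_complex p (RtoC x).
Proof.
  intros H. assert (L := ln_mean_pos p H). unfold KarlinMcGregor, KM_complex.
  rewrite <- !RtoC_mult, !Cexp_RtoC. unfold Rpower. f_equal.
  - f_equal. f_equal. f_equal. f_equal. ring.
  - f_equal. f_equal. unfold decay. field. lra.
Qed.

Lemma KM_complex_shift (p : nat -> R) (w : C) : entire_offspring p ->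
  Cmod (Pi p (Cexp (RtoC (ln (mean p)) * w))) < 1 -> KM_complex p (w + 1) = KM_complex p w.
Proof.
  intros H Hw. assert (HE := mean_gt_1 p H). assert (H1 : 0 < p 1%nat < 1) by apply H.
  unfold KM_complex.
  replace (RtoC (ln (mean p)) * (w + 1))%C with (RtoC (ln (mean p)) + RtoC (ln (mean p)) * w)%C by ring.
  replace (RtoC (decay p * ln (mean p)) * (w + 1))%C
    with (RtoC (decay p * ln (mean p)) + RtoC (decay p * ln (mean p)) * w)%C by ring.
  rewrite !Cexp_add, !Cexp_RtoC, exp_ln by lra.
  rewrite (Pi_mean p _ H), (Phi_pgf p _ H Hw).
  replace (RtoC (exp (decay p * ln (mean p)))) with (/ RtoC (p 1%nat))%C.
  - field. apply RtoC_neq_0. lra.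
  - rewrite <- (exp_decay p H) at 1. rewrite exp_Ropp, RtoC_inv.
    + field. apply RtoC_neq_0, Rgt_not_eq, exp_pos.
    + apply Rgt_not_eq, exp_pos.
Qed.

Lemma Cexp_polar (L u v : R) : Cexp (RtoC L * (u, v)) = (exp (L * u) * cos (L * v), exp (L * u) * sin (L * v)).
Proof.
  unfold Cexp, Re, Im, RtoC, Cmult; simpl.
  replace (L * u - 0 * v) with (L * u) by ring. replace (L * v + 0 * u) with (L * v) by ring. reflexivity.
Qed.

Lemma exp_ln_mean_nat (p : nat -> R) (k : nat) : entire_offspring p -> exp (ln (mean p) * INR k) = mean p ^ k.
Proof.
  intros H. assert (HE := mean_gt_1 p H). rewrite <- Rpower_pow by lra. unfold Rpower. f_equal. ring.
Qed.

(* [h2 > h1 > PI / (2 ln E)]: the strip is wider than the image of the right half plane. *)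
Lemma Pi_strip_bound (p : nat -> R) : entire_offspring p -> vanishing_Pi p ->
  exists k rho h, 0 <= rho < 1 /\ PI / 2 < ln (mean p) * h /\
    forall u v, INR k <= u -> Rabs v <= h -> Cmod (Pi p (Cexp (RtoC (ln (mean p)) * (u, v)))) <= rho.
Proof.
  intros H HV. assert (HE := mean_gt_1 p H). assert (L := ln_mean_pos p H). assert (PP := PI_RGT_0).
  destruct (Pi_annulus_bound p H HV) as [k [rho [del [Hrho [Hdel HB]]]]].
  assert (Pk : forall n, 0 < mean p ^ n) by (intros; apply pow_lt; lra).
  set (e := Rmin (PI / 2) (del / mean p ^ (k + 1))).
  assert (He : 0 < e) by (apply Rmin_pos; [lra|apply Rdiv_lt_0_compat; auto]).
  assert (E1 : e <= PI / 2) by apply Rmin_l. assert (E2 : e <= del / mean p ^ (k + 1)) by apply Rmin_r.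
  exists k, rho, ((PI / 2 + e) / ln (mean p)). split; [exact Hrho|].
  split. { replace (ln (mean p) * ((PI / 2 + e) / ln (mean p))) with (PI / 2 + e) by (field; lra). lra. }
  assert (Base : forall u v, INR k <= u -> u <= INR k + 1 -> Rabs v <= (PI / 2 + e) / ln (mean p) ->
            Cmod (Pi p (Cexp (RtoC (ln (mean p)) * (u, v)))) <= rho).
  { intros u v Hu1 Hu2 Hv.
    assert (Em : Cmod (Cexp (RtoC (ln (mean p)) * (u, v))) = exp (ln (mean p) * u)).
    { rewrite Cmod_Cexp. f_equal. unfold Re, RtoC; simpl. ring. }
    assert (U2 : exp (ln (mean p) * u) <= mean p ^ (k + 1)).
    { rewrite <- (exp_ln_mean_nat p (k + 1) H). apply exp_le_mono. rewrite plus_INR. simpl INR. nra. }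
    apply HB.
    - rewrite Em, <- (exp_ln_mean_nat p k H). apply exp_le_mono. nra.
    - rewrite Em. eapply Rle_trans; [exact U2|]. apply Rle_pow; [lra|lia].
    - rewrite Cexp_polar. unfold Re; simpl.
      assert (Cs : - e <= cos (ln (mean p) * v)).
      { assert (Av : Rabs (ln (mean p) * v) <= PI / 2 + e).
        { rewrite Rabs_mult, (Rabs_pos_eq (ln (mean p))) by lra.
          apply (Rmult_le_compat_l (ln (mean p))) in Hv; [|lra].
          replace (ln (mean p) * ((PI / 2 + e) / ln (mean p))) with (PI / 2 + e) in Hv by (field; lra). exact Hv. }
        assert (Ec : cos (ln (mean p) * v) = cos (Rabs (ln (mean p) * v))).
        { unfold Rabs. destruct (Rcase_abs (ln (mean p) * v)); [now rewrite cos_neg|reflexivity]. }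
        rewrite Ec. apply Rle_trans with (cos (PI / 2 + e)).
        - replace (PI / 2 + e) with (e + PI / 2) by ring. rewrite cos_plus, cos_PI2, sin_PI2.
          assert (X := abs_sin_le e). assert (Y := Rle_abs (sin e)). rewrite (Rabs_pos_eq e) in X; lra.
        - apply cos_decr_1; try lra; apply Rabs_pos. }
      assert (X := exp_pos (ln (mean p) * u)).
      assert (Q : mean p ^ (k + 1) * e <= del).
      { rewrite Rmult_comm. apply Rle_div_r in E2; [exact E2|apply Pk]. }
      nra. }
  assert (Ind : forall j u v, INR k <= u -> u <= INR k + 1 + INR j -> Rabs v <= (PI / 2 + e) / ln (mean p) ->
            Cmod (Pi p (Cexp (RtoC (ln (mean p)) * (u, v)))) <= rho).
  { induction j as [|j IH]; intros u v Hu1 Hu2 Hv.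
    - apply Base; auto. simpl in Hu2. lra.
    - destruct (Rle_dec u (INR k + 1 + INR j)) as [h|h]; [now apply IH|].
      rewrite S_INR in Hu2.
      assert (Hj := pos_INR j).
      assert (B1 := IH (u - 1) v ltac:(lra) ltac:(lra) Hv).
      replace (RtoC (ln (mean p)) * (u, v))%C with (RtoC (ln (mean p)) + RtoC (ln (mean p)) * ((u - 1)%R, v))%C.
      2:{ unfold RtoC, Cmult, Cplus; simpl. f_equal; ring. }
      rewrite Cexp_add, Cexp_RtoC, exp_ln by lra. rewrite (Pi_mean p _ H).
      eapply Rle_trans; [apply pgf_unit_disc_le; [exact H|lra]|exact B1]. }
  intros u v Hu Hv. destruct (INR_unbounded u) as [N HN].
  apply (Ind N u v Hu); [|exact Hv]. assert (X := pos_INR k). lra.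
Qed.

Definition strip_data (p : nat -> R) (k : nat) (rho h : R) : Prop :=
  0 <= rho < 1 /\ PI / 2 < ln (mean p) * h /\
  forall u v, INR k <= u -> Rabs v <= h -> Cmod (Pi p (Cexp (RtoC (ln (mean p)) * (u, v)))) <= rho.

Lemma pair_shift (u v x : R) : ((u, v) + RtoC x)%C = (u + x, v).
Proof. unfold Cplus, RtoC; simpl. f_equal; ring. Qed.

Lemma KM_shift_nat (p : nat -> R) (k : nat) (rho h u v : R) (j : nat) : entire_offspring p ->
  strip_data p k rho h -> INR k <= u -> Rabs v <= h -> KM_complex p (u + INR j, v) = KM_complex p (u, v).
Proof.
  intros H [Hr [_ HS]] Hu Hv. induction j as [|j IH].
  - simpl. now rewrite Rplus_0_r.
  - rewrite <- IH, S_INR. rewrite <- (KM_complex_shift p (u + INR j, v) H).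
    + f_equal. rewrite (pair_shift (u + INR j) v 1). f_equal. ring.
    + eapply Rle_lt_trans; [apply HS; [assert (X := pos_INR j); lra|exact Hv]|lra].
Qed.

Lemma KM_shift_Z (p : nat -> R) (k : nat) (rho h u v : R) (z : Z) : entire_offspring p ->
  strip_data p k rho h -> INR k <= u -> INR k <= u + IZR z -> Rabs v <= h ->
  KM_complex p (u + IZR z, v) = KM_complex p (u, v).
Proof.
  intros H HS Hu Huz Hv. destruct (Z_le_gt_dec 0 z) as [h0|h0].
  - rewrite <- (Z2Nat.id z h0), <- INR_IZR_INZ. now apply (KM_shift_nat p k rho h).
  - assert (E := KM_shift_nat p k rho h (u + IZR z) v (Z.to_nat (- z)) H HS Huz Hv).
    rewrite <- E. f_equal. rewrite INR_IZR_INZ, Z2Nat.id, opp_IZR by lia. f_equal. ring.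
Qed.

Lemma KM_real_shift_Z (p : nat -> R) (u : R) (z : Z) : entire_offspring p ->
  KM_complex p (RtoC (u + IZR z)) = KM_complex p (RtoC u).
Proof.
  intros H.
  assert (One : forall x, KM_complex p (RtoC (x + 1)) = KM_complex p (RtoC x)).
  { intros x. rewrite RtoC_plus. apply KM_complex_shift; [exact H|].
    apply Cmod_Pi_lt_1; [exact H|]. rewrite <- RtoC_mult, Cexp_RtoC. apply exp_pos. }
  assert (N : forall (j : nat) x, KM_complex p (RtoC (x + INR j)) = KM_complex p (RtoC x)).
  { intros j x. induction j as [|j IH]; [simpl; now rewrite Rplus_0_r|].
    rewrite S_INR, <- Rplus_assoc, One. exact IH. }
  destruct (Z_le_gt_dec 0 z) as [h0|h0].
  - rewrite <- (Z2Nat.id z h0), <- INR_IZR_INZ. apply N.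
  - rewrite <- (N (Z.to_nat (- z)) (u + IZR z)). f_equal. f_equal.
    rewrite INR_IZR_INZ, Z2Nat.id, opp_IZR by lia. ring.
Qed.

Lemma unif_entire_KM (p : nat -> R) (k : nat) (rho h : R) : entire_offspring p -> strip_data p k rho h ->
  unif_entire (KM_complex p) (in_box (INR k) (INR k + 3) (- h) h).
Proof.
  intros H [Hr [_ HS]]. assert (Bd := in_box_bounded (INR k) (INR k + 3) (- h) h).
  apply unif_entire_mult; [exact Bd| |].
  - apply (unif_entire_Phi_comp p _ _ rho H Bd (proj2 Hr)).
    + intros [u v] [B1 B2]. simpl in *. apply HS; [lra|]. apply Rabs_le. lra.
    + apply (unif_entire_Pi_comp p _ _ _ H Bd (C11_comp _ _ _ _ C11_Cexp (C11_linear (RtoC (ln (mean p)))))).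
  - apply (unif_entire_C11 _ _ _ (C11_comp _ _ _ _ C11_Cexp (C11_linear (RtoC (decay p * ln (mean p)))))).
Qed.

Lemma KM_strip_bounded (p : nat -> R) (k : nat) (rho h : R) : entire_offspring p -> strip_data p k rho h ->
  exists M, 0 <= M /\ forall u v, INR k < u -> Rabs v < h -> Cmod (KM_complex p (u, v)) <= M.
Proof.
  intros H HS.
  destruct (unif_entire_bounded _ _ (in_box_bounded _ _ _ _) (unif_entire_KM p k rho h H HS)) as [M [HM HB]].
  exists M. split; [exact HM|]. intros u v Hu Hv.
  assert (Ha := Rabs_def2 _ _ Hv).
  destruct (Rlt_dec u (INR k + 3)) as [h3|h3].
  - apply HB. split; simpl; lra.
  - set (z := up (INR k + 1 - u)). destruct (archimed (INR k + 1 - u)) as [A1 A2]. fold z in A1, A2.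
    rewrite <- (KM_shift_Z p k rho h u v z H HS); try lra.
    apply HB. split; simpl; lra.
Qed.

Definition KM_periodic (p : nat -> R) (k : nat) (v u : R) : C :=
  KM_complex p (u + IZR (up (INR k + 1 - u)), v).

Lemma KM_periodic_eq (p : nat -> R) (k : nat) (rho h u v : R) (z : Z) : entire_offspring p ->
  strip_data p k rho h -> INR k <= u + IZR z -> Rabs v <= h ->
  KM_periodic p k v u = KM_complex p (u + IZR z, v).
Proof.
  intros H HS Hu Hv. unfold KM_periodic.
  set (y := up (INR k + 1 - u)). destruct (archimed (INR k + 1 - u)) as [A1 A2]. fold y in A1, A2.
  rewrite <- (KM_shift_Z p k rho h (u + IZR z) v (y - z) H HS Hu).
  - f_equal. rewrite minus_IZR. f_equal. ring.
  - rewrite minus_IZR. lra.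
  - exact Hv.
Qed.

Lemma KM_periodic_0 (p : nat -> R) (k : nat) (u : R) : entire_offspring p ->
  KM_periodic p k 0 u = KarlinMcGregor p u.
Proof.
  intros H. unfold KM_periodic. rewrite (KM_complex_real p u H).
  apply (KM_real_shift_Z p u (up (INR k + 1 - u)) H).
Qed.

Lemma ccont_ext_loc (f g : R -> C) (x d : R) : 0 < d -> (forall y, Rabs (y - x) < d -> f y = g y) ->
  ccont f x -> ccont g x.
Proof.
  intros Hd E H eps He. destruct (H eps He) as [d1 [Hd1 Hf]].
  exists (Rmin d d1). split; [now apply Rmin_pos|]. intros y Hy.
  assert (X := Rmin_l d d1). assert (Y := Rmin_r d d1).
  rewrite <- (E y) by lra. rewrite <- (E x); [apply Hf; lra|]. rewrite Rminus_diag, Rabs_R0. exact Hd.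
Qed.

Lemma ccont_KM_periodic (p : nat -> R) (k : nat) (rho h v x : R) : entire_offspring p ->
  strip_data p k rho h -> Rabs v < h -> ccont (KM_periodic p k v) x.
Proof.
  intros H HS Hv. assert (Ha := Rabs_def2 _ _ Hv).
  set (z := up (INR k + 1 - x)). destruct (archimed (INR k + 1 - x)) as [A1 A2]. fold z in A1, A2.
  apply (ccont_ext_loc (fun y => KM_complex p (y + IZR z, v)) _ x 1 Rlt_0_1).
  - intros y Hy. apply Rabs_def2 in Hy. symmetry. apply (KM_periodic_eq p k rho h); auto; lra.
  - apply (unif_entire_box_ccont (KM_complex p) (INR k) (INR k + 3) (- h) h (fun y => (y + IZR z, v)) x).
    + now apply (unif_entire_KM p k rho h).
    + split; simpl; lra.
    + apply continuous_ccont; simpl; [|apply continuous_const].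
      apply (ex_derive_continuous (fun y => y + IZR z)). auto_derive. auto.
Qed.

Lemma KM_periodic_period (p : nat -> R) (k : nat) (rho h v u : R) : entire_offspring p ->
  strip_data p k rho h -> Rabs v <= h -> KM_periodic p k v (u + 1) = KM_periodic p k v u.
Proof.
  intros H HS Hv. set (z := up (INR k + 1 - u)). destruct (archimed (INR k + 1 - u)) as [A1 A2]. fold z in A1, A2.
  rewrite (KM_periodic_eq p k rho h (u + 1) v (z - 1) H HS); [|rewrite minus_IZR; lra|exact Hv].
  unfold KM_periodic. fold z. f_equal. rewrite minus_IZR. f_equal. ring.
Qed.

Lemma theta_shift (p : nat -> R) (k : nat) (rho h v : R) (n : nat) (m : Z) : entire_offspring p ->
  strip_data p k rho h -> Rabs v < h ->
  CRInt (fun u => KM_periodic p k v u ^ n * fourier_mode (- m) u)%C 0 1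
    = (theta p n m * RtoC (exp (- (2 * PI * IZR m * v))))%C.
Proof.
  intros H HS Hv. assert (Ha := Rabs_def2 _ _ Hv).
  assert (H0 : 0 < h) by (assert (X := Rabs_pos v); lra).
  set (c := (- (RtoC (2 * PI * IZR m) * Ci))%C).
  set (f := fun w => (KM_complex p w ^ n * Cexp (c * w))%C).
  assert (Uf : unif_entire f (in_box (INR k) (INR k + 3) (- h) h)).
  { assert (Bd := in_box_bounded (INR k) (INR k + 3) (- h) h).
    apply unif_entire_mult; [exact Bd| |].
    - apply unif_entire_pow; [exact Bd|]. now apply (unif_entire_KM p k rho h).
    - apply (unif_entire_C11 _ _ _ (C11_comp _ _ _ _ C11_Cexp (C11_linear c))). }
  assert (Ec : forall u y, Cexp (c * (u, y)) = (fourier_mode (- m) u * RtoC (exp (2 * PI * IZR m * y)))%C).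
  { intros u y. unfold fourier_mode. rewrite <- Cexp_RtoC, <- Cexp_add. f_equal.
    rewrite opp_IZR. unfold c, RtoC, Ci, Cmult, Cplus, Copp; simpl. f_equal; ring. }
  assert (Per : forall y, Rabs y <= h -> f (INR k + 2, y) = f (INR k + 1, y)).
  { intros y Hy. unfold f. rewrite !Ec.
    replace (INR k + 2) with (INR k + 1 + 1) by ring. rewrite fourier_mode_periodic.
    rewrite (KM_shift_Z p k rho h (INR k + 1) y 1 H HS); auto; lra. }
  assert (Cm : forall y, Rabs y < h -> forall x, ccont (fun u => KM_periodic p k y u ^ n * fourier_mode (- m) u)%C x).
  { intros y Hy x. apply ccont_mult; [|apply ccont_fourier_mode].
    apply (ccont_pow (KM_periodic p k y)). now apply (ccont_KM_periodic p k rho h). }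
  assert (Pm : forall y, Rabs y < h -> forall u,
      (KM_periodic p k y (u + 1) ^ n * fourier_mode (- m) (u + 1))%C = (KM_periodic p k y u ^ n * fourier_mode (- m) u)%C).
  { intros y Hy u. rewrite fourier_mode_periodic. rewrite (KM_periodic_period p k rho h); auto. lra. }
  set (I := fun y => CRInt (fun u => f (u, y)) (INR k + 1) (INR k + 2)).
  assert (EI : forall y, Rabs y < h -> I y =
      (RtoC (exp (2 * PI * IZR m * y)) * CRInt (fun u => KM_periodic p k y u ^ n * fourier_mode (- m) u) 0 1)%C).
  { intros y Hy. rewrite <- (CRInt_period _ (INR k + 1) (Cm y Hy) (Pm y Hy)).
    replace (INR k + 1 + 1) with (INR k + 2) by ring.
    apply CRInt_unique.
    apply (is_CRInt_ext (fun u => RtoC (exp (2 * PI * IZR m * y)) * (KM_periodic p k y u ^ n * fourier_mode (- m) u))%C).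
    - intros u Hu. rewrite Rmin_left, Rmax_right in Hu by lra. unfold f. rewrite Ec.
      rewrite (KM_periodic_eq p k rho h u y 0 H HS); [|lra|lra]. rewrite Rplus_0_r. ring.
    - apply is_CRInt_scal, CRInt_correct. intros x _. now apply Cm. }
  assert (Eq : forall a b, - h < a -> a <= b -> b < h -> I a = I b).
  { intros a b Ha' Hab Hb.
    assert (R0 := rect_int_unif_entire f _ _ _ _ (INR k + 1) (INR k + 2) a b Uf ltac:(lra) ltac:(lra) ltac:(lra) Ha' Hab Hb).
    unfold rect_int in R0. fold (I a) (I b) in R0.
    replace (CRInt (fun y => f (INR k + 2, y)) a b) with (CRInt (fun y => f (INR k + 1, y)) a b) in R0.
    - set (T := CRInt (fun y => f (INR k + 1, y)) a b) in *.
      replace (I a) with ((I a + Ci * T - I b - Ci * T) + I b)%C by ring. rewrite R0. ring.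
    - apply (@RInt_ext C_R_CompleteNormedModule). intros y Hy. symmetry. apply Per.
      rewrite Rmin_left, Rmax_right in Hy by lra. apply Rabs_le. lra. }
  assert (E0 : I v = I 0).
  { destruct (Rle_dec 0 v) as [h0|h0]; [symmetry|]; apply Eq; lra. }
  rewrite (EI v Hv), (EI 0) in E0 by (rewrite Rabs_R0; exact H0).
  rewrite Rmult_0_r, exp_0, Cmult_1_l in E0.
  assert (Et : theta p n m = CRInt (fun u => KM_periodic p k 0 u ^ n * fourier_mode (- m) u)%C 0 1).
  { unfold theta. apply CRInt_ext_all. intros u. rewrite (KM_periodic_0 p k u H). f_equal.
    unfold fourier_mode. f_equal. rewrite opp_IZR.
    replace (2 * PI * - IZR m * u) with (- (2 * PI * IZR m * u)) by ring. rewrite RtoC_opp. ring. }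
  rewrite Et, <- E0.
  replace (RtoC (exp (- (2 * PI * IZR m * v)))) with (/ RtoC (exp (2 * PI * IZR m * v)))%C.
  - field. apply RtoC_neq_0, Rgt_not_eq, exp_pos.
  - rewrite exp_Ropp, RtoC_inv; [reflexivity|]. apply Rgt_not_eq, exp_pos.
Qed.

Definition laurent_term (p : nat -> R) (n : nat) (w : C) (m : Z) : C :=
  (theta p n m * Cexp (RtoC (2 * PI * IZR m) * Ci * w))%C.

Lemma Cexp_mode (m : Z) (u v : R) :
  Cexp (RtoC (2 * PI * IZR m) * Ci * (u, v)) = (RtoC (exp (- (2 * PI * IZR m * v))) * fourier_mode m u)%C.
Proof.
  unfold fourier_mode. rewrite <- Cexp_RtoC, <- Cexp_add. f_equal.
  unfold RtoC, Ci, Cmult, Cplus; simpl. f_equal; ring.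
Qed.

Definition laurent_data (p : nat -> R) (k : nat) (M q : R) : Prop :=
  0 <= M /\ 0 < q < 1 /\
  forall u v, INR k < u -> Rabs (ln (mean p) * v) < PI / 2 ->
    Cmod (Pi p (Cexp (RtoC (ln (mean p)) * (u, v)))) < 1 /\
    Cmod (KM_complex p (u, v)) <= M /\
    forall n,
      (forall j, Cmod (laurent_term p n (u, v) (Z.of_nat j)) <= M ^ n * q ^ j) /\
      (forall j, Cmod (laurent_term p n (u, v) (- Z.of_nat (S j))) <= M ^ n * q ^ j) /\
      exists l1 l2,
        is_Cseries (fun j => laurent_term p n (u, v) (Z.of_nat j)) l1 /\
        is_Cseries (fun j => laurent_term p n (u, v) (- Z.of_nat (S j))) l2 /\
        (KM_complex p (u, v) ^ n)%C = (l1 + l2)%C.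

Lemma KM_laurent (p : nat -> R) : entire_offspring p -> vanishing_Pi p ->
  exists k M q, laurent_data p k M q.
Proof.
  intros H HV. assert (L := ln_mean_pos p H). assert (PP := PI_RGT_0).
  destruct (Pi_strip_bound p H HV) as [k [rho [h HS]]].
  assert (HS' : strip_data p k rho h) by exact HS. destruct HS as [Hr [Hh HSb]].
  destruct (KM_strip_bounded p k rho h H HS') as [M [HM HB]].
  set (h0 := PI / 2 / ln (mean p)).
  assert (Hh0 : h0 < h). { unfold h0. apply Rlt_div_l; lra. }
  assert (Hh00 : 0 < h0) by (unfold h0; apply Rdiv_lt_0_compat; lra).
  set (h2 := (h + h0) / 2). assert (H2a : h0 < h2 < h) by (unfold h2; lra).
  set (q := exp (- (2 * PI * (h2 - h0)))).
  assert (Hq : 0 < q < 1).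
  { unfold q. split; [apply exp_pos|]. rewrite <- exp_0. apply exp_increasing. nra. }
  exists k, M, q. split; [exact HM|]. split; [exact Hq|].
  intros u v Hu Hv.
  assert (Hv0 : Rabs v < h0).
  { unfold h0. apply (Rlt_div_r (Rabs v)); [exact L|].
    rewrite Rabs_mult, (Rabs_pos_eq (ln (mean p))) in Hv by lra. lra. }
  assert (Hvh : Rabs v < h) by lra.
  split. { eapply Rle_lt_trans; [apply HSb|]; lra. }
  split; [now apply HB|].
  intros n.
  assert (gB : forall y x, Rabs y < h -> Cmod (KM_periodic p k y x ^ n) <= M ^ n).
  { intros y x Hy. rewrite Cmod_pow. apply pow_incr. split; [apply Cmod_ge_0|]. unfold KM_periodic.
    destruct (archimed (INR k + 1 - x)) as [A1 A2]. apply HB; lra. }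
  assert (Cg : forall y x, Rabs y < h -> ccont (fun x => KM_periodic p k y x ^ n)%C x).
  { intros y x Hy. apply (ccont_pow (KM_periodic p k y)). now apply (ccont_KM_periodic p k rho h). }
  assert (ThB : forall m y, Rabs y < h -> Cmod (theta p n m) * exp (- (2 * PI * IZR m * y)) <= M ^ n).
  { intros m y Hy. rewrite <- (Cmod_RtoC_nonneg (exp _)) by (left; apply exp_pos). rewrite <- Cmod_mult.
    rewrite <- (theta_shift p k rho h y n m H HS' Hy).
    replace (M ^ n) with ((1 - 0) * M ^ n) by ring.
    apply (is_CRInt_norm_le_const (fun x => KM_periodic p k y x ^ n * fourier_mode (- m) x)%C 0 1 _ _ ltac:(lra)).
    - intros x _. rewrite Cmod_mult, Cmod_fourier_mode, Rmult_1_r. now apply gB.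
    - apply CRInt_correct. intros x _. apply ccont_mult; [now apply Cg|apply ccont_fourier_mode]. }
  assert (Bnd : forall (m : Z) (j : nat), IZR m = INR j \/ IZR m = - INR j ->
            Cmod (theta p n m * RtoC (exp (- (2 * PI * IZR m * v)))) <= M ^ n * q ^ j).
  { intros m j Hm. rewrite Cmod_mult, Cmod_RtoC_nonneg by (left; apply exp_pos).
    assert (Av := Rabs_def2 _ _ Hv0). assert (Nj := pos_INR j).
    assert (Eq : q ^ j = exp (- (2 * PI * (h2 - h0)) * INR j)).
    { rewrite <- Rpower_pow by apply Hq. unfold Rpower, q. rewrite ln_exp. f_equal. ring. }
    destruct Hm as [Hm|Hm].
    - assert (T := ThB m (- h2) ltac:(rewrite Rabs_Ropp, Rabs_pos_eq; lra)).
      replace (exp (- (2 * PI * IZR m * v)))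
        with (exp (- (2 * PI * IZR m * - h2)) * exp (- (2 * PI * INR j * (h2 + v)))).
      2:{ rewrite <- exp_plus. f_equal. rewrite Hm. ring. }
      rewrite <- Rmult_assoc. apply Rmult_le_compat; auto.
      + apply Rmult_le_pos; [apply Cmod_ge_0|left; apply exp_pos].
      + left; apply exp_pos.
      + rewrite Eq. apply exp_le_mono.
        assert (PI * INR j * (h2 - h0) <= PI * INR j * (h2 + v)) by (apply Rmult_le_compat_l; [nra|lra]). lra.
    - assert (T := ThB m h2 ltac:(rewrite Rabs_pos_eq; lra)).
      replace (exp (- (2 * PI * IZR m * v)))
        with (exp (- (2 * PI * IZR m * h2)) * exp (- (2 * PI * INR j * (h2 - v)))).
      2:{ rewrite <- exp_plus. f_equal. rewrite Hm. ring. }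
      rewrite <- Rmult_assoc. apply Rmult_le_compat; auto.
      + apply Rmult_le_pos; [apply Cmod_ge_0|left; apply exp_pos].
      + left; apply exp_pos.
      + rewrite Eq. apply exp_le_mono.
        assert (PI * INR j * (h2 - h0) <= PI * INR j * (h2 - v)) by (apply Rmult_le_compat_l; [nra|lra]). lra. }
  assert (MN : 0 <= M ^ n) by now apply pow_le.
  assert (B1 : forall j, Cmod (theta p n (Z.of_nat j) * RtoC (exp (- (2 * PI * IZR (Z.of_nat j) * v)))) <= M ^ n * q ^ j).
  { intros j. apply Bnd. left. symmetry. apply INR_IZR_INZ. }
  assert (B2 : forall j, Cmod (theta p n (- Z.of_nat (S j)) * RtoC (exp (- (2 * PI * IZR (- Z.of_nat (S j)) * v)))) <= M ^ n * q ^ j).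
  { intros j. eapply Rle_trans; [apply (Bnd _ (S j)); right; rewrite opp_IZR; f_equal; symmetry; apply INR_IZR_INZ|].
    apply Rmult_le_compat_l; [exact MN|]. simpl. assert (X := pow_lt q j (proj1 Hq)). nra. }
  assert (Em : forall m, laurent_term p n (u, v) m
             = (theta p n m * RtoC (exp (- (2 * PI * IZR m * v))) * fourier_mode m u)%C).
  { intros m. unfold laurent_term. rewrite Cexp_mode. ring. }
  split; [|split].
  - intros j. rewrite Em, Cmod_mult, Cmod_fourier_mode, Rmult_1_r. apply B1.
  - intros j. rewrite Em, Cmod_mult, Cmod_fourier_mode, Rmult_1_r. apply B2.
  - destruct (fourier_expansion (fun x => KM_periodic p k v x ^ n)%C (M ^ n)
                (fun m => theta p n m * RtoC (exp (- (2 * PI * IZR m * v))))%C (fun j => M ^ n * q ^ j))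
      with (u := u) as [l1 [l2 [S1 [S2 E]]]].
    + intros x. now apply Cg.
    + intros x. now rewrite (KM_periodic_period p k rho h v x H HS' ltac:(lra)).
    + intros x. now apply gB.
    + intros m. symmetry. now apply (theta_shift p k rho h).
    + apply ex_series_geom_scal. lra.
    + exact B1.
    + exact B2.
    + exists l1, l2. split; [|split].
      * revert S1. apply is_Cseries_ext. intros j. now rewrite Em.
      * revert S2. apply is_Cseries_ext. intros j. now rewrite Em.
      * rewrite <- E. rewrite (KM_periodic_eq p k rho h u v 0 H HS'); [|lra|lra]. now rewrite Rplus_0_r.
Qed.

Lemma pow_n_Cpow (z : C) (n : nat) : @pow_n C_Ring z n = (z ^ n)%C.
Proof. induction n as [|n IH]; [reflexivity|]. rewrite Cpow_S, <- IH. reflexivity. Qed.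

Lemma is_pseries_Cseries (a : nat -> C) (z w : C) :
  @is_pseries C_AbsRing C_NormedModule a z w -> is_Cseries (fun n => a n * z ^ n)%C w.
Proof.
  apply is_Cseries_ext. intros n. rewrite <- pow_n_Cpow. apply Cmult_comm.
Qed.

Lemma is_Cseries_bounded (a : nat -> C) (l : C) : is_Cseries a l -> exists B, 0 <= B /\ forall n, Cmod (a n) <= B.
Proof.
  intros H. apply is_series_Clim in H. destruct (H 1 ltac:(lra)) as [N HN].
  assert (Fin : forall m, exists B, 0 <= B /\ forall n, (n <= m)%nat -> Cmod (a n) <= B).
  { induction m as [|m [B [HB IH]]].
    - exists (Cmod (a O)). split; [apply Cmod_ge_0|]. intros n Hn. replace n with O by lia. lra.
    - exists (B + Cmod (a (S m))). assert (X := Cmod_ge_0 (a (S m))). split; [lra|].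
      intros n Hn. destruct (Nat.eq_dec n (S m)) as [->|h]; [lra|].
      specialize (IH n ltac:(lia)). lra. }
  destruct (Fin N) as [B [HB HF]]. exists (B + 2). split; [lra|].
  intros n. destruct (le_dec n N) as [h|h]; [specialize (HF n h); lra|].
  destruct n as [|n]; [lia|].
  assert (A1 := HN n ltac:(lia)). assert (A2 := HN (S n) ltac:(lia)). rewrite sum_n_C_Sn in A2.
  set (s := @sum_n C_AbelianMonoid a n : C) in *.
  replace (a (S n)) with ((s + a (S n) - l) - (s - l))%C by ring.
  assert (T := Cmod_minus_le (s + a (S n) - l) (s - l)). lra.
Qed.

(* The series takes small values at small arguments, where [Phi] is injective. *)
Lemma kappa_inverts (p : nat -> R) (kappa : nat -> C) : entire_offspring p -> is_Phi_inv_coeffs p kappa ->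
  exists r B Q, 0 < r < 1 /\ 0 <= B /\ 0 < Q /\ (forall n, Cmod (kappa n) <= B * Q ^ n) /\
    forall v, Cmod v <= r -> is_Cseries (fun n => kappa n * Phi p v ^ n)%C v.
Proof.
  intros H [K0 [r [Hr HK]]].
  destruct (Phi_inj_near_0 p H) as [r0 [Hr0 Inj]].
  destruct (Phi_bound p (1 / 2) H ltac:(lra)) as [A [HA HPhi]].
  destruct (HK (RtoC (r / 2))) as [w0 [Hw0 _]]. { rewrite Cmod_RtoC_nonneg; lra. }
  destruct (is_Cseries_bounded _ _ (is_pseries_Cseries _ _ _ Hw0)) as [B [HB HBd]].
  assert (Coef : forall n, Cmod (kappa n) <= B * (2 / r) ^ n).
  { intros n. specialize (HBd n). rewrite Cmod_mult, Cmod_pow, Cmod_RtoC_nonneg in HBd by lra.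
    assert (P : 0 < (r / 2) ^ n) by (apply pow_lt; lra).
    replace (2 / r) with (/ (r / 2)) by (field; lra). rewrite pow_inv.
    apply (Rle_div_r (Cmod (kappa n)) B ((r / 2) ^ n) P). exact HBd. }
  set (t := Rmin (r / (4 * A)) (Rmin (r0 / 2) (r0 * r / (8 * A * (B + 1))))).
  assert (Ht : 0 < t).
  { repeat apply Rmin_pos; try lra; apply Rdiv_lt_0_compat; nra. }
  assert (T1 : t <= r / (4 * A)) by apply Rmin_l.
  assert (T2 : t <= Rmin (r0 / 2) (r0 * r / (8 * A * (B + 1)))) by apply Rmin_r.
  assert (T3 := Rmin_l (r0 / 2) (r0 * r / (8 * A * (B + 1)))).
  assert (T4 := Rmin_r (r0 / 2) (r0 * r / (8 * A * (B + 1)))).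
  exists t, B, (2 / r). split; [lra|]. split; [exact HB|]. split; [apply Rdiv_lt_0_compat; lra|].
  split; [exact Coef|].
  intros v Hv.
  assert (Hz := HPhi v ltac:(lra)).
  assert (Hz1 : Cmod (Phi p v) <= A * t).
  { eapply Rle_trans; [exact Hz|]. apply Rmult_le_compat_l; lra. }
  assert (Hz2 : A * t <= r / 4).
  { apply (Rle_div_r t r (4 * A)) in T1; lra. }
  destruct (HK (Phi p v) ltac:(lra)) as [w [Hw [Hw1 HE]]].
  apply is_pseries_Cseries in Hw.
  refine (eq_ind w (fun l => is_Cseries (fun n => kappa n * Phi p v ^ n)%C l) Hw v _).
  assert (Small : Cmod w <= 4 * (A * t) / r * (B * 2)).
  { assert (G : is_series (fun n => 4 * (A * t) / r * B * (1 / 2) ^ n) (4 * (A * t) / r * (B * 2))).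
    { replace (4 * (A * t) / r * (B * 2)) with (4 * (A * t) / r * B * / (1 - 1 / 2)) by (field; lra).
      apply (is_series_scal_l (V := R_NormedModule)). apply is_series_geom. rewrite Rabs_pos_eq; lra. }
    refine (Cmod_series_le _ _ _ _ _ Hw G). intros n.
    assert (C0 : 0 <= 4 * (A * t) / r) by (apply Rmult_le_pos; [nra|left; now apply Rinv_0_lt_compat]).
    destruct n as [|n].
    - rewrite K0, Cmult_0_l, Cmod_0. simpl. nra.
    - rewrite Cmod_mult, Cmod_pow.
      set (x := 4 * (A * t) / r) in *.
      assert (X1 : x <= 1). { unfold x. apply Rle_div_l; lra. }
      assert (E2 : 2 / r * (A * t) = x * (1 / 2)) by (unfold x; field; lra).
      apply Rle_trans with (B * (2 / r) ^ S n * (A * t) ^ S n).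
      + apply Rmult_le_compat; [apply Cmod_ge_0|apply pow_le, Cmod_ge_0|apply Coef|].
        apply pow_incr. split; [apply Cmod_ge_0|exact Hz1].
      + rewrite Rmult_assoc, <- Rpow_mult_distr, E2, Rpow_mult_distr.
        assert (Xn : x ^ S n <= x).
        { simpl. assert (0 <= x ^ n <= 1) by (split; [now apply pow_le|rewrite <- (pow1 n); apply pow_incr; lra]). nra. }
        assert (Hn : 0 < (1 / 2) ^ S n) by (apply pow_lt; lra).
        replace (x * B * (1 / 2) ^ S n) with (B * (x * (1 / 2) ^ S n)) by ring.
        apply Rmult_le_compat_l; [exact HB|]. apply Rmult_le_compat_r; lra. }
  apply (Inj w v); [|lra|exact HE].
  eapply Rle_trans; [exact Small|].
  replace (4 * (A * t) / r * (B * 2)) with (t * (8 * A * B / r)) by (field; lra).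
  assert (F : t * (8 * A * (B + 1)) <= r0 * r).
  { apply (Rle_div_r t (r0 * r) (8 * A * (B + 1))); [nra|lra]. }
  replace (t * (8 * A * B / r)) with (t * (8 * A * B) / r) by (field; lra).
  apply Rle_div_l; [lra|]. assert (0 <= t * (8 * A)) by nra. nra.
Qed.

Lemma ccont_Pi (p : nat -> R) (gam : R -> C) (t : R) : entire_offspring p -> ccont gam t ->
  ccont (fun u => Pi p (gam u)) t.
Proof.
  intros H. destruct (Pi_regular_all p (Cmod (gam t) + 1) H) as [_ [L [HL HLip]]].
  apply (ccont_lip (Pi p) gam t L 1); [exact HL|lra|].
  intros w Hw. apply HLip; [|lra]. assert (T := Cmod_triangle_inv w (gam t)). lra.
Qed.

Lemma Pi_weight_bound (p : nat -> R) : entire_offspring p -> vanishing_Pi p ->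
  exists K, 0 <= K /\ forall z, 0 <= Re z -> Cmod (Pi p z) <= K * pow_weight (decay p) (Im z).
Proof.
  intros H HV. destruct (Pi_decay p H HV) as [R0 [K [HR0 [HK HD]]]].
  assert (Hb := decay_pos p H). set (b := decay p) in *.
  assert (P1 : 0 < Rpower (1 + R0 ^ 2) (b / 2)) by apply exp_pos.
  assert (P2 : 0 < Rpower 2 (b / 2)) by apply exp_pos.
  exists (Rpower (1 + R0 ^ 2) (b / 2) + K * Rpower 2 (b / 2)). split; [nra|].
  intros z Hz. assert (W := pow_weight_pos b (Im z)).
  assert (Hi : Im z ^ 2 <= Cmod z ^ 2).
  { rewrite <- (pow2_abs (Im z)). apply pow_incr. split; [apply Rabs_pos|apply snd_le_Cmod]. }
  destruct (Rle_dec R0 (Cmod z)) as [h|h].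
  - eapply Rle_trans; [apply (HD z Hz h)|].
    assert (Q : Rpower (Cmod z) (- b) <= Rpower 2 (b / 2) * pow_weight b (Im z)).
    { unfold pow_weight, Rpower. rewrite <- exp_plus. apply exp_le_mono.
      assert (L : ln (1 + Im z ^ 2) <= ln 2 + 2 * ln (Cmod z)).
      { replace (ln 2 + 2 * ln (Cmod z)) with (ln (2 * (Cmod z * Cmod z))) by (rewrite !ln_mult by nra; ring).
        apply ln_le; [assert (X := pow2_ge_0 (Im z)); lra|]. nra. }
      apply (Rmult_le_compat_l b) in L; lra. }
    assert (X : K * Rpower (Cmod z) (- b) <= K * (Rpower 2 (b / 2) * pow_weight b (Im z)))
      by (apply Rmult_le_compat_l; lra).
    assert (Y : 0 <= Rpower (1 + R0 ^ 2) (b / 2) * pow_weight b (Im z)) by (apply Rmult_le_pos; lra). lra.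
  - assert (B := Cmod_Pi_le p z 0 H Hz). rewrite (Pi_0 p H), Cmod_1 in B.
    assert (Q : 1 <= Rpower (1 + R0 ^ 2) (b / 2) * pow_weight b (Im z)).
    { unfold pow_weight, Rpower. rewrite <- exp_plus.
      apply Rle_trans with (exp 0); [rewrite exp_0; lra|apply exp_le_mono].
      assert (L : ln (1 + Im z ^ 2) <= ln (1 + R0 ^ 2)).
      { apply ln_le; [assert (X := pow2_ge_0 (Im z)); lra|].
        assert (Cmod z ^ 2 <= R0 ^ 2) by (apply pow_incr; split; [apply Cmod_ge_0|lra]). lra. }
      apply (Rmult_le_compat_l b) in L; lra. }
    assert (Y : 0 <= K * Rpower 2 (b / 2) * pow_weight b (Im z)) by (apply Rmult_le_pos; [apply Rmult_le_pos|]; lra). lra.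
Qed.

Definition Pi_exp (p : nat -> R) (x : R) (z : C) : C := (Pi p z * Cexp (z * RtoC x))%C.

Lemma Cmod_Cexp_mult_R (u v x : R) : Cmod (Cexp ((u, v) * RtoC x)) = exp (u * x).
Proof. rewrite Cmod_Cexp. f_equal. unfold Re, RtoC; simpl. ring. Qed.

Lemma ccont_Pi_exp (p : nat -> R) (x : R) (gam : R -> C) (t : R) : entire_offspring p -> ccont gam t ->
  ccont (fun u => Pi_exp p x (gam u)) t.
Proof.
  intros H Hg. apply ccont_mult; [now apply ccont_Pi|].
  apply ccont_Cexp, ccont_mult; [exact Hg|apply ccont_const].
Qed.

Lemma Pi_exp_contour_shift (p : nat -> R) (x c : R) : entire_offspring p -> vanishing_Pi p -> 1 < decay p ->
  0 < x -> 0 < c -> exists I,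
    line_int (fun y => Pi_exp p x (0, y)) I /\ line_int (fun y => Pi_exp p x (c, y)) I.
Proof.
  intros H HV Hb Hx Hc. destruct (Pi_weight_bound p H HV) as [K [HK HKb]].
  assert (Ex : forall u, 0 <= u -> 0 < exp (u * x)) by (intros; apply exp_pos).
  assert (Bd : forall u v, 0 <= u <= c -> Cmod (Pi_exp p x (u, v)) <= K * exp (c * x) * pow_weight (decay p) v).
  { intros u v Hu. unfold Pi_exp. rewrite Cmod_mult, Cmod_Cexp_mult_R.
    assert (A := HKb (u, v) (proj1 Hu)). simpl in A. unfold Im in A; simpl in A.
    replace (K * exp (c * x) * pow_weight (decay p) v) with (K * pow_weight (decay p) v * exp (c * x)) by ring.
    apply Rmult_le_compat; [apply Cmod_ge_0|left; apply exp_pos|exact A|]. apply exp_le_mono. nra. }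
  assert (KE : 0 <= K * exp (c * x)) by (apply Rmult_le_pos; [lra|left; apply exp_pos]).
  assert (Hdom : integrable_dom (fun t => K * exp (c * x) * pow_weight (decay p) t)).
  { apply integrable_dom_scal; [exact KE|now apply pow_weight_integrable]. }
  assert (Cv : forall u y, ccont (fun y => Pi_exp p x (u, y)) y).
  { intros u y. apply (ccont_Pi_exp p x (fun y => (u, y)) y H), ccont_pair_2. }
  assert (Ch : forall v y, ccont (fun u => Pi_exp p x (u, v)) y).
  { intros v y. apply (ccont_Pi_exp p x (fun u => (u, v)) y H), ccont_pair_1. }
  destruct (line_int_exists _ _ (Cv 0) Hdom (fun t => Bd 0 t ltac:(lra))) as [I HI].
  destruct (line_int_exists _ _ (Cv c) Hdom (fun t => Bd c t ltac:(lra))) as [J HJ].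
  exists I. split; [exact HI|]. replace I with J; [exact HJ|].
  apply Cmod_small_eq. intros eps He. apply (line_int_le _ _ _ _ HJ).
  destruct (HI (eps / 2) ltac:(lra)) as [Y1 [HY1 HI1]].
  destruct (Rpower_neg_small (decay p) (eps / 4 / (c * (K * exp (c * x)) + 1)) ltac:(lra)) as [Y2 [HY2 HS]].
  { apply Rdiv_lt_0_compat; nra. }
  exists (Rmax Y1 Y2). intros N HN.
  assert (M1 := Rmax_l Y1 Y2). assert (M2 := Rmax_r Y1 Y2).
  assert (Uf : unif_entire (Pi_exp p x) (in_box (- 1) (c + 1) (- N - 1) (N + 1))).
  { assert (Bs := in_box_bounded (- 1) (c + 1) (- N - 1) (N + 1)).
    apply unif_entire_mult; [exact Bs|now apply unif_entire_Pi|].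
    apply (unif_entire_ext (fun z => Cexp (RtoC x * z))).
    - intros z _. f_equal. ring.
    - exact (unif_entire_C11 _ _ _ (C11_comp _ _ _ _ C11_Cexp (C11_linear (RtoC x)))). }
  assert (R0 := rect_int_unif_entire _ _ _ _ _ 0 c (- N) N Uf ltac:(lra) Hc ltac:(lra) ltac:(lra) ltac:(lra) ltac:(lra)).
  unfold rect_int in R0.
  assert (Side : forall v, Rabs v = N -> Cmod (CRInt (fun u => Pi_exp p x (u, v)) 0 c) <= eps / 4).
  { intros v Hv.
    assert (W : pow_weight (decay p) v <= eps / 4 / (c * (K * exp (c * x)) + 1)).
    { replace (pow_weight (decay p) v) with (pow_weight (decay p) N).
      - eapply Rle_trans; [apply pow_weight_le; lra|]. apply HS. lra.
      - unfold pow_weight. now rewrite <- Hv, pow2_abs. }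
    eapply Rle_trans.
    - apply (is_CRInt_norm_le_const (fun u => Pi_exp p x (u, v)) 0 c
               (K * exp (c * x) * (eps / 4 / (c * (K * exp (c * x)) + 1))) _ ltac:(lra)).
      + intros u Hu. eapply Rle_trans; [apply Bd, Hu|]. apply Rmult_le_compat_l; [exact KE|exact W].
      + apply CRInt_correct. intros y _. apply Ch.
    - rewrite Rminus_0_r, <- Rmult_assoc. apply Rmult_div_small; nra. }
  assert (S1 := Side N ltac:(apply Rabs_pos_eq; lra)).
  assert (S2 := Side (- N) ltac:(rewrite Rabs_Ropp; apply Rabs_pos_eq; lra)).
  specialize (HI1 (- N) N ltac:(lra) ltac:(lra)).
  set (Bo := CRInt (fun u => Pi_exp p x (u, - N)) 0 c) in *.
  set (To := CRInt (fun u => Pi_exp p x (u, N)) 0 c) in *.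
  set (Ri := CRInt (fun y => Pi_exp p x (c, y)) (- N) N) in *.
  set (Le := CRInt (fun y => Pi_exp p x (0, y)) (- N) N) in *.
  assert (Ci2 : (Ci * Ci)%C = (- (1))%C).
  { unfold Ci, Cmult, Copp, RtoC; simpl. f_equal; ring. }
  assert (E : (Ri - Le)%C = (Ci * Bo - Ci * To)%C).
  { replace (Ri - Le)%C with (- (Ci * Ci) * (Ri - Le))%C by (rewrite Ci2; ring).
    replace (- (Ci * Ci) * (Ri - Le))%C with (- Ci * (Bo + Ci * Ri - To - Ci * Le) + Ci * (Bo - To))%C by ring.
    rewrite R0. ring. }
  replace (Ri - I)%C with ((Ri - Le) + (Le - I))%C by ring. rewrite E.
  eapply Rle_trans; [apply Cmod_triangle|].
  assert (T := Cmod_minus_le (Ci * Bo) (Ci * To)). rewrite !Cmod_mult, Cmod_Ci in T. lra.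
Qed.

(** * Term-by-term inversion *)

Lemma line_int_series_exists (g : R -> R) (f : nat -> R -> C) (a : nat -> R) (l : nat -> C) :
  integrable_dom g -> (forall t, g t <= 1) -> (forall k x, ccont (f k) x) ->
  (forall k t, Cmod (f k t) <= a k * g t) -> (forall k, 0 <= a k) -> ex_series a ->
  (forall k, line_int (f k) (l k)) ->
  forall F, (forall t, is_Cseries (fun k => f k t) (F t)) ->
    (forall x, ccont F x) /\ exists I, line_int F I /\ is_Cseries l I.
Proof.
  intros Hg Hg1 Cf Hb Ha Ea Hl F HF.
  assert (CF : forall x, ccont F x).
  { intros x. apply (ccont_series f F a x); auto. intros k t. eapply Rle_trans; [apply Hb|].
    rewrite <- (Rmult_1_r (a k)) at 2. apply Rmult_le_compat_l; auto. }
  split; [exact CF|]. destruct Ea as [A HA].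
  destruct (line_int_exists F (fun t => A * g t) CF) as [I HI].
  - apply integrable_dom_scal; [|exact Hg].
    assert (X := sum_n_le_series a A 0 Ha HA). rewrite sum_O in X. assert (Y := Ha O). lra.
  - intros t. refine (Cmod_series_le _ (fun k => g t * a k) _ _ _ (HF t) _).
    + intros k. rewrite Rmult_comm. apply Hb.
    + rewrite Rmult_comm. apply (is_series_scal_l (V := R_NormedModule) (g t)). exact HA.
  - exists I. split; [exact HI|].
    apply (line_int_series g f F a l I Hg Cf CF Hb Ha (ex_intro _ A HA) HF Hl HI).
Qed.

Definition gamma_arg (p : nat -> R) (n : nat) (m : Z) : C :=
  (- ((RtoC (2 * PI * IZR m) * Ci + RtoC (INR n * ln (p 1%nat))) / RtoC (ln (mean p))))%C.

Lemma gamma_arg_eq (p : nat -> R) (n : nat) (m : Z) : entire_offspring p ->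
  gamma_arg p n m = (INR n * decay p, - (2 * PI * IZR m / ln (mean p))).
Proof.
  intros H. assert (L := ln_mean_pos p H). unfold gamma_arg, Cdiv. rewrite <- RtoC_inv by lra.
  unfold decay, RtoC, Ci, Cmult, Cplus, Copp; simpl. f_equal; field; lra.
Qed.

Lemma Re_gamma_arg (p : nat -> R) (n : nat) (m : Z) : entire_offspring p ->
  Re (gamma_arg p n m) = INR n * decay p.
Proof. intros H. now rewrite (gamma_arg_eq p n m H). Qed.

Lemma bromwich_integral (p : nat -> R) (n : nat) (m : Z) (x c : R) : entire_offspring p ->
  1 < decay p -> (1 <= n)%nat -> 0 < x -> 1 <= c ->
  line_int (fun y => theta p n m * bromwich (gamma_arg p n m) x c y)%C
    (RtoC (2 * PI * Rpower x (INR n * decay p - 1)) * KG_term p n (- ln x / ln (mean p)) m)%C.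
Proof.
  intros H Hb Hn Hx Hc. assert (L := ln_mean_pos p H). assert (PP := PI_RGT_0).
  assert (Nn : 1 <= INR n) by (apply (le_INR 1); exact Hn).
  destruct (gamma_inversion (gamma_arg p n m) x c) as [J [HJ E]]; auto.
  { rewrite (Re_gamma_arg p n m H). nra. }
  assert (NG : CGamma (gamma_arg p n m) <> 0%C).
  { intros Z. rewrite Z, Cmult_0_l in E. symmetry in E.
    assert (X : Cmod (RtoC (2 * PI) * Cexp ((gamma_arg p n m - 1) * RtoC (ln x))) = 0) by (rewrite E; apply Cmod_0).
    rewrite Cmod_mult, Cmod_Cexp, Cmod_RtoC_nonneg in X by lra.
    assert (Y := exp_pos (Re ((gamma_arg p n m - 1) * RtoC (ln x)))). nra. }
  replace (RtoC (2 * PI * Rpower x (INR n * decay p - 1)) * KG_term p n (- ln x / ln (mean p)) m)%C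
    with (theta p n m * J)%C.
  - apply line_int_scal; [|exact HJ]. intros y. apply ccont_bromwich. lra.
  - unfold KG_term. fold (gamma_arg p n m).
    replace J with (CGamma (gamma_arg p n m) * J / CGamma (gamma_arg p n m))%C by (field; exact NG).
    rewrite E, (RtoC_mult (2 * PI) (Rpower x (INR n * decay p - 1))).
    replace (Cexp ((gamma_arg p n m - 1) * RtoC (ln x)))
      with (RtoC (Rpower x (INR n * decay p - 1)) * Cexp (RtoC (2 * PI * IZR m * (- ln x / ln (mean p))) * Ci))%C.
    + field. exact NG.
    + unfold Rpower. rewrite <- Cexp_RtoC, <- Cexp_add, (gamma_arg_eq p n m H). f_equal.
      unfold RtoC, Ci, Cmult, Cplus, Cminus, Copp; simpl. f_equal; field; lra.
Qed.

Definition log_coord (p : nat -> R) (c y : R) : C :=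
  (fst (clog (c, y)) / ln (mean p), snd (clog (c, y)) / ln (mean p)).

Lemma log_coord_spec (p : nat -> R) (c y : R) : entire_offspring p ->
  (RtoC (ln (mean p)) * log_coord p c y)%C = clog (c, y).
Proof.
  intros H. assert (L := ln_mean_pos p H). unfold log_coord. destruct (clog (c, y)) as [a b].
  unfold RtoC, Cmult; simpl. f_equal; field; lra.
Qed.

Lemma laurent_bromwich (p : nat -> R) (n : nat) (m : Z) (x c y : R) : entire_offspring p ->
  (theta p n m * bromwich (gamma_arg p n m) x c y)%C =
  (laurent_term p n (log_coord p c y) m *
   (Cexp (- (RtoC (INR n * decay p) * clog (c, y))) * Cexp ((c, y) * RtoC x)))%C.
Proof.
  intros H. assert (L := ln_mean_pos p H). unfold bromwich, laurent_term.
  replace (Cexp (- (gamma_arg p n m * clog (c, y))))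
    with (Cexp (RtoC (2 * PI * IZR m) * Ci * log_coord p c y) * Cexp (- (RtoC (INR n * decay p) * clog (c, y))))%C.
  - ring.
  - rewrite <- Cexp_add, (gamma_arg_eq p n m H). f_equal. unfold log_coord. destruct (clog (c, y)) as [a b].
    unfold RtoC, Ci, Cmult, Cplus, Copp; simpl. f_equal; field; lra.
Qed.

Lemma Cmod_Cexp_power_le (b c y : R) (n : nat) : 1 < b -> 1 <= c -> (1 <= n)%nat ->
  Cmod (Cexp (- (RtoC (INR n * b) * clog (c, y)))) <= pow_weight b y * Rpower c (- b) ^ (n - 1).
Proof.
  intros Hb Hc Hn. rewrite Cmod_Cexp.
  rewrite <- Rpower_pow by apply exp_pos. unfold pow_weight, Rpower. rewrite ln_exp, <- exp_plus.
  apply exp_le_mono. rewrite minus_INR by exact Hn. simpl (INR 1).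
  unfold clog, RtoC, Re; cbn [fst snd Cmult Copp].
  replace (- (INR n * b * (ln (c ^ 2 + y ^ 2) / 2) - 0 * atan (y / c)))
    with (- b / 2 * ln (c ^ 2 + y ^ 2) - (INR n - 1) * b / 2 * ln (c ^ 2 + y ^ 2)) by field.
  assert (Y := pow2_ge_0 y). assert (Nn : 1 <= INR n) by (apply (le_INR 1); exact Hn).
  assert (L1 : ln (1 + y ^ 2) <= ln (c ^ 2 + y ^ 2)) by (apply ln_le; nra).
  assert (L2 : 2 * ln c <= ln (c ^ 2 + y ^ 2)).
  { replace (2 * ln c) with (ln (c * c)) by (rewrite ln_mult by lra; ring). apply ln_le; nra. }
  assert (P : 0 <= (INR n - 1) * b) by nra.
  assert (Q : (INR n - 1) * b * (2 * ln c) <= (INR n - 1) * b * ln (c ^ 2 + y ^ 2)) by (apply Rmult_le_compat_l; lra).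
  assert (Q2 : b * ln (1 + y ^ 2) <= b * ln (c ^ 2 + y ^ 2)) by (apply Rmult_le_compat_l; lra).
  lra.
Qed.

Definition Phi_Pi_power (p : nat -> R) (n : nat) (x : R) (z : C) : C :=
  (Phi p (Pi p z) ^ n * Cexp (z * RtoC x))%C.

Lemma Phi_Pi_KM (p : nat -> R) (n : nat) (c y : R) : entire_offspring p -> 0 < c ->
  (Phi p (Pi p (c, y)) ^ n)%C =
  (KM_complex p (log_coord p c y) ^ n * Cexp (- (RtoC (INR n * decay p) * clog (c, y))))%C.
Proof.
  intros H Hc. unfold KM_complex. rewrite (log_coord_spec p c y H), (Cexp_clog (c, y)) by exact Hc.
  rewrite (RtoC_mult (decay p)), <- Cmult_assoc, (log_coord_spec p c y H).
  rewrite Cpow_mult_l, <- Cexp_nat, <- Cmult_assoc, <- Cexp_add.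
  replace (RtoC (INR n) * (RtoC (decay p) * clog (c, y)) + - (RtoC (INR n * decay p) * clog (c, y)))%C with (RtoC 0)
    by (rewrite RtoC_mult; ring).
  rewrite Cexp_0. ring.
Qed.

Lemma ln_le_clog (c y : R) : 1 <= c -> ln c <= fst (clog (c, y)).
Proof.
  intros Hc. unfold clog. cbn [fst snd]. assert (Y := pow2_ge_0 y).
  replace (ln c) with (ln (c * c) / 2) by (rewrite ln_mult by lra; field).
  apply Rmult_le_compat_r; [lra|]. apply ln_le; nra.
Qed.

Lemma log_coord_in_strip (p : nat -> R) (k : nat) (c y : R) : entire_offspring p -> 1 <= c ->
  mean p ^ k < c -> INR k < fst (log_coord p c y) /\ Rabs (ln (mean p) * snd (log_coord p c y)) < PI / 2.
Proof.
  intros H Hc Hk. assert (L := ln_mean_pos p H). assert (HE := mean_gt_1 p H).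
  unfold log_coord. cbn [fst snd]. split.
  - apply (Rlt_div_r (INR k)); [exact L|].
    apply Rlt_le_trans with (ln c); [|now apply ln_le_clog].
    rewrite <- (ln_exp (INR k * ln (mean p))). rewrite (Rmult_comm (INR k)), (exp_ln_mean_nat p k H).
    apply ln_increasing; [apply pow_lt; lra|exact Hk].
  - replace (ln (mean p) * (snd (clog (c, y)) / ln (mean p))) with (snd (clog (c, y))) by (field; lra).
    apply snd_clog_bound.
Qed.

Lemma power_integral (p : nat -> R) (k : nat) (M q c x : R) (n : nat) : entire_offspring p ->
  laurent_data p k M q -> 1 < decay p -> 1 <= c -> mean p ^ k < c -> 0 < x -> (1 <= n)%nat ->
  (forall y, ccont (fun y => Phi_Pi_power p n x (c, y)) y) /\
  ex_ZSeries (KG_term p n (- ln x / ln (mean p))) /\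
  line_int (fun y => Phi_Pi_power p n x (c, y))
    (RtoC (2 * PI * Rpower x (INR n * decay p - 1)) * ZSeries (KG_term p n (- ln x / ln (mean p))))%C.
Proof.
  intros H [HM [Hq HLau]] Hb Hc Hk Hx Hn. assert (PP := PI_RGT_0).
  set (E := fun y => (Cexp (- (RtoC (INR n * decay p) * clog (c, y))) * Cexp ((c, y) * RtoC x))%C).
  set (f := fun m y => (theta p n m * bromwich (gamma_arg p n m) x c y)%C).
  assert (fE : forall m y, f m y = (laurent_term p n (log_coord p c y) m * E y)%C).
  { intros m y. unfold f, E. now apply laurent_bromwich. }
  set (W := exp (c * x) * Rpower c (- decay p) ^ (n - 1)).
  assert (HW : 0 < W).
  { unfold W. apply Rmult_lt_0_compat; [apply exp_pos|]. apply pow_lt, exp_pos. }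
  assert (EB : forall y, Cmod (E y) <= pow_weight (decay p) y * W).
  { intros y. unfold E, W. rewrite Cmod_mult, Cmod_Cexp_mult_R.
    assert (A := Cmod_Cexp_power_le (decay p) c y n Hb Hc Hn). assert (X := exp_pos (c * x)). nra. }
  set (a := fun j => M ^ n * W * q ^ j).
  assert (MN : 0 <= M ^ n) by now apply pow_le.
  assert (Ha : forall j, 0 <= a j).
  { intros j. unfold a. apply Rmult_le_pos; [nra|]. apply pow_le; lra. }
  assert (Ea : ex_series a) by (apply ex_series_geom_scal; lra).
  assert (Hdom := pow_weight_integrable (decay p) Hb).
  assert (Hd1 : forall t, pow_weight (decay p) t <= 1) by (intros; apply pow_weight_le_1; lra).
  assert (Lau : forall y, (forall j, Cmod (laurent_term p n (log_coord p c y) (Z.of_nat j)) <= M ^ n * q ^ j) /\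
        (forall j, Cmod (laurent_term p n (log_coord p c y) (- Z.of_nat (S j))) <= M ^ n * q ^ j) /\
        exists l1 l2,
          is_Cseries (fun j => laurent_term p n (log_coord p c y) (Z.of_nat j)) l1 /\
          is_Cseries (fun j => laurent_term p n (log_coord p c y) (- Z.of_nat (S j))) l2 /\
          (KM_complex p (log_coord p c y) ^ n)%C = (l1 + l2)%C).
  { intros y. destruct (log_coord_in_strip p k c y H Hc Hk) as [S1 S2].
    exact (proj2 (proj2 (HLau _ _ S1 S2)) n). }
  assert (Bnd : forall m j y, Cmod (laurent_term p n (log_coord p c y) m) <= M ^ n * q ^ j ->
            Cmod (f m y) <= a j * pow_weight (decay p) y).
  { intros m j y Hm. rewrite fE, Cmod_mult.
    replace (a j * pow_weight (decay p) y) with (M ^ n * q ^ j * (pow_weight (decay p) y * W)) by (unfold a; ring).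
    apply Rmult_le_compat; auto; apply Cmod_ge_0. }
  assert (Cf : forall m y, ccont (f m) y).
  { intros m y. apply ccont_scal, ccont_bromwich. lra. }
  set (V0 := RtoC (2 * PI * Rpower x (INR n * decay p - 1))).
  set (T := KG_term p n (- ln x / ln (mean p))).
  assert (If : forall m, line_int (f m) (V0 * T m)%C) by (intros m; now apply bromwich_integral).
  assert (NV0 : V0 <> 0%C).
  { apply RtoC_neq_0, Rgt_not_eq. apply Rmult_lt_0_compat; [lra|apply exp_pos]. }
  set (F1 := fun y => CSeries (fun j => f (Z.of_nat j) y)).
  set (F2 := fun y => CSeries (fun j => f (- Z.of_nat (S j))%Z y)).
  assert (S12 : forall y, is_Cseries (fun j => f (Z.of_nat j) y) (F1 y) /\
             is_Cseries (fun j => f (- Z.of_nat (S j))%Z y) (F2 y) /\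
             Phi_Pi_power p n x (c, y) = (F1 y + F2 y)%C).
  { intros y. destruct (Lau y) as [_ [_ [l1 [l2 [Q1 [Q2 Q3]]]]]].
    apply (is_Cseries_scal (E y)) in Q1. apply (is_Cseries_scal (E y)) in Q2.
    assert (R1 : is_Cseries (fun j => f (Z.of_nat j) y) (E y * l1)%C).
    { revert Q1. apply is_Cseries_ext. intros j. rewrite fE. apply Cmult_comm. }
    assert (R2 : is_Cseries (fun j => f (- Z.of_nat (S j))%Z y) (E y * l2)%C).
    { revert Q2. apply is_Cseries_ext. intros j. rewrite fE. apply Cmult_comm. }
    unfold F1, F2. rewrite (CSeries_unique _ _ R1), (CSeries_unique _ _ R2).
    split; [exact R1|]. split; [exact R2|].
    unfold Phi_Pi_power. rewrite (Phi_Pi_KM p n c y H) by lra. rewrite Q3. unfold E. ring. }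
  destruct (line_int_series_exists _ (fun j => f (Z.of_nat j)) a (fun j => V0 * T (Z.of_nat j))%C Hdom Hd1) with (F := F1)
    as [CF1 [I1 [HI1 HS1]]]; auto.
  { intros j y. apply Bnd. exact (proj1 (Lau y) j). }
  { intros y. exact (proj1 (S12 y)). }
  destruct (line_int_series_exists _ (fun j => f (- Z.of_nat (S j))%Z) a (fun j => V0 * T (- Z.of_nat (S j))%Z)%C Hdom Hd1) with (F := F2)
    as [CF2 [I2 [HI2 HS2]]]; auto.
  { intros j y. apply Bnd. exact (proj1 (proj2 (Lau y)) j). }
  { intros y. exact (proj1 (proj2 (S12 y))). }
  assert (T1 : is_Cseries (fun j => T (Z.of_nat j)) (/ V0 * I1)%C).
  { apply (is_Cseries_scal (/ V0)%C) in HS1. revert HS1. apply is_Cseries_ext. intros j. field. exact NV0. }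
  assert (T2 : is_Cseries (fun j => T (- Z.of_nat (S j))%Z) (/ V0 * I2)%C).
  { apply (is_Cseries_scal (/ V0)%C) in HS2. revert HS2. apply is_Cseries_ext. intros j. field. exact NV0. }
  split; [|split].
  - intros y. apply (ccont_ext (fun y => F1 y + F2 y)%C); [|apply ccont_plus; auto].
    intros t. symmetry. exact (proj2 (proj2 (S12 t))).
  - split; [eexists; exact T1|eexists; exact T2].
  - unfold ZSeries. rewrite (CSeries_unique _ _ T1), (CSeries_unique _ _ T2).
    replace (V0 * (/ V0 * I1 + / V0 * I2))%C with (I1 + I2)%C by (field; exact NV0).
    apply (line_int_ext (fun y => F1 y + F2 y)%C).
    + intros y. symmetry. exact (proj2 (proj2 (S12 y))).
    + apply line_int_plus; auto.
Qed.

Lemma KG_term_shift (p : nat -> R) (n : nat) (z : R) (m : Z) : KG_term p n (z + 1) m = KG_term p n z m.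
Proof.
  unfold KG_term. f_equal. f_equal.
  rewrite Rmult_plus_distr_l, Rmult_1_r, RtoC_plus, Cmult_plus_distr_r, Cexp_add, Cexp_2PI. ring.
Qed.

Lemma V_periodic (p : nat -> R) (kappa : nat -> C) (n : nat) (x : R) : entire_offspring p -> 0 < x ->
  ex_ZSeries (KG_term p n (- ln x / ln (mean p))) -> V p kappa n (x / mean p) = V p kappa n x.
Proof.
  intros H Hx [[l1 H1] [l2 H2]]. assert (L := ln_mean_pos p H). assert (HE := mean_gt_1 p H).
  unfold V, KG. f_equal.
  assert (E : - ln (x / mean p) / ln (mean p) = - ln x / ln (mean p) + 1).
  { rewrite ln_div by lra. field. lra. }
  rewrite E. unfold ZSeries.
  rewrite (CSeries_unique _ _ H1), (CSeries_unique _ _ H2).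
  rewrite (CSeries_unique _ l1), (CSeries_unique _ l2); [reflexivity| |].
  - revert H2. apply is_Cseries_ext. intros j. symmetry. apply KG_term_shift.
  - revert H1. apply is_Cseries_ext. intros j. symmetry. apply KG_term_shift.
Qed.

Lemma contour_abscissa (p : nat -> R) (k : nat) (r X : R) : entire_offspring p -> vanishing_Pi p ->
  0 < r -> 0 <= X -> exists c, 1 <= c /\ mean p ^ k < c /\ X * Rpower c (- decay p) <= 1 / 2 /\
    forall y, Cmod (Pi p (c, y)) <= r.
Proof.
  intros H HV Hr HX. assert (Hb := decay_pos p H).
  destruct (Pi_decay p H HV) as [R0 [K [HR0 [HK HD]]]].
  destruct (Rpower_neg_small (decay p) (Rmin (1 / 2 / (X + 1)) (r / (K + 1))) Hb) as [Y [HY HS]].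
  { apply Rmin_pos; apply Rdiv_lt_0_compat; lra. }
  assert (HP : 0 <= mean p ^ k) by (apply pow_le; assert (U := mean_gt_1 p H); lra).
  set (c := R0 + Y + mean p ^ k + 1). exists c.
  assert (Hs := HS c ltac:(unfold c; lra)).
  assert (M1 := Rmin_l (1 / 2 / (X + 1)) (r / (K + 1))). assert (M2 := Rmin_r (1 / 2 / (X + 1)) (r / (K + 1))).
  split; [unfold c; lra|]. split; [unfold c; lra|]. split.
  - eapply Rle_trans; [|apply (Rmult_div_small X (1 / 2)); lra]. apply Rmult_le_compat_l; lra.
  - intros y. assert (Hcz : c <= Cmod (c, y)).
    { eapply Rle_trans; [|apply re_le_Cmod]. apply Rle_abs. }
    eapply Rle_trans; [apply HD; unfold c in *; cbn [fst snd Re]; lra|].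
    eapply Rle_trans; [|apply (Rmult_div_small K r HK Hr)]. apply Rmult_le_compat_l; [exact HK|].
    eapply Rle_trans; [|exact M2]. apply HS. unfold c in *; lra.
Qed.

Lemma density_expansion (p : nat -> R) (kappa : nat -> C) (x : R) : entire_offspring p -> vanishing_Pi p ->
  is_Phi_inv_coeffs p kappa -> 1 < decay p -> 0 < x ->
  ex_CRInt_gen (density_integrand p x) (Rbar_locally m_infty) (Rbar_locally p_infty) /\
  (forall n, (1 <= n)%nat -> ex_ZSeries (KG_term p n (- ln x / ln (mean p)))) /\
  is_Cseries (fun k => RtoC (Rpower x (INR (S k) * decay p - 1)) * V p kappa (S k) x)%C (density p x).
Proof.
  intros H HV Hk Hb Hx. assert (PP := PI_RGT_0).
  destruct (KM_laurent p H HV) as [k [M [q HL]]]. assert (HL' := HL).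
  destruct HL as [HM [Hq HLau]].
  destruct (kappa_inverts p kappa H Hk) as [r [B [Q [Hr [HB [HQ [Coef Inv]]]]]]].
  assert (HQM : 0 <= Q * M) by (apply Rmult_le_pos; lra).
  destruct (contour_abscissa p k r (Q * M) H HV (proj1 Hr) HQM) as [c [Hc [Hck [HX HPi]]]].
  destruct (Pi_exp_contour_shift p x c H HV Hb Hx ltac:(lra)) as [I [HI0 HIc]].
  assert (Pow : forall n, (1 <= n)%nat -> _) by (intros n Hn; exact (power_integral p k M q c x n H HL' Hb Hc Hck Hx Hn)).
  assert (Dint : forall y, density_integrand p x y = Pi_exp p x (0, y)).
  { intros y. unfold density_integrand, Pi_exp.
    replace (Ci * RtoC y)%C with ((0, y) : C); [reflexivity|].
    unfold Ci, RtoC, Cmult; simpl. f_equal; ring. }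
  assert (Cd : forall y, ccont (density_integrand p x) y).
  { intros y. apply (ccont_ext (fun y => Pi_exp p x (0, y))); [intros t; symmetry; apply Dint|].
    apply (ccont_Pi_exp p x (fun y => (0, y)) y H), ccont_pair_2. }
  assert (Ld : line_int (density_integrand p x) I).
  { apply (line_int_ext (fun y => Pi_exp p x (0, y))); [intros t; symmetry; apply Dint|exact HI0]. }
  split; [|split].
  - exists I. now apply line_int_RInt_gen.
  - intros n Hn. apply (Pow n Hn).
  - set (g := fun j y => (kappa (S j) * Phi_Pi_power p (S j) x (c, y))%C).
    set (a := fun j => B * (Q * M) * exp (c * x) * (1 / 2) ^ j).
    assert (Ser : is_Cseries (fun j => kappa (S j) * (RtoC (2 * PI * Rpower x (INR (S j) * decay p - 1)) *
                     ZSeries (KG_term p (S j) (- ln x / ln (mean p)))))%C I).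
    { apply (line_int_series (pow_weight (decay p)) g (fun y => Pi_exp p x (c, y)) a).
      - now apply pow_weight_integrable.
      - intros j y. apply ccont_scal. apply (Pow (S j) ltac:(lia)).
      - intros y. apply (ccont_Pi_exp p x (fun y => (c, y)) y H), ccont_pair_2.
      - intros j y. unfold g, Phi_Pi_power. rewrite (Phi_Pi_KM p (S j) c y H) by lra.
        destruct (log_coord_in_strip p k c y H Hc Hck) as [S1 S2].
        assert (KB := proj1 (proj2 (HLau _ _ S1 S2))).
        change (Cmod (KM_complex p (log_coord p c y)) <= M) in KB.
        rewrite !Cmod_mult, Cmod_pow, Cmod_Cexp_mult_R.
        assert (A := Cmod_Cexp_power_le (decay p) c y (S j) Hb Hc ltac:(lia)).
        replace (S j - 1)%nat with j in A by lia.
        assert (A2 : Cmod (KM_complex p (log_coord p c y)) ^ S j <= M ^ S j) by (apply pow_incr; split; [apply Cmod_ge_0|exact KB]).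
        assert (X := exp_pos (c * x)). assert (Wp := pow_weight_pos (decay p) y).
        assert (Rc : 0 < Rpower c (- decay p)) by apply exp_pos.
        apply Rle_trans with (B * Q ^ S j * (M ^ S j * (pow_weight (decay p) y * Rpower c (- decay p) ^ j) * exp (c * x))).
        { apply Rmult_le_compat; [apply Cmod_ge_0| |apply Coef|].
          - apply Rmult_le_pos; [apply Rmult_le_pos; [apply pow_le|]; apply Cmod_ge_0|lra].
          - apply Rmult_le_compat_r; [lra|]. apply Rmult_le_compat; auto; [apply pow_le|]; apply Cmod_ge_0. }
        replace (B * Q ^ S j * (M ^ S j * (pow_weight (decay p) y * Rpower c (- decay p) ^ j) * exp (c * x)))
          with (B * (Q * M) * exp (c * x) * pow_weight (decay p) y * (Q * M * Rpower c (- decay p)) ^ j)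
          by (rewrite !Rpow_mult_distr; simpl; ring).
        unfold a.
        replace (B * (Q * M) * exp (c * x) * (1 / 2) ^ j * pow_weight (decay p) y)
          with (B * (Q * M) * exp (c * x) * pow_weight (decay p) y * (1 / 2) ^ j) by ring.
        apply Rmult_le_compat_l; [|apply pow_incr; split; [apply Rmult_le_pos; lra|exact HX]].
        apply Rmult_le_pos; [|lra]. apply Rmult_le_pos; [|lra]. apply Rmult_le_pos; lra.
      - intros j. unfold a. apply Rmult_le_pos; [|apply pow_le; lra].
        apply Rmult_le_pos; [|left; apply exp_pos]. apply Rmult_le_pos; lra.
      - apply ex_series_geom_scal. lra.
      - intros y. unfold g, Phi_Pi_power, Pi_exp.
        assert (S0 := Inv _ (HPi y)).
        apply is_Cseries_decr in S0; [|rewrite (proj1 Hk); ring].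
        apply (is_Cseries_scal (Cexp ((c, y) * RtoC x))) in S0.
        rewrite (Cmult_comm (Pi p (c, y))). revert S0. apply is_Cseries_ext. intros j. ring.
      - intros j. apply line_int_scal; [apply (Pow (S j) ltac:(lia))|]. apply (Pow (S j) ltac:(lia)).
      - exact HIc. }
    apply (is_Cseries_scal (/ RtoC (2 * PI))%C) in Ser.
    assert (N2 : RtoC (2 * PI) <> 0%C) by (apply RtoC_neq_0; lra).
    unfold density. rewrite (CRInt_gen_line_int _ I Cd Ld).
    revert Ser. apply is_Cseries_ext. intros j. unfold V, KG.
    rewrite (RtoC_mult (2 * PI)). field. exact N2.
Qed.

Theorem theorem3p1
  (p : nat -> R) (kappa : nat -> C)
  (Hpgf : is_pgf_coeffs p)
  (Hp1 : 0 < p 1%nat < 1)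
  (Hkappa : is_Phi_inv_coeffs p kappa)
  (Hentire : CV_radius p = p_infty)
  (Hstrong_p : filterlim (fun y : R => Pi p (Ci * RtoC y)%C)
                 (Rbar_locally p_infty) (locally (RtoC 0)))
  (Hstrong_m : filterlim (fun y : R => Pi p (Ci * RtoC y)%C)
                 (Rbar_locally m_infty) (locally (RtoC 0)))
  (Hlog : ln (p 1%nat) / ln (mean p) < -1) :
  0 < beta p /\
  (forall x : R, 0 < x ->
     ex_CRInt_gen (density_integrand p x)
       (Rbar_locally m_infty) (Rbar_locally p_infty) /\
     (forall n : nat, (1 <= n)%nat ->
        ex_ZSeries (KG_term p n (- ln x / ln (mean p))) /\
        V p kappa n (x / mean p) = V p kappa n x) /\
     @is_series C_AbsRing C_NormedModule
       (fun k : nat =>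
          (RtoC (Rpower x (alpha p + INR k * beta p)) *
           V p kappa (S k) x)%C)
       (density p x) /\
     @is_series C_AbsRing C_NormedModule
       (fun k : nat =>
          (RtoC (Rpower x (-1 - INR (S k) * log_mean p (p 1%nat))) *
           V p kappa (S k) x)%C)
       (density p x)).
Proof.
  assert (H : entire_offspring p) by (split; [|split]; assumption).
  assert (HV : vanishing_Pi p) by (split; assumption).
  assert (Hb : 1 < decay p) by (unfold decay; lra).
  split; [exact (decay_pos p H)|].
  intros x Hx.
  destruct (density_expansion p kappa x H HV Hkappa Hb Hx) as [A [B S]].
  split; [exact A|]. split; [|split].
  - intros n Hn. split; [now apply B|]. apply V_periodic; auto.
  - revert S. apply is_Cseries_ext. intros k. f_equal. f_equal. f_equal.
    rewrite S_INR. unfold alpha, beta, decay, log_mean. ring.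
  - revert S. apply is_Cseries_ext. intros k. f_equal. f_equal. f_equal.
    unfold decay, log_mean. ring.
Qed.
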